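(* Let $\alpha\in(0,1)$, $0\le a<\alpha$ and $\hat\alpha=\frac{\alpha-a}{1-a}$. Let $Z$ be the asymmetric $K$ process with environment $\gamma$ and asymmetry parameter $a$, as defined in the context, and let $$\bar R(t,s;\gamma)=\mathbb P\big(Z_t=Z_{t+s}\,\big|\,\gamma\big),\qquad t,s>0 .$$ Then for almost every $\gamma$ and all $t,s>0$, $$\lim_{\varepsilon\to0}\bar R(\varepsilon t,\varepsilon s;\gamma)=\hat\Pi(t,s),\qquad\text{where}\quad \hat\Pi(t,s)=\frac{\sin(\pi\hat\alpha)}{\pi}\int_{s/(t+s)}^1\theta^{-\hat\alpha}(1-\theta)^{\hat\alpha-1}\,d\theta .$$
   Context: $\mathbb{N}^*=\{1,2,\ldots\}$. $K$ process. Let $\gamma=\{\gamma_x,\ x\in[0,\infty)\}$ be the increments (jumps) of an $\alpha$-stable subordinator on $[0,\infty)$, given by a Poisson point process on $(0,\infty)\times(0,\infty)$ with intensity measure $\alpha x^{-1-\alpha}\,dx\,dy$ ($x$ being the jump size, $y$ the jump location); $\gamma_x=0$ if there is no jump at location $x$. Given $\gamma$, let $\hat{\mathcal N}=\{\hat N^{(x)}=(\hat N^{(x)}_r)_{r\ge0},\ x\in[0,1]\}$ be independent Poisson counting processes, $\hat N^{(x)}$ having rate $\gamma_x^a$ if $\gamma_x>0$ and $\hat N^{(x)}\equiv0$ if $\gamma_x=0$; let $\hat\sigma^{(x)}_j$ be the $j$-th event time of $\hat N^{(x)}$. Let $\hat{\mathcal T}=\{\hat T^{(x)}_i,\ i\in\mathbb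 N^*,\ x\in[0,1]\}$ be i.i.d. mean 1 exponential random variables independent of $\hat{\mathcal N}$ and $\gamma$. (All sums over $x\in[0,1]$ involve only the countably many $x$ with $\gamma_x>0$.) Set $$\Gamma(r)=\sum_{x\in[0,1]}\gamma_x^{1-a}\sum_{i=1}^{\hat N^{(x)}_r}\hat T^{(x)}_i,\qquad r\ge0,$$ $Y_t=x$ if $\Gamma(\hat\sigma^{(x)}_j-)\le t<\Gamma(\hat\sigma^{(x)}_j)$ for some $x$ and $j\ge1$, and $Y_t=\infty$ otherwise. Set $Z_t=\gamma_{Y_t}^{1-a}$ if $Y_t\ne\infty$, and $Z_t=0$ if $Y_t=\infty$. *)

(* Defs.v *)
From HB Require Import structures.
From mathcomp Require Import all_boot all_order all_algebra.
From mathcomp Require Import all_classical all_reals all_analysis measurable_realfun.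
Set Implicit Arguments.
Unset Strict Implicit.
Unset Printing Implicit Defensive.
Import Order.TTheory GRing.Theory Num.Theory.
Import numFieldNormedType.Exports.
Local Open Scope classical_set_scope.
Local Open Scope ring_scope.

(* The sigma-algebra generated by the random variables X j, j in D. *)
Definition sigma_of (T J : Type) (d : measure_display) (U : measurableType d)
    (D : set J) (X : J -> T -> U) : set (set T) :=
  <<s \bigcup_(j in D) preimage_set_system setT (X j) measurable >>.

Definition mutually_independent (d : measure_display) (T : measurableType d)
    (R : realType) (P : probability T R) (I : eqType) (D : set I)
    (F : I -> set (set T)) : Prop :=
  forall (s : seq I) (A : I -> set T), uniq s ->
    (forall i, i \in s -> D i /\ F i (A i)) ->
    P (\bigcap_(i in [set` s]) A i) = (\prod_(i <- s) P (A i))%E.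

(* The second argument of poisson_prob is a dummy; poisson_prob 0 _ is the
   Dirac mass at 0. *)
Definition poisson_law (R : realType) (rate : R) : set nat -> \bar R :=
  poisson_prob rate 0%N.

(* The random (simple) point set S is a Poisson point process with intensity
   measure m; the number of its points in A may be infinite. *)
Definition poisson_point_process (d dU : measure_display)
    (T : measurableType d) (U : measurableType dU) (R : realType)
    (P : probability T R) (m : set U -> \bar R) (S : T -> set U) : Prop :=
  let count (A : set U) (w : T) : \bar R := counting (S w `&` A) in
  [/\ forall A, measurable A -> measurable_fun setT (count A),
      forall A k, measurable A -> (m A < +oo)%E ->
        P [set w | count A w = k%:R%:E] = poisson_law (fine (m A)) [set k],
      forall A, measurable A -> m A = +oo%E ->
        P [set w | count A w = +oo%E] = 1%E
    & forall A : nat -> set U, (forall i, measurable (A i)) ->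
        trivIset setT A ->
        mutually_independent P setT
          (fun i => sigma_of [set: unit] (fun _ => count (A i)))].

(* alpha x^(-1-alpha) dx dy on (0,oo) x (0,oo); first coordinate: jump size,
   second coordinate: jump location. *)
Definition stable_intensity (R : realType) (alpha : R) (A : set (R * R)) :
    \bar R :=
  (\int[(lebesgue_measure \x lebesgue_measure)%E]_(p in
      A `&` [set q : R * R | 0 < q.1 /\ 0 < q.2]%R)
     (alpha * p.1 `^ (-1 - alpha))%:E)%E.

Definition jump_points (R : realType) (g : R -> R) : set (R * R) :=
  [set p | 0 < p.1 /\ p.1 = g p.2].

(* gamma w y is the jump at location y, and 0 if there is none.  Locations
   live in (0,oo), hence the vanishing condition on (-oo,0]. *)
Definition stable_jumps (d : measure_display) (T : measurableType d)
    (R : realType) (P : probability T R) (alpha : R) (gamma : T -> R -> R) :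
    Prop :=
  [/\ forall w y, 0 <= gamma w y,
      forall w y, y <= 0 -> gamma w y = 0
    & poisson_point_process P (stable_intensity alpha)
        (fun w => jump_points (gamma w))].

Definition poisson_counting_process (d : measure_display)
    (T : measurableType d) (R : realType) (P : probability T R) (rate : R)
    (N : R -> T -> nat) : Prop :=
  (forall r, 0 <= r -> measurable_fun setT (N r)) /\
  (forall w, [/\ N 0 w = 0%N,
    forall u v, 0 <= u -> u <= v -> (N u w <= N v w)%N
    & forall r, 0 <= r -> \forall u \near r^'+, N u w = N r w]) /\
  (forall u v, 0 <= u -> u <= v -> forall k : nat,
    P [set w | (N v w - N u w)%N = k] = poisson_law (rate * (v - u)) [set k]) /\
  (forall t : nat -> R, 0 <= t 0%N -> (forall i, t i <= t i.+1) ->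
    mutually_independent P setT
      (fun i => sigma_of [set: unit] (fun _ w => (N (t i.+1) w - N (t i) w)%N))).

(* The driving randomness given the environment g: clocks N x, and holding
   variables tau x i for x in [0,1] and i = 1, 2, ... *)
Definition K_driving (d : measure_display) (T : measurableType d)
    (R : realType) (P : probability T R) (a : R) (g : R -> R)
    (N : R -> R -> T -> nat) (tau : R -> nat -> T -> R) : Prop :=
  let I := [set x : R | 0 <= x <= 1] in
  let J := [set p : R * nat | I p.1 /\ (1 <= p.2)%N] in
  let sigmaN x := sigma_of [set r : R | 0 <= r] (N x) in
  let sigmatau (p : R * nat) := sigma_of [set: unit] (fun _ => tau p.1 p.2) in
  [/\ (forall x, I x -> 0 < g x -> poisson_counting_process P (g x `^ a) (N x)),
      (forall x, I x -> g x = 0 -> forall r w, 0 <= r -> N x r w = 0%N),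
      mutually_independent P I sigmaN,
      (forall x i, I x -> (1 <= i)%N ->
         [/\ measurable_fun setT (tau x i), (forall w, 0 <= tau x i w)
           & forall B, measurable B ->
               P (tau x i @^-1` B) = exponential_prob 1 B])
    & mutually_independent P J sigmatau /\
      forall A B : set T,
        sigma_of [set q : R * R | I q.1 /\ 0 <= q.2] (fun q => N q.1 q.2) A ->
        sigma_of J (fun p => tau p.1 p.2) B ->
        P (A `&` B) = (P A * P B)%E].

(* Below, n x and tau x are one realization of the clocks and holding
   variables. *)

(* +oo if the j-th event never occurs *)
Definition event_time (R : realType) (n : R -> nat) (j : nat) : \bar R :=
  ereal_inf [set r%:E | r in [set r : R | 0 <= r /\ (j <= n r)%N]].

Definition K_clock (R : realType) (a : R) (g : R -> R) (n : R -> R -> nat)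
    (tau : R -> nat -> R) (r : R) : \bar R :=
  \esum_(x in [set x : R | 0 <= x <= 1])
    (g x `^ (1 - a) * \sum_(1 <= i < (n x r).+1) tau x i)%:E.

Definition K_at (R : realType) (a : R) (g : R -> R) (n : R -> R -> nat)
    (tau : R -> nat -> R) (t x : R) : Prop :=
  let Gamma := K_clock a g n tau in
  0 <= x <= 1 /\ exists (j : nat) (r : R),
    [/\ (1 <= j)%N, event_time (n x) j = r%:E,
        (lim (Gamma u @[u --> r^'-]) <= t%:E)%E & (t%:E < Gamma r)%E].

(* Almost surely no two clocks ring simultaneously, so that at most one x
   satisfies K_at; the infimum returns this x, and +oo if there is none.  On
   the exceptional null set it only serves as a measurable tie-break. *)
Definition K_Y (R : realType) (a : R) (g : R -> R) (n : R -> R -> nat)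
    (tau : R -> nat -> R) (t : R) : \bar R :=
  ereal_inf [set x%:E | x in K_at a g n tau t].

Definition K_Z (R : realType) (a : R) (g : R -> R) (n : R -> R -> nat)
    (tau : R -> nat -> R) (t : R) : R :=
  if K_Y a g n tau t is x%:E then g x `^ (1 - a) else 0.

(* P is the law of the driving randomness given the environment g. *)
Definition K_Rbar (d : measure_display) (T : measurableType d)
    (R : realType) (P : probability T R) (a : R) (g : R -> R)
    (N : R -> R -> T -> nat) (tau : R -> nat -> T -> R) (t s : R) : \bar R :=
  let Z w := K_Z a g (fun x r => N x r w) (fun x i => tau x i w) in
  P [set w | Z w t = Z w (t + s)].

Definition Pihat (R : realType) (ah t s : R) : R :=
  sin (pi * ah) / pi *
  \int[lebesgue_measure]_(theta in [set theta : R | s / (t + s) <= theta <= 1])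
     (theta `^ (- ah) * (1 - theta) `^ (ah - 1)).

(* Main.v *)
(* Given the environment, write gam_k for the jumps, r_k = gam_k^a for the rates
   and c_k = gam_k^(1-a) for the mean holding times.  The clock Gamma is a pure
   jump subordinator with Laplace exponent
   phi(l) = sum_k r_k l c_k / (1 + l c_k).  The law of large numbers for the
   Poisson counts of large jumps gives y^alpha #{k : gam_k > y} -> 1 as y -> 0,
   which makes phi regularly varying at infinity with index
   ah = (alpha - a) / (1 - a).

   For polynomials p, q and y_k = exp(-l Gamma(k d)), the mean of
   sum_k (p(y_k) - p(y_(k+1))) q(y_(k+1)) is an explicit combination of
   quotients phi(l j) / phi(l (i + j)).  When p and q approximate indicator
   functions, this sum nearly decides whether Gamma takes a value in a given
   interval.  As l -> oo the quotients tend to (j / (i + j))^ah, and the limiting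
   combination is an integral against the beta density, whence the generalized
   arcsine law for the probability of a gap ]t, t + s] in the range of Gamma.

   On such a gap Z is constant.  Without a gap, Z_t = Z_(t+s) forces one of
   several unlikely events: a gap starting at t or t + s that is too short, a
   late crossing, an atypically large contribution of the small jumps, two
   simultaneous rings, or rings at two locations with the same jump size. *)
Require Import Defs.
From mathcomp Require Import all_boot all_order all_algebra.
From mathcomp Require Import all_classical all_reals all_analysis measurable_realfun.
From mathcomp Require Import ring lra.
Set Implicit Arguments.
Unset Strict Implicit.
Unset Printing Implicit Defensive.
Import Order.TTheory GRing.Theory Num.Theory.
Import numFieldNormedType.Exports.
Local Open Scope classical_set_scope.
Local Open Scope ring_scope.

(** * Independence and the clock of countably many sites *)

(** The randomness of the environment enters only through the almost sure counts of its jumps; after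
    their enumeration everything concerns one fixed sequence. The law of the range of the clock is
    extracted from Laplace transforms at two times, averaged along a dyadic grid: p drops where the
    clock passes t, and q tests whether it is then still below t + s, so the sum is close to 1 when
    the clock lands between the two levels and close to 0 when it leaps over both. Expanding in
    monomials turns the mean into geometric series, whence the quotients of [phi]. The beta integral
    has to be known with its total mass pi / sin(pi ah), which is why the reflection formula is
    established on the way. The comparison with Z follows the clock up to time K / phi(1/eps), when
    it has most likely passed eps (t + s). Z records a mean holding time and not a site, so two
    distinct visits can still give the same value. The expected number of such pairs among the sites
    that matter is small against the square of the number of visits, because the regular counting
    function leaves only o(x^(-alpha)) jumps at any single size x. *)

Section layer_cake.
Context d (T : measurableType d) (R : realType) (P : probability T R).
Local Open Scope ereal_scope.
Let mu : {measure set (measurableTypeR R) -> \bar R} := @lebesgue_measure R.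

Lemma integral_layer_cake (f : T -> R) (g : T -> \bar R) :
  measurable_fun setT f -> (forall w, 0 <= f w)%R ->
  measurable_fun setT g -> (forall w, 0 <= g w) ->
  \int[P]_w ((f w)%:E * g w) =
  \int[mu]_(s in `]0%R, +oo[) \int[P]_(w in [set w | (s <= f w)%R]) g w.
Proof.
move=> mf f0 mg g0.
pose h (p : T * measurableTypeR R) : \bar R :=
  ((\1_[set p : T * measurableTypeR R | (0 < p.2 <= f p.1)%R] p)%:E * g p.1).
have mD : measurable [set p : T * measurableTypeR R | (0 < p.2 <= f p.1)%R].
  pose b1 (p : T * measurableTypeR R) := (0 < p.2)%R.
  pose b2 (p : T * measurableTypeR R) := (p.2 <= f p.1)%R.
  rewrite [X in measurable X](_ : _ =
      b1 @^-1` [set true] `&` b2 @^-1` [set true]); last first.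
    by apply/seteqP; split => p; rewrite /b1 /b2 /=;
      first [by move=> /andP[-> ->] | by move=> [-> ->]].
  apply: measurableI.
  - have : measurable_fun setT b1 by exact: measurable_fun_ltr.
    by move=> /(_ measurableT [set true]); rewrite setTI; exact.
  - have : measurable_fun setT b2.
      by apply: measurable_fun_ler => //; exact: measurableT_comp.
    by move=> /(_ measurableT [set true]); rewrite setTI; exact.
have mh : measurable_fun setT h.
  apply: emeasurable_funM; last exact: measurableT_comp.
  by apply/measurable_EFinP/measurable_indic.
have h0 p : 0 <= h p by rewrite mule_ge0// lee_fin.
transitivity (\int[P]_w \int[mu]_s h (w, s)).
  apply: eq_integral => w _.
  transitivity (\int[mu]_s ((\1_`]0%R, f w] s)%:E * g w)).
    rewrite ge0_integralZr//.
    - rewrite integral_indic//= setIT lebesgue_measure_itv/= lte_fin.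
      case: ltP => [|fw0]; first by rewrite sube0.
      by have -> : f w = 0%R by apply/eqP; rewrite eq_le fw0 f0.
    - by apply/measurable_EFinP/measurable_indic.
  apply: eq_integral => s _; rewrite /h; congr (_%:E * _).
rewrite (fubini_tonelli h)//.
rewrite [RHS]integral_mkcond; apply: eq_integral => s _.
rewrite patchE; case: ifPn => [|].
  rewrite inE/= in_itv/= andbT => s0.
  rewrite [RHS]integral_mkcond; apply: eq_integral => w _.
  rewrite /h /= indicE patchE; case: ifPn.
    by rewrite inE/= => sf; rewrite mem_set ?mul1e//=; exact/andP.
  move=> H; rewrite memNset ?mul0e//= => /andP[_ sf].
  by move/negP: H; apply; rewrite inE.
move/negP; rewrite inE/= in_itv/= andbT => s0.
apply: integral0_eq => w _; rewrite /h indicE memNset ?mul0e//=.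
by move=> /andP[/s0].
Qed.

Lemma measurable_ge_set (f : T -> R) (s : R) : measurable_fun setT f ->
  measurable [set w | (s <= f w)%R].
Proof.
move=> mf; have := mf measurableT `[s, +oo[%classic (measurable_itv _).
rewrite setTI; congr measurable; apply/seteqP.
by split => w /=; rewrite in_itv/= andbT.
Qed.

Lemma measurable_tail (f : T -> R) : measurable_fun setT f ->
  measurable_fun setT (fun s : R => P [set w | (s <= f w)%R]).
Proof.
move=> mf; pose F (s : R) := fine (P [set w | (s <= f w)%R]).
have PF s : (F s)%:E = P [set w | (s <= f w)%R].
  by rewrite /F fineK// fin_num_measure//; exact: measurable_ge_set.
rewrite (_ : (fun _ => _) = EFin \o F); last first.
  by apply/funext => s /=; rewrite PF.
apply/measurable_EFinP; apply: nonincreasing_measurable => // s t st.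
rewrite -lee_fin !PF le_measure ?inE//; try exact: measurable_ge_set.
by move=> w /=; exact: le_trans.
Qed.

(** By the layer cake formula, E[f g] sees g only through its integrals over the level events of f.
    These lie in [G], so factorisation over the events of [G] already gives factorisation against f.
    This is how independence, stated for events, reaches functions. *)
Lemma integral_decouple (G : set (set T)) (f : T -> R) (g : T -> \bar R)
    (C : \bar R) :
  (forall A, G A -> measurable A) ->
  (forall c, (0 < c)%R -> G [set w | (c <= f w)%R]) ->
  measurable_fun setT f -> (forall w, 0 <= f w)%R ->
  measurable_fun setT g -> (forall w, 0 <= g w) -> 0 <= C ->
  (forall A, G A -> \int[P]_(w in A) g w = P A * C) ->
  \int[P]_w ((f w)%:E * g w) = (\int[P]_w (f w)%:E) * C.
Proof.
move=> mG Gf mf f0 mg g0 C0 GC.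
rewrite integral_layer_cake//.
rewrite [X in _ = X * _](_ : _ = \int[P]_w ((f w)%:E * cst 1 w)); last first.
  by apply: eq_integral => w _; rewrite mule1.
rewrite integral_layer_cake//.
rewrite -ge0_integralZr//; last first.
- by move=> s _; apply: integral_ge0.
- rewrite (_ : (fun _ => _) = (fun s : R => P [set w | (s <= f w)%R])); last first.
    apply/funext => s /=; rewrite integral_cst//= ?mul1e//.
    exact: measurable_ge_set.
  by apply: measurable_funTS; exact: measurable_tail.
apply: eq_integral => s; rewrite inE/= in_itv/= andbT => s0.
by rewrite (GC _ (Gf _ s0)) integral_cst//= ?mul1e//; apply: mG; exact: Gf.
Qed.

End layer_cake.

Section independence.
Context d (T : measurableType d) (R : realType) (P : probability T R).
Local Open Scope ereal_scope.

Lemma prode_ge0 (I : eqType) (s : seq I) (f : I -> \bar R) :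
  (forall i, i \in s -> 0 <= f i) -> 0 <= \prod_(i <- s) f i.
Proof.
move=> f0; rewrite big_seq; elim/big_ind: _ => //; first by move=> *; exact: mule_ge0.
Qed.

Lemma indep_prod_integral (I : eqType) (F : I -> set (set T))
    (f : I -> T -> R) (A0 : set T) (s1 s2 : seq I) (B : I -> set T) :
  measurable A0 ->
  (forall i A, F i A -> measurable A) ->
  (forall s B, uniq s -> (forall i, i \in s -> i \in s1 ++ s2) ->
    (forall i, i \in s -> F i (B i)) ->
    P (A0 `&` \bigcap_(i in [set` s]) B i) = P A0 * \prod_(i <- s) P (B i)) ->
  (forall i, i \in s1 -> [/\ measurable_fun setT (f i),
     (forall w, 0 <= f i w)%R &
     forall c, (0 < c)%R -> F i [set w | (c <= f i w)%R]]) ->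
  uniq (s1 ++ s2) -> (forall i, i \in s2 -> F i (B i)) ->
  \int[P]_(w in A0 `&` \bigcap_(i in [set` s2]) B i) (\prod_(i <- s1) f i w)%:E =
  P A0 * (\prod_(i <- s2) P (B i)) * \prod_(i <- s1) \int[P]_w (f i w)%:E.
Proof.
move=> mA0 mF indep; elim: s1 s2 B indep => [|i s1 IH] s2 B indep fP us FB.
  rewrite big_nil mule1.
  under eq_integral do rewrite big_nil.
  rewrite integral_cst//= ?mul1e; last first.
    by apply: measurableI => //; apply: fin_bigcap_measurable => // j /= js; exact/mF/FB.
  by apply: indep.
set A := A0 `&` _.
have mA : measurable A.
  by apply: measurableI => //; apply: fin_bigcap_measurable => // j /= js; exact/mF/FB.
have fP' j : j \in s1 -> [/\ measurable_fun setT (f j),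
     (forall w, 0 <= f j w)%R &
     forall c, (0 < c)%R -> F j [set w | (c <= f j w)%R]].
  by move=> js; apply: fP; rewrite inE js orbT.
have [mfi fi0 Fi] := fP i (mem_head _ _).
have mprod : measurable_fun setT (fun w => (\prod_(j <- s1) f j w)%:E).
  by apply/measurable_EFinP; apply: measurable_prod => j /fP'[].
have prod0 w : (0 <= \prod_(j <- s1) f j w)%R.
  by rewrite big_seq; apply: prodr_ge0 => j js; have [] := fP' j js.
set C := P A0 * (\prod_(j <- s2) P (B j)) * \prod_(j <- s1) \int[P]_w (f j w)%:E.
have C0 : 0 <= C.
  rewrite /C !mule_ge0//; first by apply: prode_ge0.
  apply: prode_ge0 => j js.
  by apply: integral_ge0 => w _; rewrite lee_fin; have [_ ->] := fP' j js.
rewrite integral_mkcond.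
transitivity (\int[P]_w ((f i w)%:E * ((fun w => (\prod_(j <- s1) f j w)%:E) \_ A) w)).
  apply: eq_integral => w _; rewrite !patchE; case: ifP => _; last by rewrite mule0.
  by rewrite big_cons EFinM.
rewrite (@integral_decouple _ _ _ _ (F i) _ _ C)//.
- by rewrite big_cons /C [in LHS]muleA [in LHS](muleC (\int[P]_w _)) -!muleA; congr (_ * _);
     congr (_ * _); rewrite muleC.
- by move=> A'; apply: mF.
- by apply/(measurable_restrictT _ _).1 => //; exact: measurable_funTS.
- by move=> w; rewrite patchE; case: ifP => // _; rewrite lee_fin.
move=> A' FA'.
rewrite -integral_mkcondr.
pose B' j := if j == i then A' else B j.
move: us; rewrite /= mem_cat negb_or => /andP[/andP[is1 is2] us].
have -> : A' `&` A = A0 `&` \bigcap_(j in [set` i :: s2]) B' j.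
  rewrite /A; apply/seteqP; split=> w /=.
    move=> [A'w [A0w Bw]]; split => // j /=; rewrite inE /B' => /orP[/eqP ->|js].
      by rewrite eqxx.
    by case: eqP => // _; apply: Bw.
  move=> [A0w Bw]; split.
    by have := Bw i; rewrite /= mem_head /B' eqxx; apply.
  split => // j /= js; have := Bw j; rewrite /= inE js orbT /B'.
  by case: eqP => [ji|_]; [rewrite -ji js in is2|apply].
rewrite IH//.
- rewrite big_cons {1}/B' eqxx /C !muleA; congr (_ * _).
  rewrite [P A' * _]muleC -!muleA; congr (_ * (_ * _)).
  by apply: eq_big_seq => j js; rewrite /B'; case: eqP => // ji; rewrite -ji js in is2.
- move=> s B1 us1 ss1 FB1; apply: indep => // j /ss1.
  by rewrite !mem_cat !inE => /or3P[] ->; rewrite ?orbT.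
- by rewrite -cat1s uniq_catCA/= mem_cat negb_or is1 is2.
- move=> j; rewrite inE /B'; case: eqP => [->//|_ /= js]; exact: FB.
Qed.

(** The number of holding variables used by a site is itself random. Splitting over the countably
    many values of the counts [U] and [V] freezes it, and the double series of one site sums to its
    own factor [C x]. *)
Lemma indep_sum_integral (U V : nat -> T -> nat) (e : nat -> nat -> nat -> T -> R)
    (c : nat -> nat -> nat -> R) (C : nat -> R) :
  (forall x k, measurable [set w | U x w = k]) ->
  (forall x k, measurable [set w | V x w = k]) ->
  (forall x k l, measurable_fun setT (e x k l)) ->
  (forall x k l w, (0 <= e x k l w)%R) ->
  (forall s u v, uniq s ->
    \int[P]_(w in \bigcap_(x in [set` s]) [set w | U x w = u x /\ V x w = v x])
       (\prod_(x <- s) e x (u x) (v x) w)%:E = (\prod_(x <- s) c x (u x) (v x))%:E) ->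
  (forall x k l, 0 <= c x k l)%R ->
  (forall x, \sum_(k <oo) \sum_(l <oo) (c x k l)%:E = (C x)%:E) ->
  (forall x, measurable_fun setT (fun w => e x (U x w) (V x w) w)) ->
  forall s, uniq s -> \int[P]_w (\prod_(x <- s) e x (U x w) (V x w) w)%:E =
    (\prod_(x <- s) C x)%:E.
Proof.
move=> mU mV me e0 H c0 cC mPhi.
pose A (s : seq nat) (u v : nat -> nat) := \bigcap_(x in [set` s]) [set w | U x w = u x /\ V x w = v x].
have mUV x k l : measurable [set w | U x w = k /\ V x w = l].
  exact: (measurableI _ _ (mU x k) (mV x l)).
have mA s u v : measurable (A s u v).
  by apply: fin_bigcap_measurable.
(* Sites in [s2] have their counts frozen at [u] and [v], those in [s1] are still random; the
   induction moves one site at a time from [s1] to [s2]. *)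
suff K s1 s2 u v : uniq (s1 ++ s2) -> \int[P]_(w in A s2 u v)
    ((\prod_(x <- s2) e x (u x) (v x) w) * \prod_(x <- s1) e x (U x w) (V x w) w)%:E =
    ((\prod_(x <- s2) c x (u x) (v x)) * \prod_(x <- s1) C x)%:E.
  move=> s us; have := K s [::] (fun=> 0%N) (fun=> 0%N).
  rewrite cats0 => /(_ us); rewrite big_nil mul1r => <-.
  rewrite /A set_nil bigcap_set0; apply: eq_integral => w _.
  by rewrite big_nil mul1r.
elim: s1 s2 u v => [|x s1 IH] s2 u v us.
  rewrite big_nil mulr1 -H//; apply: eq_integral => w _.
  by rewrite big_nil mulr1.
pose h w := ((\prod_(x <- s2) e x (u x) (v x) w) * \prod_(x <- x :: s1) e x (U x w) (V x w) w)%R.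
have mh : measurable_fun setT (EFin \o h).
  by apply/measurable_EFinP; apply: measurable_funM; apply: measurable_prod => *.
have h0 w : 0 <= (h w)%:E.
  by rewrite lee_fin mulr_ge0//; apply: prodr_ge0.
have step k l : \int[P]_(w in A s2 u v `&` [set w | U x w = k /\ V x w = l]) (h w)%:E =
   ((\prod_(x <- s2) c x (u x) (v x)) * c x k l * \prod_(x <- s1) C x)%:E.
  pose u' y := if y == x then k else u y.
  pose v' y := if y == x then l else v y.
  move: us; rewrite /= mem_cat negb_or => /andP[/andP[xs1 xs2] us].
  have su' y : y \in s2 -> u' y = u y.
    by move=> ys; rewrite /u'; case: eqP => // yx; rewrite -yx ys in xs2.
  have sv' y : y \in s2 -> v' y = v y.
    by move=> ys; rewrite /v'; case: eqP => // yx; rewrite -yx ys in xs2.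
  have := IH (x :: s2) u' v'; rewrite -cat1s uniq_catCA/= mem_cat negb_or xs1 xs2 us.
  move=> /(_ isT).
  rewrite [X in _ = (X * _)%:E -> _]big_cons.
  have [-> ->] : u' x = k /\ v' x = l by rewrite /u' /v' eqxx.
  rewrite (eq_big_seq (fun y => c y (u y) (v y))); last first.
    by move=> y ys; rewrite su' ?sv'.
  rewrite [(c x k l * _)%R]mulrC => <-.
  have -> : A s2 u v `&` [set w | U x w = k /\ V x w = l] = A (x :: s2) u' v'.
    apply/seteqP; split => w /=.
      move=> [Aw [Uw Vw]] y /=; rewrite inE => /predU1P[->|ys].
        by rewrite /u' /v' eqxx.
      by rewrite su'// sv'//; exact: Aw.
    move=> Aw; split.
      by move=> y /= ys; have := Aw y; rewrite /= inE ys orbT su' ?sv'//; apply.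
    by have := Aw x; rewrite /= mem_head /u' /v' eqxx; apply.
  apply: eq_integral => w; rewrite inE => Aw; congr (_%:E).
  have [Ux Vx] : U x w = k /\ V x w = l.
    by have := Aw x; rewrite /= mem_head /u' /v' eqxx; apply.
  rewrite /h !big_cons Ux Vx.
  have [-> ->] : u' x = k /\ v' x = l by rewrite /u' /v' eqxx.
  rewrite [X in _ = (_ * X * _)%R](eq_big_seq (fun y => e y (u y) (v y) w)); last first.
    by move=> y ys; rewrite su' ?sv'.
  by ring.
have -> : A s2 u v = \bigcup_k \bigcup_l (A s2 u v `&` [set w | U x w = k /\ V x w = l]).
  apply/seteqP; split => w /=; last by move=> [k _ [l _ []]].
  by move=> Aw; exists (U x w) => //; exists (V x w).
rewrite ge0_integral_bigcup//; last 3 first.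
- by apply: measurable_funTS.
- by move=> w _; exact: h0.
- by apply/trivIsetP => i j _ _ /eqP ij; rewrite -subset0 => w /= [[l _ [_ [Ui _]]] [m _ [_ [Uj _]]]];
    apply: ij; rewrite -Ui.
rewrite big_cons.
transitivity (\sum_(k <oo) (\sum_(l <oo) (((\prod_(x <- s2) c x (u x) (v x)) * \prod_(x <- s1) C x)%:E * (c x k l)%:E))).
  apply: eq_eseriesr => k _; rewrite ge0_integral_bigcup//.
  - by apply: eq_eseriesr => l _; rewrite step mulrAC EFinM.
  - by move=> l; exact: (measurableI _ _ (mA _ _ _) (mUV _ _ _)).
  - by apply: measurable_funTS.
  - by move=> w _; exact: h0.
  - by apply/trivIsetP => i j _ _ /eqP ij; rewrite -subset0 => w /= [[_ [_ Ui]] [_ [_ Uj]]];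
    apply: ij; rewrite -Ui.
under eq_eseriesr => k _.
  rewrite nneseriesZl; last by move=> l _; rewrite lee_fin.
  over.
rewrite nneseriesZl//; last by move=> k _; apply: nneseries_ge0 => l _; rewrite lee_fin.
  by rewrite cC -EFinM; congr (_%:E); ring.
by move=> k; apply: bigcup_measurable => l _; exact: (measurableI _ _ (mA _ _ _) (mUV _ _ _)).
Qed.

End independence.

Section exponential_variable.
Context d (T : measurableType d) (R : realType) (P : probability T R).

Lemma continuous_powR_itv (p b : R) : 0 < p ->
  {within `[0, b], continuous (fun s : R => s `^ p)}.
Proof.
move=> p0; apply: (@continuous_subspaceW _ _ `[0, b]%classic `[0, +oo[%classic).
  by move=> x /=; rewrite !in_itv/= andbT => /andP[].
apply/continuous_within_itvcyP; split.
  move=> x; rewrite in_itv/= andbT => x0.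
  apply: differentiable_continuous; apply/derivable1_diffP.
  by apply: derivable_powR; rewrite in_itv/= andbT.
by rewrite powR0 ?gt_eqF//; exact: powR_cvg0.
Qed.

Lemma is_derive_powR (p x : R) : 0 < x ->
  is_derive x 1 (fun s : R => s `^ p) (p * x `^ (p - 1)).
Proof.
move=> x0; have xi : x \in `]0, +oo[ by rewrite in_itv/= andbT.
apply: DeriveDef; first exact: derivable_powR.
by rewrite -derive1E powR_derive1.
Qed.

(** Layer cake again: P(s <= exp(-c X)) is 1 - s^(1/c) for s in ]0, 1] and 0 beyond, and the
    integral of this tail is 1 - c / (1 + c). *)
Lemma exponential_laplace (X : T -> R) (c : R) : 0 <= c ->
  measurable_fun setT X -> (forall w, 0 <= X w) ->
  (forall B, measurable B -> P (X @^-1` B) = exponential_prob 1 B) ->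
  (\int[P]_w (expR (- c * X w))%:E = ((1 + c)^-1)%:E)%E.
Proof.
rewrite le_eqVlt => /predU1P[<-|c0] mX X0 law.
  rewrite addr0 invr1; under eq_integral do rewrite oppr0 mul0r expR0.
  by rewrite integral_cst//= mul1e probability_setT.
have mf : measurable_fun setT (fun w => expR (- c * X w)).
  by apply: measurableT_comp => //; exact: measurable_funM.
rewrite (_ : (\int[P]_w _ = \int[P]_w ((expR (- c * X w))%:E * cst 1 w))%E); last first.
  by apply: eq_integral => w _; rewrite mule1.
rewrite integral_layer_cake//.
have Ps s : 0 < s <= 1 ->
  P [set w | s <= expR (- c * X w)] = (1 - s `^ c^-1)%:E.
  move=> /andP[s0 s1].
  have -> : [set w | s <= expR (- c * X w)] = X @^-1` `[0, - ln s / c].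
    apply/seteqP; split => w /=; rewrite in_itv/= X0/= ler_pdivlMr//.
      by rewrite -{1}[s]lnK ?posrE// ler_expR; lra.
    by move=> H; rewrite -{1}[s]lnK ?posrE// ler_expR; lra.
  rewrite law//.
  have [s1'|s1'] := ltP s 1.
    rewrite exponential_prob_itv0c; last first.
      by rewrite divr_gt0// oppr_gt0 ln_lt0// s0.
    rewrite EFinB; congr (_ - _%:E)%E.
    by rewrite /powR gt_eqF//; congr expR; field; rewrite gt_eqF.
  have -> : s = 1 by apply/eqP; rewrite eq_le s1 s1'.
  rewrite ln1 oppr0 mul0r powR1 subrr set_itv1.
  by rewrite /exponential_prob integral_set1.
have -> : `]0, +oo[%classic = `]0, 1]%classic `|` `]1, +oo[%classic :> set R.
  by rewrite -itv_bndbnd_setU// bnd_simp.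
rewrite ge0_integral_setU//=; last 3 first.
- apply: measurable_funTS.
  rewrite (_ : (fun _ => _) = (fun s : R => P [set w | s <= expR (- c * X w)])); last first.
    apply/funext => s /=; rewrite integral_cst//= ?mul1e//.
    exact: measurable_ge_set.
  exact: measurable_tail.
- by move=> s _; apply: integral_ge0.
- by rewrite disj_set2E; apply/eqP; rewrite -subset0 => x /=; rewrite !in_itv/= andbT => -[/andP[_ +]]; rewrite leNgt => /negP.
rewrite [X in (_ + X)%E]integral0_eq ?adde0; last first.
  move=> s; rewrite /= in_itv/= andbT => s1.
  rewrite (_ : [set w | _] = set0) ?integral_set0//.
  rewrite -subset0 => w /= H.
  have : expR (- c * X w) <= 1 by rewrite -expR0 ler_expR mulNr oppr_le0 mulr_ge0// ltW.
  by move: H s1; lra.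
transitivity (\int[lebesgue_measure]_(s in `[0%R, 1%R]) (1 - s `^ c^-1)%:E)%E.
  rewrite -(@integral_itv_obnd_cbnd R 0 (BRight 1) (fun s => (1 - s `^ c^-1)%:E)); last first.
    apply/measurable_EFinP; apply: measurable_funB => //.
    by apply: measurable_funTS; exact: measurable_powR.
  apply: eq_integral => s; rewrite inE/= in_itv/= => s01.
  rewrite integral_cst//= ?mul1e ?Ps//.
  exact: measurable_ge_set.
have q1 : 0 < 1 + c^-1 by rewrite addr_gt0 ?invr_gt0.
pose F (s : R) : R := s - s `^ (1 + c^-1) / (1 + c^-1).
have dF (x : R) : 0 < x -> is_derive x 1 F (1 - x `^ c^-1).
  move=> x0; rewrite /F; have ? := is_derive_powR (1 + c^-1) x0.
  apply: is_derive_eq; rewrite scaler0 add0r /GRing.scale/=.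
  by rewrite (_ : 1 + c^-1 - 1 = c^-1) ?mulKf ?gt_eqF//; ring.
have cF : {within `[0, 1], continuous F}.
  have idc : {within `[0, 1], continuous (fun s : R => s)}.
    by apply: continuous_subspaceT => ?; exact: cvg_id.
  move=> x; apply: (@cvgB _ _ _ _ _ id); first exact: idc.
  by apply: cvgMl; exact: continuous_powR_itv.
rewrite (@continuous_FTC2 _ _ F)//.
- rewrite /F powR1 powR0; last by rewrite gt_eqF.
  rewrite -EFinB; congr (_%:E); field; rewrite ?gt_eqF//=; lra.
- move=> x; apply: cvgB; first exact: cvg_cst.
  by apply: continuous_powR_itv; rewrite invr_gt0.
- have [_ F0 F1] := (continuous_within_itvP F ltr01).1 cF; split => //.
  by move=> x; rewrite in_itv/= => /andP[x0 _]; have [] := dF _ x0.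
- move=> x; rewrite in_itv/= => /andP[x0 _].
  by rewrite derive1E; have [_ ->] := dF _ x0.
Qed.

End exponential_variable.

Section driven.
Context d (T : measurableType d) (R : realType) (P : probability T R).

(** [K_driving] seen along an enumeration of the sites that carry a jump: every rate is positive,
    and sums over sites become series. *)
Definition driven (r : nat -> R) (N : nat -> R -> T -> nat)
    (tau : nat -> nat -> T -> R) : Prop :=
  [/\ forall k, 0 < r k /\ poisson_counting_process P (r k) (N k),
      mutually_independent P setT (fun k => sigma_of [set u : R | 0 <= u] (N k)),
      forall k i, (1 <= i)%N -> [/\ measurable_fun setT (tau k i),
         (forall w, 0 <= tau k i w)
         & forall B, measurable B -> P (tau k i @^-1` B) = exponential_prob 1 B],
      mutually_independent P [set p : nat * nat | (1 <= p.2)%N]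
        (fun p => sigma_of [set: unit] (fun _ => tau p.1 p.2))
    & forall A B : set T,
        sigma_of [set q : nat * R | 0 <= q.2] (fun q => N q.1 q.2) A ->
        sigma_of [set p : nat * nat | (1 <= p.2)%N] (fun p => tau p.1 p.2) B ->
        P (A `&` B) = (P A * P B)%E].

Lemma sigma_of_sub (J K : Type) (d' : measure_display) (U : measurableType d')
    (D : set J) (E : set K) (X : J -> T -> U) (Y : K -> T -> U) :
  (forall j, D j -> exists2 k, E k & X j = Y k) ->
  sigma_of D X `<=` sigma_of E Y.
Proof.
move=> h; apply: smallest_sub; first exact: smallest_sigma_algebra.
move=> A [j Dj XA]; apply: sub_sigma_algebra.
by have [k Ek XY] := h j Dj; exists k => //; rewrite -XY.
Qed.

Lemma sigma_of_measurable (J : Type) (d' : measure_display) (U : measurableType d')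
    (D : set J) (X : J -> T -> U) :
  (forall j, D j -> measurable_fun setT (X j)) ->
  sigma_of D X `<=` measurable.
Proof.
move=> mX; apply: smallest_sub; first exact: sigma_algebra_measurable.
by move=> A [j Dj [B mB <-]]; exact: mX.
Qed.

Lemma sigma_of_preimage (J : Type) (d' : measure_display) (U : measurableType d')
    (D : set J) (X : J -> T -> U) (j : J) (B : set U) :
  D j -> measurable B -> sigma_of D X (X j @^-1` B).
Proof.
by move=> Dj mB; apply: sub_sigma_algebra; exists j => //; exists B => //; rewrite setTI.
Qed.

Lemma sigma_of_setI (J : Type) (d' : measure_display) (U : measurableType d')
    (D : set J) (X : J -> T -> U) (A B : set T) :
  sigma_of D X A -> sigma_of D X B -> sigma_of D X (A `&` B).
Proof.
move=> XA XB.
exact: (@measurableI _ (g_sigma_algebraType (\bigcup_(j in D) preimage_set_system setT (X j) measurable))).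
Qed.

Lemma sigma_of_bigcap (I : eqType) (J : Type) (d' : measure_display) (U : measurableType d')
    (D : set J) (X : J -> T -> U) (s : seq I) (A : I -> set T) :
  (forall i, i \in s -> sigma_of D X (A i)) ->
  sigma_of D X (\bigcap_(i in [set` s]) A i).
Proof.
move=> XA.
exact: (@fin_bigcap_measurable _ (g_sigma_algebraType (\bigcup_(j in D) preimage_set_system setT (X j) measurable))).
Qed.

Lemma K_driving_driven (a : R) (g : R -> R) (N : R -> R -> T -> nat)
    (tau : R -> nat -> T -> R) (e : nat -> R) :
  K_driving P a g N tau -> injective e ->
  (forall k, 0 <= e k <= 1) -> (forall k, 0 < g (e k)) ->
  driven (fun k => g (e k) `^ a) (fun k => N (e k)) (fun k => tau (e k)).
Proof.
move=> [NP N0 Nind tauP [tauind cross]] ei eI g0; split.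
- by move=> k; split; [exact: powR_gt0|exact: (NP _ (eI k) (g0 k))].
(* Independence is given for families indexed by locations; [xget] serves as a left inverse of the
   injection [e] to reindex the family [A]. *)
- move=> s A us sA; have := Nind [seq e k | k <- s] (fun x => A (xget 0%N [set k | e k = x])).
  have Ae k : A (xget 0%N [set j | e j = e k]) = A k.
    rewrite (_ : xget _ _ = k)//; apply: ei.
    exact: (@xgetPex _ 0%N [set j | e j = e k] (ex_intro _ k erefl)).
  rewrite map_inj_uniq// => /(_ us).
  rewrite big_map; under eq_bigr do rewrite Ae.
  rewrite (_ : \bigcap_(_ in _) _ = \bigcap_(i in [set` s]) A i); last first.
    apply/seteqP; split => w /= H.
      by move=> k ks; rewrite -Ae; apply: H; apply: map_f.
    by move=> _ /= /mapP[k ks ->]; rewrite Ae; exact: H.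
  apply => _ /mapP[k ks ->]; split; first exact: eI.
  by rewrite Ae; have [_] := sA k ks.
- by move=> k i i1; exact: (tauP _ _ (eI k) i1).
- move=> s A us sA.
  pose ee (p : nat * nat) := (e p.1, p.2).
  have eei : injective ee by move=> [a1 b1] [a2 b2] [/ei -> ->].
  have := tauind [seq ee k | k <- s] (fun x => A (xget (0%N, 0%N) [set k | ee k = x])).
  have Ae k : A (xget (0%N, 0%N) [set j | ee j = ee k]) = A k.
    rewrite (_ : xget _ _ = k)//; apply: eei.
    exact: (@xgetPex _ (0%N, 0%N) [set j | ee j = ee k] (ex_intro _ k erefl)).
  rewrite map_inj_uniq// => /(_ us).
  rewrite big_map; under eq_bigr do rewrite Ae.
  rewrite (_ : \bigcap_(_ in _) _ = \bigcap_(i in [set` s]) A i); last first.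
    apply/seteqP; split => w /= H.
      by move=> k ks; rewrite -Ae; apply: H; apply: map_f.
    by move=> _ /= /mapP[k ks ->]; rewrite Ae; exact: H.
  apply => _ /mapP[k ks ->]; have [? ?] := sA k ks; split; first by split; [exact: eI|].
  by rewrite Ae.
- move=> A B NA tB; apply: cross.
    by apply: sigma_of_sub NA => -[k u] /= u0; exists (e k, u) => //=; split => //; exact: eI.
  by apply: sigma_of_sub tB => -[k u] /= u0; exists (e k, u) => //=; split => //; exact: eI.
Qed.

End driven.

Lemma poisson_law_pmf (R : realType) (r : R) (k : nat) : 0 <= r ->
  poisson_law r [set k] = (r ^+ k / k`!%:R * expR (- r))%:E.
Proof.
rewrite /poisson_law /poisson_prob le_eqVlt => /predU1P[<-|r0].
  rewrite ltxx diracE; case: k => [|k].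
    by rewrite mem_set//= expr0 fact0 divr1 oppr0 expR0 mulr1.
  by rewrite memNset//= expr0n/= !mul0r.
by rewrite r0 esum_set1 ?lee_fin ?poisson_pmf_ge0// /poisson_pmf r0.
Qed.

(** Values z > 1 are included because the Chernoff bound for the jump counts takes z = exp(h). *)
Lemma poisson_pgf (R : realType) (r z : R) : 0 <= r -> 0 <= z ->
  (\sum_(k <oo) (r ^+ k / k`!%:R * expR (- r) * z ^+ k)%:E = (expR (- (r * (1 - z))))%:E)%E.
Proof.
move=> r0 z0.
transitivity ((expR (- r))%:E * \sum_(k <oo) ((r * z) ^+ k / k`!%:R)%:E)%E.
  rewrite -nneseriesZl//; last first.
    by move=> k _; rewrite lee_fin divr_ge0// exprn_ge0// mulr_ge0.
  by apply: eq_eseriesr => k _; rewrite -EFinM exprMn; congr (_%:E); ring.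
rewrite (_ : - (r * (1 - z)) = - r + r * z); last by ring.
rewrite expRD EFinM; congr (_ * _)%E.
rewrite expRE -EFin_lim; last first.
  rewrite /pseries/=; under eq_fun do rewrite mulrC.
  exact: is_cvg_series_exp_coeff.
apply/congr_lim/funext => n/=; rewrite /pseries/= /series/= -sumEFin//.
by apply: eq_bigr => k _; rewrite mulrC.
Qed.

(** * Joint Laplace transform of finitely many sites at two times *)

Section laplace_finite.
Context d (T : measurableType d) (R : realType) (P : probability T R).
Variables (r : nat -> R) (N : nat -> R -> T -> nat) (tau : nat -> nat -> T -> R).
Hypothesis drv : driven P r N tau.

(** This is 1 - 1 / (1 + z), the Laplace exponent at z of a rate 1 compound Poisson process with
    standard exponential jumps. *)
Definition lap_exponent (z : R) : R := z / (1 + z).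

Definition holding_sum (k n : nat) (w : T) : R := \sum_(1 <= i < n.+1) tau k i w.

Lemma driven_rate_gt0 k : 0 < r k.
Proof. by have [+ _ _ _ _] := drv => /(_ k)[]. Qed.

Lemma driven_measurable_count k u : 0 <= u -> measurable_fun setT (N k u).
Proof. by have [+ _ _ _ _] := drv => /(_ k)[_ [+ _]]; apply. Qed.

Lemma driven_measurable_eq k u n : 0 <= u -> measurable [set w | N k u w = n].
Proof.
move=> u0; have mN := driven_measurable_count k u0; have := mN measurableT [set n].
by rewrite setTI; apply.
Qed.

Lemma driven_count0 k w : N k 0 w = 0%N.
Proof. by have [+ _ _ _ _] := drv => /(_ k)[_ [_ [/(_ w)[]]]]. Qed.

Lemma driven_mono k w u v : 0 <= u -> u <= v -> (N k u w <= N k v w)%N.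
Proof. by move=> u0 uv; have [/(_ k)[_ [_ [/(_ w)[_ h _] _]]] _ _ _ _] := drv; exact: h. Qed.

Lemma driven_increment k u v n : 0 <= u -> u <= v ->
  P [set w | (N k v w - N k u w)%N = n] = poisson_law (r k * (v - u)) [set n].
Proof. by move=> u0 uv; have [/(_ k)[_ [_ [_ [h _]]]] _ _ _ _] := drv; exact: h. Qed.

Lemma measurable_increment k u v n : 0 <= u -> 0 <= v ->
  measurable [set w | (N k v w - N k u w)%N = n].
Proof.
move=> u0 v0; rewrite (_ : [set w | _] =
    \bigcup_i \bigcup_j [set w | [/\ N k v w = i, N k u w = j & (i - j)%N = n]]); last first.
  apply/seteqP; split => w /=; last by move=> [i _ [j _ [-> ->]]].
  by move=> wn; exists (N k v w) => //; exists (N k u w).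
apply: bigcup_measurable => i _; apply: bigcup_measurable => j _.
have [<-|ijn] := pselect ((i - j)%N = n); last first.
  by rewrite (_ : [set w | _] = set0)//; apply/seteqP; split => // w [].
rewrite (_ : [set w | _] = [set w | N k v w = i] `&` [set w | N k u w = j]).
  by apply: measurableI; exact: driven_measurable_eq.
by apply/seteqP; split => w /= [].
Qed.

Lemma driven_two_increments k u v m n : 0 <= u -> u <= v ->
  P [set w | N k u w = m /\ (N k v w - N k u w)%N = n] =
  ((r k * u) ^+ m / m`!%:R * expR (- (r k * u)) *
   ((r k * (v - u)) ^+ n / n`!%:R * expR (- (r k * (v - u)))))%:E.
Proof.
move=> u0 uv; have v0 := le_trans u0 uv.
have [+ _ _ _ _] := drv => /(_ k)[rk [_ [_ [_ ind]]]].
(* The grid 0, u, v, v, ...: as the count vanishes at 0, the count at [u] is its first increment. *)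
pose t (i : nat) := if i is i'.+1 then (if i' is 0 then u else v) else 0.
have {ind} := ind t (lexx 0) _.
have t_le i : t i <= t i.+1 by case: i => [|[|i]] /=.
move=> /(_ t_le) ind.
pose A (i : nat) := if i is 0 then [set w | N k u w = m] else [set w | (N k v w - N k u w)%N = n].
have := ind [:: 0%N; 1%N] A isT.
rewrite (_ : \bigcap_(_ in _) _ = [set w | N k u w = m /\ (N k v w - N k u w)%N = n]); last first.
  apply/seteqP; split => w /=.
    by move=> H; split; [exact: (H 0%N)|exact: (H 1%N)].
  by move=> [H1 H2] i /=; rewrite !inE => /orP[]/eqP ->.
move=> ->.
  rewrite !big_cons big_nil mule1 /A/= driven_increment// EFinM; congr (_ * _)%E.
    rewrite -poisson_law_pmf ?mulr_ge0// 1?ltW//.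
    rewrite -[in RHS](subr0 u) -driven_increment//; congr (P _).
    by apply/seteqP; split => w /=; rewrite driven_count0 subn0.
  by rewrite poisson_law_pmf// mulr_ge0 ?subr_ge0// ltW.
move=> i; rewrite !inE => /orP[]/eqP -> /=; split => //.
  rewrite (_ : [set w | _] = (fun w => (N k u w - N k 0 w)%N) @^-1` [set m]); last first.
    by apply/seteqP; split => w /=; rewrite driven_count0 subn0.
  exact: (@sigma_of_preimage _ _ unit _ _ setT (fun _ w => (N k u w - N k 0 w)%N) tt).
rewrite (_ : [set w | _] = (fun w => (N k v w - N k u w)%N) @^-1` [set n])//.
exact: (@sigma_of_preimage _ _ unit _ _ setT (fun _ w => (N k v w - N k u w)%N) tt).
Qed.

Lemma measurable_holding k i : (1 <= i)%N -> measurable_fun setT (tau k i).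
Proof. by move=> i1; have [_ _ /(_ k i i1)[]] := drv. Qed.

Lemma holding_ge0 k i w : (1 <= i)%N -> 0 <= tau k i w.
Proof. by move=> i1; have [_ _ /(_ k i i1)[]] := drv. Qed.

Lemma holding_sum_ge0 k n w : 0 <= holding_sum k n w.
Proof.
rewrite /holding_sum big_nat_cond; apply: sumr_ge0 => i /andP[/andP[i1 _] _].
exact: holding_ge0.
Qed.

Lemma holding_sum_mono k m n w : (m <= n)%N -> holding_sum k m w <= holding_sum k n w.
Proof.
move=> mn; rewrite /holding_sum [leRHS](@big_cat_nat _ _ _ m.+1)//= lerDl.
rewrite big_nat_cond; apply: sumr_ge0 => i /andP[/andP[i1 _] _].
by apply: holding_ge0; exact: leq_trans i1.
Qed.

Lemma measurable_holding_sum k n : measurable_fun setT (holding_sum k n).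
Proof.
elim: n => [|n IH].
  rewrite (_ : holding_sum k 0 = cst 0) //.
  by apply/funext => w; rewrite /holding_sum big_geq.
rewrite (_ : holding_sum k n.+1 = (fun w => holding_sum k n w + tau k n.+1 w)); last first.
  by apply/funext => w; rewrite /holding_sum big_nat_recr.
by apply: measurable_funD => //; exact: measurable_holding.
Qed.

Lemma measurable_fun_nat_case (h : nat -> T -> R) (M : T -> nat) :
  (forall n, measurable_fun setT (h n)) -> measurable_fun setT M ->
  measurable_fun setT (fun w => h (M w) w).
Proof.
move=> mh mM _ B mB; rewrite setTI.
rewrite (_ : _ @^-1` B = \bigcup_n (M @^-1` [set n] `&` h n @^-1` B)); last first.
  apply/seteqP; split => w /=; last by move=> [n _ [<-]].
  by move=> Bw; exists (M w).
apply: bigcup_measurable => n _; apply: measurableI.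
  by rewrite -[X in measurable X]setTI; exact: mM.
by rewrite -[X in measurable X]setTI; exact: mh.
Qed.

Lemma measurable_holding_count k u : 0 <= u ->
  measurable_fun setT (fun w => holding_sum k (N k u w) w).
Proof.
move=> u0; apply: measurable_fun_nat_case; first exact: measurable_holding_sum.
exact: driven_measurable_count.
Qed.

(** The holding variables up to the count at [u] enter at both times, those between the two counts
    only at [v]. With the counts frozen, each contributes the Laplace transform of an exponential
    variable; summing over the independent Poisson counts then exponentiates. *)
Lemma laplace_finite (c : nat -> R) (u v a b : R) (s : seq nat) :
  (forall k, 0 <= c k) -> 0 <= u -> u <= v -> 0 <= a -> 0 <= b -> uniq s ->
  (\int[P]_w (\prod_(k <- s) expR (- (a * (c k * holding_sum k (N k u w) w) +
     b * (c k * holding_sum k (N k v w) w))))%:E =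
   (\prod_(k <- s) expR (- (u * (r k * lap_exponent ((a + b) * c k)) +
     (v - u) * (r k * lap_exponent (b * c k)))))%:E)%E.
Proof.
move=> c0 u0 uv a0 b0 us; have v0 := le_trans u0 uv.
(* Coefficient of the i-th holding variable when the count at [u] is m: it is weighted by a + b if
   already used at [u], and by b if used only at [v]. *)
pose cf k m i := if (i <= m)%N then (a + b) * c k else b * c k.
have cf0 k m i : 0 <= cf k m i by rewrite /cf; case: ifP => _; rewrite mulr_ge0// addr_ge0.
pose e k m n w := \prod_(i <- iota 1 (m + n)) expR (- cf k m i * tau k i w).
pose V k w := (N k v w - N k u w)%N.
pose p1 k m := (r k * u) ^+ m / m`!%:R * expR (- (r k * u)).
pose p2 k n := (r k * (v - u)) ^+ n / n`!%:R * expR (- (r k * (v - u))).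
have ru0 k : 0 <= r k * u by rewrite mulr_ge0// ltW// driven_rate_gt0.
have rv0 k : 0 <= r k * (v - u) by rewrite mulr_ge0 ?subr_ge0// ltW// driven_rate_gt0.
have p10 k m : 0 <= p1 k m by rewrite mulr_ge0 ?expR_ge0// divr_ge0// exprn_ge0.
have p20 k m : 0 <= p2 k m by rewrite mulr_ge0 ?expR_ge0// divr_ge0// exprn_ge0.
have z1 k : 0 <= (1 + (a + b) * c k)^-1 by rewrite invr_ge0 addr_ge0// mulr_ge0// addr_ge0.
have z2 k : 0 <= (1 + b * c k)^-1 by rewrite invr_ge0 addr_ge0// mulr_ge0.
pose cc k m n := p1 k m * (1 + (a + b) * c k)^-1 ^+ m * (p2 k n * (1 + b * c k)^-1 ^+ n).
pose C k := expR (- (u * (r k * lap_exponent ((a + b) * c k)) +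
     (v - u) * (r k * lap_exponent (b * c k)))).
have ee k w : e k (N k u w) (V k w) w = expR (- (a * (c k * holding_sum k (N k u w) w) +
     b * (c k * holding_sum k (N k v w) w))).
  rewrite /e /V subnKC ?driven_mono// -expR_sum; congr expR.
  rewrite (_ : iota 1 _ = index_iota 1 (N k v w).+1); last by rewrite /index_iota subn1.
  rewrite /holding_sum [in RHS](@big_cat_nat _ _ _ (N k u w).+1 1 (N k v w).+1)//=; last first.
    by rewrite ltnS driven_mono.
  rewrite (@big_cat_nat _ _ _ (N k u w).+1 1 (N k v w).+1)//=; last first.
    by rewrite ltnS driven_mono.
  rewrite (eq_big_nat _ _ (F2 := fun i => - ((a + b) * c k) * tau k i w)); last first.
    by move=> i /andP[_ iN]; rewrite /cf -ltnS iN.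
  rewrite [X in _ + X = _](eq_big_nat _ _ (F2 := fun i => - (b * c k) * tau k i w)); last first.
    by move=> i /andP[iN _]; rewrite /cf leqNgt iN.
  by rewrite -!mulr_sumr; ring.
under eq_integral do under eq_bigr do rewrite -ee.
apply: (@indep_sum_integral _ _ _ P (fun k => N k u) V e cc C) => //.
- by move=> k m; exact: driven_measurable_eq.
- by move=> k m; exact: measurable_increment.
- move=> k m n; apply: measurable_prod => i; rewrite mem_iota => /andP[i1 _].
  by apply: measurableT_comp => //; apply: measurable_funM => //; exact: measurable_holding.
- by move=> k m n w; apply: prodr_ge0 => i _; exact: expR_ge0.
- move=> s' mu mv us'.
  pose A0 := \bigcap_(k in [set` s']) [set w | N k u w = mu k /\ V k w = mv k].
  (* Sites and holding indices are flattened into one list of pairs, the index set in which the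
     holding variables are independent. *)
  pose L := [seq (k, i) | k <- s', i <- iota 1 (mu k + mv k)].
  have uL : uniq L.
    apply: allpairs_uniq_dep => //; first by move=> k _; exact: iota_uniq.
    by move=> [k1 i1] [k2 i2] /= _ _ [-> ->].
  have L1 p : p \in L -> (1 <= p.2)%N.
    by move=> /allpairsPdep[k [i [_ + ->]]]; rewrite mem_iota => /andP[].
  have := @indep_prod_integral _ _ _ P (nat * nat)%type
    (fun p => if (1 <= p.2)%N then sigma_of [set: unit] (fun _ => tau p.1 p.2) else set0)
    (fun p w => expR (- cf p.1 (mu p.1) p.2 * tau p.1 p.2 w)) A0 L [::] (fun=> setT).
  rewrite cats0 set_nil bigcap_set0 setIT big_nil mule1 => H.
  transitivity (\int[P]_(w in A0) (\prod_(p <- L) expR (- cf p.1 (mu p.1) p.2 * tau p.1 p.2 w))%:E)%E.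
    by apply: eq_integral => w _; rewrite /L big_allpairs_dep.
  have sA0 : sigma_of [set q : nat * R | 0 <= q.2] (fun q => N q.1 q.2) A0.
    apply: sigma_of_bigcap => k ks.
    rewrite (_ : [set w | _] = (N k u @^-1` [set mu k]) `&` (N k v @^-1` [set (mu k + mv k)%N])); last first.
      apply/seteqP; split => w /= [Nu].
        by rewrite /V Nu => <-; rewrite -Nu subnKC ?driven_mono.
      by rewrite /V Nu => ->; rewrite addKn.
    by apply: sigma_of_setI;
      [exact: (@sigma_of_preimage _ _ (nat * R) _ _ [set q | 0 <= q.2] (fun q => N q.1 q.2) (k, u))
      |exact: (@sigma_of_preimage _ _ (nat * R) _ _ [set q | 0 <= q.2] (fun q => N q.1 q.2) (k, v))].
  have PA0 : P A0 = (\prod_(k <- s') (p1 k (mu k) * p2 k (mv k)))%:E.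
    have [_ Nind _ _ _] := drv.
    rewrite /A0 Nind//.
      rewrite -prodEFin; apply: eq_bigr => k _; rewrite -driven_two_increments//.
    move=> k _; split => //.
    rewrite (_ : [set w | _] = (N k u @^-1` [set mu k]) `&` (N k v @^-1` [set (mu k + mv k)%N])); last first.
      apply/seteqP; split => w /= [Nu].
        by rewrite /V Nu => <-; rewrite -Nu subnKC ?driven_mono.
      by rewrite /V Nu => ->; rewrite addKn.
    by apply: sigma_of_setI;
      [exact: (@sigma_of_preimage _ _ R _ _ [set q | 0 <= q] (N k) u)
      |exact: (@sigma_of_preimage _ _ R _ _ [set q | 0 <= q] (N k) v)].
  rewrite H//.
  + rewrite PA0 (eq_big_seq (fun p : nat * nat => (1 + cf p.1 (mu p.1) p.2)^-1%:E)); last first.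
      move=> p /L1 p1'; have [_ _ /(_ p.1 p.2 p1')[t1 t2 t3] _ _] := drv.
      by rewrite exponential_laplace.
    rewrite prodEFin -EFinM; congr (_%:E).
    rewrite /L big_allpairs_dep -big_split/=; apply: eq_bigr => k _.
    rewrite iotaD big_cat/=.
    rewrite (eq_big_seq (fun _ => (1 + (a + b) * c k)^-1)); last first.
      by move=> i; rewrite mem_iota /cf add1n ltnS => /andP[_ ->].
    rewrite [X in _ * (_ * X) = _](eq_big_seq (fun _ => (1 + b * c k)^-1)); last first.
      by move=> i; rewrite mem_iota /cf add1n => /andP[iN _]; rewrite leqNgt iN.
    by rewrite !big_const_seq !count_predT !size_iota !iter_mulr_1 /cc; ring.
  + apply: (sigma_of_measurable _ sA0) => -[k q] /= q0; exact: driven_measurable_count.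
  + move=> p A; case: ifP => // p1'; apply: sigma_of_measurable => _ _.
    exact: measurable_holding.
  + move=> s0 B us0 ss0 FB; have [_ _ _ tind cross] := drv.
    have FB' p : p \in s0 -> (1 <= p.2)%N /\ sigma_of [set: unit] (fun _ => tau p.1 p.2) (B p).
      by move=> ps; have := FB p ps; rewrite L1//; exact: ss0.
    rewrite cross//; last first.
      apply: sigma_of_bigcap => p /FB'[p1' Bp].
      by apply: sigma_of_sub Bp => _ _; exists p.
    by congr (_ * _)%E; apply: tind => // p /FB'[].
  + move=> p /L1 p1'; split.
    * by apply: measurableT_comp => //; apply: measurable_funM => //; exact: measurable_holding.
    * by move=> w; exact: expR_ge0.
    * move=> q q0; rewrite p1'.
      rewrite (_ : [set w | _] = tau p.1 p.2 @^-1` [set x | q <= expR (- cf p.1 (mu p.1) p.2 * x)])//.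
      apply: (@sigma_of_preimage _ _ unit _ _ setT (fun=> tau p.1 p.2) tt) => //.
      by apply: measurable_ge_set; apply: measurableT_comp => //; exact: measurable_funM.
- by move=> k m n; rewrite /cc !mulr_ge0// exprn_ge0.
- move=> k; rewrite /cc.
  under eq_eseriesr => m _.
    under eq_eseriesr => n _ do rewrite EFinM.
    rewrite nneseriesZl; last by move=> n _; rewrite lee_fin mulr_ge0// exprn_ge0.
    rewrite poisson_pgf// -EFinM mulrC EFinM.
    over.
  rewrite nneseriesZl; last by move=> n _; rewrite lee_fin mulr_ge0// exprn_ge0.
  rewrite poisson_pgf// -EFinM -expRD /C /lap_exponent; congr (expR _)%:E.
  have h1 : 1 + b * c k != 0 by rewrite gt_eqF// ltr_pwDl// mulr_ge0.
  have h2 : 1 + (a + b) * c k != 0 by rewrite gt_eqF// ltr_pwDl// mulr_ge0// addr_ge0.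
  by field; rewrite h1 h2.
- move=> k; under eq_fun do rewrite ee.
  apply: measurableT_comp => //; apply: measurableT_comp => //.
  by apply: measurable_funD; apply: measurable_funM => //; apply: measurable_funM => //;
    exact: measurable_holding_count.
Qed.

End laplace_finite.

Section expc.
Variable R : realType.

(** The value 0 at +oo lets the Laplace transform of the clock be computed before the clock is known
    to be finite; finiteness is later deduced from it. *)
Definition expc (l : R) (x : \bar R) : R :=
  if x is y%:E then expR (- (l * y)) else 0.

Lemma expc_ge0 l x : 0 <= expc l x.
Proof. by case: x => [y| |] //=; exact: expR_ge0. Qed.

Lemma expc_le1 l x : 0 <= l -> (0 <= x)%E -> expc l x <= 1.
Proof.
case: x => [y| |] //= l0; rewrite lee_fin => y0.
by rewrite -expR0 ler_expR oppr_le0 mulr_ge0.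
Qed.

Lemma expc_anti l x y : 0 <= l -> (0 <= x)%E -> (x <= y)%E -> expc l y <= expc l x.
Proof.
case: x y => [x| |] [y| |] l0; rewrite /= ?lee_fin => // x0 xy; rewrite ?expR_ge0//.
by rewrite ler_expR lerN2 ler_wpM2l.
Qed.

Lemma expc_le l (y : R) x : 0 < l -> (0 <= x)%E ->
  (expc l x <= expR (- (l * y))) = (y%:E <= x)%E.
Proof.
case: x => [x| |] //= l0 _; last by rewrite leey expR_ge0.
by rewrite ler_expR lerN2 ler_pM2l// lee_fin.
Qed.

Lemma expc_lt l (y : R) x : 0 < l -> (0 <= x)%E ->
  (expc l x < expR (- (l * y))) = (y%:E < x)%E.
Proof.
case: x => [x| |] //= l0 _; last by rewrite ltry expR_gt0.
by rewrite ltr_expR ltrN2 ltr_pM2l// lte_fin.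
Qed.

Lemma expc_series_cvg (l : R) (a : nat -> R) : 0 < l -> (forall k, 0 <= a k) ->
  expR (- (l * \sum_(0 <= k < n) a k)) @[n --> \oo] -->
  expc l (\sum_(k <oo) (a k)%:E).
Proof.
move=> l0 a0.
have cv : (\sum_(0 <= k < n) a k)%:E @[n --> \oo] --> (\sum_(k <oo) (a k)%:E)%E.
  under eq_fun do rewrite -sumEFin.
  by apply: is_cvg_nneseries => n _ _; rewrite lee_fin.
have : (0 <= \sum_(k <oo) (a k)%:E)%E by apply: nneseries_ge0 => n _ _; rewrite lee_fin.
move: cv; case: (limn _) => [S| |]//= cv _.
  have cS : \sum_(0 <= k < n) a k @[n --> \oo] --> S by move/fine_cvg : cv.
  apply: continuous_cvg; first exact: continuous_expR.
  by apply: cvgN; apply: cvgMr.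
move/cvgeryP : cv => cv.
apply: (@cvg_comp _ _ _ (fun n => l * \sum_(0 <= k < n) a k) (fun x => expR (- x)) _ (pinfty_nbhs R)); last exact: cvgr_expR.
apply/cvgryPge => A; move/cvgryPge : cv => /(_ (A / l)).
by apply: filterS => n; rewrite ler_pdivrMr// mulrC.
Qed.

End expc.

Lemma cvg_exprn (R : realType) (S : Type) (F : set_system S) (FF : Filter F)
    (f : S -> R) (a : R) (m : nat) :
  f x @[x --> F] --> a -> f x ^+ m @[x --> F] --> a ^+ m.
Proof.
move=> fa; elim: m => [|m IH]; first by under eq_fun do rewrite expr0; exact: cvg_cst.
by under eq_fun do rewrite exprS; rewrite exprS; exact: cvgM.
Qed.

Lemma cvg_big_sum (R : realType) (S : Type) (F : set_system S) (FF : Filter F)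
    (I : Type) (s : seq I) (f : I -> S -> R) (a : I -> R) :
  (forall i, f i x @[x --> F] --> a i) ->
  \sum_(i <- s) f i x @[x --> F] --> \sum_(i <- s) a i.
Proof.
move=> fa; elim: s => [|i s IH].
  by under eq_fun do rewrite big_nil; rewrite big_nil; exact: cvg_cst.
by under eq_fun do rewrite big_cons; rewrite big_cons; exact: cvgD.
Qed.

(** * The clock of all sites and its Laplace exponent *)

Section laplace_clock.
Context d (T : measurableType d) (R : realType) (P : probability T R).
Variables (r : nat -> R) (N : nat -> R -> T -> nat) (tau : nat -> nat -> T -> R).
Hypothesis drv : driven P r N tau.

Definition clock (c : nat -> R) (u : R) (w : T) : \bar R :=
  \sum_(k <oo) (c k * holding_sum tau k (N k u w) w)%:E.

Definition phi (c : nat -> R) (l : R) : R :=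
  limn (series (fun k => r k * lap_exponent (l * c k))).

Variable c : nat -> R.
Hypothesis c0 : forall k, 0 <= c k.
Hypothesis rc : cvgn (series (fun k => r k * c k)).

Lemma lap_exponent_ge0 (z : R) : 0 <= z -> 0 <= lap_exponent z.
Proof. by move=> z0; rewrite divr_ge0// addr_ge0. Qed.

Lemma lap_exponent_le (z : R) : 0 <= z -> lap_exponent z <= z.
Proof. by move=> z0; rewrite ler_pdivrMr ?ltr_pwDl// ler_peMr// lerDl. Qed.

Lemma phi_cvg l : 0 <= l ->
  series (fun k => r k * lap_exponent (l * c k)) @ \oo --> phi c l.
Proof.
move=> l0; apply: (@series_le_cvg _ _ (fun k => l *: (r k * c k))).
- by move=> n; rewrite mulr_ge0 ?lap_exponent_ge0// ?mulr_ge0// ltW// (driven_rate_gt0 drv).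
- by move=> n; rewrite /GRing.scale/= !mulr_ge0// ltW// (driven_rate_gt0 drv).
- move=> n; rewrite /GRing.scale/= [leRHS]mulrCA ler_wpM2l//; first by rewrite ltW// (driven_rate_gt0 drv).
  by rewrite lap_exponent_le// mulr_ge0.
- exact: is_cvg_seriesZ.
Qed.

Lemma clock_term_ge0 k n w : 0 <= c k * holding_sum tau k n w.
Proof. by rewrite mulr_ge0// (holding_sum_ge0 drv). Qed.

Lemma clock_ge0 u w : (0 <= clock c u w)%E.
Proof. by apply: nneseries_ge0 => k _ _; rewrite lee_fin clock_term_ge0. Qed.

Lemma clock_mono u v w : 0 <= u -> u <= v -> (clock c u w <= clock c v w)%E.
Proof.
move=> u0 uv; apply: lee_nneseries => k _; first by rewrite lee_fin clock_term_ge0.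
rewrite lee_fin ler_wpM2l//; apply: (holding_sum_mono drv).
exact: (driven_mono drv).
Qed.

Lemma measurable_clock u : 0 <= u -> measurable_fun setT (clock c u).
Proof.
move=> u0; apply: ge0_emeasurable_sum => [k w _ _|k _].
  by rewrite lee_fin clock_term_ge0.
apply/measurable_EFinP; apply: measurable_funM => //.
exact: (measurable_holding_count drv).
Qed.

Lemma expc_clock_cvg l u w : 0 < l ->
  expR (- (l * \sum_(0 <= k < n) c k * holding_sum tau k (N k u w) w)) @[n --> \oo] -->
  expc l (clock c u w).
Proof. by move=> l0; apply: expc_series_cvg => // k; exact: clock_term_ge0. Qed.

Lemma measurable_expc_clock l u : 0 < l -> 0 <= u ->
  measurable_fun setT (fun w => expc l (clock c u w)).
Proof.
move=> l0 u0; apply: (@measurable_fun_cvg _ _ _ setT (fun n w =>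
  expR (- (l * \sum_(0 <= k < n) c k * holding_sum tau k (N k u w) w)))); last first.
  by move=> w _; exact: expc_clock_cvg.
move=> n.
apply: measurableT_comp => //; apply: measurableT_comp => //; apply: measurable_funM => //.
apply: measurable_sum => k; apply: measurable_funM => //.
exact: (measurable_holding_count drv).
Qed.

(** Dominated convergence from the first n sites, all integrands lying in [0, 1]. The exponents are
    integers because y = exp(-l clock) will be inserted in polynomials. *)
Lemma laplace_clock l u v m j : 0 < l -> 0 <= u -> u <= v ->
  (\int[P]_w (expc l (clock c u w) ^+ m * expc l (clock c v w) ^+ j)%:E =
   (expR (- (u * phi c (l * (m + j)%:R) + (v - u) * phi c (l * j%:R))))%:E)%E.
Proof.
move=> l0 u0 uv; have v0 := le_trans u0 uv.
pose h u n w := expR (- (l * \sum_(0 <= k < n) c k * holding_sum tau k (N k u w) w)).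
have mh q n : 0 <= q -> measurable_fun setT (h q n).
  move=> q0; apply: measurableT_comp => //; apply: measurableT_comp => //; apply: measurable_funM => //.
  apply: measurable_sum => k; apply: measurable_funM => //.
  exact: (measurable_holding_count drv).
have hle q n w : 0 <= h q n w <= 1.
  rewrite expR_ge0/= -expR0 ler_expR oppr_le0 mulr_ge0 ?(ltW l0)//.
  by apply: sumr_ge0 => k _; exact: clock_term_ge0.
have cvL : (\int[P]_w (h u n w ^+ m * h v n w ^+ j)%:E)%E @[n --> \oo] -->
    (\int[P]_w (expc l (clock c u w) ^+ m * expc l (clock c v w) ^+ j)%:E)%E.
  apply: (@dominated_cvg _ _ _ P setT measurableT
      (fun n w => (h u n w ^+ m * h v n w ^+ j)%:E) _ (cst 1%E)) => //.
  - move=> n; apply/measurable_EFinP; apply: measurable_funM; apply: measurable_funX; exact: mh.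
  - move=> w _; apply/cvg_EFin; first exact: nearW.
    by apply: cvgM; apply: cvg_exprn; exact: expc_clock_cvg.
  - exact: finite_measure_integrable_cst.
  - move=> n w _; rewrite lee_fin ger0_norm; last first.
      by rewrite mulr_ge0// exprn_ge0//; have /andP[] := hle u n w; have /andP[] := hle v n w.
    have /andP[? ?] := hle u n w; have /andP[? ?] := hle v n w.
    by rewrite mulr_ile1// ?exprn_ge0// exprn_ile1.
rewrite -(cvg_lim _ cvL)//; apply/cvg_lim => //.
have E n : (\int[P]_w (h u n w ^+ m * h v n w ^+ j)%:E =
   (expR (- (u * series (fun k => r k * lap_exponent (l * (m + j)%:R * c k)) n +
     (v - u) * series (fun k => r k * lap_exponent (l * j%:R * c k)) n)))%:E)%E.
  have := laplace_finite drv c0 u0 uv (_ : 0 <= l * m%:R) (_ : 0 <= l * j%:R) (iota_uniq 0 n).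
  rewrite -mulrDr -natrD => H.
  rewrite /series/= -[index_iota 0 n]/(iota 0 (n - 0)) subn0.
  transitivity ((\int[P]_w (\prod_(k <- iota 0 n)
    expR (- (l * m%:R * (c k * holding_sum tau k (N k u w) w) +
             l * j%:R * (c k * holding_sum tau k (N k v w) w))))%:E))%E.
    apply: eq_integral => w _; rewrite /h /index_iota subn0 -!expRM_natl -expRD -expR_sum.
    congr (expR _)%:E; rewrite sumrN big_split/= -!mulr_sumr; ring.
  rewrite H ?mulr_ge0// ?(ltW l0)//.
  rewrite -expR_sum sumrN big_split/= -!mulr_sumr.
  by congr (expR (- (_ + _)))%:E; rewrite /index_iota subn0.
under eq_fun do rewrite E.
apply/cvg_EFin; first exact: nearW.
apply: continuous_cvg; first exact: continuous_expR.
apply: cvgN; apply: cvgD; apply: cvgMr; apply: phi_cvg; rewrite mulr_ge0// ltW//.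
Qed.

End laplace_clock.

(** * Gap probabilities by polynomial approximation *)

Section sandwich_path.
Variable R : realType.
Implicit Types (p q : R -> R) (y : nat -> R).

(** A discrete Stieltjes integral of [q] with respect to [p]: the drop of [p] is concentrated where
    the decreasing path y passes the threshold of [p], and [q] reads off whether y is then still
    above its own, lower threshold. *)
Definition variation_sum p q y (K : nat) : R :=
  \sum_(0 <= k < K) (p (y k) - p (y k.+1)) * q (y k.+1).

(** Only monotonicity and the end values are imposed; closeness to an indicator is measured apart,
    by the error [kp] at two points. *)
Definition step_fun p : Prop :=
  [/\ forall x z, 0 <= x -> x <= z -> z <= 1 -> p x <= p z, p 0 = 0 & p 1 = 1].

Lemma telescope_down (f : nat -> R) (K : nat) :
  \sum_(0 <= k < K) (f k - f k.+1) = f 0%N - f K.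
Proof.
rewrite -[RHS]opprB -telescope_sumr// -sumrN.
by apply: eq_bigr => k _; rewrite opprB.
Qed.

Lemma step_fun_itv p x : step_fun p -> 0 <= x <= 1 -> 0 <= p x <= 1.
Proof.
move=> [pm p0 p1] /andP[x0 x1]; rewrite -{1}p0 -p1.
by apply/andP; split; exact: pm.
Qed.

Lemma variation_sum_ge0 p q y K : step_fun p -> step_fun q ->
  (forall k, 0 <= y k.+1) -> (forall k, y k.+1 <= y k) -> y 0%N = 1 ->
  0 <= variation_sum p q y K.
Proof.
move=> sp sq y0 yd y1; have yle k : y k <= 1.
  by elim: k => [|k IH]; [rewrite y1|exact: le_trans IH].
apply: sumr_ge0 => k _; apply: mulr_ge0.
  by rewrite subr_ge0; have [pm _ _] := sp; exact: pm.
by have /andP[] : 0 <= q (y k.+1) <= 1 by apply: step_fun_itv => //; rewrite y0 yle.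
Qed.

Lemma variation_sum_le1 p q y K : step_fun p -> step_fun q ->
  (forall k, 0 <= y k.+1) -> (forall k, y k.+1 <= y k) -> y 0%N = 1 ->
  variation_sum p q y K <= 1.
Proof.
move=> sp sq y0 yd y1; have yle k : y k <= 1.
  by elim: k => [|k IH]; [rewrite y1|exact: le_trans IH].
have y0' k : 0 <= y k by case: k => [|k]; rewrite ?y1.
apply: (@le_trans _ _ (\sum_(0 <= k < K) (p (y k) - p (y k.+1)))).
  apply: ler_sum => k _; apply: ler_piMr.
    by rewrite subr_ge0; have [pm _ _] := sp; exact: pm.
  by have /andP[] : 0 <= q (y k.+1) <= 1 by apply: step_fun_itv => //; rewrite y0 yle.
rewrite (telescope_down (fun k => p (y k))).
rewrite y1; have [_ _ ->] := sp.
by have /andP[? ?] : 0 <= p (y K) <= 1; [apply: step_fun_itv => //; rewrite y0' yle|lra].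
Qed.

(** Up to the visit, [p] has lost at least 1 - kp, and every value of [q] met on the way is at least
    1 - kp because the path is still above b. The later terms are nonnegative. *)
Lemma variation_sum_hit p q y K k (a b kp : R) : step_fun p -> step_fun q ->
  (forall k, 0 <= y k.+1) -> (forall k, y k.+1 <= y k) -> y 0%N = 1 ->
  0 <= b -> kp <= 1 -> a <= 1 -> p a <= kp -> 1 - kp <= q b ->
  (k <= K)%N -> b <= y k < a -> (1 - kp) ^+ 2 <= variation_sum p q y K.
Proof.
move=> sp sq y0 yd y1 b0 kp1 a1 pa qb kK /andP[byk yka].
have yle j : y j <= 1.
  by elim: j => [|j IH]; [rewrite y1|exact: le_trans IH].
have y0' j : 0 <= y j by case: j => [|j]; rewrite ?y1.
have ymono i j : (i <= j)%N -> y j <= y i.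
  by move=> ij; rewrite -(subnK ij); elim: (j - i)%N => [//|n IH]; rewrite addSn (le_trans (yd _)).
have [pm p0 p1] := sp; have [qm q0 q1] := sq.
have term j : 0 <= (p (y j) - p (y j.+1)) * q (y j.+1).
  by rewrite mulr_ge0// ?subr_ge0 ?pm//; have /andP[] : 0 <= q (y j.+1) <= 1 by apply: step_fun_itv => //; rewrite y0 yle.
rewrite /variation_sum (@big_cat_nat _ _ _ k)//=.
apply: (@le_trans _ _ (\sum_(0 <= j < k) (p (y j) - p (y j.+1)) * q (y j.+1))); last first.
  by rewrite lerDl; apply: sumr_ge0.
apply: (@le_trans _ _ (\sum_(0 <= j < k) (p (y j) - p (y j.+1)) * (1 - kp))).
  rewrite -mulr_suml (telescope_down (fun k => p (y k))).
  rewrite y1 p1 expr2; apply: ler_wpM2r; first by lra.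
  by have := pm (y k) a (y0' k) (ltW yka) a1; lra.
apply: ler_sum_nat => j /andP[_ jk].
apply: ler_wpM2l; first by rewrite subr_ge0 pm.
apply: (le_trans qb); apply: qm => //.
by apply: (le_trans byk); exact: ymono.
Qed.

(** A path that leaps over [b, a[ has two kinds of steps. Those ending above a drop [p] only within
    [p a, 1], a total of at most kp; those ending below b carry a factor [q] of at most kp. The
    truncation [p'] of [p] at the value p a separates the two. *)
Lemma variation_sum_miss p q y K (a b kp : R) : step_fun p -> step_fun q ->
  (forall k, 0 <= y k.+1) -> (forall k, y k.+1 <= y k) -> y 0%N = 1 ->
  0 <= a -> a <= 1 -> b <= 1 -> 0 <= kp -> 1 - kp <= p a -> q b <= kp ->
  (forall k, (k <= K)%N -> ~~ (b <= y k < a)) -> variation_sum p q y K <= kp *+ 2.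
Proof.
move=> sp sq y0 yd y1 a0 a1 b1 kp0 pa qb miss.
have yle j : y j <= 1.
  by elim: j => [|j IH]; [rewrite y1|exact: le_trans IH].
have y0' j : 0 <= y j by case: j => [|j]; rewrite ?y1.
have [pm p0 p1] := sp; have [qm q0 q1] := sq.
pose p' x := Num.max (p x) (p a).
have p'm j : p' (y j.+1) <= p' (y j).
  by rewrite /p' ge_max !le_max pm//= lexx orbT.
apply: (@le_trans _ _ (\sum_(0 <= j < K) ((p' (y j) - p' (y j.+1)) + kp * (p (y j) - p (y j.+1))))).
  apply: ler_sum_nat => j /andP[_ jK].
  have pj : p (y j.+1) <= p (y j) by exact: pm.
  have [ya|ya] := leP a (y j.+1).
    have -> : p' (y j.+1) = p (y j.+1) by rewrite /p' max_l// pm.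
    have -> : p' (y j) = p (y j) by rewrite /p' max_l// pm// (le_trans ya).
    rewrite -[leLHS]addr0 lerD//; last by rewrite mulr_ge0// subr_ge0.
    apply: ler_piMr; first by rewrite subr_ge0.
    by rewrite -q1 qm.
  rewrite -[leLHS]add0r lerD ?subr_ge0// mulrC ler_wpM2r ?subr_ge0//.
  apply: le_trans qb; apply: qm => //.
  by have := miss _ jK; rewrite ya andbT -ltNge => /ltW.
rewrite big_split/= -mulr_sumr.
rewrite (telescope_down (fun k => p' (y k))).
rewrite (telescope_down (fun k => p (y k))).
rewrite y1 p1.
have h1 : p' 1 = 1 by rewrite /p' p1 max_l// -p1 pm.
have h2 : p a <= p' (y K) by rewrite /p' le_max lexx orbT.
have h3 : 0 <= p (y K) by rewrite -p0 pm.
rewrite h1 mulr2n lerD//; first by lra.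
by rewrite -[leRHS]mulr1 ler_wpM2l//; lra.
Qed.

End sandwich_path.

Section has_mean.
Context d (T : measurableType d) (R : realType) (P : probability T R).

(** Integrability and value are bundled because the monomials carry coefficients of both signs. *)
Definition has_mean (f : T -> R) (c : R) : Prop :=
  P.-integrable setT (EFin \o f) /\ (\int[P]_w (f w)%:E = c%:E)%E.

Lemma has_mean_bounded (f : T -> R) (c : R) : measurable_fun setT f ->
  (forall w, 0 <= f w <= 1) -> (\int[P]_w (f w)%:E = c%:E)%E -> has_mean f c.
Proof.
move=> mf f01 fc; split => //.
apply: (@le_integrable _ _ _ P _ measurableT _ (cst 1%E)) => //.
- exact/measurable_EFinP.
- move=> w _ /=; have /andP[f0 f1] := f01 w.
  by rewrite lee_fin ger0_norm// normr1.
- exact: finite_measure_integrable_cst.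
Qed.

Lemma has_meanD f g a b : has_mean f a -> has_mean g b ->
  has_mean (fun w => f w + g w) (a + b).
Proof.
move=> [fi fa] [gi gb]; split.
  exact: (integrableD measurableT fi gi).
by under eq_integral do rewrite EFinD; rewrite (integralD measurableT fi gi) fa gb.
Qed.

Lemma has_meanZ f a k : has_mean f a -> has_mean (fun w => k * f w) (k * a).
Proof.
move=> [fi fa]; split.
  exact: (integrableZl measurableT k fi).
by under eq_integral do rewrite EFinM; rewrite (integralZl measurableT fi) fa.
Qed.

Lemma has_meanB f g a b : has_mean f a -> has_mean g b ->
  has_mean (fun w => f w - g w) (a - b).
Proof.
move=> fa gb; rewrite -mulN1r.
by under [X in has_mean X]eq_fun do rewrite -[X in _ + X]mulN1r; exact/has_meanD/has_meanZ.
Qed.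

Lemma has_mean_cst k : has_mean (fun=> k) k.
Proof.
split; first exact: finite_measure_integrable_cst.
by rewrite integral_cst//= probability_setT mule1.
Qed.

Lemma has_mean_sum (I : Type) (s : seq I) (f : I -> T -> R) (c : I -> R) :
  (forall i, has_mean (f i) (c i)) ->
  has_mean (fun w => \sum_(i <- s) f i w) (\sum_(i <- s) c i).
Proof.
move=> fc; elim: s => [|i s IH].
  by under [X in has_mean X]eq_fun do rewrite big_nil; rewrite big_nil; exact: has_mean_cst.
by under [X in has_mean X]eq_fun do rewrite big_cons; rewrite big_cons; exact: has_meanD.
Qed.

Lemma has_mean_indic (A : set T) : measurable A -> has_mean \1_A (fine (P A)).
Proof.
move=> mA; apply: has_mean_bounded => //.
  by move=> w; rewrite indicE; case: (_ \in _) => /=; rewrite ?lexx ?ler01.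
by rewrite integral_indic// setIT fineK// fin_num_measure.
Qed.

Lemma has_mean_le f g a b : has_mean f a -> has_mean g b ->
  (forall w, f w <= g w) -> a <= b.
Proof.
move=> [fi fa] [gi gb] fg; rewrite -lee_fin -fa -gb.
by apply: le_integral => // w _; rewrite lee_fin.
Qed.

End has_mean.

(** * Visits of the path: means of variation sums, then vanishing mesh *)

Section sandwich_prob.
Context d (T : measurableType d) (R : realType) (P : probability T R).
Variables (y : R -> T -> R) (Lam : nat -> R).
Hypothesis my : forall u, 0 <= u -> measurable_fun setT (y u).
Hypothesis y01 : forall u w, 0 <= y u w <= 1.
Hypothesis yd : forall u v w, 0 <= u -> u <= v -> y v w <= y u w.
Hypothesis y1 : forall w, y 0 w = 1.
Hypothesis Ey : forall u v m j, 0 <= u -> u <= v ->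
  (\int[P]_w (y u w ^+ m * y v w ^+ j)%:E =
   (expR (- (u * Lam (m + j)%N + (v - u) * Lam j)))%:E)%E.
Hypothesis Lam0 : Lam 0 = 0.
Hypothesis Lam_gt0 : forall i, (0 < i)%N -> 0 < Lam i.

Definition grid_mean (p q : {poly R}) (dl : R) (K : nat) : R :=
  \sum_(0 <= k < K) \sum_(i < size p) \sum_(j < size q) p`_i * q`_j *
    (expR (- (k%:R * dl * Lam (i + j)%N + dl * Lam j)) -
       expR (- (k.+1%:R * dl * Lam (i + j)%N))).

Lemma grid_meanP (p q : {poly R}) (dl : R) (K : nat) : 0 <= dl ->
  has_mean P (fun w => variation_sum (horner p) (horner q) (fun k => y (k%:R * dl) w) K)
    (grid_mean p q dl K).
Proof.
move=> dl0; apply: has_mean_sum => k.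
rewrite [X in has_mean _ X](_ : _ = (fun w => \sum_(i < size p) \sum_(j < size q)
   p`_i * q`_j * (y (k%:R * dl) w ^+ i * y (k.+1%:R * dl) w ^+ j -
     y (k.+1%:R * dl) w ^+ i * y (k.+1%:R * dl) w ^+ j))); last first.
  apply/funext => w; rewrite !horner_coef -sumrB mulr_suml; apply: eq_bigr => i _.
  by rewrite mulr_sumr; apply: eq_bigr => j _; ring.
have kd0 : 0 <= k%:R * dl by rewrite mulr_ge0.
have kd1 : k%:R * dl <= k.+1%:R * dl by rewrite ler_wpM2r// ler_nat.
have kd2 : 0 <= k.+1%:R * dl by rewrite mulr_ge0.
have yy u v m j : 0 <= u -> u <= v ->
    has_mean P (fun w => y u w ^+ m * y v w ^+ j) (expR (- (u * Lam (m + j)%N + (v - u) * Lam j))).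
  move=> u0 uv; have v0 := le_trans u0 uv; apply: has_mean_bounded.
  - by apply: measurable_funM; apply: measurable_funX; exact: my.
  - move=> w; have /andP[? ?] := y01 u w; have /andP[? ?] := y01 v w.
    by rewrite mulr_ge0 ?exprn_ge0//= mulr_ile1// ?exprn_ge0// exprn_ile1.
  - exact: Ey.
apply: has_mean_sum => i; apply: has_mean_sum => j; apply: has_meanZ; apply: has_meanB.
  have -> : dl * Lam j = (k.+1%:R * dl - k%:R * dl) * Lam j.
    by rewrite -mulrBl -addn1 natrD addrAC subrr add0r mul1r.
  exact: yy.
have := yy (k.+1%:R * dl) (k.+1%:R * dl) i j kd2 (lexx _).
by rewrite subrr mul0r addr0.
Qed.

(** The sum over k in [grid_mean] is geometric of ratio exp(-dl Lam(i + j)); this is its value over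
    all k. *)
Definition grid_lim (p q : {poly R}) (dl : R) : R :=
  \sum_(i < size p) \sum_(j < size q) p`_i * q`_j *
    ((expR (- (dl * Lam j)) - expR (- (dl * Lam (i + j)%N))) /
     (1 - expR (- (dl * Lam (i + j)%N)))).

Lemma grid_mean_cvg (p q : {poly R}) (dl : R) : 0 < dl -> grid_mean p q dl K @[K --> \oo] --> grid_lim p q dl.
Proof.
move=> dl0.
have E K : grid_mean p q dl K = \sum_(i < size p) \sum_(j < size q) p`_i * q`_j *
    ((expR (- (dl * Lam j)) - expR (- (dl * Lam (i + j)%N))) *
     series (geometric 1 (expR (- (dl * Lam (i + j)%N)))) K).
  rewrite /grid_mean exchange_big/=; apply: eq_bigr => i _.
  rewrite exchange_big/=; apply: eq_bigr => j _.
  rewrite -mulr_sumr; congr (_ * _); rewrite /series/= mulr_sumr; apply: eq_bigr => k _.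
  rewrite mul1r mulrBl -!expRM_natl -!expRD; congr (expR _ - expR _); first by ring.
  by rewrite -addn1 natrD; ring.
under eq_fun do rewrite E.
apply: cvg_big_sum => i; apply: cvg_big_sum => j; apply: cvgMr.
(* For i = j = 0 the ratio is 1, but the numerator vanishes, so the default 0 / 0 = 0 is the right
   value. *)
have [ij|ij] := posnP (i + j).
  have [-> ->] : (i : nat) = 0%N /\ (j : nat) = 0%N.
    by move/eqP : ij; rewrite addn_eq0 => /andP[/eqP ? /eqP].
  rewrite addn0 Lam0 mulr0 !subrr mul0r; under eq_fun do rewrite mul0r; exact: cvg_cst.
apply: cvgMr.
rewrite -[X in _ --> X]mul1r; apply: cvg_geometric_series.
rewrite ger0_norm ?expR_ge0// -expR0 ltr_expR oppr_lt0 mulr_gt0//; exact: Lam_gt0.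
Qed.

(** Limit of [grid_lim] as dl tends to 0: to first order each difference of exponentials is dl times
    a difference of exponents, and dl cancels. *)
Definition ratio_sum (L : nat -> R) (p q : {poly R}) : R :=
  \sum_(i < size p) \sum_(j < size q) p`_i * q`_j * (1 - L j / L (i + j)%N).

Lemma expR_quot_cvg (a : R) (dl : nat -> R) : 0 <= a -> (forall n, 0 < dl n) ->
  dl n @[n --> \oo] --> 0 -> (1 - expR (- (dl n * a))) / dl n @[n --> \oo] --> a.
Proof.
move=> a0 dl0 dlc.
have da n : 0 < 1 + dl n * a by rewrite ltr_pwDl// mulr_ge0// ltW.
apply: (@squeeze_cvgr _ _ _ _ (fun n => a / (1 + dl n * a)) (cst a)).
- apply: nearW => n; apply/andP; split.
    rewrite ler_pdivlMr// mulrAC ler_pdivrMr//.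
    have e1 : expR (- (dl n * a)) * (1 + dl n * a) <= 1.
      rewrite expRN mulrC ler_pdivrMr ?expR_gt0// mul1r; exact: expR_ge1Dx.
    by move: e1; lra.
  rewrite ler_pdivrMr//; have := expR_ge1Dx (- (dl n * a)); rewrite /cst; lra.
- rewrite -[X in _ --> X]divr1; apply: cvgM; first exact: cvg_cst.
  apply: cvgV; first exact: oner_neq0.
  rewrite -[X in _ --> X]addr0 -[X in _ --> _ + X](mul0r a).
  by apply: cvgD; [exact: cvg_cst|exact: cvgMl].
- exact: cvg_cst.
Qed.

Lemma Lam_ge0 i : 0 <= Lam i.
Proof. by case: i => [|i]; [rewrite Lam0|exact/ltW/Lam_gt0]. Qed.

Lemma grid_lim_cvg (p q : {poly R}) (dl : nat -> R) : (forall n, 0 < dl n) ->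
  dl n @[n --> \oo] --> 0 -> p`_0 = 0 ->
  grid_lim p q (dl n) @[n --> \oo] --> ratio_sum Lam p q.
Proof.
move=> dl0 dlc p0; apply: cvg_big_sum => i; apply: cvg_big_sum => j.
(* At i = j = 0 [ratio_sum] has 1 - 0 / 0 = 1 where [grid_lim] has 0; the vanishing constant
   coefficient of [p] removes this discrepancy. *)
have [i0|i0] := posnP i.
  by rewrite i0 p0 !mul0r; under eq_fun do rewrite !mul0r; exact: cvg_cst.
apply: cvgMr.
have ij : (0 < i + j)%N by rewrite addn_gt0 i0.
have La := Lam_gt0 ij.
have -> : 1 - Lam j / Lam (i + j)%N = (Lam (i + j)%N - Lam j) / Lam (i + j)%N.
  by rewrite mulrBl divff// gt_eqF.
rewrite (_ : (fun n => _) = (fun n => ((1 - expR (- (dl n * Lam (i + j)%N))) / dl n -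
    (1 - expR (- (dl n * Lam j))) / dl n) / ((1 - expR (- (dl n * Lam (i + j)%N))) / dl n))); last first.
  apply/funext => n; have h1 : dl n != 0 by rewrite gt_eqF.
  have h2 : 1 - expR (- (dl n * Lam (i + j)%N)) != 0.
    by rewrite gt_eqF// subr_gt0 -expR0 ltr_expR oppr_lt0 mulr_gt0.
  by field; rewrite h1 h2.
apply: cvgM; first by apply: cvgB; apply: expR_quot_cvg => //; exact: Lam_ge0.
by apply: cvgV; [rewrite gt_eqF|apply: expR_quot_cvg => //; exact: Lam_ge0].
Qed.

(** Dyadic times are countable, which makes this an event; right continuity of the clock later
    recovers all times. *)
Definition hit (a b : R) : set T :=
  [set w | exists n k, b <= y (k%:R * 2 ^- n) w < a].

Lemma hit_measurable a b : measurable (hit a b).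
Proof.
rewrite (_ : hit a b = \bigcup_n \bigcup_k [set w | b <= y (k%:R * 2 ^- n) w < a]); last first.
  by apply/seteqP; split => [w [n [k]]|w [n _ [k _]]]; [exists n => //; exists k|exists n, k].
apply: bigcup_measurable => n _; apply: bigcup_measurable => k _.
have mk : measurable_fun setT (y (k%:R * 2 ^- n)) by apply: my; rewrite mulr_ge0// invr_ge0 exprn_ge0.
have := mk measurableT `[b, a[%classic (measurable_itv _).
by rewrite setTI; congr measurable; apply/seteqP; split => w /=; rewrite in_itv.
Qed.

Definition hit_upto a b n K : set T :=
  [set w | exists2 k, (k <= K)%N & b <= y (k%:R * 2 ^- n) w < a].

Lemma hit_upto_measurable a b n K : measurable (hit_upto a b n K).
Proof.
rewrite (_ : hit_upto a b n K = \bigcup_(k in [set k | (k <= K)%N]) [set w | b <= y (k%:R * 2 ^- n) w < a]); last first.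
  by apply/seteqP; split => [w [k]|w [k]]; exists k.
apply: bigcup_measurable => k _.
have mk : measurable_fun setT (y (k%:R * 2 ^- n)) by apply: my; rewrite mulr_ge0// invr_ge0 exprn_ge0.
have := mk measurableT `[b, a[%classic (measurable_itv _).
by rewrite setTI; congr measurable; apply/seteqP; split => w /=; rewrite in_itv.
Qed.

Lemma hit_upto_sub a b n K : hit_upto a b n K `<=` hit a b.
Proof. by move=> w [k _ h]; exists n, k. Qed.

(** The grids of mesh 2^-n on [0, n] are nested and exhaust the dyadic times, so continuity from
    below applies. *)
Lemma hit_cvg a b : fine (P (hit_upto a b n (n * 2 ^ n))) @[n --> \oo] --> fine (P (hit a b)).
Proof.
apply: fine_cvg; rewrite fineK ?fin_num_measure//; last exact: hit_measurable.
have nd m n : (m <= n)%N -> hit_upto a b m (m * 2 ^ m) `<=` hit_upto a b n (n * 2 ^ n).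
  move=> mn w [k km h]; exists (k * 2 ^ (n - m))%N.
    apply: (@leq_trans (m * 2 ^ m * 2 ^ (n - m))); first by rewrite leq_mul2r km orbT.
    by rewrite -mulnA -expnD subnKC// leq_mul2r mn orbT.
  rewrite (_ : (k * 2 ^ (n - m))%:R * 2 ^- n = k%:R * 2 ^- m :> R)//.
  rewrite natrM natrX -{2}(subnK mn) exprD invfM.
  by field; rewrite !expf_neq0.
rewrite [X in P X](_ : _ = \bigcup_n hit_upto a b n (n * 2 ^ n)); last first.
  apply/seteqP; split => [w [n [k h]]|w [n _]]; last exact: hit_upto_sub.
  exists (maxn n k) => //; exists (k * 2 ^ (maxn n k - n))%N.
    by rewrite leq_mul// ?leq_maxr// leq_exp2l// leq_subr.
  rewrite (_ : (k * 2 ^ (maxn n k - n))%:R * 2 ^- (maxn n k) = k%:R * 2 ^- n :> R)//.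
  rewrite natrM natrX -{2}(subnK (leq_maxl n k)) exprD invfM.
  by field; rewrite !expf_neq0.
apply: (nondecreasing_cvg_mu (F := fun n => hit_upto a b n (n * 2 ^ n))).
- by move=> n; exact: hit_upto_measurable.
- by apply: bigcup_measurable => n _; exact: hit_upto_measurable.
- by move=> m n mn; apply/subsetPset; exact: nd.
Qed.

Let dyadic_cvg : (2 ^- n : R) @[n --> \oo] --> 0.
Proof.
rewrite (_ : (fun n => _) = (fun n => 2^-1 ^+ n)); last by apply/funext => n; rewrite exprVn.
by apply: cvg_expr; rewrite ger0_norm ?invr_ge0// invf_lt1// ltr1n.
Qed.

(** [variation_sum_hit] in mean. The horizon K tends to infinity first, for a fixed mesh, and the
    mesh to 0 afterwards; visits are restricted to [0, n] so that they all occur before the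
    horizon. *)
Lemma hit_lower (p q : {poly R}) (a b kp : R) :
  step_fun (horner p) -> step_fun (horner q) -> 0 <= b -> a <= 1 -> kp <= 1 ->
  p.[a] <= kp -> 1 - kp <= q.[b] ->
  (1 - kp) ^+ 2 * fine (P (hit a b)) <= ratio_sum Lam p q.
Proof.
move=> sp sq b0 a1 kp1 pa qb.
have dl0 n : 0 < 2 ^- n :> R by rewrite invr_gt0 exprn_gt0.
have p0 : p`_0 = 0 by have [_ + _] := sp; rewrite horner_coef0.
have c1 := grid_lim_cvg (q := q) dl0 dyadic_cvg p0.
have c2 : (1 - kp) ^+ 2 * fine (P (hit_upto a b n (n * 2 ^ n))) @[n --> \oo] -->
   (1 - kp) ^+ 2 * fine (P (hit a b)) by apply: cvgMr; exact: hit_cvg.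
apply: (ler_cvg_to c2 c1); apply: nearW => n.
apply: (ler_cvg_to (cvg_cst _) (grid_mean_cvg (p := p) (q := q) (dl0 n))).
exists (n * 2 ^ n)%N => // K /= nK.
have sub : hit_upto a b n (n * 2 ^ n) `<=` hit_upto a b n K.
  by move=> w [k kn h]; exists k => //; exact: leq_trans kn nK.
apply: (@has_mean_le _ _ _ P (fun w => (1 - kp) ^+ 2 * \1_(hit_upto a b n (n * 2 ^ n)) w)
  (fun w => variation_sum (horner p) (horner q) (fun k => y (k%:R * 2 ^- n) w) K)).
- by apply/has_meanZ/has_mean_indic; exact: hit_upto_measurable.
- by apply: grid_meanP; exact: ltW.
move=> w; rewrite indicE.
have kd0 k : 0 <= k%:R * 2 ^- n :> R by rewrite mulr_ge0// ltW.
have kd1 k : k%:R * 2 ^- n <= k.+1%:R * 2 ^- n :> R by rewrite ler_pM2r// ler_nat.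
case: (boolP (w \in _)) => [|_].
  rewrite inE => -[k kn h]; rewrite mulr1.
  apply: (@variation_sum_hit _ _ _ _ _ k a b) => //.
  - by move=> j; have /andP[] := y01 (j.+1%:R * 2 ^- n) w.
  - by move=> j; exact: yd.
  - by rewrite mul0r.
  - exact: leq_trans nK.
rewrite mulr0; apply: variation_sum_ge0 => //.
- by move=> j; have /andP[] := y01 (j.+1%:R * 2 ^- n) w.
- by move=> j; exact: yd.
- by rewrite mul0r.
Qed.

(** [variation_sum_miss] off the event and the trivial bound 1 on it: a path without a visit at any
    dyadic time misses on every grid. *)
Lemma hit_upper (p q : {poly R}) (a b kp : R) :
  step_fun (horner p) -> step_fun (horner q) -> 0 <= a -> a <= 1 -> b <= 1 -> 0 <= kp ->
  1 - kp <= p.[a] -> q.[b] <= kp ->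
  ratio_sum Lam p q <= fine (P (hit a b)) + kp *+ 2.
Proof.
move=> sp sq a0 a1 b1 kp0 pa qb.
have dl0 n : 0 < 2 ^- n :> R by rewrite invr_gt0 exprn_gt0.
have p0 : p`_0 = 0 by have [_ + _] := sp; rewrite horner_coef0.
have c1 := grid_lim_cvg (q := q) dl0 dyadic_cvg p0.
apply: (ler_cvg_to c1 (cvg_cst _)); apply: nearW => n.
apply: (ler_cvg_to (grid_mean_cvg (p := p) (q := q) (dl0 n)) (cvg_cst _)).
apply: nearW => K.
apply: (@has_mean_le _ _ _ P
  (fun w => variation_sum (horner p) (horner q) (fun k => y (k%:R * 2 ^- n) w) K)
  (fun w => \1_(hit a b) w + kp *+ 2)).
- by apply: grid_meanP; exact: ltW.
- by apply: has_meanD; [apply/has_mean_indic; exact: hit_measurable|exact: has_mean_cst].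
move=> w; rewrite indicE.
have kd0 k : 0 <= k%:R * 2 ^- n :> R by rewrite mulr_ge0// ltW.
have kd1 k : k%:R * 2 ^- n <= k.+1%:R * 2 ^- n :> R by rewrite ler_pM2r// ler_nat.
case: (boolP (w \in _)) => [_|].
  apply: (@le_trans _ _ 1); last by rewrite lerDl mulrn_wge0.
  apply: variation_sum_le1 => //.
  - by move=> j; have /andP[] := y01 (j.+1%:R * 2 ^- n) w.
  - by move=> j; exact: yd.
  - by rewrite mul0r.
move/negP => nh; rewrite add0r; apply: (@variation_sum_miss _ _ _ _ _ a b) => //.
- by move=> j; have /andP[] := y01 (j.+1%:R * 2 ^- n) w.
- by move=> j; exact: yd.
- by rewrite mul0r.
- by move=> k _; apply/negP => h; apply: nh; rewrite inE; exists n, k.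
Qed.

End sandwich_prob.

Section step_poly.
Variable R : realType.

Lemma bernoulli_lower (u : R) M : 0 <= u <= 1 -> 1 - M%:R * u <= (1 - u) ^+ M.
Proof.
move=> /andP[u0 u1]; elim: M => [|M IH]; first by rewrite mul0r subr0 expr0.
rewrite exprS; apply: (@le_trans _ _ ((1 - u) * (1 - M%:R * u))); last first.
  by rewrite ler_wpM2l// subr_ge0.
rewrite -addn1 natrD; have : 0 <= M%:R * u * u :> R by rewrite !mulr_ge0.
by lra.
Qed.

Lemma bernoulli_upper (u : R) M : 0 <= u <= 1 -> (1 - u) ^+ M * (1 + M%:R * u) <= 1.
Proof.
move=> /andP[u0 u1]; elim: M => [|M IH]; first by rewrite mul0r addr0 expr0 mulr1.
apply: le_trans IH; rewrite exprSr -[leLHS]mulrA ler_wpM2l//.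
  by rewrite exprn_ge0// subr_ge0.
rewrite -addn1 natrD; have : 0 <= M%:R * u * u :> R by rewrite !mulr_ge0.
have := mulr_ge0 u0 u0; by lra.
Qed.

(* The polynomials 1 - (1 - X^n)^M with M ~ th^(-n) approximate the indicator
   function of [th, 1] as n tends to infinity. *)
Lemma step_poly_exists (x z kp : R) : 0 < x -> x < z -> z <= 1 -> 0 < kp ->
  exists p : {poly R}, [/\ step_fun (horner p), p.[x] <= kp & 1 - kp <= p.[z]].
Proof.
move=> x0 xz z1 kp0; pose th := (x + z) / 2.
have xth : x < th by rewrite /th; lra.
have thz : th < z by rewrite /th; lra.
have th0 : 0 < th := lt_trans x0 xth.
have z0 : 0 < z := lt_trans x0 xz.
have x1 : x <= 1 := ltW (lt_le_trans xz z1).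
have [x0' z0' th0'] : [/\ 0 <= x, 0 <= z & 0 <= th] by split; exact: ltW.
have c1 : (x / th) ^+ n @[n --> \oo] --> 0.
  by apply: cvg_expr; rewrite (ger0_norm (divr_ge0 x0' th0')) ltr_pdivrMr ?mul1r.
have c2 : x ^+ n @[n --> \oo] --> 0.
  by apply: cvg_expr; rewrite ger0_norm//; exact: lt_le_trans z1.
have c3 : (th / z) ^+ n @[n --> \oo] --> 0.
  by apply: cvg_expr; rewrite (ger0_norm (divr_ge0 th0' z0')) ltr_pdivrMr ?mul1r.
have kp2 : 0 < kp / 2 by rewrite divr_gt0.
have [n [n0 h1 h2 h3]] : exists n, [/\ (0 < n)%N, (x / th) ^+ n < kp / 2, x ^+ n < kp / 2 & (th / z) ^+ n < kp].
  have /cvgr0_norm_lt /(_ _ kp2) H1 := c1.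
  have /cvgr0_norm_lt /(_ _ kp2) H2 := c2.
  have /cvgr0_norm_lt /(_ _ kp0) H3 := c3.
  near \oo => n; exists n; split.
  - by near: n; exists 1%N.
  - by apply: le_lt_trans (ler_norm _) _; near: n.
  - by apply: le_lt_trans (ler_norm _) _; near: n.
  - by apply: le_lt_trans (ler_norm _) _; near: n.
(* With th^-n < M <= th^-n + 1, M x^n is at most (x/th)^n + x^n while M z^n exceeds (z/th)^n; the
   two Bernoulli inequalities convert this into the estimates at x and z. *)
pose M := (Num.truncn (th ^- n)).+1.
have thn0 : 0 < th ^+ n by rewrite exprn_gt0.
have thi : 0 <= th ^- n by rewrite invr_ge0 ltW.
have M1 : th ^- n < M%:R by have /andP[] := truncn_itv thi.
have M2 : M%:R <= th ^- n + 1.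
  by rewrite /M -addn1 natrD lerD2r; have /andP[] := truncn_itv thi.
exists (1 - (1 - 'X^n) ^+ M); split.
- have E t : (1 - (1 - 'X^n) ^+ M : {poly R}).[t] = 1 - (1 - t ^+ n) ^+ M.
    by rewrite !hornerE.
  split.
  + move=> s t s0 st t1; rewrite !E lerD2l lerN2.
    have tn1 : t ^+ n <= 1 by rewrite exprn_ile1// (le_trans s0).
    have stn : s ^+ n <= t ^+ n by rewrite lerXn2r// nnegrE// (le_trans s0).
    by rewrite lerXn2r ?nnegrE//; lra.
  + by rewrite E expr0n gtn_eqF// subr0 expr1n subrr.
  + by rewrite E expr1n subrr expr0n/= subr0.
- have xn : 0 <= x ^+ n <= 1.
    by rewrite exprn_ge0//= exprn_ile1.
  rewrite !hornerE; have := bernoulli_lower M xn.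
  have : M%:R * x ^+ n <= (x / th) ^+ n + x ^+ n.
    rewrite expr_div_n -[X in _ + X]mul1r mulrC [leRHS](_ : _ = x ^+ n * (th ^- n + 1)); last by ring.
    by rewrite ler_wpM2l//; case/andP: xn.
  by lra.
have zn : 0 <= z ^+ n <= 1 by rewrite exprn_ge0//= exprn_ile1.
have zn0 : 0 < z ^+ n by rewrite exprn_gt0.
rewrite !hornerE; have := bernoulli_upper M zn.
have Mz : (th / z) ^+ n * (M%:R * z ^+ n) >= 1.
  rewrite expr_div_n mulrCA mulfVK ?gt_eqF// -ler_pdivrMr// div1r ltW//.
have B0 : 0 <= (1 - z ^+ n) ^+ M by rewrite exprn_ge0// subr_ge0; case/andP: zn.
have D0 : 0 < M%:R * z ^+ n :> R by rewrite mulr_gt0.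
set B := (1 - z ^+ n) ^+ M in B0 *; set D := M%:R * z ^+ n in Mz D0 *.
move=> BD; have : B <= (th / z) ^+ n.
  have : B * D <= (th / z) ^+ n * D by apply: le_trans Mz; move: BD; rewrite mulrDr mulr1; lra.
  by rewrite ler_pM2r.
by lra.
Unshelve. all: by end_near. Qed.

End step_poly.

(** * The reflection formula for the beta integral *)

Section derivative_comparison.
Variable R : realType.

(** Integral inequalities are handled as inequalities between primitives: derivatives are compared
    on the open interval only, so densities that blow up at the ends are allowed. *)
Lemma derive_le_increment (F G f g : R -> R) (a b : R) : a <= b ->
  {within `[a, b], continuous F} -> {within `[a, b], continuous G} ->
  (forall x : R, a < x < b -> is_derive x 1 F (f x)) ->
  (forall x : R, a < x < b -> is_derive x 1 G (g x)) ->
  (forall x : R, a < x < b -> f x <= g x) ->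
  F b - F a <= G b - G a.
Proof.
move=> ab cF cG dF dG fg.
have cGF : {within `[a, b], continuous (fun x => G x - F x)}.
  by move=> x; apply: cvgB; [exact: cG|exact: cF].
have dGF x : a < x < b -> is_derive x 1 (fun x => G x - F x) (g x - f x).
  by move=> xab; apply: is_deriveB; [exact: dG|exact: dF].
suff : G a - F a <= G b - F b by lra.
apply: (@ger0_derive1_ndecr _ (fun x => G x - F x) a b) => //.
- by move=> x; rewrite in_itv/= => /dGF[].
- move=> x; rewrite in_itv/= => xab; rewrite derive1E.
  by have [_ ->] := dGF _ xab; rewrite subr_ge0 fg.
Qed.

(** Cutting the base off at 0 gives continuity at 0 from both sides, hence on the whole line, and
    composition with any nonnegative continuous function follows. *)
Lemma continuous_posn_powR (p : R) : 0 < p ->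
  continuous (fun x : R => Num.max x 0 `^ p).
Proof.
move=> p0 x; have [x0|x0] := ltP 0 x.
  apply: (@cvg_trans _ ((fun y : R => y `^ p) @ x)).
    apply: near_eq_cvg; near=> y; rewrite max_l// ltW//.
    by near: y; exact: lt_nbhsr.
  have -> : Num.max x 0 = x by rewrite max_l// ltW.
  have c : {for x, continuous (fun y : R => y `^ p)}.
    apply: differentiable_continuous; apply/derivable1_diffP.
    by apply: derivable_powR; rewrite in_itv/= andbT.
  exact: c.
suff : Num.max y 0 `^ p @[y --> x] --> 0.
  by rewrite /continuous_at (max_r x0) powR0// gt_eqF.
apply/cvgr0Pnorm_lt => e e0.
have ep0 : 0 < e `^ p^-1 by rewrite powR_gt0.
near=> y; rewrite ger0_norm ?powR_ge0//.
have -> : e = (e `^ p^-1) `^ p by rewrite -powRrM mulVf ?gt_eqF// powRr1// ltW.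
apply: gt0_ltr_powR => //; rewrite ?nnegrE ?le_max ?lexx ?orbT//.
  exact: ltW.
rewrite gt_max ep0 andbT; near: y; apply: lt_nbhsl.
exact: le_lt_trans ep0.
Unshelve. all: by end_near. Qed.

Lemma continuous_within_powR (f : R -> R) (a b p : R) : 0 < p ->
  (forall x, a <= x <= b -> 0 <= f x) -> {within `[a, b], continuous f} ->
  {within `[a, b], continuous (fun x => f x `^ p)}.
Proof.
move=> p0 f0 cf.
apply: (@subspace_eq_continuous _ _ _ (fun x => Num.max (f x) 0 `^ p)).
  by move=> x; rewrite inE/= in_itv/= => /f0 fx; rewrite max_l.
move=> x; apply: (@cvg_comp _ _ _ f (fun y : R => Num.max y 0 `^ p) _ (nbhs (f x))); first exact: cf.
exact: continuous_posn_powR.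
Qed.

End derivative_comparison.

(** * Partial fractions of the cotangent and the cosecant *)

Section cosecant.
Variable R : realType.

(** Partial sums of the partial fraction series of pi cot(pi x). Pairing the poles -k and k + 1
    makes each of them exactly odd under x -> 1 - x. *)
Definition cot_sum (x : R) (n : nat) : R :=
  \sum_(0 <= k < n) ((x + k%:R)^-1 - (k%:R + 1 - x)^-1).

(** Likewise for pi / sin(pi x), whose residues alternate in sign. *)
Definition csc_sum (x : R) (n : nat) : R :=
  \sum_(0 <= k < n) (-1) ^+ k * ((x + k%:R)^-1 + (k%:R + 1 - x)^-1).

Lemma nat_shift_neq0 (x : R) n : 0 < x -> x + n%:R != 0.
Proof. by move=> x0; rewrite gt_eqF// ltr_pwDl. Qed.

Lemma nat_shift1_neq0 (x : R) n : x < 1 -> n%:R + 1 - x != 0.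
Proof. by move=> x1; rewrite gt_eqF// -addrA ltr_wpDl// subr_gt0. Qed.

(** Finite form of cot(y/2) - cot y = 1 / sin y, by which the cosecant series is reduced to the
    cotangent series. *)
Lemma cot_sum_half (x : R) n : 0 < x < 1 ->
  cot_sum (x / 2) n - cot_sum x n.*2 = csc_sum x n.*2.
Proof.
move=> /andP[x0 x1]; elim: n => [|n IH].
  by rewrite /cot_sum /csc_sum !big_geq// subrr.
move: IH; rewrite /cot_sum /csc_sum doubleS !(big_nat_recr _.+1)//= !(big_nat_recr _)//= => IH.
have E : n.*2%:R = n%:R * 2 :> R by rewrite -muln2 natrM.
have h1 := nat_shift_neq0 n.*2 x0.
have h2 := nat_shift_neq0 n.*2.+1 x0.
have h3 := nat_shift1_neq0 n.*2 x1.
have h4 := nat_shift1_neq0 n.*2.+1 x1.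
rewrite -addn1 natrD E in h1 h2 h3 h4 *.
have x20 : 0 < x / 2 by rewrite divr_gt0.
have x21 : x / 2 < 1 by lra.
have h5 := nat_shift_neq0 n x20.
have h6 := nat_shift1_neq0 n x21.
have -> : (-1) ^+ n.*2 = 1 :> R by rewrite -muln2 mulnC exprM sqrrN expr1n expr1n.
have -> : (-1) ^+ (n.*2 + 1) = -1 :> R by rewrite exprD -muln2 mulnC exprM sqrrN expr1n expr1n mul1r expr1.
move/eqP: IH; rewrite subr_eq => /eqP ->.
have e5 : (x / 2 + n%:R)^-1 = 2 * (x + n%:R * 2)^-1.
  rewrite (_ : x + n%:R * 2 = 2 * (x / 2 + n%:R)); last by field.
  by rewrite invfM mulrA divff ?mul1r.
have e6 : (n%:R + 1 - x / 2)^-1 = 2 * (n%:R * 2 + 1 + 1 - x)^-1.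
  rewrite (_ : n%:R * 2 + 1 + 1 - x = 2 * (n%:R + 1 - x / 2)); last by field.
  by rewrite invfM mulrA divff ?mul1r.
rewrite e5 e6 [x + (n%:R * 2 + 1)]addrA; ring.
Qed.

(** Finite form of the duplication formula of the cotangent, the functional equation behind
    Herglotz's argument. *)
Lemma cot_sum_dup (x : R) n : 0 < x < 1 ->
  cot_sum (x / 2) n + cot_sum ((x + 1) / 2) n = 2 * cot_sum x n.*2.
Proof.
move=> /andP[x0 x1]; elim: n => [|n IH].
  by rewrite /cot_sum !big_geq// addr0 mulr0.
move: IH; rewrite /cot_sum doubleS !(big_nat_recr _.+1)//= !(big_nat_recr _)//= => IH.
have E : n.*2%:R = n%:R * 2 :> R by rewrite -muln2 natrM.
have E1 : n.*2.+1%:R = n%:R * 2 + 1 :> R by rewrite -addn1 natrD E.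
rewrite E1 E.
have e5 : (x / 2 + n%:R)^-1 = 2 * (x + n%:R * 2)^-1.
  rewrite (_ : x + n%:R * 2 = 2 * (x / 2 + n%:R)); last by field.
  by rewrite invfM mulrA divff ?mul1r.
have e6 : (n%:R + 1 - x / 2)^-1 = 2 * (n%:R * 2 + 1 + 1 - x)^-1.
  rewrite (_ : n%:R * 2 + 1 + 1 - x = 2 * (n%:R + 1 - x / 2)); last by field.
  by rewrite invfM mulrA divff ?mul1r.
have e7 : ((x + 1) / 2 + n%:R)^-1 = 2 * (x + (n%:R * 2 + 1))^-1.
  rewrite (_ : x + (n%:R * 2 + 1) = 2 * ((x + 1) / 2 + n%:R)); last by field.
  by rewrite invfM mulrA divff ?mul1r.
have e8 : (n%:R + 1 - (x + 1) / 2)^-1 = 2 * (n%:R * 2 + 1 - x)^-1.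
  rewrite (_ : n%:R * 2 + 1 - x = 2 * (n%:R + 1 - (x + 1) / 2)); last by field.
  by rewrite invfM mulrA divff ?mul1r.
rewrite e5 e6 e7 e8 !mulrDr -IH; ring.
Qed.

Lemma cot_sum_anti (x : R) n : cot_sum (1 - x) n = - cot_sum x n.
Proof.
rewrite /cot_sum -sumrN; apply: eq_bigr => k _; rewrite [RHS]opprB.
by congr (_ ^-1 - _ ^-1); ring.
Qed.

Lemma cot_sum_bounds (x : R) n : 0 < x <= 2^-1 ->
  x^-1 - x *+ 4 - n.+1%:R^-1 *+ 2 <= cot_sum x n.+1 <= x^-1.
Proof.
move=> /andP[x0 x2].
(* Regrouping the poles k + 1 and -(k + 1) leaves 1/x minus a sum of order x and one unpaired
   term. *)
pose E n := \sum_(0 <= k < n) ((k%:R + 1 - x)^-1 - (k%:R + 1 + x)^-1).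
have kx k : 0 < k%:R + 1 - x by rewrite -addrA ltr_wpDl//; lra.
have kx' k : 0 < k%:R + 1 + x by rewrite ltr_wpDl// ler_wpDl.
have EE m : cot_sum x m.+1 = x^-1 - E m - (m%:R + 1 - x)^-1.
  rewrite /cot_sum /E; elim: m => [|m IH].
    by rewrite big_nat1 big_geq// addr0 subr0 add0r.
  rewrite big_nat_recr//= IH [in RHS]big_nat_recr//=.
  by rewrite -(addn1 m) natrD (addrC x); ring.
have E0 m : 0 <= E m.
  apply: sumr_ge0 => k _; rewrite subr_ge0 lef_pV2 ?posrE//; lra.
(* As x <= 1/2, each 1 / ((k + 1)^2 - x^2) is at most 1 / ((k + 1)^2 - 1/4), which telescopes to at
   most 2; the factor 2 x gives the bound 4 x. *)
have E4 m : E m <= x *+ 2 * (2 - (m%:R + 2^-1)^-1).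
  rewrite /E; elim: m => [|m IH].
    by rewrite big_geq// add0r invrK subrr mulr0.
  rewrite big_nat_recr//=; apply: (@le_trans _ _ (x *+ 2 * (2 - (m%:R + 2^-1)^-1) +
     x *+ 2 * ((m%:R + 2^-1)^-1 - (m.+1%:R + 2^-1)^-1))); last by rewrite -mulrDr; apply: ler_wpM2l; lra.
  rewrite lerD//.
  have -> : (m%:R + 1 - x)^-1 - (m%:R + 1 + x)^-1 = x *+ 2 * ((m%:R + 1 - x) * (m%:R + 1 + x))^-1.
    by field; rewrite !gt_eqF.
  have m0 : 0 < m%:R + 2^-1 :> R by rewrite ltr_wpDl.
  have m1 : 0 < m.+1%:R + 2^-1 :> R by rewrite ltr_wpDl.
  have -> : (m%:R + 2^-1)^-1 - (m.+1%:R + 2^-1)^-1 = ((m%:R + 2^-1) * (m.+1%:R + 2^-1))^-1 :> R.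
    by rewrite -(addn1 m) natrD in m1 *; field; rewrite !gt_eqF//; lra.
  apply: ler_wpM2l; first by lra.
  rewrite lef_pV2 ?posrE ?mulr_gt0//.
  have xx : x * x <= 4^-1 by have := ler_pM (ltW x0) (ltW x0) x2 x2; lra.
  by rewrite -(addn1 m) natrD; move: xx; lra.
rewrite EE; have m0 : 0 < n%:R + 2^-1 :> R by rewrite ltr_wpDl.
have e1 : E n <= x *+ 4.
  apply: (le_trans (E4 n)); have : 0 <= (x *+ 2) * (n%:R + 2^-1)^-1.
    by rewrite mulr_ge0 ?invr_ge0 ?(ltW m0)// mulrn_wge0// ltW.
  by lra.
have e2 : (n%:R + 1 - x)^-1 <= n.+1%:R^-1 *+ 2.
  rewrite (_ : n.+1%:R^-1 *+ 2 = (n.+1%:R / 2)^-1); last by rewrite invf_div mulr_natl.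
  rewrite lef_pV2 ?posrE//.
  by rewrite -(addn1 n) natrD; have : 0 <= n%:R :> R by []; lra.
have e3 : 0 <= (n%:R + 1 - x)^-1 by rewrite invr_ge0 ltW.
have e0 := E0 n; move: e0 e1 e2 e3; set r := n.+1%:R^-1; set q := (_ + 1 - x)^-1.
by move=> *; apply/andP; split; lra.
Qed.

Definition cot_lim (x : R) : R := limn (cot_sum x).

Lemma cot_sum_nd (x : R) : 0 < x <= 2^-1 -> nondecreasing_seq (cot_sum x).
Proof.
move=> /andP[x0 x2]; apply/nondecreasing_seqP => n.
have n0 : 0 <= n%:R :> R by [].
by rewrite /cot_sum big_nat_recr//= lerDl subr_ge0 lef_pV2 ?posrE; lra.
Qed.

Lemma cot_lim_cvg_half (x : R) : 0 < x <= 2^-1 -> cot_sum x @ \oo --> cot_lim x.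
Proof.
move=> x01; apply: nondecreasing_is_cvgn; first exact: cot_sum_nd.
exists x^-1 => _ [n _ <-]; apply: (le_trans (cot_sum_nd x01 (leqnSn n))).
by have /andP[] := cot_sum_bounds n x01.
Qed.

Lemma cot_lim_cvg (x : R) : 0 < x < 1 -> cot_sum x @ \oo --> cot_lim x.
Proof.
move=> /andP[x0 x1]; have [x2|x2] := leP x 2^-1; first by apply: cot_lim_cvg_half; rewrite x0.
have x01 : 0 < 1 - x <= 2^-1 by lra.
have := cot_lim_cvg_half x01.
rewrite (_ : cot_sum (1 - x) = \- cot_sum x); last first.
  by apply/funext => n; rewrite cot_sum_anti.
by move=> /cvgP; rewrite is_cvgNE.
Qed.

Lemma cot_lim_anti (x : R) : 0 < x < 1 -> cot_lim (1 - x) = - cot_lim x.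
Proof.
move=> x01; apply/cvg_lim => //.
rewrite (_ : cot_sum (1 - x) = \- cot_sum x); last first.
  by apply/funext => n; rewrite cot_sum_anti.
by apply: cvgN; exact: cot_lim_cvg.
Qed.

Lemma cvg_double (u : nat -> R) (l : R) : u @ \oo --> l -> u n.*2 @[n --> \oo] --> l.
Proof.
move=> ul; apply: (@cvg_comp _ _ _ double u _ \oo) => //.
by apply/cvgnyPge => A; exists A => // n /= An; rewrite -addnn (leq_trans An)// leq_addr.
Qed.

Lemma cot_lim_dup (x : R) : 0 < x < 1 ->
  cot_lim (x / 2) + cot_lim ((x + 1) / 2) = 2 * cot_lim x.
Proof.
move=> x01; have x1 : 0 < x / 2 < 1 by lra.
have x2 : 0 < (x + 1) / 2 < 1 by lra.
have h1 : cot_sum (x / 2) n + cot_sum ((x + 1) / 2) n @[n --> \oo] -->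
    cot_lim (x / 2) + cot_lim ((x + 1) / 2) by apply: cvgD; exact: cot_lim_cvg.
have h2 : 2 * cot_sum x n.*2 @[n --> \oo] --> 2 * cot_lim x.
  by apply: cvgMr; apply: cvg_double; exact: cot_lim_cvg.
rewrite -(cvg_lim _ h1)// -(cvg_lim _ h2)//; congr (lim (_ @ \oo)).
by apply/funext => n /=; rewrite -cot_sum_dup.
Qed.

Lemma csc_sum_cvg (x : R) : 0 < x < 1 ->
  csc_sum x n.*2 @[n --> \oo] --> cot_lim (x / 2) - cot_lim x.
Proof.
move=> x01; under eq_fun do rewrite -cot_sum_half//.
apply: cvgB; first by apply: cot_lim_cvg; lra.
by apply: cvg_double; exact: cot_lim_cvg.
Qed.

Lemma cot_lim_bounds (x : R) : 0 < x <= 2^-1 -> x^-1 - x *+ 4 <= cot_lim x <= x^-1.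
Proof.
move=> x01; have c := cot_lim_cvg_half x01; apply/andP; split.
  have c' : x^-1 - x *+ 4 - n.+1%:R^-1 *+ 2 @[n --> \oo] --> x^-1 - x *+ 4 - 0 *+ 2.
    apply: cvgB; first exact: cvg_cst.
    by apply: cvgMn; exact: cvg_harmonic.
  rewrite mul0rn subr0 in c'.
  have c'' : cot_sum x n.+1 @[n --> \oo] --> cot_lim x by rewrite (cvg_shiftS (cot_sum x)).
  by apply: (ler_cvg_to c' c''); apply: nearW => n; have /andP[] := cot_sum_bounds n x01.
have c'' : cot_sum x n.+1 @[n --> \oo] --> cot_lim x by rewrite (cvg_shiftS (cot_sum x)).
by apply: (ler_cvg_to c'' (cvg_cst _)); apply: nearW => n; have /andP[] := cot_sum_bounds n x01.
Qed.

Definition cotpi (x : R) : R := pi * (cos (pi * x) / sin (pi * x)).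

Lemma sinpi_gt0 (x : R) : 0 < x < 1 -> 0 < sin (pi * x).
Proof.
move=> /andP[x0 x1]; apply: sin_gt0_pi; rewrite mulr_gt0 ?pi_gt0//=.
by rewrite -[ltRHS]mulr1 ltr_pM2l// pi_gt0.
Qed.

Lemma cotpi_anti (x : R) : cotpi (1 - x) = - cotpi x.
Proof.
rewrite /cotpi mulrBr mulr1 addrC sinDpi cosDpi sinN cosN opprK.
by rewrite mulNr mulrN.
Qed.

Lemma cotpi_dup (x : R) : 0 < x < 1 -> cotpi (x / 2) + cotpi ((x + 1) / 2) = 2 * cotpi x.
Proof.
move=> x01; rewrite /cotpi.
have -> : pi * ((x + 1) / 2) = pi * (x / 2) + pi / 2 by field.
rewrite sinDpihalf cosDpihalf.
have s1 : 0 < sin (pi * (x / 2)) by apply: sinpi_gt0; lra.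
have s2 : 0 < sin (pi * x) by exact: sinpi_gt0.
have E : pi * x = (pi * (x / 2)) *+ 2 by rewrite mulr2n; field.
have c1 : cos (pi * (x / 2)) != 0.
  by apply/eqP => c0; move: s2; rewrite E sin_mulr2n c0 mul0r mul0rn ltxx.
rewrite E sin_mulr2n cos_mulr2n.
have := cos2Dsin2 (pi * (x / 2)).
set c := cos _ in c1 *; set s := sin _ in s1 *.
move=> H; have -> : c ^+ 2 *+ 2 - 1 = c ^+ 2 - s ^+ 2 by rewrite -H; ring.
by field; rewrite c1 gt_eqF.
Qed.

Lemma cotpi_csc (x : R) : 0 < x < 1 -> cotpi (x / 2) - cotpi x = pi / sin (pi * x).
Proof.
move=> x01; rewrite /cotpi.
have s1 : 0 < sin (pi * (x / 2)) by apply: sinpi_gt0; lra.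
have s2 : 0 < sin (pi * x) by exact: sinpi_gt0.
have E : pi * x = (pi * (x / 2)) *+ 2 by rewrite mulr2n; field.
have c1 : cos (pi * (x / 2)) != 0.
  by apply/eqP => c0; move: s2; rewrite E sin_mulr2n c0 mul0r mul0rn ltxx.
rewrite E sin_mulr2n cos_mulr2n.
have := cos2Dsin2 (pi * (x / 2)).
set c := cos _ in c1 *; set s := sin _ in s1 *.
move=> H; have -> : c ^+ 2 *+ 2 - 1 = c ^+ 2 *+ 2 - (c ^+ 2 + s ^+ 2) by rewrite H.
have -> : pi / (c * s *+ 2) = pi * (c ^+ 2 + s ^+ 2) / (c * s *+ 2) by rewrite H mulr1.
by field; rewrite c1 gt_eqF.
Qed.

Lemma sin_le_id (y : R) : 0 <= y -> sin y <= y.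
Proof.
move=> y0; rewrite -[leLHS]subr0 -sin0 -[leRHS]subr0.
apply: (@derive_le_increment _ (@sin R) id (@cos R) (fun=> 1) 0 y y0).
- by apply: continuous_subspaceT; exact: continuous_sin.
- by apply: continuous_subspaceT => x; exact: cvg_id.
- by move=> x _; exact: cos_le1.
Qed.

Lemma cos_ge_quadratic (y : R) : 0 <= y -> 1 - y ^+ 2 / 2 <= cos y.
Proof.
move=> y0; suff : - cos y - - cos 0 <= y ^+ 2 / 2 - 0 ^+ 2 / 2.
  by rewrite cos0 expr0n/= mul0r; lra.
apply: (@derive_le_increment _ (fun y => - cos y) (fun y => y ^+ 2 / 2) (@sin R) id 0 y y0).
- by apply: continuous_subspaceT => x; apply: cvgN; exact: continuous_cos.
- by apply: continuous_subspaceT => x; apply: cvgMl; exact: exprn_continuous.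
- by move=> x _; apply: is_derive_eq; rewrite opprK.
- by move=> x _; apply: is_derive_eq; rewrite /GRing.scale/= ?mulr0 ?add0r ?expr1; field.
- by move=> x /andP[x0 _]; apply: sin_le_id; exact: ltW.
Qed.

Lemma ycos_le_sin (y : R) : 0 <= y <= pi -> y * cos y <= sin y.
Proof.
move=> /andP[y0 ypi]; suff : y * cos y - 0 * cos 0 <= sin y - sin 0.
  by rewrite sin0 mul0r !subr0.
apply: (@derive_le_increment _ (fun y => y * cos y) (@sin R) (fun y => cos y - y * sin y) (@cos R) 0 y y0).
- by apply: continuous_subspaceT => x; apply: cvgM; [exact: cvg_id|exact: continuous_cos].
- by apply: continuous_subspaceT; exact: continuous_sin.
- by move=> x _; apply: is_derive_eq; rewrite /GRing.scale/=; ring.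
- move=> x /andP[x0 xy]; rewrite gerBl mulr_ge0 ?(ltW x0)// sin_ge0_pi// (ltW x0)/=.
  by rewrite (le_trans (ltW xy)).
Qed.

Lemma cotpi_bounds (x : R) : 0 < x <= 2^-1 -> x^-1 - pi ^+ 2 * x <= cotpi x <= x^-1.
Proof.
move=> /andP[x0 x2]; have p0 := pi_gt0 R.
have y0 : 0 < pi * x by rewrite mulr_gt0.
have s0 : 0 < sin (pi * x) by apply: sinpi_gt0; lra.
rewrite /cotpi mulrA; apply/andP; split; last first.
  rewrite ler_pdivrMr// ler_pdivlMl// mulrA (mulrC x).
  by apply: ycos_le_sin; rewrite ltW//= -[leRHS]mulr1 ler_pM2l//; lra.
have c0 : 0 <= cos (pi * x).
  by apply: cos_ge0_pihalf; apply/andP; split; [lra|rewrite ler_pM2l//].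
apply: (@le_trans _ _ (pi * cos (pi * x) / (pi * x))); last first.
  by rewrite ler_wpM2l ?mulr_ge0 ?(ltW p0)// lef_pV2 ?posrE// sin_le_id// ltW.
rewrite ler_pdivlMr//; have := cos_ge_quadratic (ltW y0).
have -> : (x^-1 - pi ^+ 2 * x) * (pi * x) = pi * (1 - (pi * x) ^+ 2) by field; rewrite gt_eqF.
move=> h; rewrite ler_pM2l//; have : 0 <= (pi * x) ^+ 2 by rewrite sqr_ge0.
by move: h; lra.
Qed.

(* Herglotz's trick *)
Lemma herglotz (g : R -> R) (K : R) : 0 <= K ->
  (forall x, 0 < x < 1 -> g (1 - x) = - g x) ->
  (forall x, 0 < x < 1 -> g (x / 2) + g ((x + 1) / 2) = 2 * g x) ->
  (forall x, 0 < x <= 2^-1 -> `|g x| <= K * x) ->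
  forall x, 0 < x < 1 -> g x = 0.
Proof.
move=> K0 ganti gdup gK.
have gbound x : 0 < x < 1 -> g x <= K.
  move=> /andP[x0 x1]; have [x2|x2] := leP x 2^-1.
    apply: (le_trans (ler_norm _)); apply: (@le_trans _ _ (K * x)); first by apply: gK; rewrite x0.
    by rewrite ler_piMr//; lra.
  have x01 : 0 < 1 - x < 1 by lra.
  have -> : g x = - g (1 - x) by rewrite ganti ?opprK// x0.
  apply: (le_trans (ler_norm _)); rewrite normrN.
  apply: (@le_trans _ _ (K * (1 - x))); first by apply: gK; lra.
  by rewrite ler_piMr//; lra.
(* Antisymmetry under x -> 1 - x upgrades the upper bound to equality. *)
suff H x : 0 < x < 1 -> g x <= 0.
  move=> x x01; apply/eqP; rewrite eq_le H//= -oppr_le0 -ganti// H//; lra.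
pose S := [set g x | x in [set x : R | 0 < x < 1]].
have S0 : has_sup S.
  split; first by exists (g 2^-1), 2^-1 => //=; lra.
  by exists K => _ [y y01 <-]; exact: gbound.
pose M := sup S.
have gM y : 0 < y < 1 -> g y <= M by move=> y01; apply: ub_le_sup; [exact: S0.2|exists y].
move=> x01; apply: (le_trans (gM _ x01)); rewrite leNgt; apply/negP => M0.
(* Each use of the duplication formula bounds one of the two halves by the supremum [M] and keeps
   the other, whose argument is halved. Near 0 the linear bound on g brings the latter below M / 2,
   so that all values stay below [M] by a fixed factor. *)
have iter y n : 0 < y < 1 -> g y <= 2^-1 ^+ n * g (y * 2^-1 ^+ n) + (1 - 2^-1 ^+ n) * M.
  move=> y01; elim: n => [|n IH]; first by rewrite !expr0 mulr1 subrr mul0r addr0 mul1r.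
  apply: (le_trans IH).
  have p0 : 0 < 2^-1 ^+ n :> R by rewrite exprn_gt0.
  have p1 : 2^-1 ^+ n <= 1 :> R by rewrite exprn_ile1//; lra.
  have z01 : 0 < y * 2^-1 ^+ n < 1.
    case/andP: y01 => y0 y1; rewrite mulr_gt0//=.
    by apply: le_lt_trans y1; rewrite ler_piMr// ltW.
  have := gdup _ z01; have := gM ((y * 2^-1 ^+ n + 1) / 2) (_ : _); rewrite exprSr mulrA.
  set q := 2^-1 ^+ n in p0 p1 z01 *; set z := y * q in z01 *.
  move=> h1 h2; have {}h1 := h1 _.
  have : g ((z + 1) / 2) <= M by apply: h1; lra.
  move=> h3; have : q * (2 * g z) <= q * (g (z / 2) + M) by rewrite ler_pM2l// -h2 lerD2l.
  by lra.
have [n hn] : exists n, K * 2^-1 ^+ n.+1 < M / 2.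
  have c : K * 2^-1 ^+ n.+1 @[n --> \oo] --> K * 0.
    apply: cvgMr; rewrite (cvg_shiftS (GRing.exp (2^-1 : R))).
    by apply: cvg_expr; rewrite ger0_norm//; lra.
  rewrite mulr0 in c; have M2 : 0 < M / 2 by rewrite divr_gt0.
  have /cvgr0_norm_lt /(_ _ M2) [n _ /(_ n (leqnn _)) /= h] := c.
  by exists n; apply: le_lt_trans (ler_norm _) h.
have p0 : 0 < 2^-1 ^+ n.+1 :> R by rewrite exprn_gt0.
have : M <= M * (1 - 2^-1 ^+ n.+1 / 2).
  apply: ge_sup; first exact: S0.1.
  move=> _ [y y01 <-]; apply: (le_trans (iter y n.+1 y01)).
  have h : g (y * 2^-1 ^+ n.+1) <= M / 2.
    apply: le_trans (ltW hn); apply: (le_trans (ler_norm _)).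
    have yq : 0 < y * 2^-1 ^+ n.+1 <= 2^-1 ^+ n.+1.
      by case/andP: y01 => y0 y1; rewrite mulr_gt0//= ler_piMl// ltW.
    apply: (@le_trans _ _ (K * (y * 2^-1 ^+ n.+1))).
      apply: gK; case/andP: yq => -> yq; apply: (le_trans yq).
      by rewrite exprS ler_piMr// exprn_ile1//; lra.
    by rewrite ler_wpM2l//; case/andP: yq.
  have : 2^-1 ^+ n.+1 * g (y * 2^-1 ^+ n.+1) <= 2^-1 ^+ n.+1 * (M / 2) by rewrite ler_pM2l.
  by lra.
have : 0 < M * (2^-1 ^+ n.+1 / 2) by rewrite mulr_gt0// divr_gt0.
by lra.
Qed.

(** The poles at 0 cancel in the difference, which is at most (4 + pi^2) x near 0, and both
    functions satisfy the same two functional equations. *)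
Lemma cot_limE (x : R) : 0 < x < 1 -> cot_lim x = cotpi x.
Proof.
move=> x01; apply/eqP; rewrite -subr_eq0; apply/eqP.
apply: (@herglotz (fun x => cot_lim x - cotpi x) (4 + pi ^+ 2)) => //.
- by rewrite addr_ge0// sqr_ge0.
- by move=> y y01; rewrite cot_lim_anti// cotpi_anti opprB opprK addrC.
- by move=> y y01; rewrite mulrBr -cot_lim_dup// -cotpi_dup//; ring.
- move=> y y01; have /andP[h1 h2] := cot_lim_bounds y01; have /andP[h3 h4] := cotpi_bounds y01.
  have p2 : 0 <= pi ^+ 2 * y :> R by rewrite mulr_ge0 ?sqr_ge0//; lra.
  have y0 : 0 < y by case/andP: y01.
  by rewrite ler_norml mulrDl; apply/andP; split; lra.
Qed.

Lemma csc_sum_cvg_csc (x : R) : 0 < x < 1 ->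
  csc_sum x n.*2 @[n --> \oo] --> pi / sin (pi * x).
Proof.
move=> x01; rewrite -cotpi_csc// -!cot_limE//; last by lra.
exact: csc_sum_cvg.
Qed.

End cosecant.

Lemma continuous_within_comp (T U V : topologicalType) (A : set T) (B : set U)
    (f : T -> U) (g : U -> V) :
  (forall x, A x -> B (f x)) -> {within A, continuous f} ->
  {within B, continuous g} -> {within A, continuous (g \o f)}.
Proof.
move=> AB /subspace_continuousP cf /subspace_continuousP cg.
apply/subspace_continuousP => x Ax W /(cg _ (AB x Ax)) WB.
have h : nbhs x (fun y => A y -> B (f y) -> W (g (f y))) := cf _ Ax _ WB.
change (nbhs x (fun y => A y -> W (g (f y)))).
by apply: filterS h => y fy Ay; exact: fy Ay (AB _ Ay).
Qed.

(** * Euler's reflection formula through alternating series *)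

Section beta_primitive.
Variables (R : realType) (al : R).
Hypothesis al01 : 0 < al < 1.

Definition beta_density (b x : R) : R := x `^ (- b) * (1 - x) `^ (b - 1).

Lemma is_derive_odds_powR (p x : R) : 0 < x < 1 ->
  is_derive x 1 (fun x : R => (x / (1 - x)) `^ p)
    (p * (x / (1 - x)) `^ (p - 1) * (1 - x) ^- 2).
Proof.
move=> /andP[x0 x1]; have x1' : 1 - x != 0 by rewrite subr_eq0 gt_eqF.
have s0 : 0 < x / (1 - x) by rewrite divr_gt0// subr_gt0.
have d1 : is_derive x 1 (fun x : R => x / (1 - x)) ((1 - x) ^- 2).
  have ? := is_deriveV x1'.
  apply: is_derive_eq; rewrite /GRing.scale/=; by field.
have d2 := is_derive1_powR p s0.
exact: (@is_derive1_comp _ (fun s : R => s `^ p) (fun x : R => x / (1 - x))).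
Qed.

Lemma continuous_odds_powR (p : R) : 0 < p ->
  {within `[0, 2^-1], continuous (fun x : R => (x / (1 - x)) `^ p)}.
Proof.
move=> p0; apply: continuous_within_powR => //.
  by move=> x /andP[x0 x2]; rewrite divr_ge0//; lra.
move=> x; apply: continuous_in_subspaceT => y; rewrite inE/= in_itv/= => /andP[y0 y2].
apply: cvgM; first exact: cvg_id.
apply: cvgV; first by rewrite subr_eq0 gt_eqF//; lra.
by apply: cvgB; [exact: cvg_cst|exact: cvg_id].
Qed.

Lemma geometric_alternating (s : R) n : 0 <= s ->
  \sum_(0 <= k < n.*2) (-1) ^+ k * s ^+ k = (1 - s ^+ n.*2) / (1 + s).
Proof.
move=> s0; have s1 : 1 + s != 0 by rewrite gt_eqF// ltr_pwDl.
elim: n => [|n IH]; first by rewrite big_geq// expr0 subrr mul0r.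
rewrite doubleS !big_nat_recr//= IH.
have e1 : (-1) ^+ n.*2 = 1 :> R by rewrite -muln2 mulnC exprM sqrrN expr1n expr1n.
by rewrite [(-1) ^+ n.*2.+1]exprS e1 !exprS; field.
Qed.

(* Comparison of the density with the partial sums of the geometric expansion
   of 1/(1+s), s = x/(1-x), whose primitives are explicit. *)
Lemma beta_half_bounds (b : R) (H : R -> R) (n : nat) : 0 < b < 1 ->
  {within `[0, 2^-1], continuous H} ->
  (forall x : R, 0 < x < 2^-1 -> is_derive x 1 H (beta_density b x)) ->
  \sum_(0 <= k < n.*2) (-1) ^+ k * (k%:R + 1 - b)^-1 <= H 2^-1 - H 0
  <= \sum_(0 <= k < n.*2) (-1) ^+ k * (k%:R + 1 - b)^-1 + (n.*2%:R + 1 - b)^-1.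
Proof.
move=> /andP[b0 b1] cH dH.
pose s x : R := x / (1 - x).
have kb (k : nat) : 0 < k%:R + 1 - b by rewrite -addrA ltr_wpDl// subr_gt0.
pose Q (k : nat) (x : R) := s x `^ (k%:R + 1 - b) / (k%:R + 1 - b).
pose q (k : nat) (x : R) := s x `^ (- b) * s x ^+ k * (1 - x) ^- 2.
have s0 (x : R) : 0 < x < 2^-1 -> 0 < s x by move=> x01; rewrite divr_gt0; lra.
have dQ k (x : R) : 0 < x < 2^-1 -> is_derive x 1 (Q k) (q k x).
  move=> x01; have x1 : 0 < x < 1 by lra.
  have ? := is_derive_odds_powR (k%:R + 1 - b) x1.
  apply: is_derive_eq; rewrite /GRing.scale/= ?mulr0 ?add0r.
  have -> : k%:R + 1 - b - 1 = - b + k%:R by ring.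
  rewrite powRD; last by rewrite (gt_eqF (s0 _ x01)) implybT.
  rewrite powR_mulrn ?(ltW (s0 _ x01))// /q -/(s x).
  by rewrite !mulrA mulVf ?mul1r// gt_eqF.
have cQ k : {within `[0, 2^-1], continuous (Q k)}.
  by move=> x; apply: cvgMl; exact: continuous_odds_powR.
have Q0 k : Q k 0 = 0 by rewrite /Q /s mul0r powR0 ?mul0r// gt_eqF.
have Qh k : Q k 2^-1 = (k%:R + 1 - b)^-1.
  rewrite /Q /s (_ : 2^-1 / (1 - 2^-1) = 1 :> R) ?powR1 ?mul1r//.
  by rewrite [X in _ / X](_ : _ = 2^-1) ?divff//; field.
pose SQ (x : R) : R := \sum_(0 <= k < n.*2) (-1) ^+ k * Q k x.
pose Sq (x : R) : R := \sum_(0 <= k < n.*2) (-1) ^+ k * q k x.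
have dSQ (x : R) : 0 < x < 2^-1 -> is_derive x 1 SQ (Sq x).
  move=> x01; rewrite /SQ /Sq.
  elim: (n.*2) => [|m IH].
    under eq_fun do rewrite big_geq//; rewrite big_geq//; exact: is_derive_cst.
  under eq_fun do rewrite big_nat_recr//=; rewrite big_nat_recr//=.
  have ? := dQ m x x01.
  by apply: is_derive_eq; rewrite /GRing.scale/= addrC.
have cSQ : {within `[0, 2^-1], continuous SQ}.
  move=> x; apply: cvg_big_sum => k; apply: cvgMr; exact: cQ.
have hE (x : R) : 0 < x < 2^-1 -> beta_density b x = s x `^ (- b) * (1 - x) ^- 2 / (1 + s x).
  move=> x01; rewrite /beta_density.
  have x1 : 0 < 1 - x by lra.
  have -> : 1 + s x = (1 - x)^-1 by rewrite /s; field; rewrite gt_eqF.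
  rewrite invrK -mulrA [_ ^- 2 * _](_ : _ = (1 - x)^-1); last by field; rewrite gt_eqF.
  rewrite /s powRM ?invr_ge0 ?(ltW x1)//; last by lra.
  rewrite -mulrA; congr (_ * _).
  rewrite -(powR_inv1 (ltW x1)) -powRrM mulN1r opprK -powRD//.
  by rewrite (gt_eqF x1) implybT.
have SqE (x : R) : 0 < x < 2^-1 -> Sq x = beta_density b x - q n.*2 x / (1 + s x).
  move=> x01; rewrite hE// /Sq /q.
  transitivity (s x `^ (- b) * (1 - x) ^- 2 * \sum_(0 <= k < n.*2) (-1) ^+ k * s x ^+ k).
    by rewrite mulr_sumr; apply: eq_bigr => k _; ring.
  rewrite geometric_alternating ?(ltW (s0 _ x01))//.
  by ring.
have q0 k (x : R) : 0 < x < 2^-1 -> 0 <= q k x.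
  by move=> x01; rewrite !mulr_ge0 ?powR_ge0 ?invr_ge0 ?exprn_ge0 ?(ltW (s0 _ x01))//; lra.
have h20 : (0 : R) <= 2^-1 by lra.
have SQ0 : SQ 0 = 0 by rewrite /SQ big1// => k _; rewrite Q0 mulr0.
have SQh : SQ 2^-1 = \sum_(0 <= k < n.*2) (-1) ^+ k * (k%:R + 1 - b)^-1.
  by apply: eq_bigr => k _; rewrite Qh.
rewrite -SQh -Qh; apply/andP; split.
  have : SQ 2^-1 - SQ 0 <= H 2^-1 - H 0; last by rewrite SQ0 subr0.
  apply: (@derive_le_increment _ SQ H Sq (beta_density b) 0 2^-1 h20) => // x x01.
  by rewrite SqE// gerBl divr_ge0 ?q0// addr_ge0// ltW// s0.
have : H 2^-1 - H 0 <= (SQ 2^-1 + Q n.*2 2^-1) - (SQ 0 + Q n.*2 0); last by rewrite SQ0 Q0 addr0 subr0.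
apply: (@derive_le_increment _ H (fun x => SQ x + Q n.*2 x) (beta_density b) (fun x => Sq x + q n.*2 x) 0 2^-1 h20) => //.
- by move=> x; apply: cvgD; [exact: cSQ|exact: cQ].
- by move=> x x01; have ? := dSQ x x01; have ? := dQ n.*2 x x01; exact: is_deriveD.
- move=> x x01; rewrite SqE// -addrA lerDl addrC subr_ge0 ler_pdivrMr ?ltr_pwDl ?(ltW (s0 _ x01))//.
  by rewrite ler_peMr ?q0// lerDl ltW// s0.
Qed.

Variable H : R -> R.
Hypothesis cH : {within `[0, 1], continuous H}.
Hypothesis dH : forall x : R, 0 < x < 1 -> is_derive x 1 H (beta_density al x).

(** Euler's formula for an arbitrary primitive [H] of the density. The interval is cut at 1/2 and
    its right half reflected, which exchanges al and 1 - al; the two alternating series then add up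
    to [csc_sum]. *)
Lemma beta_reflection : H 1 - H 0 = pi / sin (pi * al).
Proof.
have /andP[a0 a1] := al01.
have cH1 : {within `[0, 2^-1], continuous H}.
  by apply: continuous_subspaceW cH => x /=; rewrite !in_itv/=; lra.
pose G (x : R) := - H (1 - x).
have cG : {within `[0, 2^-1], continuous G}.
  suff cHr : {within `[0, 2^-1], continuous (H \o (fun x : R => 1 - x))}.
    by move=> x; apply: cvgN; exact: cHr.
  apply: (@continuous_within_comp R R R [set` `[0, 2^-1]%R] [set` `[(0:R), 1]%R] (fun x : R => 1 - x) H) => //.
    by move=> x /=; rewrite !in_itv/=; lra.
  by apply: continuous_subspaceT => x; apply: cvgB; [exact: cvg_cst|exact: cvg_id].
have dG (x : R) : 0 < x < 2^-1 -> is_derive x 1 G (beta_density (1 - al) x).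
  move=> x01; have x1 : 0 < 1 - x < 1 by lra.
  have d1 := dH x1.
  have d2 : is_derive x 1 (fun x : R => 1 - x) (-1).
    have d := is_deriveB (is_derive_cst (1 : R) x 1) (is_derive_id x (1 : R)).
    by apply: (is_derive_eq d); rewrite sub0r.
  have d3 := @is_derive1_comp _ H (fun x : R => 1 - x) x _ _ d1 d2.
  rewrite (_ : G = - (H \o (fun x : R => 1 - x)))//.
  apply: is_derive_eq; rewrite mulrN1 opprK /beta_density.
  by rewrite mulrC; congr (_ `^ _ * _ `^ _); ring.
have dH1 (x : R) : 0 < x < 2^-1 -> is_derive x 1 H (beta_density al x) by move=> x01; apply: dH; lra.
have B1 n := beta_half_bounds n al01 cH1 dH1.
have al01' : 0 < 1 - al < 1 by lra.
have B2 n := beta_half_bounds n al01' cG dG.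
have E n : csc_sum al n.*2 = \sum_(0 <= k < n.*2) (-1) ^+ k * (k%:R + 1 - al)^-1 +
    \sum_(0 <= k < n.*2) (-1) ^+ k * (k%:R + 1 - (1 - al))^-1.
  rewrite /csc_sum -big_split/=; apply: eq_bigr => k _; rewrite -mulrDr addrC.
  by congr (_ * (_ + _ ^-1)); ring.
have HE : H 1 - H 0 = (H 2^-1 - H 0) + (G 2^-1 - G 0).
  by rewrite /G subr0 (_ : 1 - 2^-1 = 2^-1); [ring|field].
have h1 : csc_sum al n.*2 @[n --> \oo] --> H 1 - H 0.
  pose rem (x : R) (n : nat) : R := (n.*2%:R + 1 - x)^-1.
  have rem0 (x : R) : 0 < x < 1 -> rem x n @[n --> \oo] --> (0 : R).
    move=> /andP[x0 x1]; apply/cvgr0Pnorm_lt => e e0.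
    near=> n.
    have n1 : 1 / e <= n%:R by near: n; exact: nbhs_infty_ger.
    have d0 : n%:R < n.*2%:R + 1 - x.
      have : (n%:R : R) <= n.*2%:R by rewrite ler_nat -addnn leq_addr.
      by lra.
    have d1 : 0 < 1 / e by rewrite divr_gt0.
    have d2 : 0 < n.*2%:R + 1 - x by lra.
    rewrite ger0_norm ?invr_ge0 ?(ltW d2)// -[ltRHS]invrK ltf_pV2 ?posrE ?invr_gt0//.
    by rewrite -[e^-1]mul1r; lra.
  have r2 : (rem al n + rem (1 - al) n) @[n --> \oo] --> (0 : R).
    by rewrite -[0 in X in _ --> X](addr0 (0:R)); apply: cvgD; exact: rem0.
  apply: (@squeeze_cvgr _ _ _ _ (fun n => (H 1 - H 0) - (rem al n + rem (1 - al) n)) (fun=> H 1 - H 0)); last exact: cvg_cst.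
    apply: nearW => n; rewrite E HE.
    have := B1 n; have := B2 n; rewrite /rem => /andP[? ?] /andP[? ?].
    apply/andP; split; lra.
  rewrite -[X in _ --> X]subr0; apply: cvgB => //; exact: cvg_cst.
rewrite -(cvg_lim _ h1)//; apply/cvg_lim => //; exact: csc_sum_cvg_csc.
Unshelve. all: by end_near. Qed.

End beta_primitive.

(** * The generalized arcsine law *)

Section beta_kernel.
Variable R : realType.
Implicit Types (p q : {poly R}) (v t u kp : R).

Lemma is_derive_scale (f : R -> R) (df k x : R) : is_derive x 1 f df ->
  is_derive x 1 (fun y => k * f y) (k * df).
Proof. by move=> ?; exact: is_deriveZ. Qed.

Lemma is_derive_big_sum (I : Type) (s : seq I) (f : I -> R -> R) (df : I -> R) (x : R) :
  (forall i, is_derive x 1 (f i) (df i)) ->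
  is_derive x 1 (fun y => \sum_(i <- s) f i y) (\sum_(i <- s) df i).
Proof.
move=> fd; elim: s => [|i s IH].
  by under eq_fun do rewrite big_nil; rewrite big_nil; exact: is_derive_cst.
under eq_fun do rewrite big_cons; rewrite big_cons.
by have ? := fd i; exact: is_deriveD.
Qed.

(** The integral over [0, 1] of p'(y) q(y^(1/v)) dy, computed on monomials. When p and q are near
    indicators with thresholds a and b, it tells whether a^(1/v) exceeds b. *)
Definition kernel_sum p q v : R :=
  \sum_(i < size p) \sum_(j < size q) p`_i * q`_j * (i%:R * v / (i%:R * v + j%:R)).

Lemma deriv_step_fun_ge0 p (x : R) : step_fun (horner p) -> 0 < x < 1 -> 0 <= p^`().[x].
Proof.
move=> [pm _ _] x01; apply/ler_addgt0Pr => e e0.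
(* The perturbation makes the polynomial strictly increasing, as the derivative criterion asks. *)
have -> : p^`().[x] + e = (p + e *: 'X)^`().[x].
  by rewrite derivD derivZ derivX hornerD hornerZ hornerC mulr1.
rewrite derivE; apply: (@incr_derive1_ge0_itv _ (horner (p + e *: 'X)) true false 0 1).
- by move=> y _; exact: derivable_horner.
- move=> y z; rewrite !in_itv/= => /andP[y0 y1] /andP[z0 z1] yz.
  by rewrite !hornerD !hornerZ !hornerX ler_ltD ?ltr_pM2l// pm// ltW.
- by rewrite in_itv.
Qed.

(* y ^ i * (y ^ (1/v)) ^ j *)
Let mono v (i j : nat) (y : R) : R := y `^ (i%:R + j%:R / v).

(** The same integral with upper limit y, so that its value at 1 is [kernel_sum]. *)
Let W p q v (y : R) : R :=
  \sum_(i < size p) \sum_(j < size q)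
    (p`_i * q`_j * (i%:R * v / (i%:R * v + j%:R))) * mono v i j y.

Let W1 p q v : W p q v 1 = kernel_sum p q v.
Proof.
by apply: eq_bigr => i _; apply: eq_bigr => j _; rewrite /mono powR1 mulr1.
Qed.

Let W0 p q v : 0 < v -> W p q v 0 = 0.
Proof.
move=> v0; apply: big1 => i _; apply: big1 => j _.
case: i => [[|i] ip] /=; first by rewrite mul0r mul0r mulr0 mul0r.
by rewrite /mono powR0 ?mulr0// gt_eqF// ltr_pwDl// divr_ge0// ltW.
Qed.

Let cW p q v (a b : R) : 0 < v -> 0 <= a -> {within `[a, b], continuous (W p q v)}.
Proof.
move=> v0 a0 x; apply: cvg_big_sum => i; apply: cvg_big_sum => j; apply: cvgMr; move: x.
have [e0|e0] := eqVneq (i%:R + j%:R / v : R) 0.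
  have -> : mono v i j = fun=> 1 by apply/funext => y; rewrite /mono e0 powRr0.
  by apply: continuous_subspaceT => x; exact: cvg_cst.
apply: (@continuous_within_powR _ (fun y => y)).
- by rewrite lt_neqAle eq_sym e0/= addr_ge0// divr_ge0// ltW.
- by move=> x /andP[ax _]; exact: le_trans ax.
- by apply: continuous_subspaceT => x; exact: cvg_id.
Qed.

Let dW p q v (y : R) : 0 < v -> 0 < y ->
  is_derive y 1 (W p q v) (p^`().[y] * q.[y `^ v^-1]).
Proof.
move=> v0 y0.
pose dm (i j : nat) := p`_i * q`_j * (i%:R * y ^+ i.-1 * (y `^ v^-1) ^+ j).
have -> : p^`().[y] * q.[y `^ v^-1] = \sum_(i < size p) \sum_(j < size q) dm i j.
  have -> : p^`().[y] = \sum_(i < size p) p`_i * i%:R * y ^+ i.-1.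
    have [->|p0] := eqVneq p 0.
      by rewrite deriv0 horner0 size_poly0 big_ord0.
    have sp : (0 < size p)%N by rewrite size_poly_gt0.
    rewrite (@horner_coef_wide _ (size p).-1); last first.
      by rewrite -ltnS prednK// lt_size_deriv.
    rewrite -[in RHS](prednK sp) big_ord_recl/= mulr0 mul0r add0r.
    by apply: eq_bigr => i _; rewrite coef_deriv /bump/= add1n mulr_natr.
  rewrite horner_coef mulr_suml; apply: eq_bigr => i _.
  by rewrite mulr_sumr; apply: eq_bigr => j _; rewrite /dm; ring.
apply: is_derive_big_sum => i; apply: is_derive_big_sum => j.
have d1 := is_derive1_powR (i%:R + j%:R / v) y0.
apply: is_derive_eq; rewrite /GRing.scale/= /dm.
case: i d1 => [[|i] ip] /= _; first by rewrite !(mul0r,mulr0).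
have d0 : i.+1%:R * v + j%:R != 0 by rewrite gt_eqF// ltr_pwDl// mulr_gt0.
have -> : y `^ (i.+1%:R + j%:R / v - 1) = y ^+ i * (y `^ v^-1) ^+ j.
  rewrite -[i.+1]addn1 natrD -powR_mulrn ?(ltW y0)// -powR_mulrn ?powR_ge0//.
  rewrite -powRrM -powRD ?(gt_eqF y0) ?implybT//; congr (_ `^ _); ring.
have v0' : v != 0 by rewrite gt_eqF.
move: d0; set n : R := i.+1%:R => d0; field.
by rewrite v0' (addrC 1) natr1.
Qed.

Section bounds.
Variables (p q : {poly R}) (v : R).
Hypotheses (sp : step_fun (horner p)) (sq : step_fun (horner q)) (v01 : 0 < v < 1).

Let v0 : 0 < v. Proof. by case/andP: v01. Qed.

Let yv01 (y : R) : 0 < y < 1 -> 0 <= y `^ v^-1 <= 1.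
Proof.
move=> /andP[y0 y1]; rewrite powR_ge0/= -[leRHS](congr1 (@^~ v^-1) (powR1 R)).
by rewrite ge0_ler_powR ?nnegrE ?invr_ge0 ?ltW.
Qed.

Let Q01 (y : R) : 0 < y < 1 -> 0 <= q.[y `^ v^-1] <= 1.
Proof. by move=> /yv01; exact: step_fun_itv. Qed.

Let cP (a b : R) : {within `[a, b], continuous (horner p)}.
Proof. by apply: continuous_subspaceT => x; exact: continuous_horner. Qed.

Let dP (y : R) : is_derive y 1 (horner p) p^`().[y].
Proof. by apply: DeriveDef; [exact: derivable_horner|rewrite derivE derive1E]. Qed.

Let W_lower (a b k : R) : 0 <= a -> a <= b -> b <= 1 ->
  (forall y, a < y < b -> k <= q.[y `^ v^-1]) ->
  k * (p.[b] - p.[a]) <= W p q v b - W p q v a.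
Proof.
move=> a0 ab b1 kq; rewrite mulrBr.
apply: (@derive_le_increment _ (fun y => k * p.[y]) _ (fun y => k * p^`().[y])
   (fun y => p^`().[y] * q.[y `^ v^-1])) => //.
- by move=> x; apply: cvgMr; exact: cP.
- exact: cW.
- by move=> x /andP[ax _]; apply: dW; [exact: v0|exact: le_lt_trans ax].
- move=> x xab; rewrite mulrC ler_wpM2l ?kq// deriv_step_fun_ge0//; lra.
Qed.

Let W_upper (a b k : R) : 0 <= a -> a <= b -> b <= 1 ->
  (forall y, a < y < b -> q.[y `^ v^-1] <= k) ->
  W p q v b - W p q v a <= k * (p.[b] - p.[a]).
Proof.
move=> a0 ab b1 kq; rewrite mulrBr.
apply: (@derive_le_increment _ _ (fun y => k * p.[y])
   (fun y => p^`().[y] * q.[y `^ v^-1]) (fun y => k * p^`().[y])) => //.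
- exact: cW.
- by move=> x; apply: cvgMr; exact: cP.
- by move=> x /andP[ax _]; apply: dW; [exact: v0|exact: le_lt_trans ax].
- move=> x xab; rewrite [leRHS]mulrC ler_wpM2l ?kq// deriv_step_fun_ge0//; lra.
Qed.

Let p1 : p.[1] = 1. Proof. by case: sp. Qed.
Let p0 : p.[0] = 0. Proof. by case: sp. Qed.
Let le01 : (0 : R) <= 1. Proof. by []. Qed.

Lemma kernel_sum_ge0 : 0 <= kernel_sum p q v.
Proof.
have : 0 * (p.[1] - p.[0]) <= W p q v 1 - W p q v 0.
  by apply: W_lower => // y /Q01/andP[].
by rewrite mul0r W0// subr0 W1.
Qed.

Lemma kernel_sum_le1 : kernel_sum p q v <= 1.
Proof.
have : W p q v 1 - W p q v 0 <= 1 * (p.[1] - p.[0]).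
  by apply: W_upper => // y /Q01/andP[].
by rewrite W0// W1 p1 p0 !subr0 mulr1.
Qed.

(** Above a, q(y^(1/v)) is at least 1 - kp and [p] rises by at least 1 - kp; below a the integrand
    is nonnegative. *)
Lemma kernel_sum_lower (a b kp : R) : 0 < a < 1 -> 0 <= b -> b <= a `^ v^-1 ->
  kp <= 1 -> p.[a] <= kp -> 1 - kp <= q.[b] -> (1 - kp) ^+ 2 <= kernel_sum p q v.
Proof.
move=> a01 b0 ba k1 pa qb; have /andP[a0 a1] := a01.
have [qm _ _] := sq.
have h1 : 0 * (p.[a] - p.[0]) <= W p q v a - W p q v 0.
  by apply: W_lower => //; [lra..|move=> y ya; have /andP[] // : 0 <= q.[y `^ v^-1] <= 1 by apply: Q01; lra].
have h2 : (1 - kp) * (p.[1] - p.[a]) <= W p q v 1 - W p q v a.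
  apply: W_lower => //; [lra..|move=> y ya].
  apply: le_trans qb _; apply: qm => //; last by have /andP[] // : 0 <= y `^ v^-1 <= 1 by apply: yv01; lra.
  by apply: le_trans ba _; apply: ge0_ler_powR; rewrite ?nnegrE ?invr_ge0 ?(ltW v0)//; lra.
rewrite -W1; rewrite W0// mul0r subr0 p1 in h1 h2 *.
have : (1 - kp) * (1 - kp) <= (1 - kp) * (1 - p.[a]) by rewrite ler_wpM2l//; lra.
rewrite expr2; lra.
Qed.

(** Below a the factor [q] is at most kp; above a, [p] rises by at most kp. *)
Lemma kernel_sum_upper (a b kp : R) : 0 < a < 1 -> b <= 1 -> a `^ v^-1 <= b ->
  0 <= kp -> 1 - kp <= p.[a] -> q.[b] <= kp -> kernel_sum p q v <= kp *+ 2.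
Proof.
move=> a01 b1 ab k0 pa qb; have /andP[a0 a1] := a01.
have [qm _ _] := sq.
have h1 : W p q v a - W p q v 0 <= kp * (p.[a] - p.[0]).
  apply: W_upper => //; [lra..|move=> y ya].
  apply: le_trans qb; apply: qm => //; first exact: powR_ge0.
  by apply: le_trans ab; apply: ge0_ler_powR; rewrite ?nnegrE ?invr_ge0 ?(ltW v0)//; lra.
have h2 : W p q v 1 - W p q v a <= 1 * (p.[1] - p.[a]).
  by apply: W_upper => //; [lra..|move=> y ya; have /andP[] // : 0 <= q.[y `^ v^-1] <= 1 by apply: Q01; lra].
rewrite -W1; rewrite W0// subr0 p1 p0 subr0 mul1r in h1 h2 *.
have /andP[_ pa1] : 0 <= p.[a] <= 1 by apply: (step_fun_itv sp); lra.
have : kp * p.[a] <= kp * 1 by rewrite ler_wpM2l.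
rewrite mulr2n; lra.
Qed.

End bounds.

End beta_kernel.

Section beta_ratio.
Variables (R : realType) (al : R).
Hypothesis al01 : 0 < al < 1.
Variable H : R -> R.
Hypothesis cH : {within `[0, 1], continuous H}.
Hypothesis dH : forall x : R, 0 < x < 1 -> is_derive x 1 H (beta_density al x).

Let I := H 1 - H 0.

(* The substitution x -> (1 - z) x / (1 - z x) turns the beta density into
   itself divided by 1 - z x, up to a constant. *)
Lemma moebius_primitive (z : R) : 0 <= z < 1 ->
  exists G : R -> R, [/\ {within `[0, 1], continuous G},
    (forall x : R, 0 < x < 1 -> is_derive x 1 G (beta_density al x * ((1 - z) / (1 - z * x)))) &
    G 1 - G 0 = (1 - z) `^ al * I].
Proof.
move=> /andP[z0 z1]; have z1' : 0 < 1 - z by lra.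
pose M (x : R) := (1 - z) * x / (1 - z * x).
have zx (x : R) : 0 <= x <= 1 -> 0 < 1 - z * x.
  move=> /andP[x0 x1]; rewrite subr_gt0 (le_lt_trans _ z1)// -[leRHS]mulr1 ler_wpM2l//.
have M01 (x : R) : 0 <= x <= 1 -> 0 <= M x <= 1.
  move=> x01; have := zx _ x01; case/andP: x01 => x0 x1 h.
  rewrite divr_ge0 ?mulr_ge0 ?(ltW h) ?(ltW z1')//= ler_pdivrMr// mul1r; nra.
exists (fun x => (1 - z) `^ al * H (M x)); split.
- have cM : {within `[0, 1], continuous M}.
    move=> x; apply: continuous_in_subspaceT => y; rewrite inE/= in_itv/= => y01.
    apply: cvgM; first by apply: cvgMr; exact: cvg_id.
    apply: cvgV; first by rewrite gt_eqF// zx.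
    by apply: cvgB; [exact: cvg_cst|apply: cvgMr; exact: cvg_id].
  have cHM : {within `[0, 1], continuous (H \o M)}.
    apply: (@continuous_within_comp R R R [set` `[(0:R), 1]%R] [set` `[(0:R), 1]%R] M H) => //.
  by move=> x; apply: cvgMr; exact: cHM.
- move=> x x01; have x01' : 0 <= x <= 1 by lra.
  have h0 := zx _ x01'; have h0' : 1 - z * x != 0 by rewrite gt_eqF.
  have x0 : 0 < x by lra.
  have Mx : 0 < M x < 1.
    rewrite divr_gt0 ?mulr_gt0//= ltr_pdivrMr// mul1r; nra.
  have dM : is_derive x 1 M ((1 - z) * (1 - z * x) ^- 2).
    have d1 := is_deriveB (is_derive_cst (1 : R) x 1) (is_deriveZ z (is_derive_id x (1 : R))).
    have d2 := @is_deriveV R (fun x : R => 1 - z * x) x _ _ h0' d1.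
    apply: is_derive_eq; rewrite /GRing.scale/=; by field.
  have d3 := @is_derive1_comp _ H M x _ _ (dH Mx) dM.
  rewrite (_ : (fun _ => _) = (1 - z) `^ al \*: (H \o M))//.
  apply: is_derive_eq; rewrite /GRing.scale/= /beta_density.
  have -> : 1 - M x = (1 - x) / (1 - z * x) by rewrite /M; field.
  have x1 : 0 < 1 - x by lra.
  rewrite /M !powRM ?invr_ge0 ?mulr_ge0 ?(ltW h0) ?(ltW x0) ?(ltW x1) ?(ltW z1')//.
  have e1 : (1 - z) `^ al * (1 - z) `^ (- al) = 1.
    by rewrite -powRD ?subrr ?powRr0// (gt_eqF z1') implybT.
  have e2 : (1 - z * x)^-1 `^ (- al) * (1 - z * x)^-1 `^ (al - 1) = 1 - z * x.
    rewrite -powRD; last by rewrite invr_eq0 (gt_eqF h0) implybT.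
    by rewrite addKr powR_inv1 ?invr_ge0 ?(ltW h0)// invrK.
  transitivity (((1 - z) `^ al * (1 - z) `^ (- al)) * ((1 - z * x)^-1 `^ (- al) * (1 - z * x)^-1 `^ (al - 1)) *
     (x `^ (- al) * (1 - x) `^ (al - 1) * ((1 - z) * (1 - z * x) ^- 2))); first by ring.
  by rewrite e1 e2; field.
- have -> : M 1 = 1 by rewrite /M !mulr1 divff// gt_eqF.
  have -> : M 0 = 0 by rewrite /M mulr0 mul0r.
  by rewrite -mulrBr.
Qed.

(** With z = i / (i + j), i (1 - x) / (i (1 - x) + j) = 1 - (1 - z) / (1 - z x), so the Moebius
    substitution evaluates its beta integral. This is where the power al of j / (i + j) becomes a
    beta integral. *)
Lemma kernel_primitive (i j : nat) : (0 < i)%N ->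
  exists G : R -> R, [/\ {within `[0, 1], continuous G},
    (forall x : R, 0 < x < 1 -> is_derive x 1 G
       (beta_density al x * (i%:R * (1 - x) / (i%:R * (1 - x) + j%:R)))) &
    G 1 - G 0 = (1 - j%:R `^ al / (i + j)%:R `^ al) * I].
Proof.
move=> i0; have /andP[a0 a1] := al01.
have i0' : (0 : R) < i%:R by rewrite ltr0n.
case: j => [|j].
  exists H; split => //.
    move=> x x01; have x1 : 1 - x != 0 by rewrite gt_eqF//; lra.
    have i1 : i%:R * (1 - x) != 0 by rewrite mulf_neq0// gt_eqF.
    by rewrite addr0 divff// mulr1; exact: dH.
  by rewrite powR0 ?gt_eqF// mul0r subr0 mul1r.
set J : R := j.+1%:R; have J0 : 0 < J by rewrite ltr0n.
have n0 : i%:R + J != 0 by rewrite gt_eqF// addr_gt0.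
have z01 : 0 <= i%:R / (i%:R + J) < 1.
  by rewrite divr_ge0 ?addr_ge0 ?(ltW i0') ?(ltW J0)//= ltr_pdivrMr ?addr_gt0// mul1r ltrDl.
have [G [cG dG G01]] := moebius_primitive z01.
exists (fun x => H x - G x); split.
- by move=> x; apply: cvgB; [exact: cH|exact: cG].
- move=> x x01; have ? := dH x01; have ? := dG _ x01.
  apply: is_derive_eq.
  have k0 : i%:R * (1 - x) + J != 0 by rewrite gt_eqF// ltr_wpDl// mulr_ge0//; lra.
  rewrite -[X in X - _]mulr1 -mulrBr; congr (_ * _).
  have JE : 1 + j%:R = J by rewrite addrC natr1.
  by field; rewrite JE k0 n0.
- have -> : H 1 - G 1 - (H 0 - G 0) = I - (G 1 - G 0) by rewrite /I; ring.
  rewrite G01 -[X in X - _]mul1r -mulrBl; congr ((_ - _) * _).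
  have -> : 1 - i%:R / (i%:R + J) = J / (i%:R + J) by field.
  rewrite powRM ?invr_ge0 ?addr_ge0 ?(ltW i0') ?(ltW J0)// natrD.
  congr (_ * _); rewrite -powR_inv1 ?addr_ge0 ?(ltW i0') ?(ltW J0)// -powRrM mulN1r.
  by rewrite powRN.
Qed.

(** For exact powers the ratio sum is, by linearity, the normalised beta integral of [kernel_sum] at
    v = 1 - x. The terms with i = 0 disappear since p(0) = 0. *)
Lemma ratio_sum_primitive (p q : {poly R}) : p.[0] = 0 ->
  exists G : R -> R, [/\ {within `[0, 1], continuous G},
    (forall x : R, 0 < x < 1 -> is_derive x 1 G (beta_density al x * kernel_sum p q (1 - x))) &
    G 1 - G 0 = ratio_sum (fun i => i%:R `^ al) p q * I].
Proof.
move=> p0.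
have /choice[G GP] : forall ij : nat * nat, exists G : R -> R, [/\ {within `[0, 1], continuous G},
    (forall x : R, 0 < x < 1 -> is_derive x 1 G (beta_density al x *
      (p`_ij.1 * q`_ij.2 * (ij.1%:R * (1 - x) / (ij.1%:R * (1 - x) + ij.2%:R))))) &
    G 1 - G 0 = p`_ij.1 * q`_ij.2 * (1 - ij.2%:R `^ al / (ij.1 + ij.2)%:R `^ al) * I].
  move=> [[|i] j] /=.
    rewrite -horner_coef0 p0; exists (fun=> 0); split.
    - by apply: continuous_subspaceT => x; exact: cvg_cst.
    - by move=> x _; rewrite !mul0r mulr0; exact: is_derive_cst.
    - by rewrite subrr !mul0r.
  have [G [cG dG G01]] := @kernel_primitive i.+1 j isT.
  exists (fun x => p`_i.+1 * q`_j * G x); split.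
  - by move=> x; apply: cvgMr; exact: cG.
  - move=> x x01; have ? := dG x x01.
    by apply: is_derive_eq; rewrite /GRing.scale/= mulrCA.
  - by rewrite -mulrBr G01 mulrA.
exists (fun x => \sum_(i < size p) \sum_(j < size q) G (nat_of_ord i, nat_of_ord j) x); split.
- by move=> x; apply: cvg_big_sum => i; apply: cvg_big_sum => j; have [cG _ _] := GP (nat_of_ord i, nat_of_ord j); exact: cG.
- move=> x x01; rewrite /kernel_sum mulr_sumr.
  apply: is_derive_big_sum => i; rewrite mulr_sumr; apply: is_derive_big_sum => j.
  by have [_ dG _] := GP (nat_of_ord i, nat_of_ord j); exact: dG.
- rewrite -sumrB /ratio_sum mulr_suml; apply: eq_bigr => i _.
  rewrite -sumrB mulr_suml; apply: eq_bigr => j _.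
  by have [_ _ /= ->] := GP (nat_of_ord i, nat_of_ord j).
Qed.

Lemma beta_density_ge0 (x : R) : 0 <= beta_density al x.
Proof. by rewrite mulr_ge0 ?powR_ge0. Qed.

Lemma beta_primitive_mono (a b : R) : 0 <= a -> a <= b -> b <= 1 -> 0 <= H b - H a.
Proof.
move=> a0 ab b1; rewrite -(subrr (0 : R)).
apply: (@derive_le_increment _ (fun=> 0) H (fun=> 0) (beta_density al)) => //.
- by apply: continuous_subspaceT => x; exact: cvg_cst.
- by apply: continuous_subspaceW cH => x /=; rewrite !in_itv/=; lra.
- by move=> x xab; apply: dH; lra.
- by move=> x _; exact: beta_density_ge0.
Qed.

Section threshold.
Variables (p q : {poly R}) (t u kp : R).
Hypotheses (sp : step_fun (horner p)) (sq : step_fun (horner q)).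
Hypotheses (t0 : 0 < t) (tu : t < u) (k01 : 0 <= kp <= 1).

(** At v = 1 - x the kernel switches where t / (1 - x) = u: it is near 1 for x below this point and
    near 0 above. *)
Let x0 := 1 - t / u.
Let u0 : 0 < u. Proof. exact: lt_trans tu. Qed.
Let x01 : 0 < x0 < 1.
Proof. by rewrite /x0 subr_gt0 ltr_pdivrMr// mul1r tu/= gtrBl divr_gt0. Qed.

Let a01 : 0 < expR (- t) < 1.
Proof. by rewrite expR_gt0/= -expR0 ltr_expR oppr_lt0. Qed.

Let threshold (x : R) : x < 1 -> (expR (- t) `^ (1 - x)^-1 <= expR (- u)) = (x0 <= x).
Proof.
move=> x1; have v0 : 0 < 1 - x by lra.
rewrite -expRM ler_expR mulNr lerN2 ler_pdivlMr// mulrC -ler_pdivlMr//.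
by rewrite /x0; apply/idP/idP; lra.
Qed.

Let v01 (x : R) : 0 < x < 1 -> 0 < 1 - x < 1. Proof. by lra. Qed.

Let sub_itv (a b : R) : 0 <= a -> b <= 1 -> `[a, b]%classic `<=` `[0, 1]%classic.
Proof. by move=> a0 b1 x /=; rewrite !in_itv/=; lra. Qed.

Lemma ratio_sum_powR_ge : p.[expR (- t)] <= kp -> 1 - kp <= q.[expR (- u)] ->
  (1 - kp) ^+ 2 * (H x0 - H 0) <= ratio_sum (fun i => i%:R `^ al) p q * I.
Proof.
move=> pa qb; have p0 : p.[0] = 0 by case: sp.
have [G [cG dG <-]] := ratio_sum_primitive q p0.
have G1 : (1 - kp) ^+ 2 * H x0 - (1 - kp) ^+ 2 * H 0 <= G x0 - G 0.
  apply: (@derive_le_increment _ (fun x => (1 - kp) ^+ 2 * H x) G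
    (fun x => (1 - kp) ^+ 2 * beta_density al x) (fun x => beta_density al x * kernel_sum p q (1 - x))).
  - by have := x01; lra.
  - move=> x; apply: cvgMr; move: x; apply: continuous_subspaceW cH; apply: sub_itv; have := x01; lra.
  - by apply: continuous_subspaceW cG; apply: sub_itv; have := x01; lra.
  - move=> x xx; have ? : is_derive x 1 H (beta_density al x) by apply: dH; have := x01; lra.
    exact: is_derive_scale.
  - by move=> x xx; apply: dG; have := x01; lra.
  - move=> x xx; rewrite mulrC ler_wpM2l ?beta_density_ge0//.
    apply: (@kernel_sum_lower _ p q _ _ _ _ (expR (- t)) (expR (- u))) => //; [have := x01; lra| |have := k01; lra].
    by apply/ltW; rewrite ltNge threshold; have := x01; lra.
have G2 : 0 - 0 <= G 1 - G x0.
  apply: (@derive_le_increment _ (fun=> 0) G (fun=> 0) (fun x => beta_density al x * kernel_sum p q (1 - x))).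
  - by have := x01; lra.
  - by apply: continuous_subspaceT => x; exact: cvg_cst.
  - by apply: continuous_subspaceW cG; apply: sub_itv; have := x01; lra.
  - by move=> x xx; apply: dG; have := x01; lra.
  - by move=> x xx; rewrite mulr_ge0 ?beta_density_ge0// kernel_sum_ge0//; have := x01; lra.
lra.
Qed.

Lemma ratio_sum_powR_le : 1 - kp <= p.[expR (- t)] -> q.[expR (- u)] <= kp ->
  ratio_sum (fun i => i%:R `^ al) p q * I <= H x0 - H 0 + kp *+ 2 * I.
Proof.
move=> pa qb; have p0 : p.[0] = 0 by case: sp.
have [G [cG dG <-]] := ratio_sum_primitive q p0.
have G1 : G x0 - G 0 <= H x0 - H 0.
  apply: (@derive_le_increment _ G H (fun x => beta_density al x * kernel_sum p q (1 - x)) (beta_density al)).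
  - by have := x01; lra.
  - by apply: continuous_subspaceW cG; apply: sub_itv; have := x01; lra.
  - by apply: continuous_subspaceW cH; apply: sub_itv; have := x01; lra.
  - by move=> x xx; apply: dG; have := x01; lra.
  - by move=> x xx; apply: dH; have := x01; lra.
  - move=> x xx; rewrite -[leRHS]mulr1 ler_wpM2l ?beta_density_ge0// kernel_sum_le1//; have := x01; lra.
have G2 : G 1 - G x0 <= kp *+ 2 * H 1 - kp *+ 2 * H x0.
  apply: (@derive_le_increment _ G (fun x => kp *+ 2 * H x) (fun x => beta_density al x * kernel_sum p q (1 - x))
    (fun x => kp *+ 2 * beta_density al x)).
  - by have := x01; lra.
  - by apply: continuous_subspaceW cG; apply: sub_itv; have := x01; lra.
  - move=> x; apply: cvgMr; move: x; apply: continuous_subspaceW cH; apply: sub_itv; have := x01; lra.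
  - by move=> x xx; apply: dG; have := x01; lra.
  - move=> x xx; have ? : is_derive x 1 H (beta_density al x) by apply: dH; have := x01; lra.
    exact: is_derive_scale.
  - move=> x xx; rewrite [leRHS]mulrC ler_wpM2l ?beta_density_ge0//.
    apply: (@kernel_sum_upper _ p q _ _ _ _ (expR (- t)) (expR (- u))) => //; [have := x01; lra|by rewrite -expR0 ler_expR; have := u0; lra| |have := k01; lra].
    by rewrite threshold; have := x01; lra.
have G3 : 0 <= kp *+ 2 * (H x0 - H 0) by rewrite mulr_ge0 ?mulrn_wge0 ?beta_primitive_mono//; have := k01; have := x01; lra.
rewrite /I; lra.
Qed.

End threshold.

End beta_ratio.

(** * Integrals of densities singular at the endpoints *)

Section improper_primitive.
Variable R : realType.
Notation mu := (@lebesgue_measure R).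

Lemma is_derive_derivable_oo_LRcontinuous (F f : R -> R) (a b : R) : a < b ->
  {within `[a, b], continuous F} ->
  (forall x : R, a < x < b -> is_derive x 1 F (f x)) ->
  derivable_oo_LRcontinuous F a b.
Proof.
move=> ab /(continuous_within_itvP _ ab)[_ Fa Fb] dF; split => // x.
by rewrite in_itv/= => /dF[].
Qed.

(** f may be unbounded at both ends: the fundamental theorem is applied on compact subintervals, and
    the limit is taken by monotone convergence for the integrals and by continuity of F for the
    increments. *)
Lemma ge0_integral_primitive (F f : R -> R) (a b : R) : a < b ->
  (forall x : R, a < x < b -> 0 <= f x) ->
  {in `]a, b[, continuous f} ->
  measurable_fun setT f ->
  {within `[a, b], continuous F} ->
  (forall x : R, a < x < b -> is_derive x 1 F (f x)) ->
  (\int[mu]_(x in `[a, b]) (f x)%:E = (F b - F a)%:E)%E.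
Proof.
move=> ab f0 cf mf cF dF.
have mfE (A : set R) : measurable A -> measurable_fun A (EFin \o f).
  by move=> mA; apply: measurable_funS (measurableT) _ _ => //; exact/measurable_EFinP.
rewrite -integral_itv_bndo_bndc; last exact: mfE.
rewrite -integral_itv_obnd_cbnd; last exact: mfE.
(* The shift to n + 2 keeps the subintervals nondegenerate from n = 0 on. *)
pose e (n : nat) : R := (b - a) / 2 * n.+2%:R^-1.
have e0 n : 0 < e n by rewrite mulr_gt0 ?divr_gt0 ?subr_gt0 ?invr_gt0 ?ltr0n.
have e1 n : a + e n < b - e n.
  have n2 : n.+2%:R^-1 <= 2^-1 :> R by rewrite lef_pV2 ?posrE ?ltr0n// ler_nat.
  have : e n <= (b - a) / 2 * 2^-1 by rewrite ler_wpM2l// divr_ge0// subr_ge0 ltW.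
  lra.
have ec : e n @[n --> \oo] --> (0 : R).
  rewrite -(mulr0 ((b - a) / 2)); apply: cvgMr.
  have := @cvg_harmonic R; rewrite -cvg_shiftS.
  exact.
pose A (n : nat) : set R := `[a + e n, b - e n]%classic.
have eA m n : (m <= n)%N -> e n <= e m.
  move=> mn; rewrite ler_wpM2l ?divr_ge0 ?subr_ge0 ?(ltW ab)//.
  by rewrite lef_pV2 ?posrE ?ltr0n// ler_nat.
have ndA : nondecreasing_seq A.
  move=> m n /eA mn; apply/subsetPset => x; rewrite /A/= !in_itv/= => /andP[? ?].
  by apply/andP; split; lra.
have UA : \bigcup_n A n = `]a, b[%classic.
  apply/seteqP; split => x /=.
    move=> [n _]; rewrite /A/= !in_itv/= => /andP[? ?]; have := e0 n => ?.
    by apply/andP; split; lra.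
  rewrite in_itv/= => /andP[ax xb].
  have m0 : 0 < Num.min (x - a) (b - x) by rewrite lt_min !subr_gt0 ax.
  move/cvgr0_norm_lt : ec => /(_ _ m0)[n _ /(_ n (leqnn n))].
  rewrite ger0_norm ?(ltW (e0 n))// lt_min => /andP[? ?].
  exists n => //; rewrite /A/= in_itv/=; apply/andP; split; lra.
rewrite -UA.
have subA n x : A n x -> a < x < b.
  rewrite /A/= in_itv/= => /andP[? ?]; have := e0 n => ?.
  by apply/andP; split; lra.
have cvI : (\int[mu]_(x in A n) (EFin \o f) x)%E @[n --> \oo] -->
    (\int[mu]_(x in \bigcup_n A n) (EFin \o f) x)%E.
  apply: ge0_nondecreasing_set_cvg_integral => //.
  - by move=> n; exact: measurable_itv.
  - by move=> n; apply: mfE; exact: measurable_itv.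
  - by move=> n x /subA /f0; rewrite lee_fin.
have IA n : (\int[mu]_(x in A n) (f x)%:E = (F (b - e n) - F (a + e n))%:E)%E.
  have en := e0 n.
  rewrite EFinB; apply: continuous_FTC2 => //.
  - move=> x; apply: continuous_in_subspaceT => y; rewrite inE/= => yA.
    by apply: cf; rewrite in_itv/=; exact: subA yA.
  - apply: (@is_derive_derivable_oo_LRcontinuous _ f) => //.
      by apply: continuous_subspaceW cF => x /=; rewrite !in_itv/= => /andP[? ?]; apply/andP; split; lra.
    by move=> x /andP[? ?]; apply: dF; apply/andP; split; lra.
  - move=> x; rewrite in_itv/= => /andP[? ?]; rewrite derive1E.
    by have [|_ ->] := dF x _; first by apply/andP; split; lra.
apply: (cvg_unique _ cvI) => //=.
under eq_fun do rewrite IA.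
apply: cvg_EFin; first exact: nearW.
move/(continuous_within_itvP _ ab) : cF => [_ /cvg_at_rightP Fa /cvg_at_leftP Fb].
apply: cvgB.
- apply: Fb; split => [n|]; first by rewrite gtrBl.
  by rewrite -[X in _ --> X]subr0; apply: cvgB => //; exact: cvg_cst.
- apply: Fa; split => [n|]; first by rewrite ltrDl.
  by rewrite -[X in _ --> X]addr0; apply: cvgD => //; exact: cvg_cst.
Qed.

End improper_primitive.

Section beta_integral.
Variables (R : realType) (al : R).
Hypothesis al01 : 0 < al < 1.
Notation mu := (@lebesgue_measure R).
Let a0 : 0 < al. Proof. by case/andP: al01. Qed.
Let a1 : al < 1. Proof. by case/andP: al01. Qed.

Lemma measurable_beta_density : measurable_fun setT (beta_density al).
Proof.
apply: measurable_funM; first exact: measurable_powR.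
apply: (measurableT_comp (measurable_powR _)).
by apply: measurable_funB => //; exact: measurable_cst.
Qed.

Lemma continuous_beta_density : {in `]0, 1[, continuous (beta_density al)}.
Proof.
move=> x; rewrite in_itv/= => /andP[x0 x1].
have c (p y : R) : 0 < y -> {for y, continuous (fun x : R => x `^ p)}.
  move=> y0; apply/differentiable_continuous/derivable1_diffP.
  by have [] := is_derive1_powR p y0.
apply: cvgM; first exact: c.
have cB : (1 - y) @[y --> x] --> 1 - x by apply: cvgB; [exact: cvg_cst|exact: cvg_id].
by apply: (@cvg_comp _ _ _ (fun y : R => 1 - y) (fun y : R => y `^ (al - 1)) _ (nbhs (1 - x)) _ cB);
  apply: c; lra.
Qed.

(** One of x and 1 - x is at least 1/2, and its power is then at most 2; the sum of the two
    remaining singular powers has an explicit primitive. *)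
Let bound (x : R) : R := 2 * x `^ (- al) + 2 * (1 - x) `^ (al - 1).

Let beta_density_bound (x : R) : 0 <= x <= 1 -> beta_density al x <= bound x.
Proof.
move=> /andP[x0 x1]; rewrite /beta_density /bound.
have P0 : 0 <= x `^ (- al) by exact: powR_ge0.
have P1 : 0 <= (1 - x) `^ (al - 1) by exact: powR_ge0.
have half (y p : R) : 2^-1 <= y -> -1 <= p -> p <= 0 -> y `^ p <= 2.
  move=> y2 p1 p0; rewrite -[p]opprK powRN -[leRHS]invrK.
  have y0 : 0 < y by lra.
  rewrite lef_pV2 ?posrE ?powR_gt0//.
  have [y1|y1] := leP y 1.
    apply: le_trans y2 _; rewrite -[leLHS]powRr1 ?(ltW y0)//.
    by apply: ger_powR; [rewrite y0|lra].
  apply: (@le_trans _ _ 1); first by lra.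
  by rewrite -[leLHS](congr1 (@^~ (- p)) (powR1 R)) ge0_ler_powR ?nnegrE//; lra.
have [xh|xh] := leP 2^-1 x.
  have h : x `^ (- al) <= 2 by have := a0; have := a1 => ? ?; apply: half; lra.
  have : x `^ (- al) * (1 - x) `^ (al - 1) <= 2 * (1 - x) `^ (al - 1) by rewrite ler_wpM2r.
  lra.
have h : (1 - x) `^ (al - 1) <= 2 by have := a0; have := a1 => ? ?; apply: half; lra.
have : x `^ (- al) * (1 - x) `^ (al - 1) <= x `^ (- al) * 2 by rewrite ler_wpM2l.
lra.
Qed.

Lemma beta_density_integrable : mu.-integrable `[0, 1] (EFin \o beta_density al).
Proof.
pose B (x : R) := 2 / (1 - al) * x `^ (1 - al) - 2 / al * (1 - x) `^ al.
have mb : measurable_fun setT bound.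
  have m1 : measurable_fun setT (fun x : R => x `^ (- al)) by exact: measurable_powR.
  have m2 : measurable_fun setT (fun x : R => (1 - x) `^ (al - 1)).
    apply: (measurableT_comp (measurable_powR _)).
    by apply: measurable_funB => //; exact: measurable_cst.
  by apply: measurable_funD; apply: measurable_funM => //; exact: measurable_cst.
have b0 (x : R) : 0 <= bound x by rewrite addr_ge0// mulr_ge0// powR_ge0.
have cb : {in `]0, 1[, continuous bound}.
  move=> x; rewrite in_itv/= => /andP[x0 x1].
  have c (p y : R) : 0 < y -> {for y, continuous (fun x : R => x `^ p)}.
    move=> y0; apply/differentiable_continuous/derivable1_diffP.
    by have [] := is_derive1_powR p y0.
  apply: cvgD; apply: cvgMr; first exact: c.
  have cB : (1 - y) @[y --> x] --> 1 - x by apply: cvgB; [exact: cvg_cst|exact: cvg_id].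
  by apply: (@cvg_comp _ _ _ (fun y : R => 1 - y) (fun y : R => y `^ (al - 1)) _ (nbhs (1 - x)) _ cB);
    apply: c; lra.
have cB : {within `[0, 1], continuous B}.
  move=> x; apply: cvgB; apply: cvgMr; move: x.
    apply: (@continuous_within_powR _ (fun y : R => y)).
    - by rewrite subr_gt0.
    - by move=> x /andP[].
    - by apply: continuous_subspaceT => x; exact: cvg_id.
  apply: (@continuous_within_powR _ (fun y : R => 1 - y)).
  - exact: a0.
  - by move=> x /andP[]; lra.
  - by apply: continuous_subspaceT => x; apply: cvgB; [exact: cvg_cst|exact: cvg_id].
have dB (x : R) : 0 < x < 1 -> is_derive x 1 B (bound x).
  move=> /andP[x0 x1]; have x1' : 0 < 1 - x by lra.
  have d1 := is_derive_scale (2 / (1 - al)) (is_derive1_powR (1 - al) x0).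
  have d2 := is_deriveB (is_derive_cst (1 : R) x 1) (is_derive_id x (1 : R)).
  have d3 := @is_derive1_comp _ (fun y : R => y `^ al) (fun y : R => 1 - y) x _ _ (is_derive1_powR al x1') d2.
  have d4 := is_derive_scale (2 / al) d3.
  apply: (is_derive_eq (is_deriveB d1 d4)).
  rewrite /bound sub0r mulrN1 mulrN opprK.
  have -> : 1 - al - 1 = - al by ring.
  by rewrite !mulrA !mulfVK// ?subr_eq0 ?gt_eqF.
have Ib := ge0_integral_primitive ltr01 (fun x _ => b0 x) cb mb cB dB.
apply/integrableP; split.
  by apply: measurable_funS (measurableT) _ _ => //; apply/measurable_EFinP; exact: measurable_beta_density.
apply: (@le_lt_trans _ _ (\int[mu]_(x in `[0%R, 1%R]) (bound x)%:E)%E); last by rewrite Ib ltry.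
apply: ge0_le_integral => //.
- apply: measurable_funS (measurableT) _ _ => //; apply: measurableT_comp => //.
  by apply/measurable_EFinP; exact: measurable_beta_density.
- by apply: measurable_funS (measurableT) _ _ => //; exact/measurable_EFinP.
- move=> x /=; rewrite in_itv/= => x01.
  by rewrite ger0_norm ?beta_density_ge0// lee_fin beta_density_bound.
Qed.

Lemma beta_primitive_exists : exists H : R -> R,
  {within `[0, 1], continuous H} /\
  (forall x : R, 0 < x < 1 -> is_derive x 1 H (beta_density al x)).
Proof.
exists (fun x => parameterized_integral mu 0 x (beta_density al)); split.
  exact: parameterized_integral_continuous beta_density_integrable.
move=> x /andP[x0 x1].
have [] := continuous_FTC1_closed x1 beta_density_integrable x0.
  by apply: continuous_beta_density; rewrite in_itv/= x0.
by move=> d e; apply: (DeriveDef d); rewrite -derive1E.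
Qed.

(** The reflection formula identifies sin(pi al) / pi with 1 / (H 1 - H 0), so [Pihat] is the upper
    tail of the normalised beta law. *)
Lemma PihatE (H : R -> R) (t s : R) : {within `[0, 1], continuous H} ->
  (forall x : R, 0 < x < 1 -> is_derive x 1 H (beta_density al x)) ->
  0 < t -> 0 < s -> Pihat al t s = (H 1 - H (s / (t + s))) / (H 1 - H 0).
Proof.
move=> cH dH t0 s0; rewrite (beta_reflection al01 cH dH) invf_div mulrC /Pihat; congr (_ * _).
have ts0 : 0 < t + s by rewrite addr_gt0.
have x0 : 0 < s / (t + s) by rewrite divr_gt0.
have x1 : s / (t + s) < 1 by rewrite ltr_pdivrMr// mul1r ltrDr.
rewrite /Rintegral.
have -> : [set theta | s / (t + s) <= theta <= 1] = `[s / (t + s), 1]%classic.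
  by apply/seteqP; split => x /=; rewrite in_itv.
have -> : (\int[mu]_(x in `[(s / (t + s))%R, 1%R]) ((x `^ (- al) * (1 - x) `^ (al - 1))%R)%:E = (H 1 - H (s / (t + s)))%:E)%E; last by [].
apply: (@ge0_integral_primitive _ H (beta_density al)) => //.
- by move=> x _; exact: beta_density_ge0.
- move=> x; rewrite in_itv/= => /andP[? ?]; apply: continuous_beta_density.
  by rewrite in_itv/=; apply/andP; split; lra.
- exact: measurable_beta_density.
- by apply: continuous_subspaceW cH => x /=; rewrite !in_itv/= => /andP[? ?]; apply/andP; split; lra.
- by move=> x /andP[? ?]; apply: dH; apply/andP; split; lra.
Qed.

End beta_integral.

Section ratio_limit.
Variables (R : realType) (al : R).
Hypothesis al01 : 0 < al < 1.

Lemma ratio_sum_cvg (S : Type) (F : set_system S) {FF : Filter F}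
    (L : S -> nat -> R) (p q : {poly R}) : p.[0] = 0 ->
  (forall i j, (0 < i)%N ->
    L e j / L e (i + j)%N @[e --> F] --> j%:R `^ al / (i + j)%:R `^ al) ->
  ratio_sum (L e) p q @[e --> F] --> ratio_sum (fun i => i%:R `^ al) p q.
Proof.
move=> p0 Lc; apply: cvg_big_sum => i; apply: cvg_big_sum => j.
case: (nat_of_ord i) => [|k].
  rewrite -horner_coef0 p0; under eq_fun do rewrite !mul0r.
  by rewrite !mul0r; exact: cvg_cst.
by apply: cvgMr; apply: cvgB; [exact: cvg_cst|exact: Lc].
Qed.

(* h e stands for the probability that the clock, rescaled by e, enters
   ]t, t + s]. *)
Lemma hit_probability_cvg (S : Type) (F : set_system S) (FF : ProperFilter F)
    (h : S -> R) (L : S -> nat -> R) (t s : R) : 0 < t -> 0 < s ->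
  (forall i j, (0 < i)%N ->
    L e j / L e (i + j)%N @[e --> F] --> j%:R `^ al / (i + j)%:R `^ al) ->
  (\forall e \near F, 0 <= h e <= 1) ->
  (\forall e \near F, forall (p q : {poly R}) (kp : R),
    step_fun (horner p) -> step_fun (horner q) -> 0 <= kp <= 1 ->
    p.[expR (- t)] <= kp -> 1 - kp <= q.[expR (- (t + s))] ->
    (1 - kp) ^+ 2 * h e <= ratio_sum (L e) p q) ->
  (\forall e \near F, forall (p q : {poly R}) (kp : R),
    step_fun (horner p) -> step_fun (horner q) -> 0 <= kp <= 1 ->
    1 - kp <= p.[expR (- t)] -> q.[expR (- (t + s))] <= kp ->
    ratio_sum (L e) p q <= h e + kp *+ 2) ->
  h e @[e --> F] --> 1 - Pihat al t s.
Proof.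
move=> t0 s0 Lc h01 hlow hup.
have [H [cH dH]] := beta_primitive_exists al01.
set u := t + s; have u0 : 0 < u by rewrite addr_gt0.
have I0 : 0 < H 1 - H 0.
  by rewrite (beta_reflection al01 cH dH) divr_gt0 ?pi_gt0// sinpi_gt0.
(* Limiting hit probability for the levels t + x and u - x. Polynomials need two distinct points to
   change value, so the interval is shrunk (x > 0) or enlarged (x < 0), and continuity of [D] at 0
   absorbs the change. *)
pose D (x : R) := (H (1 - (t + x) / (u - x)) - H 0) / (H 1 - H 0).
have -> : 1 - Pihat al t s = D 0.
  rewrite (PihatE al01 cH dH)// /D addr0 subr0 -/u.
  have -> : 1 - t / u = s / u by rewrite /u; field; rewrite gt_eqF.
  by field; rewrite gt_eqF.
have x01 : 0 < 1 - t / u < 1.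
  by rewrite subr_gt0 ltr_pdivrMr// mul1r ltrDl s0/= gtrBl divr_gt0.
have cD : D x @[x --> 0] --> D 0.
  apply: cvgM; last exact: cvg_cst.
  apply: cvgB; last exact: cvg_cst.
  have c1 : 1 - (t + x) / (u - x) @[x --> 0] --> 1 - (t + 0) / (u - 0).
    apply: cvgB; first exact: cvg_cst.
    apply: cvgM; first by apply: cvgD; [exact: cvg_cst|exact: cvg_id].
    apply: cvgV; first by rewrite subr0 gt_eqF.
    by apply: cvgB; [exact: cvg_cst|exact: cvg_id].
  apply: (@cvg_comp _ _ _ (fun x : R => 1 - (t + x) / (u - x)) H _ (nbhs (1 - (t + 0) / (u - 0))) _ c1).
  rewrite addr0 subr0; have [dx _] := dH _ x01.
  have cHx : {for 1 - t / u, continuous H} by exact/differentiable_continuous/derivable1_diffP.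
  exact: cHx.
have DI (x : R) : 0 < t + x -> t + x < u - x -> 0 <= D x <= 1.
  move=> tx txu; have ux : 0 < u - x by lra.
  have q0 : 0 < (t + x) / (u - x) by rewrite divr_gt0.
  have q1 : (t + x) / (u - x) < 1 by rewrite ltr_pdivrMr// mul1r.
  rewrite /D ler_pdivrMr// mul1r divr_ge0 ?(ltW I0)//=; last first.
    by apply: (beta_primitive_mono cH dH); lra.
  suff : 0 <= H 1 - H (1 - (t + x) / (u - x)) by lra.
  by apply: (beta_primitive_mono cH dH); lra.
apply/cvgrPdist_lt => e e0.
pose kp := Num.min (e / 16) 2^-1.
have k0 : 0 < kp by rewrite lt_min divr_gt0//= invr_gt0.
have k1 : kp <= 2^-1 by rewrite ge_min lexx orbT.
have k2 : kp <= e / 16 by rewrite ge_min lexx.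
have [x [x0 xt xs xp xm]] : exists x : R,
    [/\ 0 < x, x < t, x + x < s, `|D 0 - D x| < e / 4 & `|D 0 - D (- x)| < e / 4].
  have e4 : 0 < e / 4 by rewrite divr_gt0.
  move/cvgrPdist_lt : cD => /(_ _ e4)[r /= r0 rD].
  pose x := Num.min (r / 2) (Num.min (t / 2) (s / 4)).
  have x0 : 0 < x by rewrite !lt_min !divr_gt0.
  have xr : x <= r / 2 by rewrite ge_min lexx.
  have xt : x <= t / 2 by rewrite !ge_min lexx orbT.
  have xs : x <= s / 4 by rewrite !ge_min lexx !orbT.
  exists x; split => //; [lra|lra|apply: rD => /=..].
    by rewrite sub0r normrN ger0_norm ?(ltW x0)//; lra.
  by rewrite sub0r opprK ger0_norm ?(ltW x0)//; lra.
have Dx : 0 <= D x <= 1 by apply: DI; rewrite /u; lra.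
have Dmx : 0 <= D (- x) <= 1 by apply: DI; rewrite /u; lra.
have E0 (y : R) : 0 < expR y :> R by exact: expR_gt0.
have E1 (y : R) : 0 < y -> expR (- y) <= 1 by move=> y0; rewrite -expR0 ler_expR; lra.
(* [p1], [q1] bound h from below through the shrunk interval, [p2], [q2] from above through the
   enlarged one. *)
have [p1 [sp1 p1l p1u]] : exists p : {poly R}, [/\ step_fun (horner p),
    p.[expR (- (t + x))] <= kp & 1 - kp <= p.[expR (- t)]].
  by apply: step_poly_exists => //; [rewrite ltr_expR; lra|exact: E1].
have [q1 [sq1 q1l q1u]] : exists p : {poly R}, [/\ step_fun (horner p),
    p.[expR (- u)] <= kp & 1 - kp <= p.[expR (- (u - x))]].
  by apply: step_poly_exists => //; [rewrite ltr_expR; lra|apply: E1; rewrite /u; lra].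
have [p2 [sp2 p2l p2u]] : exists p : {poly R}, [/\ step_fun (horner p),
    p.[expR (- t)] <= kp & 1 - kp <= p.[expR (- (t - x))]].
  by apply: step_poly_exists => //; [rewrite ltr_expR; lra|apply: E1; lra].
have [q2 [sq2 q2l q2u]] : exists p : {poly R}, [/\ step_fun (horner p),
    p.[expR (- (u + x))] <= kp & 1 - kp <= p.[expR (- u)]].
  by apply: step_poly_exists => //; [rewrite ltr_expR; lra|exact: E1].
pose Q p q := ratio_sum (fun i => i%:R `^ al) p q.
have Q1 : (1 - kp) ^+ 2 * D x <= Q p1 q1.
  rewrite mulrA ler_pdivrMr//.
  have := @ratio_sum_powR_ge _ _ al01 _ cH dH p1 q1 (t + x) (u - x) kp sp1 sq1.
  apply => //; rewrite /u; lra.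
have Q2 : Q p2 q2 <= D (- x) + kp *+ 2.
  rewrite -(ler_pM2r I0) mulrDl divfK ?gt_eqF//.
  have := @ratio_sum_powR_le _ _ al01 _ cH dH p2 q2 (t - x) (u + x) kp sp2 sq2.
  rewrite opprK; apply => //; rewrite /u; lra.
have e8 : 0 < e / 8 by rewrite divr_gt0.
have p10 : p1.[0] = 0 by case: sp1.
have p20 : p2.[0] = 0 by case: sp2.
have c1 : ratio_sum (L e) p1 q1 @[e --> F] --> Q p1 q1 by exact: ratio_sum_cvg.
have c2 : ratio_sum (L e) p2 q2 @[e --> F] --> Q p2 q2 by exact: ratio_sum_cvg.
move/cvgrPdist_lt : c1 => /(_ _ e8) c1; move/cvgrPdist_lt : c2 => /(_ _ e8) c2.
near=> z.
have hz : 0 <= h z <= 1 by near: z.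
have z1 : `|Q p1 q1 - ratio_sum (L z) p1 q1| < e / 8 by near: z.
have z2 : `|Q p2 q2 - ratio_sum (L z) p2 q2| < e / 8 by near: z.
have k01 : 0 <= kp <= 1 by lra.
have l1 : (1 - kp) ^+ 2 * h z <= ratio_sum (L z) p2 q2.
  by have hz' := near hlow z; apply: hz'.
have l2 : ratio_sum (L z) p1 q1 <= h z + kp *+ 2.
  by have hz' := near hup z; apply: hz'.
have sq (y : R) : 0 <= y <= 1 -> y - kp *+ 2 <= (1 - kp) ^+ 2 * y.
  move=> /andP[y0 y1].
  have -> : (1 - kp) ^+ 2 * y = y - kp * y *+ 2 + kp ^+ 2 * y by ring.
  have : kp * y <= kp * 1 by rewrite ler_wpM2l// ltW.
  have : 0 <= kp ^+ 2 * y by rewrite mulr_ge0// exprn_ge0// ltW.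
  rewrite !mulr2n; lra.
have s1 := sq _ Dx; have s2 := sq _ hz.
move: z1 z2 xp xm; rewrite !ltr_norml => /andP[? ?] /andP[? ?] /andP[? ?] /andP[? ?].
rewrite mulr2n in l2 Q2 s1 s2; apply/andP; split; lra.
Unshelve. all: by end_near. Qed.

End ratio_limit.

(** * Regular variation of the Laplace exponent *)

Section level_sums.
Variable R : realType.
Notation mu := (@lebesgue_measure R).
Implicit Types (f : nat -> R).

Lemma nneseries_cvgn f : (forall k, 0 <= f k) ->
  (\sum_(k <oo) (f k)%:E < +oo)%E -> cvgn (series f).
Proof.
move=> f0 fy; have s0 : (0 <= \sum_(k <oo) (f k)%:E)%E.
  by apply: nneseries_ge0 => k _ _; rewrite lee_fin.
apply: nondecreasing_is_cvgn.
  by apply/nondecreasing_seqP => n; rewrite /series/= big_nat_recr//= lerDl.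
exists (fine (\sum_(k <oo) (f k)%:E)) => _ [n _ <-].
rewrite -lee_fin fineK; last by rewrite ge0_fin_numE.
rewrite /series/= -sumEFin; apply: nneseries_lim_ge => k _ _.
by rewrite lee_fin.
Qed.

Lemma nneseries_limn f : (forall k, 0 <= f k) -> cvgn (series f) ->
  (\sum_(k <oo) (f k)%:E)%E = (limn (series f))%:E.
Proof.
move=> f0 cf; rewrite -EFin_lim//; apply/congr_lim/funext => n /=.
by rewrite sumEFin.
Qed.

Definition exceed f (y : R) : \bar R := (\sum_(k <oo) ((y < f k)%R%:R)%:E)%E.

Lemma exceed_ge0 f y : (0 <= exceed f y)%E.
Proof. by apply: nneseries_ge0 => k _ _; rewrite lee_fin. Qed.

Lemma measurable_exceed f : measurable_fun setT (exceed f).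
Proof.
apply: ge0_emeasurable_sum => [k y _ _|k _]; first by rewrite lee_fin.
apply/measurable_EFinP.
have -> : (fun y => (y < f k)%R%:R : R) = \1_(`]-oo, f k[%classic : set R).
  by apply/funext => y; rewrite indicE mem_setE in_itv.
by apply: measurable_indic; exact: measurable_itv.
Qed.

Lemma series_layer_cake f : (forall k, 0 <= f k) ->
  (\sum_(k <oo) (f k)%:E = \int[mu]_(y in `]0%R, +oo[) exceed f y)%E.
Proof.
move=> f0; rewrite integral_nneseries//=; last first.
- move=> k; apply/measurable_EFinP.
  have -> : (fun y => (y < f k)%R%:R : R) = \1_(`]-oo, f k[%classic : set R).
    by apply/funext => y; rewrite indicE mem_setE in_itv.
  by apply: measurable_funS (measurableT) _ _ => //; apply: measurable_indic; exact: measurable_itv.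
apply: eq_eseriesr => k _.
under eq_integral => y _.
  have -> : (y < f k)%R%:R = \1_(`]-oo, f k[%classic : set R) y :> R.
    by rewrite indicE mem_setE in_itv.
  over.
rewrite integral_indic//.
rewrite (_ : _ `&` _ = `]0, f k[%classic); last first.
  by apply/seteqP; split => y /=; rewrite !in_itv/= ?andbT; [case=> -> ->|case/andP=> -> ->].
transitivity (lebesgue_measure (`]0, f k[%classic : set R)) => //.
rewrite lebesgue_measure_itv/= lte_fin; case: ifPn; first by rewrite sube0.
by rewrite -leNgt => fk; congr EFin; apply/eqP; rewrite eq_le fk f0.
Qed.

(** By the layer cake formula a sum is the integral of its counting function, so counts are compared
    level by level instead of terms index by index. *)
Lemma series_exceed_le f (f' : nat -> R) (K : R) :
  (forall k, 0 <= f k) -> (forall k, 0 <= f' k) -> 0 <= K ->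
  (forall y : R, 0 < y -> (exceed f y <= K%:E * exceed f' y)%E) ->
  (\sum_(k <oo) (f k)%:E <= K%:E * \sum_(k <oo) (f' k)%:E)%E.
Proof.
move=> f0 f'0 K0 le; rewrite !series_layer_cake// -ge0_integralZl//; last 2 first.
- by apply: measurable_funS (measurableT) _ _ => //; exact: measurable_exceed.
- by move=> y _; exact: exceed_ge0.
apply: ge0_le_integral => //.
- by move=> y _; exact: exceed_ge0.
- by apply: measurable_funS (measurableT) _ _ => //; exact: measurable_exceed.
- apply: measurable_funS (measurableT) _ _ => //.
  by apply: measurable_funeM; exact: measurable_exceed.
- by move=> y; rewrite /= in_itv/= andbT => y0; exact: le.
Qed.

End level_sums.

Section stable_sequence.
Variables (R : realType) (alpha a : R) (gam : nat -> R).
Hypotheses (alpha01 : 0 < alpha < 1) (a_alpha : 0 <= a < alpha).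
Hypothesis gam0 : forall k, 0 < gam k.
Hypothesis exceed_fin : forall c, 0 < c -> (exceed gam c < +oo)%E.
Hypothesis exceed_asym : c `^ alpha * fine (exceed gam c) @[c --> 0^'+] --> (1 : R).
Notation mu := (@lebesgue_measure R).

Let a1 : 0 < 1 - a.
Proof. by case/andP: alpha01 => ? ?; case/andP: a_alpha => ? ?; lra. Qed.

Let exceedK c : 0 < c -> (fine (exceed gam c))%:E = exceed gam c.
Proof. by move=> c0; rewrite fineK// ge0_fin_numE ?exceed_ge0// exceed_fin. Qed.

Lemma exceed_asym_bounds (eta : R) : 0 < eta -> exists2 c1, 0 < c1 &
  forall c, 0 < c -> c < c1 ->
    1 - eta < c `^ alpha * fine (exceed gam c) < 1 + eta.
Proof.
move=> e0; move/cvgrPdist_lt : exceed_asym => /(_ _ e0)[c1 /= c10 c1P].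
exists c1 => // c c0 cc1; have := c1P c; rewrite /= sub0r normrN gtr0_norm// => /(_ cc1 c0).
by rewrite ltr_norml => /andP[? ?]; apply/andP; split; lra.
Qed.

Lemma gam_bounded : exists2 B, 0 < B & forall k, gam k <= B.
Proof.
have := @nneseries_cvgn _ (fun k => (1 < gam k)%R%:R) (fun k => ler0n _ _) (exceed_fin ltr01).
move/cvg_series_cvg_0/cvgr0_norm_lt => /(_ 2^-1).
rewrite invr_gt0 ltr0n => /(_ isT)[n _ nP].
have S0 : 0 <= \sum_(k < n) gam k by apply: sumr_ge0 => k _; exact: ltW.
exists (1 + \sum_(k < n) gam k); first by rewrite ltr_pwDl.
move=> k; have [kn|nk] := ltnP k n.
  rewrite (bigD1 (Ordinal kn))//=.
  have : 0 <= \sum_(i < n | i != Ordinal kn) gam i by apply: sumr_ge0 => i _; exact: ltW.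
  lra.
have := nP k nk; have [g1 _|_] := leP (gam k) 1; first by rewrite (le_trans g1)// lerDl.
rewrite normr1 => ?; exfalso; lra.
Qed.

(** The truncated jumps exceed no level beyond c, and a level y < c at most 2 y^(-alpha) times;
    alpha < 1 makes this integrable at 0, whence C = 2 / (1 - alpha). *)
Lemma small_jumps_sum : exists C c1, [/\ 0 < C, 0 < c1 & forall c, 0 < c -> c < c1 ->
  (\sum_(k <oo) (Num.min (gam k) c)%:E <= (C * c `^ (1 - alpha))%:E)%E].
Proof.
have /andP[al0 al1] := alpha01.
have al1' : 0 < 1 - alpha by lra.
have [c1 c10 c1P] := exceed_asym_bounds (ltr01 : 0 < 1 :> R).
exists (2 / (1 - alpha)), c1; split => //; first by rewrite divr_gt0.
move=> c c0 cc1; rewrite series_layer_cake; last by move=> k; rewrite le_min !ltW.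
pose f (y : R) : R := 2 * y `^ (- alpha).
pose F (y : R) : R := 2 / (1 - alpha) * y `^ (1 - alpha).
have mf : measurable_fun setT f.
  apply: measurable_funM; first exact: measurable_cst.
  exact: measurable_powR.
have f0 (y : R) : 0 <= f y by rewrite mulr_ge0 ?powR_ge0.
have If : (\int[mu]_(y in `[0%R, c]) (f y)%:E = (F c - F 0)%:E)%E.
  apply: ge0_integral_primitive => //.
  - move=> y; rewrite in_itv/= => /andP[y0 _]; apply: cvgMr.
    have cp : {for y, continuous (fun x : R => x `^ (- alpha))}.
      apply/differentiable_continuous/derivable1_diffP.
      by have [] := is_derive1_powR (- alpha) y0.
    exact: cp.
  - move=> y; apply: cvgMr; move: y.
    apply: (@continuous_within_powR _ (fun y : R => y)) => //.
      by move=> y /andP[].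
    by apply: continuous_subspaceT => x; exact: cvg_id.
  - move=> y /andP[y0 _]; have d1 := is_derive_scale (2 / (1 - alpha)) (is_derive1_powR (1 - alpha) y0).
    apply: (is_derive_eq d1); rewrite /f mulrA divfK ?gt_eqF//.
    by congr (_ * _ `^ _); ring.
have -> : (2 / (1 - alpha) * c `^ (1 - alpha))%:E = (\int[mu]_(y in `[0%R, c]) (f y)%:E)%E.
  by rewrite If /F powR0 ?gt_eqF// mulr0 subr0.
rewrite [leRHS]integral_mkcond.
apply: (@le_trans _ _ (\int[mu]_(y in `]0%R, +oo[) (((EFin \o f) \_ `[0%R, c]) y))%E); last first.
  apply: ge0_subset_integral => //.
  - apply/(measurable_restrictT (EFin \o f)) => //.
    by apply: measurable_funS (measurableT) _ _ => //; exact/measurable_EFinP.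
  - by move=> y _; apply: erestrict_ge0 => z _; rewrite lee_fin.
apply: ge0_le_integral => //.
- by move=> y _; exact: exceed_ge0.
- by apply: measurable_funS (measurableT) _ _ => //; exact: measurable_exceed.
- apply: measurable_funS (measurableT) _ _ => //.
  apply/(measurable_restrictT (EFin \o f)) => //.
  by apply: measurable_funS (measurableT) _ _ => //; exact/measurable_EFinP.
- move=> y; rewrite /= in_itv/= andbT => y0; rewrite patchE mem_setE in_itv/= (ltW y0)/=.
  have [yc|cy] := leP y c; last first.
    rewrite /exceed eseries0// => k _ _; rewrite lt_min [X in _ && X](_ : _ = false) ?andbF//.
    by apply/negbTE; rewrite -leNgt ltW.
  apply: (@le_trans _ _ (exceed gam y)).
    apply: lee_nneseries => k _; rewrite lee_fin ?ler_nat// lt_min.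
    by case: (y < gam k) => //=; case: (y < c).
  have yc1 := le_lt_trans yc cc1.
  have /andP[_ h] := c1P y y0 yc1.
  rewrite -exceedK// lee_fin /f powRN ler_pdivlMr ?powR_gt0// mulrC ltW//.
Qed.

Lemma gam_summable : (\sum_(k <oo) (gam k)%:E < +oo)%E.
Proof.
have [C [c1 [C0 c10 h]]] := small_jumps_sum; have [B B0 gB] := gam_bounded.
pose c := c1 / 2; have c0 : 0 < c by rewrite divr_gt0.
have cc1 : c < c1 by rewrite /c; lra.
pose M := Num.max 1 (B / c).
apply: (@le_lt_trans _ _ (M%:E * \sum_(k <oo) (Num.min (gam k) c)%:E)%E).
  rewrite -nneseriesZl; last by move=> k _; rewrite lee_fin le_min !ltW.
  apply: lee_nneseries => k _; rewrite ?lee_fin ?(ltW (gam0 k))//.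
  have [gc|cg] := leP (gam k) c.
    by rewrite ler_peMl ?(ltW (gam0 k))// le_max lexx.
  by rewrite -ler_pdivrMr// le_max ler_pM2r ?invr_gt0// gB orbT.
apply: (@le_lt_trans _ _ (M%:E * (C * c `^ (1 - alpha))%:E)%E); last by rewrite -EFinM ltry.
by rewrite lee_pmul2l ?fin_numE// ?h// lte_fin lt_max ltr01.
Qed.

(** The contribution of a jump of size x to phi(l) as a function of x: x^a times [lap_exponent] at l
    x^(1-a). *)
Definition jump_cost (l x : R) : R := l * x / (1 + l * x `^ (1 - a)).

Lemma jump_cost_den_gt0 l x : 0 <= l -> 0 < 1 + l * x `^ (1 - a).
Proof. by move=> l0; rewrite ltr_pwDl// mulr_ge0// powR_ge0. Qed.

Lemma jump_cost_ge0 l x : 0 <= l -> 0 <= x -> 0 <= jump_cost l x.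
Proof. by move=> l0 x0; rewrite divr_ge0 ?mulr_ge0// ltW// jump_cost_den_gt0. Qed.

Let powRK (x : R) : 0 <= x -> x `^ a * x `^ (1 - a) = x.
Proof.
move=> x0; have [->|x0'] := eqVneq x 0; first by rewrite [0 `^ (1 - a)]powR0 ?mulr0// gt_eqF.
rewrite -powRD ?x0' ?implybT//.
by rewrite addrCA subrr addr0 powRr1.
Qed.

(** Clearing denominators reduces this to the monotonicity of x^a, where a >= 0 enters. It makes the
    level sets half-lines. *)
Lemma jump_cost_lt l x y : 0 < l -> 0 <= x -> x < y -> jump_cost l x < jump_cost l y.
Proof.
move=> l0 x0 xy; have y0 := le_lt_trans x0 xy; have [a0 _] := andP a_alpha.
rewrite ltr_pdivrMr ?jump_cost_den_gt0 ?ltW// mulrAC ltr_pdivlMr ?jump_cost_den_gt0 ?ltW//.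
rewrite -!mulrA ltr_pM2l// !mulrDr !mulr1.
suff : x * (l * y `^ (1 - a)) <= y * (l * x `^ (1 - a)) by lra.
rewrite mulrCA [leRHS]mulrCA ler_pM2l//.
rewrite -{1}(powRK x0) -{2}(powRK (ltW y0)) mulrAC [leRHS]mulrAC -!mulrA [X in _ <= _ * X]mulrC.
rewrite ler_wpM2r ?mulr_ge0 ?powR_ge0// ge0_ler_powR ?nnegrE ?(ltW y0)// ltW//.
Qed.

Lemma jump_cost_le l x : 0 < l -> 0 <= x -> jump_cost l x <= x `^ a.
Proof.
move=> l0 x0; have l0' := ltW l0; rewrite ler_pdivrMr ?jump_cost_den_gt0// mulrDr mulr1 mulrCA powRK//.
by rewrite lerDr powR_ge0.
Qed.

Lemma continuous_jump_cost l M : 0 < l -> {within `[0, M], continuous (jump_cost l)}.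
Proof.
move=> l0 x; apply: cvgM.
  by apply: cvgMr; move: x; apply: continuous_subspaceT => x; exact: cvg_id.
apply: cvgV; first by rewrite gt_eqF// jump_cost_den_gt0// ltW.
apply: cvgD; first exact: cvg_cst.
apply: cvgMr; move: x; apply: (@continuous_within_powR _ (fun y : R => y)) => //.
  by move=> y /andP[].
by apply: continuous_subspaceT => x; exact: cvg_id.
Qed.

Let r k := gam k `^ a.
Let c k := gam k `^ (1 - a).

Lemma jump_costE l k : jump_cost l (gam k) = r k * lap_exponent (l * c k).
Proof.
rewrite /jump_cost /lap_exponent /r /c -{1}(powRK (ltW (gam0 k))).
by rewrite (mulrCA l) mulrA -!mulrA.
Qed.

Lemma rate_size_cvg : cvgn (series (fun k => r k * c k)).
Proof.
rewrite (_ : (fun _ => _) = gam); last by apply/funext => k; exact: powRK (ltW (gam0 k)).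
by apply: nneseries_cvgn gam_summable => k; exact: ltW.
Qed.

Lemma phi_jump_cost l : 0 <= l -> (phi r c l)%:E = (\sum_(k <oo) (jump_cost l (gam k))%:E)%E.
Proof.
move=> l0; have J0 k : 0 <= jump_cost l (gam k) by rewrite jump_cost_ge0// ltW.
rewrite nneseries_limn//; last first.
  apply: nneseries_cvgn => //.
  apply: (@le_lt_trans _ _ (l%:E * \sum_(k <oo) (gam k)%:E)%E).
    rewrite -nneseriesZl; last by move=> k _; rewrite lee_fin ltW.
    apply: lee_nneseries => k _; rewrite ?lee_fin//.
    rewrite ler_pdivrMr ?jump_cost_den_gt0// ler_peMr ?mulr_ge0 ?(ltW (gam0 k))//.
    by rewrite lerDl mulr_ge0 ?powR_ge0.
  by rewrite lte_mul_pinfty// ?lee_fin// gam_summable.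
congr (limn _)%:E; congr series; apply/funext => k; by rewrite jump_costE.
Qed.

Lemma exceed_ratio (mu' eta : R) : 0 < mu' -> 0 < eta -> exists2 c1, 0 < c1 &
  forall b, 0 < b -> b / mu' < c1 ->
    fine (exceed gam (b / mu')) <= (1 + eta) * mu' `^ alpha * fine (exceed gam b).
Proof.
move=> m0 e0; pose e := Num.min (eta / 4) 4^-1.
have e'0 : 0 < e by rewrite lt_min divr_gt0//= invr_gt0.
have e4 : e <= 4^-1 by rewrite ge_min lexx orbT.
have ee : e <= eta / 4 by rewrite ge_min lexx.
have [c1 c10 c1P] := exceed_asym_bounds e'0.
(* Both b and b / mu' have to lie in the range of the asymptotics. *)
pose c2 := Num.min c1 (c1 / mu').
exists c2; first by rewrite lt_min c10 divr_gt0.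
move=> b b0 bm; have bm0 : 0 < b / mu' by rewrite divr_gt0.
have bm1 : b / mu' < c1 by apply: lt_le_trans bm _; rewrite ge_min lexx.
have /andP[_ u] := c1P _ bm0 bm1.
have bc1 : b < c1.
  rewrite -(ltr_pM2r (_ : 0 < mu'^-1)) ?invr_gt0//.
  by apply: lt_le_trans bm _; rewrite ge_min lexx orbT.
have /andP[l _] := c1P _ b0 bc1.
set n1 := fine _ in u *; set n2 := fine _ in l *.
have bE : b `^ alpha = (b / mu') `^ alpha * mu' `^ alpha.
  by rewrite -powRM ?divfK ?gt_eqF ?(ltW bm0) ?(ltW m0).
rewrite -(ler_pM2l (_ : 0 < (b / mu') `^ alpha)) ?powR_gt0//.
apply: (le_trans (ltW u)); rewrite bE in l.
have -> : (b / mu') `^ alpha * ((1 + eta) * mu' `^ alpha * n2) =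
   (1 + eta) * ((b / mu') `^ alpha * mu' `^ alpha * n2) by ring.
apply: (@le_trans _ _ ((1 + eta) * (1 - e))); last first.
  by rewrite ler_wpM2l ?(ltW l)// addr_ge0// ltW.
have : eta * e <= eta * 4^-1 by rewrite ler_wpM2l// ltW.
nra.
Qed.

Definition size_index : R := (alpha - a) / (1 - a).

Lemma size_index_gt0 : 0 < size_index.
Proof. by rewrite divr_gt0//; case/andP: a_alpha => ? ?; rewrite subr_gt0. Qed.

(* The level sets of jump_cost l are half-lines, so the asymptotics of the
   counting function transfers to the sum, up to the finitely many big jumps. *)
Lemma phi_scaling (rho eta : R) : 0 < rho -> 0 < eta -> exists2 C, 0 <= C &
  forall l, 0 < l -> phi r c (rho * l) <= (1 + eta) * rho `^ size_index * phi r c l + C.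
Proof.
(* Scaling: a jump x at rho l costs m^(-a) times a jump m x at l. Counts scale by m^alpha, so the
   sum scales by m^(alpha - a), which is rho to the power [size_index]. *)
move=> rho0 eta0; pose m := rho `^ (1 - a)^-1.
have m0 : 0 < m by rewrite powR_gt0.
have mrho : m `^ (1 - a) = rho by rewrite -powRrM mulVf ?gt_eqF// powRr1// ltW.
have [c1 c10 c1P] := exceed_ratio m0 eta0.
pose S := fine (\sum_(k <oo) (gam k)%:E).
have SE : S%:E = (\sum_(k <oo) (gam k)%:E)%E.
  rewrite fineK// ge0_fin_numE ?gam_summable//.
  by apply: nneseries_ge0 => k _ _; rewrite lee_fin ltW.
have S0 : 0 <= S by rewrite -lee_fin SE; apply: nneseries_ge0 => k _ _; rewrite lee_fin ltW.
exists (c1 `^ (a - 1) * S); first by rewrite mulr_ge0// powR_ge0.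
move=> l l0; have l0' := ltW l0; have rl0 : 0 <= rho * l by rewrite mulr_ge0// ltW.
have gam0' k := ltW (gam0 k).
have mg0 k : 0 <= m * gam k by rewrite mulr_ge0// ltW.
have costE k : jump_cost (rho * l) (gam k) = m `^ (- a) * jump_cost l (m * gam k).
  rewrite /jump_cost powRM ?(ltW m0)// mrho mulrA [l * (rho * _)]mulrCA mulrA; congr (_ / _); last by rewrite !mulrA.
  have mE : rho = m `^ (- a) * m.
    by rewrite -mrho -{3}[m]powRr1 ?(ltW m0)// -powRD ?(gt_eqF m0) ?implybT// addrC.
  by rewrite {1}mE; ring.
pose f k := if gam k <= c1 then jump_cost l (m * gam k) else 0.
have f0 k : 0 <= f k by rewrite /f; case: ifP => // _; exact: jump_cost_ge0.
have fle : (\sum_(k <oo) (f k)%:E <= ((1 + eta) * m `^ alpha)%:E * \sum_(k <oo) (jump_cost l (gam k))%:E)%E.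
  apply: series_exceed_le => //.
  - by move=> k; exact: jump_cost_ge0.
  - by rewrite mulr_ge0 ?powR_ge0// addr_ge0// ltW.
  - move=> y y0.
    have [[k0 yk0]|nk] := pselect (exists k, y < f k); last first.
      rewrite {1}/exceed eseries0; last first.
        move=> k _ _; case: ltP => // yk; exfalso; apply: nk; by exists k.
      by rewrite mule_ge0 ?exceed_ge0// lee_fin mulr_ge0 ?powR_ge0// addr_ge0// ltW.
    have gk0 : gam k0 <= c1 by move: yk0; rewrite /f; case: ifP => // _; rewrite ltNge (ltW y0).
    move: (yk0); rewrite /f gk0 => yk0'.
    have J0 : jump_cost l 0 = 0 by rewrite /jump_cost mulr0 mul0r.
    have [|b] := @IVT _ (jump_cost l) 0 (m * gam k0) y (mg0 k0) (continuous_jump_cost l0).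
      by rewrite J0 min_l ?max_r ?jump_cost_ge0// (ltW y0) (ltW yk0').
    rewrite in_itv/= => /andP[b0 bk] by_.
    have b0' : 0 < b.
      by rewrite lt_neqAle b0 andbT; apply/negP => /eqP b_; move: y0; rewrite -by_ -b_ J0 ltxx.
    have lvl x : 0 <= x -> (y < jump_cost l x) = (b < x).
      move=> x0; rewrite -by_; apply/idP/idP; last exact: jump_cost_lt.
      by apply: contraTT; rewrite -!leNgt le_eqVlt => /predU1P[->//|xb]; rewrite ltW// jump_cost_lt.
    have bm : b / m < c1.
      apply: lt_le_trans gk0; rewrite ltr_pdivrMr// mulrC -lvl//.
    have h := c1P b b0' bm.
    apply: (@le_trans _ _ (exceed gam (b / m))).
      apply: lee_nneseries => k _; rewrite ?lee_fin ?ler_nat// /f.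
      case: ifP => [_|_]; last by rewrite ltNge (ltW y0).
      by rewrite lvl// ltr_pdivrMr// mulrC.
    have -> : exceed (fun k => jump_cost l (gam k)) y = exceed gam b.
      by apply: eq_eseriesr => k _; rewrite lvl.
    have bm0 : 0 < b / m by rewrite divr_gt0.
    have e1 := exceedK bm0; have e2 := exceedK b0'.
    by rewrite -e1 -e2 -EFinM lee_fin.
(* A jump above c1 costs at most (m x)^a, itself at most a multiple of x; summability bounds these
   terms uniformly in l. *)
have gle : (\sum_(k <oo) (jump_cost l (m * gam k) - f k)%:E <= (m `^ a * c1 `^ (a - 1))%:E * \sum_(k <oo) (gam k)%:E)%E.
  rewrite -nneseriesZl; last by move=> k _; rewrite lee_fin.
  apply: lee_nneseries => k _; rewrite ?lee_fin /f.
    by case: ifP => _; rewrite ?subrr// subr0 jump_cost_ge0.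
  case: ifPn => [_|]; first by rewrite subrr !mulr_ge0 ?powR_ge0.
  rewrite -ltNge => ck; rewrite subr0; apply: le_trans (jump_cost_le l0 (mg0 k)) _.
  rewrite powRM ?(ltW m0)// -mulrA ler_wpM2l ?powR_ge0//.
  rewrite -{2}(powRK (gam0' k)) mulrCA -[leLHS]mulr1 ler_wpM2l ?powR_ge0//.
  have -> : a - 1 = - (1 - a) by ring.
  by rewrite powRN mulrC ler_pdivlMr ?powR_gt0// mul1r ge0_ler_powR ?nnegrE ?(ltW a1) ?(ltW c10)// ltW.
have phiE : (phi r c (rho * l))%:E = ((m `^ (- a))%:E * \sum_(k <oo) (jump_cost l (m * gam k))%:E)%E.
  rewrite phi_jump_cost// -nneseriesZl; last by move=> k _; rewrite lee_fin jump_cost_ge0.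
  by apply: eq_eseriesr => k _; rewrite costE.
have sumE : (\sum_(k <oo) (jump_cost l (m * gam k))%:E = \sum_(k <oo) (f k)%:E + \sum_(k <oo) (jump_cost l (m * gam k) - f k)%:E)%E.
  rewrite -nneseriesD => [|k _ _|k _ _]; rewrite ?lee_fin//.
    by apply: eq_eseriesr => k _; rewrite -EFinD addrC subrK.
  by rewrite /f; case: ifP => _; rewrite ?subrr// subr0 jump_cost_ge0.
rewrite -lee_fin phiE sumE.
apply: (@le_trans _ _ (m `^ (- a) * ((1 + eta) * m `^ alpha * phi r c l + m `^ a * c1 `^ (a - 1) * S))%:E).
  rewrite EFinM lee_wpmul2l ?lee_fin ?powR_ge0// EFinD leeD//.
    by rewrite EFinM phi_jump_cost.
  by rewrite EFinM SE.
rewrite lee_fin mulrDr lerD//.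
  rewrite mulrA ler_wpM2r//; first by rewrite -lee_fin phi_jump_cost// nneseries_ge0// => k _ _; rewrite lee_fin jump_cost_ge0.
  rewrite mulrCA ler_wpM2l ?addr_ge0 ?(ltW eta0)//.
  rewrite -powRD ?(gt_eqF m0) ?implybT// -powRrM /size_index.
  by rewrite [- a + _]addrC mulrC.
rewrite !mulrA -powRD ?(gt_eqF m0) ?implybT// addrC subrr powRr0 mul1r//.
Qed.

(* Each of the jumps larger than l ^ (-1/(1-a)) contributes at least half of
   its rate. *)
Lemma phi_lower : exists2 l0, 0 < l0 & forall l, l0 < l -> 4^-1 * l `^ size_index <= phi r c l.
Proof.
have h2 : (0 : R) < 2^-1 by rewrite invr_gt0.
have [c1 c10 c1P] := exceed_asym_bounds h2.
exists (c1 `^ (- (1 - a))); first by rewrite powR_gt0.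
move=> l ll; have l0 : 0 < l by apply: lt_trans ll; rewrite powR_gt0.
pose b := l `^ (- (1 - a)^-1); have b0 : 0 < b by rewrite powR_gt0.
have bl : b `^ (1 - a) = l^-1.
  by rewrite -powRrM mulNr mulVf ?gt_eqF// powR_inv1// ltW.
have bc : b < c1.
  rewrite ltNge; apply/negP => cb; move: ll; rewrite ltNge => /negP; apply.
  rewrite powRN -[leLHS]invrK lef_pV2 ?posrE ?invr_gt0 ?powR_gt0// -bl.
  by rewrite ge0_ler_powR ?nnegrE ?(ltW a1) ?(ltW b0) ?(ltW c10).
have /andP[lb _] := c1P b b0 bc.
have [a0 _] := andP a_alpha.
rewrite -lee_fin phi_jump_cost ?(ltW l0)//.
apply: (@le_trans _ _ ((2^-1 * b `^ a)%:E * exceed gam b)%E).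
  rewrite -exceedK// -EFinM lee_fin.
  have -> : l `^ size_index = b `^ (a - alpha).
    by rewrite -powRrM /size_index; congr (_ `^ _); rewrite mulrC -opprB; ring.
  rewrite powRD ?(gt_eqF b0) ?implybT// powRN.
  have -> : 4^-1 * (b `^ a / b `^ alpha) = 2^-1 * b `^ a * (2^-1 / b `^ alpha) by field; rewrite gt_eqF// powR_gt0.
  rewrite ler_wpM2l ?mulr_ge0 ?powR_ge0// ler_pdivrMr ?powR_gt0// mulrC.
  by apply: ltW; apply: le_lt_trans lb; lra.
rewrite /exceed -nneseriesZl; last by move=> k _; rewrite lee_fin.
apply: lee_nneseries => k _; first by rewrite -EFinM lee_fin !mulr_ge0 ?powR_ge0.
rewrite -EFinM lee_fin; case: ltP => [bk|_]; last by rewrite mulr0 jump_cost_ge0 ?(ltW l0)// ltW.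
rewrite mulr1 ler_pdivlMr ?jump_cost_den_gt0 ?(ltW l0)//.
have g0 := gam0 k.
have h : 1 <= l * gam k `^ (1 - a).
  apply: (@le_trans _ _ (l * b `^ (1 - a))); first by rewrite bl divff// gt_eqF.
  by rewrite ler_pM2l// ge0_ler_powR ?nnegrE ?(ltW a1) ?(ltW b0) ?(ltW bk) ?(ltW g0).
have h3 : b `^ a <= gam k `^ a by rewrite ge0_ler_powR ?nnegrE ?(ltW b0) ?(ltW bk) ?(ltW g0).
rewrite -[X in _ <= l * X](powRK (ltW g0)).
apply: (@le_trans _ _ (2^-1 * gam k `^ a * (1 + l * gam k `^ (1 - a)))).
  by rewrite ler_wpM2r ?ler_wpM2l// addr_ge0// mulr_ge0 ?powR_ge0// ltW.
rewrite -mulrA mulrCA [leRHS]mulrCA ler_wpM2l ?powR_ge0//; lra.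
Qed.


Lemma phi_cvgy M : \forall l \near +oo, M < phi r c l.
Proof.
have [l0 l00 l0P] := phi_lower; have ah0 := size_index_gt0.
near=> l.
have ll : l0 < l by near: l; apply: nbhs_pinfty_gt; exact: num_real.
have h : (4 * (`|M| + 1)) `^ size_index^-1 < l by near: l; apply: nbhs_pinfty_gt; exact: num_real.
have l0' : 0 < l := lt_trans l00 ll.
apply: lt_le_trans (l0P l ll).
rewrite mulrC ltr_pdivlMr// mulrC.
apply: (@lt_trans _ _ (4 * (`|M| + 1))).
  rewrite ltr_pM2l//; apply: le_lt_trans (ler_norm M) _; by rewrite ltrDl.
have M0 : 0 <= 4 * (`|M| + 1) by rewrite mulr_ge0// addr_ge0.
rewrite -[ltLHS]powRr1// -(mulVf (lt0r_neq0 ah0)) powRrM.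
by rewrite gt0_ltr_powR ?nnegrE ?powR_ge0// ltW.
Unshelve. all: by end_near. Qed.

(** The upper bound is [phi_scaling] at rho, the lower bound [phi_scaling] at 1 / rho applied to rho
    l; the additive constants disappear since phi tends to infinity. *)
Lemma phi_quotient_cvg (rho : R) : 0 < rho ->
  phi r c (rho * l) / phi r c l @[l --> +oo] --> rho `^ size_index.
Proof.
move=> rho0; set A := rho `^ size_index; have A0 : 0 < A by rewrite powR_gt0.
apply/cvgrPdist_lt => e e0.
pose eta := Num.min (e / (4 * A)) 2^-1.
have eta0 : 0 < eta by rewrite lt_min invr_gt0 ltr0n andbT divr_gt0// mulr_gt0.
have eta1 : eta <= 2^-1 by rewrite ge_min lexx orbT.
have etaA : eta * A <= e / 4.
  apply: (@le_trans _ _ (e / (4 * A) * A)); first by rewrite ler_wpM2r ?(ltW A0)// ge_min lexx.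
  by rewrite invfM mulrA divfK// gt_eqF.
have [C C0 CP] := phi_scaling rho0 eta0.
have rhoV : 0 < rho^-1 by rewrite invr_gt0.
have [C' C'0 CP'] := phi_scaling rhoV eta0.
near=> l.
have l0 : 0 < l by near: l; apply: nbhs_pinfty_gt; exact: num_real.
have lC : 4 * C / e + (4 * A * C') / e < phi r c l by near: l; exact: phi_cvgy.
have p1 : 0 <= 4 * C / e by rewrite divr_ge0 ?mulr_ge0// ltW.
have p2 : 0 <= 4 * A * C' / e by rewrite divr_ge0 ?mulr_ge0// ltW.
have ph0 : 0 < phi r c l by lra.
have q1 : C / phi r c l < e / 4.
  rewrite ltr_pdivrMr// mulrAC ltr_pdivlMr// mulrC -ltr_pdivrMl// mulrC; lra.
have q2 : A * C' / phi r c l < e / 4.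
  rewrite ltr_pdivrMr// mulrAC ltr_pdivlMr// [_ * 4]mulrC [e * _]mulrC -ltr_pdivrMr// !mulrA; lra.
have u1 : phi r c (rho * l) / phi r c l <= (1 + eta) * A + C / phi r c l.
  by rewrite ler_pdivrMr// mulrDl divfK ?gt_eqF// CP.
have rl0 : 0 < rho * l by rewrite mulr_gt0.
have := CP' _ rl0; rewrite mulKf ?gt_eqF// => u2.
have AV : rho^-1 `^ size_index = A^-1.
  by rewrite -powR_inv1 ?(ltW rho0)// -powRrM mulN1r powRN.
have u3 : (1 - eta) * A - A * C' / phi r c l <= phi r c (rho * l) / phi r c l.
  rewrite ler_pdivlMr// mulrBl divfK ?gt_eqF//.
  move: u2; rewrite AV -(ler_pM2l A0) => u2.
  have h : A * phi r c l - A * C' <= (1 + eta) * phi r c (rho * l).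
    rewrite lerBlDr; apply: le_trans u2 _; rewrite mulrDr lerD2r.
    rewrite (_ : A * _ = (A * A^-1) * ((1 + eta) * phi r c (rho * l))); last by ring.
    by rewrite mulfV ?gt_eqF// mul1r.
  have e1 : 0 <= 1 - eta by lra.
  have h2 : (1 - eta) * (A * phi r c l - A * C') <= phi r c (rho * l).
    apply: le_trans (ler_wpM2l e1 h) _; rewrite mulrA.
    have ph1 : 0 <= phi r c (rho * l).
      by rewrite -lee_fin phi_jump_cost ?(ltW rl0)// nneseries_ge0// => k _ _; rewrite lee_fin jump_cost_ge0// ltW.
    rewrite -[leRHS]mul1r ler_wpM2r//; nra.
  apply: le_trans h2; rewrite mulrBr mulrA lerD2l lerN2.
  by rewrite ler_piMl ?mulr_ge0// ?ltW// gtrBl.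
by rewrite ltr_norml; apply/andP; split; lra.
Unshelve. all: by end_near. Qed.

Lemma phi0 : phi r c 0 = 0.
Proof.
apply/EFin_inj; rewrite phi_jump_cost// eseries0// => k _ _.
by rewrite /jump_cost !mul0r.
Qed.

Lemma phi_ratio_cvg (i j : nat) : (0 < i)%N ->
  phi r c (l * j%:R) / phi r c (l * (i + j)%:R) @[l --> +oo] -->
  (j%:R `^ size_index / (i + j)%:R `^ size_index : R).
Proof.
move=> i0; have ah0 := size_index_gt0.
have ij0 : (0 : R) < (i + j)%:R by rewrite ltr0n addn_gt0 i0.
have [->|j0] := posnP j.
  rewrite [0%:R `^ _]powR0 ?gt_eqF// mul0r.
  under eq_fun do rewrite mulr0 phi0 mul0r.
  exact: cvg_cst.
have j0' : (0 : R) < j%:R by rewrite ltr0n.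
have rho0 : (0 : R) < j%:R / (i + j)%:R by rewrite divr_gt0.
have -> : j%:R `^ size_index / (i + j)%:R `^ size_index = (j%:R / (i + j)%:R) `^ size_index :> R.
  by rewrite powRM ?invr_ge0 ?ltW// -powR_inv1 ?powR_ge0// -powRrM mulrN1 -[(i + j)%:R^-1]powR_inv1 ?(ltW ij0)// -powRrM mulN1r.
have h := phi_quotient_cvg rho0.
have c1 : l * (i + j)%:R @[l --> +oo] --> (+oo : set_system R).
  by apply/cvgryPgt => A; near=> l; rewrite -ltr_pdivrMr//; near: l; apply: nbhs_pinfty_gt; exact: num_real.
have := cvg_comp _ _ c1 h; apply: cvg_trans; apply: near_eq_cvg; near=> l.
by rewrite /= mulrCA divfK// gt_eqF.
Unshelve. all: by end_near. Qed.

(** The selected jumps are those below b = (dl / l)^(1/(1-a)), of total size at most C b^(1-alpha) =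
    C dl^p l^(-p) with p = 1 - [size_index]. Since phi(l) is at least a quarter of l to the power
    [size_index], the choice 4 C dl^p = e gives the bound. *)
Lemma small_jumps_negligible (e : R) : 0 < e -> exists2 dl, 0 < dl &
  \forall l \near +oo, (\sum_(k <oo) (if l * c k < dl then r k * c k else 0)%:E
    <= (e * phi r c l / l)%:E)%E.
Proof.
move=> e0; have [C [c1 [C0 c10 CP]]] := small_jumps_sum.
have [l0 l00 l0P] := phi_lower.
have /andP[al0 al1] := alpha01; have /andP[a0 aal] := a_alpha.
pose p := (1 - alpha) / (1 - a); have p0 : 0 < p by rewrite divr_gt0// subr_gt0.
pose dl := (e / (4 * C)) `^ p^-1; have dl0 : 0 < dl by rewrite powR_gt0 ?divr_gt0 ?mulr_gt0.
exists dl => //; near=> l.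
have ll : l0 < l by near: l; apply: nbhs_pinfty_gt; exact: num_real.
have l1 : dl / c1 `^ (1 - a) < l by near: l; apply: nbhs_pinfty_gt; exact: num_real.
have lp : 0 < l := lt_trans l00 ll.
pose b := (dl / l) `^ (1 - a)^-1.
have dll : 0 < dl / l by rewrite divr_gt0.
have b0 : 0 < b by rewrite powR_gt0.
have bE : b `^ (1 - a) = dl / l by rewrite -powRrM mulVf ?gt_eqF// powRr1// ltW.
have bc1 : b < c1.
  rewrite ltNge; apply/negP => cb; move: l1; rewrite ltr_pdivrMr ?powR_gt0// ltNge => /negP; apply.
  rewrite -ler_pdivlMl// mulrC -bE.
  by rewrite ge0_ler_powR ?nnegrE ?(ltW a1) ?(ltW b0) ?(ltW c10).
apply: (@le_trans _ _ (\sum_(k <oo) (Num.min (gam k) b)%:E)%E).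
  apply: lee_nneseries => k _.
    by rewrite lee_fin; case: ifP => // _; rewrite mulr_ge0 ?powR_ge0.
  rewrite lee_fin; case: ifPn => [lk|_]; last by rewrite le_min !ltW.
  rewrite powRK ?(ltW (gam0 k))// le_min lexx/= leNgt; apply/negP => bg.
  move: lk; rewrite ltNge => /negP; apply; rewrite -ler_pdivrMl// mulrC -bE.
  by rewrite ge0_ler_powR ?nnegrE ?(ltW a1) ?(ltW b0) ?(ltW bg) ?(ltW (gam0 k)).
apply: le_trans (CP b b0 bc1) _; rewrite lee_fin.
have -> : b `^ (1 - alpha) = dl `^ p * l `^ (- p).
  rewrite -powRrM [_^-1 * _]mulrC -/p powRM ?invr_ge0 ?(ltW lp) ?(ltW dl0)//.
  by rewrite -[l^-1]powR_inv1 ?(ltW lp)// -powRrM mulN1r.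
have -> : dl `^ p = e / (4 * C).
  by rewrite -powRrM mulVf ?gt_eqF// powRr1// divr_ge0 ?mulr_ge0 ?ltW.
have -> : l `^ (- p) = l `^ size_index / l.
  rewrite -[l^-1]powR_inv1 ?(ltW lp)// -powRD ?(gt_eqF lp) ?implybT//; congr (_ `^ _).
  by rewrite /p /size_index; field; rewrite gt_eqF.
have h := l0P l ll.
have -> : C * (e / (4 * C) * (l `^ size_index / l)) = e * (4^-1 * l `^ size_index) / l.
  by field; rewrite !gt_eqF.
by rewrite ler_wpM2r ?invr_ge0 ?(ltW lp)// ler_wpM2l// ltW.
Unshelve. all: by end_near. Qed.

Definition multiplicity (x : R) : \bar R := (\sum_(k <oo) ((gam k == x)%:R)%:E)%E.

Lemma multiplicity_ge0 x : (0 <= multiplicity x)%E.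
Proof. by apply: nneseries_ge0 => k _ _; rewrite lee_fin. Qed.

Lemma multiplicityD_le x y : x < y -> (multiplicity y + exceed gam y <= exceed gam x)%E.
Proof.
move=> xy; rewrite -nneseriesD => [|k _ _|k _ _]; rewrite ?lee_fin//.
apply: lee_nneseries => k _; first by rewrite -EFinD lee_fin addr_ge0.
rewrite -EFinD lee_fin; case: eqP => [->|_]; first by rewrite ltxx xy addr0.
by rewrite add0r ler_nat; case: ltP => // yk; rewrite (lt_trans xy yk).
Qed.

(** The jumps of size exactly x lie between the levels x / (1 + th) and x, where the asymptotics
    leaves room for only a small multiple of x^(-alpha). *)
Lemma multiplicity_small (eta : R) : 0 < eta -> exists2 c1, 0 < c1 &
  forall x, 0 < x -> x < c1 -> (multiplicity x <= (eta * x `^ (- alpha))%:E)%E.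
Proof.
move=> eta0; have /andP[al0 al1] := alpha01.
pose th := Num.min (eta / 4) 1.
have th0 : 0 < th by rewrite lt_min divr_gt0/=.
have th1 : th <= 1 by rewrite ge_min lexx orbT.
have th4 : th <= eta / 4 by rewrite ge_min lexx.
have [c1 c10 c1P] := exceed_asym_bounds th0.
exists c1 => // x x0 xc1.
have t1 : 0 < 1 + th by rewrite addr_gt0.
pose y := x / (1 + th); have y0 : 0 < y by rewrite divr_gt0.
have yx : y < x by rewrite ltr_pdivrMr// ltr_pMr// ltrDl.
have /andP[_ h1] := c1P y y0 (lt_trans yx xc1).
have /andP[h2 _] := c1P x x0 xc1.
have := multiplicityD_le yx; rewrite -(exceedK x0) -(exceedK y0).
move: h1 h2; set n1 := fine _; set n2 := fine _ => h1 h2.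
have := multiplicity_ge0 x; case: (multiplicity x) => [m| |]//= m0.
rewrite -EFinD !lee_fin => h.
rewrite powRN ler_pdivlMr ?powR_gt0//.
have xE : x `^ alpha = y `^ alpha * (1 + th) `^ alpha.
  by rewrite -powRM ?divfK ?gt_eqF ?(ltW y0) ?(ltW t1).
have p1 : (1 + th) `^ alpha <= 1 + th.
  rewrite -[leRHS]powRr1 ?(ltW t1)//; apply: ler_powR; last exact: ltW.
  by rewrite lerDl (ltW th0).
have h3 : x `^ alpha * n1 <= (1 + th) * (1 + th).
  rewrite xE mulrAC; apply: ler_pM => //; rewrite ?powR_ge0 ?(ltW h1)//.
  by rewrite mulr_ge0 ?powR_ge0// -lee_fin exceedK// exceed_ge0.
have h4 : x `^ alpha * (m + n2) <= x `^ alpha * n1 by rewrite ler_wpM2l ?powR_ge0.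
rewrite mulrDr in h4.
have h5 : th * th <= th * 1 by rewrite ler_wpM2l// ltW.
rewrite mulrC; nra.
Qed.

(** For a jump below c1, r^2 times the multiplicity is at most eta r gam^(a - alpha). As l c >= dl,
    the power gam^(a - alpha) is of order at most phi(l), and r is at most (1 + dl) / dl times its
    term in phi(l). This gives a bound of order eta phi(l)^2, to which the big jumps add a
    constant. *)
Lemma ties_negligible (dl e : R) : 0 < dl -> 0 < e ->
  \forall l \near +oo, (\sum_(k <oo) ((if dl <= l * c k then r k ^+ 2 else 0)%:E * multiplicity (gam k))
    <= (e * phi r c l ^+ 2)%:E)%E.
Proof.
move=> dl0 e0; have /andP[al0 al1] := alpha01; have /andP[a0 aal] := a_alpha.
have [l0 l00 l0P] := phi_lower.
have [B B0 gB] := gam_bounded.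
(* [D] collects the constants of the estimate for jumps below c1, and eta = e / (2 D) makes that
   part half of the target. *)
pose D := 4 * dl `^ (- size_index) * ((1 + dl) / dl).
have D0 : 0 < D by rewrite !mulr_gt0 ?powR_gt0 ?divr_gt0 ?addr_gt0// invr_gt0.
pose eta := e / (2 * D); have eta0 : 0 < eta by rewrite divr_gt0// mulr_gt0.
have [c1 c10 c1P] := multiplicity_small eta0.
have c2 : 0 < c1 / 2 by rewrite divr_gt0.
have c21 : c1 / 2 < c1 by lra.
pose M := fine (exceed gam (c1 / 2)).
have M0 : 0 <= M by rewrite -lee_fin exceedK// exceed_ge0.
(* Jumps of size at least c1: their number and each multiplicity are at most [M], each squared rate
   at most B^(2 a). *)
pose C := (B `^ a) ^+ 2 * M * M.
near=> l.
have ll : l0 < l by near: l; apply: nbhs_pinfty_gt; exact: num_real.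
have lp : 0 < l := lt_trans l00 ll.
have lC : 2 * C / e + 1 < phi r c l by near: l; exact: phi_cvgy.
have C0 : 0 <= C by rewrite !mulr_ge0// powR_ge0.
have p1 : 0 <= 2 * C / e by rewrite divr_ge0 ?(ltW e0)// mulr_ge0.
have ph1 : 1 < phi r c l by lra.
have ph0 : 0 < phi r c l by lra.
pose K := eta * (l / dl) `^ size_index * ((1 + dl) / dl).
have d10 : 0 <= (1 + dl) / dl by rewrite divr_ge0 ?addr_ge0 ?(ltW dl0).
have K0 : 0 <= K by rewrite mulr_ge0// mulr_ge0 ?powR_ge0 ?(ltW eta0).
have term k : ((if (dl <= l * c k)%R then (r k ^+ 2)%R else 0%R)%:E * multiplicity (gam k) <=
   K%:E * (jump_cost l (gam k))%:E + ((B `^ a) ^+ 2 * M)%:E * ((c1 / 2 < gam k)%R%:R)%:E)%E.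
  have g0 := gam0 k.
  have J0 : 0 <= jump_cost l (gam k) by rewrite jump_cost_ge0// ltW.
  have [gc|cg] := ltP (gam k) c1; last first.
    apply: (@le_trans _ _ (((B `^ a) ^+ 2)%:E * M%:E)%E).
      apply: lee_pmul => //.
      - by rewrite lee_fin; case: ifP => // _; rewrite exprn_ge0// powR_ge0.
      - exact: multiplicity_ge0.
      - rewrite lee_fin; case: ifP => _; last by rewrite exprn_ge0// powR_ge0.
        by rewrite lerXn2r ?nnegrE ?powR_ge0// ge0_ler_powR ?nnegrE ?(ltW g0) ?(ltW B0).
      - rewrite exceedK//; have := multiplicityD_le (lt_le_trans c21 cg).
        by apply: le_trans; rewrite leeDl// exceed_ge0.
    rewrite (lt_le_trans c21 cg) mule1 -EFinM leeDr// -EFinM lee_fin mulr_ge0//.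
  apply: (@le_trans _ _ (K%:E * (jump_cost l (gam k))%:E)%E); last first.
    by rewrite leeDl// -EFinM lee_fin !mulr_ge0 ?exprn_ge0 ?powR_ge0.
  case: ifPn => [dk|_]; last by rewrite mul0e -EFinM lee_fin mulr_ge0.
  apply: (@le_trans _ _ ((r k ^+ 2)%:E * (eta * gam k `^ (- alpha))%:E)%E).
    by rewrite lee_wpmul2l ?c1P// lee_fin exprn_ge0// powR_ge0.
  rewrite -!EFinM lee_fin jump_costE.
  have lapd : 1 <= (1 + dl) / dl * lap_exponent (l * c k).
    rewrite /lap_exponent mulrA ler_pdivlMr ?addr_gt0// ?(lt_le_trans dl0 dk)// mul1r mulrAC ler_pdivlMr//.
    by rewrite mulrDl mul1r [leRHS]mulrDl mul1r lerD// mulrC.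
  have gpow : gam k `^ (a - alpha) <= (l / dl) `^ size_index.
    have -> : a - alpha = - (1 - a) * size_index by rewrite /size_index; field; rewrite gt_eqF.
    rewrite powRrM ge0_ler_powR ?nnegrE ?powR_ge0 ?(ltW size_index_gt0)//.
      by rewrite divr_ge0 ?ltW.
    rewrite powRN -[leRHS]invrK lef_pV2 ?posrE ?invr_gt0 ?divr_gt0 ?powR_gt0//.
    by rewrite invf_div ler_pdivrMr// mulrC.
  have -> : r k ^+ 2 * (eta * gam k `^ (- alpha)) = eta * r k * gam k `^ (a - alpha).
    rewrite powRD ?(gt_eqF g0) ?implybT// -/(r k) expr2; ring.
  apply: (@le_trans _ _ (eta * r k * (l / dl) `^ size_index)).
    by rewrite ler_wpM2l// mulr_ge0 ?powR_ge0 ?ltW.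
  have -> : K * (r k * lap_exponent (l * c k)) = eta * r k * (l / dl) `^ size_index * ((1 + dl) / dl * lap_exponent (l * c k)).
    by rewrite /K; ring.
  by rewrite ler_peMr// mulr_ge0 ?powR_ge0// mulr_ge0 ?(ltW eta0)// powR_ge0.
apply: (@le_trans _ _ (K%:E * (phi r c l)%:E + ((B `^ a) ^+ 2 * M)%:E * exceed gam (c1 / 2))%E).
  rewrite phi_jump_cost ?(ltW lp)// -!nneseriesZl; last 2 first.
  - by move=> k _; rewrite lee_fin.
  - by move=> k _; rewrite lee_fin jump_cost_ge0// ltW.
  rewrite -nneseriesD => [|k _ _|k _ _].
  - apply: lee_nneseries => // k _; rewrite mule_ge0 ?multiplicity_ge0// lee_fin.
    by case: ifP => // _; rewrite exprn_ge0// powR_ge0.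
  - by rewrite -EFinM lee_fin mulr_ge0// jump_cost_ge0// ltW.
  - by rewrite -EFinM lee_fin !mulr_ge0 ?exprn_ge0 ?powR_ge0.
rewrite -exceedK// -!EFinM -EFinD lee_fin -/M -/C.
have q1 : (l / dl) `^ size_index <= 4 * dl `^ (- size_index) * phi r c l.
  rewrite powRM ?invr_ge0 ?(ltW lp) ?(ltW dl0)// -[dl^-1]powR_inv1 ?(ltW dl0)// -powRrM mulN1r.
  rewrite [leRHS]mulrAC ler_wpM2r ?powR_ge0//.
  by rewrite -ler_pdivrMl// l0P.
have q2 : K * phi r c l <= e / 2 * phi r c l ^+ 2.
  have -> : e / 2 * phi r c l ^+ 2 = eta * (4 * dl `^ (- size_index) * phi r c l) * ((1 + dl) / dl) * phi r c l.
    by rewrite /eta /D; field; rewrite !gt_eqF ?powR_gt0// addr_gt0.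
  rewrite ler_wpM2r ?(ltW ph0)// /K ler_wpM2r//.
  by rewrite ler_wpM2l// (ltW eta0).
have q3 : C <= e / 2 * phi r c l ^+ 2.
  have s1 : 2 * C / e <= phi r c l ^+ 2 by rewrite expr2; nra.
  by rewrite mulrAC ler_pdivlMr// mulrC [e * _]mulrC -ler_pdivrMr.
lra.
Unshelve. all: by end_near. Qed.

End stable_sequence.

(** * The stable environment *)

Section poisson_deviation.
Context d (T : measurableType d) (R : realType) (P : probability T R).

Lemma expR_quadratic_upper (h : R) : 0 <= h <= 2^-1 -> expR h <= 1 + h + h ^+ 2 *+ 2.
Proof.
move=> /andP[h0 h1]; have e1 := expR_ge1Dx (- h).
have e0 : 0 < 1 - h by lra.
have -> : expR h = (expR (- h))^-1 by rewrite expRN invrK.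
apply: (@le_trans _ _ (1 - h)^-1).
  by rewrite lef_pV2 ?posrE ?expR_gt0//; lra.
rewrite -[leLHS]mul1r ler_pdivrMr// mulr2n expr2; nra.
Qed.

Lemma expRN_quadratic_upper (h : R) : 0 <= h -> expR (- h) <= 1 - h + h ^+ 2.
Proof.
move=> h0; have e1 := expR_ge1Dx h.
rewrite expRN; apply: (@le_trans _ _ (1 + h)^-1).
  by rewrite lef_pV2 ?posrE ?expR_gt0//; lra.
rewrite -[leLHS]mul1r ler_pdivrMr ?ltr_pwDl// expr2; nra.
Qed.

Variables (X : T -> \bar R) (lam eta : R).
Hypothesis mX : measurable_fun setT X.
Hypothesis lam0 : 0 <= lam.
Hypothesis eta0 : 0 < eta.
Hypothesis lawX : forall k : nat, P [set w | X w = k%:R%:E] = poisson_law lam [set k].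

(** At most 1/2 for exp(h) <= 1 + h + 2 h^2, and at most eta / 4 so that 2 h^2 uses up no more than
    half of the exponent eta h. *)
Let h := Num.min 2^-1 (eta / 4).
Let h0 : 0 < h. Proof. by rewrite lt_min invr_gt0 ltr0n/= divr_gt0. Qed.
Let h1 : h <= 2^-1. Proof. by rewrite ge_min lexx. Qed.
Let h2 : h <= eta / 4. Proof. by rewrite ge_min lexx orbT. Qed.

Definition poisson_typical : set T :=
  [set w | exists k : nat, X w = k%:R%:E /\ `|k%:R - lam| <= eta * lam].

Let level (k : nat) : set T := [set w | X w = k%:R%:E].
Let ok (k : nat) : bool := `|k%:R - lam| <= eta * lam.
Let A (k : nat) : set T := if ok k then level k else set0.

Let mA k : measurable (A k).
Proof.
rewrite /A; case: ifP => // _.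
by have := mX measurableT (emeasurable_set1 (k%:R%:E)); rewrite setTI.
Qed.

Let typicalE : poisson_typical = \bigcup_k A k.
Proof.
apply/seteqP; split => w.
  by move=> [k [Xk kl]]; exists k => //; rewrite /A /ok kl.
by move=> [k _]; rewrite /A; case: ifPn => // okk Xk; exists k.
Qed.

Lemma measurable_poisson_typical : measurable poisson_typical.
Proof. by rewrite typicalE; apply: bigcupT_measurable; exact: mA. Qed.

Let pmf (k : nat) : R := lam ^+ k / k`!%:R * expR (- lam).
Let pmf0 k : 0 <= pmf k.
Proof. by rewrite mulr_ge0 ?expR_ge0// divr_ge0// exprn_ge0. Qed.

Let PtypicalE : P poisson_typical = (\sum_(k <oo) (if ok k then pmf k else 0)%:E)%E.
Proof.
have tA : trivIset setT A.
  apply/trivIsetP => i j _ _ ij; rewrite /A; case: (ok i); rewrite ?set0I//.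
  case: (ok j); rewrite ?setI0//; rewrite -subset0 => w []; rewrite /level/= => -> [/eqP].
  by rewrite eqr_nat (negbTE ij).
rewrite typicalE measure_semi_bigcup//; last by apply: bigcupT_measurable; exact: mA.
apply: eq_eseriesr => k _; rewrite /A; case: ifP => _; last by rewrite measure0.
exact: etrans (lawX k) (poisson_law_pmf k lam0).
Qed.

(* Chernoff bounds at e^h and e^(-h) *)
Lemma poisson_deviation :
  (P (~` poisson_typical) <= (2 * expR (- (lam * (eta * h / 2))))%:E)%E.
Proof.
pose u (z : R) (k : nat) : R := pmf k * z ^+ k.
have uS (z : R) : 0 <= z -> (\sum_(k <oo) (u z k)%:E = (expR (- (lam * (1 - z))))%:E)%E.
  by move=> z0; exact: poisson_pgf.
pose c1 := expR (- (h * lam * (1 + eta))).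
pose c2 := expR (h * lam * (1 - eta)).
have u0 (z : R) k : 0 <= z -> 0 <= u z k by move=> z0; rewrite mulr_ge0// exprn_ge0.
(* Where k is atypical, one of the two tilted weights is at least 1, so the Poisson weights, which
   sum to 1, are dominated term by term. *)
have split_ge1 : (1 <= P poisson_typical + (c1%:E * (expR (- (lam * (1 - expR h))))%:E +
    c2%:E * (expR (- (lam * (1 - expR (- h)))))%:E))%E.
  have s1 := uS _ (expR_ge0 h); have s2 := uS _ (expR_ge0 (- h)).
  rewrite PtypicalE -s1 -s2 -nneseriesZl; last by move=> k _; rewrite lee_fin u0// expR_ge0.
  rewrite -nneseriesZl; last by move=> k _; rewrite lee_fin u0// expR_ge0.
  rewrite -nneseriesD => [|k _ _|k _ _]; last 2 first.
  - by rewrite -EFinM lee_fin mulr_ge0 ?u0 ?expR_ge0.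
  - by rewrite -EFinM lee_fin mulr_ge0 ?u0 ?expR_ge0.
  rewrite -nneseriesD => [|k _ _|k _ _]; last 2 first.
  - by rewrite lee_fin; case: ifP.
  - by rewrite -!EFinM -EFinD lee_fin addr_ge0// mulr_ge0 ?u0 ?expR_ge0.
  have -> : 1%E = (\sum_(k <oo) (u 1 k)%:E)%E by rewrite uS// subrr mulr0 oppr0 expR0.
  apply: lee_nneseries => k _; first by rewrite lee_fin u0.
  rewrite -!EFinM -!EFinD lee_fin /u expr1n mulr1.
  case: ifPn => [_|]; first by rewrite lerDl addr_ge0// !mulr_ge0 ?expR_ge0 ?exprn_ge0 ?expR_ge0.
  rewrite add0r /ok -ltNge => kl.
  have -> : c1 * (pmf k * expR h ^+ k) = pmf k * expR (h * (k%:R - lam - eta * lam)).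
    rewrite -expRM_natl mulrCA -expRD; congr (_ * expR _); ring.
  have -> : c2 * (pmf k * expR (- h) ^+ k) = pmf k * expR (- (h * (k%:R - lam + eta * lam))).
    rewrite -expRM_natl mulrCA -expRD; congr (_ * expR _); ring.
  rewrite -mulrDr ler_peMr//.
  have [kl'|lk] := leP lam k%:R.
    rewrite ger0_norm ?subr_ge0// in kl.
    apply: (@le_trans _ _ (expR (h * (k%:R - lam - eta * lam)))); last by rewrite lerDl expR_ge0.
    by apply: le_trans (expR_ge1Dx _); rewrite lerDl mulr_ge0 ?(ltW h0)// subr_ge0 ltW.
  rewrite ltr0_norm ?subr_lt0// in kl.
  apply: (@le_trans _ _ (expR (- (h * (k%:R - lam + eta * lam))))); last by rewrite lerDr expR_ge0.
  have kl' : 0 <= - (k%:R - lam + eta * lam) by lra.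
  by apply: le_trans (expR_ge1Dx _); rewrite lerDl -mulrN mulr_ge0 ?(ltW h0).
have e1 : c1 * expR (- (lam * (1 - expR h))) <= expR (- (lam * (eta * h / 2))).
  rewrite -expRD ler_expR.
  have hh : 0 <= h <= 2^-1 by rewrite (ltW h0) h1.
  have q := expR_quadratic_upper hh.
  have q1 : expR h - 1 - h - eta * h <= - (eta * h / 2).
    have : h * h <= eta / 4 * h by rewrite ler_wpM2r ?(ltW h0)// h2.
    rewrite mulr2n expr2 in q; lra.
  have : lam * (expR h - 1 - h - eta * h) <= lam * (- (eta * h / 2)) by rewrite ler_wpM2l.
  lra.
have e2 : c2 * expR (- (lam * (1 - expR (- h)))) <= expR (- (lam * (eta * h / 2))).
  rewrite -expRD ler_expR.
  have q := expRN_quadratic_upper (ltW h0).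
  have q1 : expR (- h) - 1 + h - eta * h <= - (eta * h / 2).
    have : h * h <= eta / 4 * h by rewrite ler_wpM2r ?(ltW h0)// h2.
    rewrite expr2 in q; have := mulr_gt0 eta0 h0; lra.
  have : lam * (expR (- h) - 1 + h - eta * h) <= lam * (- (eta * h / 2)) by rewrite ler_wpM2l.
  lra.
rewrite probability_setC; last exact: measurable_poisson_typical.
rewrite leeBlDr; last by rewrite fin_num_measure//; exact: measurable_poisson_typical.
apply: le_trans split_ge1 _; rewrite addeC leeD2r// -!EFinM -EFinD lee_fin; lra.
Qed.

End poisson_deviation.

(** * Almost sure jump counts of the Poisson environment *)

Section stable_environment.
Variable R : realType.
Notation mu := (@lebesgue_measure R).

Lemma integral_stable_tail (alpha c : R) : 0 < alpha -> 0 < c ->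
  (\int[mu]_(x in `[c, +oo[) (alpha * x `^ (-1 - alpha))%:E = (c `^ (- alpha))%:E)%E.
Proof.
move=> al0 c0.
have dF (x : R) : c <= x -> is_derive x 1 (fun x : R => - 1 * x `^ (- alpha)) (alpha * x `^ (-1 - alpha)).
  move=> cx; have x0 := lt_le_trans c0 cx.
  apply: (is_derive_eq (is_derive_scale (- 1) (is_derive1_powR (- alpha) x0))).
  by rewrite mulN1r mulNr opprK addrC.
have cP (p x : R) : c <= x -> {for x, continuous (fun x : R => x `^ p)}.
  move=> cx; apply/differentiable_continuous/derivable1_diffP.
  by have [] := is_derive1_powR p (lt_le_trans c0 cx).
rewrite (@ge0_continuous_FTC2y _ _ (fun x : R => - 1 * x `^ (- alpha)) c 0).
- by rewrite sub0e mulN1r EFinN oppeK.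
- by move=> x _; rewrite mulr_ge0 ?powR_ge0// ltW.
- apply/continuous_within_itvcyP; split.
    move=> x; rewrite in_itv/= andbT => /ltW cx; apply: cvgMr; exact: cP.
  by apply: cvg_at_right_filter; apply: cvgMr; exact: cP.
- rewrite -(mulr0 (- 1)); apply: cvgMr.
  apply/cvgr0Pnorm_lt => e e0; near=> x.
  have x0 : 0 < x by near: x; apply: nbhs_pinfty_gt; exact: num_real.
  have xe : (e^-1) `^ alpha^-1 < x by near: x; apply: nbhs_pinfty_gt; exact: num_real.
  rewrite ger0_norm ?powR_ge0// powRN -[ltRHS]invrK ltf_pV2 ?posrE ?invr_gt0 ?powR_gt0//.
  rewrite -[ltLHS]powRr1 ?invr_ge0 ?(ltW e0)// -(mulVf (lt0r_neq0 al0)) powRrM.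
  by rewrite gt0_ltr_powR ?nnegrE ?powR_ge0// ltW.
- by move=> x /ltW /dF[].
- by apply: cvg_at_right_filter; apply: cvgMr; exact: cP.
- move=> x; rewrite in_itv/= andbT => /ltW /dF[dx <-]; by rewrite derive1E.
Unshelve. all: by end_near. Qed.

Lemma stable_intensity_strip (alpha c : R) : 0 < alpha -> 0 < c ->
  stable_intensity alpha (`[c, +oo[ `*` `[0, 1]) = (c `^ (- alpha))%:E.
Proof.
move=> al0 c0; rewrite /stable_intensity.
pose h (x : R) : R := alpha * x `^ (-1 - alpha) * \1_(`[c, +oo[%classic : set R) x.
pose f (p : R * R) : \bar R := (h p.1 * \1_(`]0, 1]%classic : set R) p.2)%:E.
have mh : measurable_fun setT h.
  apply: measurable_funM; last by apply: measurable_indic; exact: measurable_itv.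
  apply: measurable_funM; first exact: measurable_cst.
  exact: measurable_powR.
have h0 (x : R) : 0 <= h x by rewrite !mulr_ge0 ?powR_ge0 ?indic_ge0// ltW.
have mf : measurable_fun setT f.
  apply/measurable_EFinP; apply: measurable_funM.
    exact: (measurableT_comp mh measurable_fst).
  apply: (measurableT_comp _ measurable_snd).
  by apply: measurable_indic; exact: measurable_itv.
have f0 p : (0 <= f p)%E by rewrite lee_fin mulr_ge0// indic_ge0.
rewrite integral_mkcond.
transitivity (\int[(mu \x mu)%E]_p f p)%E.
  apply: eq_integral.
  move=> [x y] _; rewrite patchE /f /h; case: ifPn.
    rewrite inE /= !in_itv/= andbT => -[[cx /andP[y0 y1]] [x0 y0']].
    by rewrite !indicE !mem_set ?mulr1//= in_itv/= ?andbT ?y0'.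
  rewrite notin_setE/= !in_itv/= !indicE !mem_setE !in_itv/= !andbT => nxy.
  case: (leP c x) => [cx|_]; last by rewrite mulr0 mul0r.
  case: (boolP (0 < y <= 1)) => [/andP[y0 y1]|_]; last by rewrite mulr0.
  exfalso; apply: nxy; split; last by split => //; exact: lt_le_trans cx.
  by split => //; rewrite y1 (ltW y0).
rewrite fubini_tonelli1//.
transitivity (\int[mu]_x (h x)%:E)%E.
  apply: eq_integral => x _; rewrite /fubini_F/f/=.
  under eq_integral do rewrite EFinM.
  rewrite ge0_integralZl//; last 2 first.
  - by apply/measurable_EFinP; apply: measurable_indic; exact: measurable_itv.
  - by rewrite lee_fin.
  rewrite integral_indic//.
  rewrite setIT.
  transitivity ((h x)%:E * lebesgue_measure (`]0%R, 1%R]%classic : set R))%E => //.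
  by rewrite lebesgue_measure_itv/= lte_fin ltr01 oppr0 adde0 mule1.
rewrite -integral_stable_tail// [RHS]integral_mkcond.
apply: eq_integral => x _; rewrite patchE /h indicE.
by case: ifP => _; rewrite ?mulr1 ?mulr0.
Qed.

(** By [stable_intensity_strip], the level above which k + 1 jumps are expected at locations in
    [0, 1]. *)
Definition size_grid (alpha : R) (k : nat) : R := k.+1%:R `^ (- alpha^-1).

Lemma size_gridK (alpha : R) k : 0 < alpha -> size_grid alpha k `^ (- alpha) = k.+1%:R.
Proof. by move=> al0; rewrite -powRrM mulrNN mulVf ?gt_eqF// powRr1. Qed.

Lemma size_grid_gt0 (alpha : R) k : 0 < size_grid alpha k.
Proof. by rewrite powR_gt0// ltr0n. Qed.

Context d (E : measurableType d) (P : probability E R).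
Variables (alpha : R) (gamma : E -> R -> R).
Hypothesis alpha0 : 0 < alpha.
Hypothesis gammaP : stable_jumps P alpha gamma.

Let count k (w : E) : \bar R :=
  counting (jump_points (gamma w) `&` (`[size_grid alpha k, +oo[ `*` `[0, 1])).

(** The Chernoff bounds at the levels of [size_grid] are geometric in k, so Borel-Cantelli applies
    along the grid. Each tolerance 1 / (n + 1) costs one null set, and countably many of them cover
    all eta. *)
Lemma jump_counts : {ae P, forall w : E, forall eta : R, 0 < eta ->
  exists k0 : nat, forall k, (k0 <= k)%N -> exists j : nat,
    count k w = j%:R%:E /\ `|j%:R - k.+1%:R| <= eta * k.+1%:R}.
Proof.
have [_ _ [mcount lawc _ _]] := gammaP.
have mstrip k : measurable (`[size_grid alpha k, +oo[ `*` `[0, 1] : set (R * R)).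
  by apply: measurableX; exact: measurable_itv.
have intE k : stable_intensity alpha (`[size_grid alpha k, +oo[ `*` `[0, 1]) = (k.+1%:R)%:E.
  by rewrite stable_intensity_strip ?size_grid_gt0// size_gridK.
have mc k : measurable_fun setT (count k) by exact: mcount.
have law k (j : nat) : P [set w | count k w = j%:R%:E] = poisson_law (k.+1%:R : R) [set j].
  have := lawc _ j (mstrip k); rewrite intE ltry => /(_ isT) => h.
  exact: h.
suff H (n : nat) : {ae P, forall w : E, exists k0 : nat, forall k, (k0 <= k)%N -> exists j : nat,
    count k w = j%:R%:E /\ `|j%:R - k.+1%:R| <= (n.+1%:R^-1 * k.+1%:R : R)}.
  have := ae_foralln H; apply: filterS => w Hw eta eta0.
  have [n _ nP] := near_infty_natSinv_lt (PosNum eta0).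
  have [k0 k0P] := Hw n; exists k0 => k kk; have [j [cj jb]] := k0P k kk.
  exists j; split => //; apply: le_trans jb _; rewrite ler_wpM2r//.
  by have := nP n (leqnn n) => /= /ltW.
have n0 : (0 : R) < n.+1%:R^-1 by rewrite invr_gt0 ltr0n.
pose B k := ~` poisson_typical (count k) (k.+1%:R : R) n.+1%:R^-1.
have mB k : measurable (B k) by apply: measurableC; exact: measurable_poisson_typical.
pose q : R := expR (- (n.+1%:R^-1 * Num.min 2^-1 (n.+1%:R^-1 / 4) / 2)).
have q1 : q < 1.
  by rewrite expR_lt1 oppr_lt0 divr_gt0// mulr_gt0// lt_min invr_gt0 ltr0n/= divr_gt0.
have PB k : (P (B k) <= (2 * q * q ^+ k)%:E)%E.
  apply: le_trans (poisson_deviation (mc k) (ler0n _ _) n0 (law k)) _.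
  have qE : q * q ^+ k = expR (- (k.+1%:R * (n.+1%:R^-1 * Num.min 2^-1 (n.+1%:R^-1 / 4) / 2))).
    by rewrite -exprS -expRM_natl mulrN.
  by rewrite lee_fin -qE mulrA.
have sB : (\sum_(k <oo) P (B k) < +oo)%E.
  apply: (@le_lt_trans _ _ (\sum_(k <oo) (geometric (2 * q) q k)%:E)%E).
    by apply: lee_nneseries.
  rewrite nneseries_limn ?ltry//.
  - by move=> k; rewrite /= mulr_ge0 ?mulr_ge0 ?exprn_ge0 ?expR_ge0.
  - by apply: is_cvg_geometric_series; rewrite ger0_norm ?expR_ge0.
have L0 := lim_sup_set_cvg0 mB sB.
exists (lim_sup_set B); split => //.
  by apply: bigcapT_measurable => k; apply: bigcup_measurable.
move=> w /= nw k _; apply: contrapT => nk; apply: nw.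
exists k => j kj; apply: contrapT => nj; apply: nk; exists j => //.
Qed.

End stable_environment.

(** * Enumeration of the jumps in [0, 1] *)

Section jump_enumeration.
Variable R : realType.

Lemma counting_esum (T : choiceType) (A : set T) (r : R) : counting A = r%:E ->
  finite_set A /\ (\esum_(x in A) (1 : \bar R) = r%:E)%E.
Proof.
rewrite /counting; case: ifPn => // /asboolP fA <-; split => //.
rewrite esum_fset// fsbig_finite//= big_const_seq count_predT.
by elim: (size _) => //= n ->; rewrite -EFinD nat1r.
Qed.

Lemma esum_one_le (T : choiceType) (A B : set T) : A `<=` B ->
  (\esum_(x in A) (1 : \bar R) <= \esum_(x in B) (1 : \bar R))%E.
Proof.
move=> AB; rewrite esum_mkcond [leRHS]esum_mkcond; apply: le_esum => x _.
by case: ifPn => [/set_mem /AB xB|_]; [rewrite mem_set|case: ifP].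
Qed.

Variables (alpha : R) (g : R -> R).
Hypothesis alpha0 : 0 < alpha.
Let pts k : set (R * R) := jump_points g `&` (`[size_grid alpha k, +oo[ `*` `[0, 1]).
Hypothesis ptsP : forall eta : R, 0 < eta ->
  exists k0 : nat, forall k, (k0 <= k)%N -> exists j : nat,
    counting (pts k) = (j%:R : R)%:E /\ `|j%:R - k.+1%:R| <= eta * k.+1%:R.

Let X := [set x : R | 0 <= x <= 1 /\ 0 < g x].

Let ptsE k x : 0 <= x <= 1 -> size_grid alpha k <= g x -> pts k (g x, x).
Proof.
move=> x01 gx; split; last by split => //=; rewrite in_itv/= ?andbT.
by split => //=; apply: lt_le_trans gx; exact: size_grid_gt0.
Qed.

Let ptsX k p : pts k p -> X p.2 /\ p = (g p.2, p.2).
Proof.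
case: p => y x [] /= [/= y0 yE] [] /=; rewrite !in_itv/= => _ x01.
by split; [split => //; rewrite -yE|rewrite -yE].
Qed.

Lemma size_grid_small (y : R) (k0 : nat) : 0 < y -> exists2 k, (k0 <= k)%N & size_grid alpha k <= y.
Proof.
move=> y0; pose M := y `^ (- alpha).
have M0 : 0 <= M by rewrite powR_ge0.
exists (maxn k0 (Num.truncn M)); first by rewrite leq_maxl.
set k := maxn _ _; have Mk : M <= k.+1%:R.
  apply: ltW; apply: lt_le_trans (truncnS_gt M) _.
  by rewrite ler_nat ltnS leq_maxr.
have -> : y = M `^ (- alpha^-1) by rewrite -powRrM mulrNN mulfV ?gt_eqF// powRr1// ltW.
rewrite /size_grid !powRN lef_pV2 ?posrE ?powR_gt0 ?ltr0n//.
by rewrite ge0_ler_powR ?nnegrE ?invr_ge0 ?(ltW alpha0).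
Qed.

Let X_countable : countable X.
Proof.
have [k0 k0P] := ptsP ltr01.
apply: (@sub_countable _ _ _ (\bigcup_k (snd @` pts (k0 + k)%N))).
  apply: subset_card_le => x [x01 gx].
  have [k kk gk] := size_grid_small k0 gx.
  exists (k - k0)%N => //; exists (g x, x) => //; rewrite subnKC//; exact: ptsE.
apply: bigcup_countable => // k _; apply: finite_set_countable; apply: finite_image.
have [j [cj _]] := k0P (k0 + k)%N (leq_addr _ _).
by have [] := counting_esum cj.
Qed.

(** The counts along the grid are eventually at least half of k + 1, which no finite set allows;
    together with countability this yields a bijection with [nat]. *)
Let X_infinite : ~ finite_set X.
Proof.
move=> fX; have h2 : (0 : R) < 2^-1 by rewrite invr_gt0.
have [k0 k0P] := ptsP h2.
pose B := (fun x => (g x, x)) @` X; have fB : finite_set B by exact: finite_image.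
pose n := size (finmap.enum_fset (fset_set B)).
have nE : (\esum_(x in B) (1 : \bar R) = (n%:R)%:E)%E.
  by have [] := @counting_esum _ B n%:R; rewrite // /counting asboolT.
pose k := maxn k0 (n * 2)%N.
have [j [cj jb]] := k0P k (leq_maxl _ _).
have [_ jE] := counting_esum cj.
have jn : (j%:R : R) <= n%:R.
  rewrite -lee_fin -jE -nE; apply: esum_one_le => p /ptsX[Xp pE].
  by exists p.2.
have nk : (n * 2)%:R <= k%:R :> R by rewrite ler_nat leq_maxr.
move: jb; rewrite ler_norml => /andP[jb _]; rewrite natrM in nk; rewrite -[k.+1%:R]natr1 in jb.
have : (n%:R : R) * 2 <= k%:R by []; move: jb jn; set kk : R := k%:R; lra.
Qed.

(** Between two levels of the grid the counting function is controlled by monotonicity, and the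
    counts at neighbouring levels have a ratio tending to 1. *)
Lemma jump_enumeration : exists e : nat -> R,
  [/\ injective e, (forall k, 0 <= e k <= 1) /\ (forall k, 0 < g (e k)),
    (forall x, 0 <= x <= 1 -> 0 < g x -> exists k, e k = x),
    (forall c, 0 < c -> (exceed (fun k => g (e k)) c < +oo)%E) &
    c `^ alpha * fine (exceed (fun k => g (e k)) c) @[c --> 0^'+] --> (1 : R)].
Proof.
have := eq_card_nat X_countable X_infinite; rewrite card_eq_sym => /card_set_bijP[e [eX einj esurj]].
have eX' k : X (e k) by exact: eX.
have inj : injective e by move=> i j ij; apply: einj => //; rewrite ?inE.
set gam := fun k => g (e k).
pose cnt (c : R) : \bar R := (\sum_(k <oo) ((c <= gam k)%R%:R)%:E)%E.
have cntE k : (\esum_(x in pts k) (1 : \bar R) = cnt (size_grid alpha k))%E.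
  rewrite (@reindex_esum _ _ _ [set i | size_grid alpha k <= gam i] _ (fun i => (gam i, e i))).
    rewrite /cnt nneseries_esumT; last by move=> i; rewrite lee_fin.
    rewrite esum_mkcond; apply: eq_esum => i _.
    by case: leP => h; [rewrite mem_set|rewrite memNset//=; apply/negP; rewrite -ltNge].
  split => [i /= gi|i i' _ _ [_]|[y x]].
  - by apply: ptsE => //; have [] := eX' i.
  - exact: inj.
  - move=> pyx; have [[x01 gx] [yE]] := ptsX pyx.
    have [i _ eix] := esurj x (conj x01 gx); exists i; last by rewrite /gam eix yE.
    by case: pyx => _ []; rewrite /gam /= eix in_itv/= andbT -yE.
have cnt_le c k : size_grid alpha k < c -> (exceed gam c <= cnt (size_grid alpha k))%E.
  move=> kc; apply: lee_nneseries => i _; rewrite lee_fin// ler_nat.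
  by case: ltP => // cg; rewrite (ltW (lt_trans kc cg)).
exists e; split => //.
- by split => k; have [] := eX' k.
- by move=> x x01 gx; have [k _ <-] := esurj x (conj x01 gx); exists k.
- move=> c c0; have [k0 k0P] := ptsP ltr01.
  have c20 : 0 < c / 2 by rewrite divr_gt0.
  have [k kk gk] := size_grid_small k0 c20.
  have [j [cj _]] := k0P k kk; have [_ jE] := counting_esum cj.
  apply: le_lt_trans (cnt_le c k _) _; first by apply: le_lt_trans gk _; lra.
  by rewrite -cntE jE ltry.
have cnt_ge c k : c < size_grid alpha k -> (cnt (size_grid alpha k) <= exceed gam c)%E.
  move=> kc; apply: lee_nneseries => i _; rewrite lee_fin// ler_nat.
  by case: (leP (size_grid alpha k)) => // cg; rewrite (lt_le_trans kc cg).
apply/cvgrPdist_lt => eps eps0.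
pose eta := Num.min (eps / 4) 2^-1.
have eta0 : 0 < eta by rewrite lt_min divr_gt0//= invr_gt0.
have eta1 : eta <= 2^-1 by rewrite ge_min lexx orbT.
have eta2 : eta <= eps / 4 by rewrite ge_min lexx.
have [k0 k0P] := ptsP eta0.
(* Once c^(-alpha) exceeds [M], the grid index n is at least k0 + 2 and twice c^alpha is less than
   eta. *)
pose M : R := 2 / eta + k0%:R + 3.
have M0 : 0 < M by rewrite addr_gt0// ltr_wpDr// divr_gt0.
near=> c.
have c0 : 0 < c by near: c; exact: nbhs_right_gt.
have cM : c < M `^ (- alpha^-1) by near: c; apply: nbhs_right_lt; rewrite powR_gt0.
pose x := c `^ alpha; have x0 : 0 < x by rewrite powR_gt0.
have xM : M < x^-1.
  rewrite -[M]invrK ltf_pV2 ?posrE ?invr_gt0//.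
  have -> : M^-1 = (M `^ (- alpha^-1)) `^ alpha.
    by rewrite -powRrM mulNr mulVf ?gt_eqF// powR_inv1// ltW.
  by rewrite gt0_ltr_powR ?nnegrE ?powR_ge0 ?(ltW c0).
pose n := Num.truncn x^-1.
have /andP[nx xn] : n%:R <= x^-1 < n.+1%:R by apply: truncn_itv; rewrite invr_ge0 ltW.
have nM : M - 1 < n%:R by rewrite -natr1 in xn; lra.
have p0 : 0 <= 2 / eta by rewrite divr_ge0// ltW.
have n2 : (k0 + 2 <= n)%N by rewrite -(ler_nat R) natrD; rewrite /M in nM; lra.
have gcmp k : (size_grid alpha k < c) = (x^-1 < k.+1%:R).
  rewrite -(invrK k.+1%:R) ltf_pV2 ?posrE ?invr_gt0 ?ltr0n//.
  have -> : k.+1%:R^-1 = size_grid alpha k `^ alpha :> R.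
    by rewrite -powRrM mulNr mulVf ?gt_eqF// powR_inv1.
  apply/idP/idP => h; first by rewrite gt0_ltr_powR ?nnegrE ?powR_ge0 ?(ltW c0).
  rewrite ltNge; apply/negP => ch; move: h; rewrite ltNge => /negP; apply.
  by rewrite ge0_ler_powR ?nnegrE ?powR_ge0 ?(ltW c0) ?(ltW alpha0).
have gcmp' k : (c < size_grid alpha k) = (k.+1%:R < x^-1).
  rewrite -{1}(invrK k.+1%:R) ltf_pV2 ?posrE ?invr_gt0 ?ltr0n//.
  have -> : k.+1%:R^-1 = size_grid alpha k `^ alpha :> R.
    by rewrite -powRrM mulNr mulVf ?gt_eqF// powR_inv1.
  apply/idP/idP => h; first by rewrite gt0_ltr_powR ?nnegrE ?powR_ge0 ?(ltW c0).
  rewrite ltNge; apply/negP => ch; move: h; rewrite ltNge => /negP; apply.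
  by rewrite ge0_ler_powR ?nnegrE ?powR_ge0 ?(ltW c0) ?(ltW alpha0).
have [j [cj]] : exists j : nat, counting (pts n) = (j%:R : R)%:E /\ `|j%:R - n.+1%:R| <= eta * n.+1%:R.
  by apply: k0P; apply: leq_trans n2; rewrite leq_addr.
rewrite ler_norml => /andP[_ ju].
(* n - 2 rather than n - 1: [cnt_ge] wants c strictly below the level, that is k + 1 < 1/x, and n =
   1/x is possible. *)
have [i [ci]] : exists j : nat, counting (pts (n - 2)%N) = (j%:R : R)%:E /\ `|j%:R - (n - 2).+1%:R| <= eta * (n - 2).+1%:R.
  by apply: k0P; rewrite leq_subRL 1?addnC//; apply: leq_trans n2; rewrite leq_addl.
rewrite ler_norml => /andP[il _].
have [_ jE] := counting_esum cj; have [_ iE] := counting_esum ci.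
have u := cnt_le c n; rewrite gcmp xn -cntE jE in u.
have l := cnt_ge c (n - 2)%N; rewrite gcmp' -cntE iE in l.
have n1E : (n - 2).+1%:R = n%:R - 1 :> R.
  by rewrite -natr1 natrB; [ring|apply: leq_trans n2; rewrite leq_addl].
have /l {}l : (n - 2).+1%:R < x^-1 by rewrite n1E; lra.
have {}u := u isT.
have exE : (fine (exceed gam c))%:E = exceed gam c.
  by rewrite fineK// ge0_fin_numE ?exceed_ge0// (le_lt_trans u)// ltry.
rewrite -exE !lee_fin in u l; set v := fine _ in u l *.
rewrite n1E in il; rewrite -natr1 in ju xn.
rewrite -/x.
have nn0 : 0 < n%:R :> R by rewrite /M in nM; have : (0 : R) <= k0%:R by []; lra.
have xn' : x * n%:R <= 1 by rewrite mulrC -ler_pdivlMr// div1r.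
have xn1 : 1 < x * (n%:R + 1) by rewrite mulrC -ltr_pdivrMr// div1r.
have xe : x * 2 < eta.
  have xM' : 2 / eta < x^-1.
    by rewrite /M in xM; have : (0 : R) <= k0%:R by []; lra.
  have xe0 : 0 < x * eta by rewrite mulr_gt0.
  have : 2 / eta * (x * eta) < x^-1 * (x * eta) by rewrite ltr_pM2r.
  have -> : 2 / eta * (x * eta) = x * 2 by field; rewrite gt_eqF.
  by rewrite mulKf ?gt_eqF.
have up : x * v <= (1 + eta) * (1 + eta).
  have h1 : v <= (1 + eta) * (n%:R + 1) by lra.
  have h2 : x * v <= x * ((1 + eta) * (n%:R + 1)) by rewrite ler_wpM2l// ltW.
  have h3 : x * (n%:R + 1) <= 1 + eta by lra.
  have : (1 + eta) * (x * (n%:R + 1)) <= (1 + eta) * (1 + eta) by rewrite ler_wpM2l//; lra.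
  lra.
have lo : (1 - eta) * (1 - eta) <= x * v.
  have h1 : (1 - eta) * (n%:R - 1) <= v by lra.
  have h2 : x * ((1 - eta) * (n%:R - 1)) <= x * v by rewrite ler_wpM2l// ltW.
  have h3 : 1 - eta <= x * (n%:R - 1) by lra.
  have : (1 - eta) * (1 - eta) <= (1 - eta) * (x * (n%:R - 1)) by rewrite ler_wpM2l//; lra.
  lra.
have q : eta * eta <= eta * 2^-1 by rewrite ler_wpM2l// ltW.
rewrite ltr_norml; apply/andP; split; nra.
Unshelve. all: by end_near. Qed.

End jump_enumeration.

(** * Paths of the K process *)

Section clock_path.
Variable R : realType.
Variables (c : nat -> R) (n : nat -> R -> nat) (h : nat -> nat -> R).
Hypothesis c0 : forall k, 0 < c k.
Hypothesis n0 : forall k, n k 0 = 0%N.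
Hypothesis n_mono : forall k u v, 0 <= u -> u <= v -> (n k u <= n k v)%N.
Hypothesis n_right : forall k r, 0 <= r -> \forall u \near r^'+, n k u = n k r.
Hypothesis h0 : forall k i, (1 <= i)%N -> 0 <= h k i.

Definition holding (k m : nat) : R := \sum_(1 <= i < m.+1) h k i.

(** The weights are an argument so that the same facts hold for the truncated weights of the small
    sites. *)
Definition path_clock (w : nat -> R) (u : R) : \bar R :=
  (\sum_(k <oo) (w k * holding k (n k u))%:E)%E.

Notation G := (path_clock c).

Lemma path_holding_ge0 k m : 0 <= holding k m.
Proof.
rewrite /holding big_nat_cond; apply: sumr_ge0 => i /andP[/andP[i1 _] _]; exact: h0.
Qed.

Lemma holding_mono k m m' : (m <= m')%N -> holding k m <= holding k m'.
Proof.
move=> mm; rewrite /holding [leRHS](@big_cat_nat _ _ _ m.+1)//= lerDl.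
rewrite big_nat_cond; apply: sumr_ge0 => i /andP[/andP[i1 _] _].
by apply: h0; exact: leq_trans i1.
Qed.

Section weights.
Variable w : nat -> R.
Hypothesis w0 : forall k, 0 <= w k.

Let term0 k m : (0 <= (w k * holding k m)%:E)%E.
Proof. by rewrite lee_fin mulr_ge0// path_holding_ge0. Qed.

Lemma path_clock_ge0 u : (0 <= path_clock w u)%E.
Proof. by apply: nneseries_ge0 => k _ _. Qed.

Lemma path_clock_mono u v : 0 <= u -> u <= v -> (path_clock w u <= path_clock w v)%E.
Proof.
move=> u0 uv; apply: lee_nneseries => k _ //.
by rewrite lee_fin ler_wpM2l// holding_mono// n_mono.
Qed.

(* Finitely many terms carry all but e of the mass at a later time, and those
   are locally constant to the right. *)
Lemma path_clock_right (r r1 e : R) : 0 <= r -> r < r1 -> (path_clock w r1 < +oo)%E -> 0 < e ->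
  exists2 v, r < v & (path_clock w v <= path_clock w r + e%:E)%E.
Proof.
move=> r0 rr1 fin e0; have e0E : (0 < e%:E)%E by rewrite lte_fin.
have tail := nneseries_tail_cvg fin (fun k _ => term0 k (n k r1)).
have [m _ mP] : \forall m \near \oo, (\sum_(m <= k <oo) (w k * holding k (n k r1))%:E < e%:E)%E.
  exact: tail (open_ereal_lt' e0E).
have : \forall u \near r^'+, forall k : 'I_m, n k u = n k r.
  by apply: filter_forall => k; exact: n_right.
move=> near_const.
have [v [rv vr1 vc]] : exists v, [/\ r < v, v < r1 & forall k : 'I_m, n k v = n k r].
  near r^'+ => v; exists v; split.
  - by near: v; exact: nbhs_right_gt.
  - by near: v; exact: nbhs_right_lt.
  - by near: v.
exists v => //; have v0 : 0 <= v by rewrite ltW// (le_lt_trans r0).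
rewrite {1}/path_clock (nneseries_split 0 m)// add0n.
apply: leeD.
  apply: (@le_trans _ _ (\sum_(0 <= k < m) (w k * holding k (n k r))%:E)%E).
    by rewrite !big_mkord; apply: lee_sum => k _; rewrite vc.
  by apply: nneseries_lim_ge => k _ _.
apply: ltW; apply: le_lt_trans (mP m (leqnn m)).
apply: lee_nneseries => k _ //; rewrite lee_fin ler_wpM2l// holding_mono// n_mono// ltW.
Unshelve. all: by end_near. Qed.

End weights.

(** Right continuity of the count: the infimum that defines a finite event time is attained. *)
Lemma event_time_le k j u : 0 <= u -> (event_time (n k) j <= u%:E)%E = (j <= n k u)%N.
Proof.
move=> u0; apply/idP/idP => [le|jn]; last by apply: ereal_inf_lbound; exists u.
rewrite leqNgt; apply/negP => lt.
near u^'+ => v.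
have uv : u < v by near: v; exact: nbhs_right_gt.
have nv : n k v = n k u by near: v; exact: n_right.
suff : (v%:E <= event_time (n k) j)%E.
  by move=> /le_trans/(_ le); rewrite lee_fin leNgt uv.
apply: le_ereal_inf_tmp => _ [r [r0 jr] <-]; rewrite lee_fin leNgt; apply/negP => rv.
by have := leq_trans jr (n_mono k r0 (ltW rv)); rewrite nv leqNgt lt.
Unshelve. all: by end_near. Qed.

Definition rings k r := exists2 j, (1 <= j)%N & event_time (n k) j = r%:E.

Lemma rings_gt0 k r : rings k r -> 0 < r.
Proof.
move=> [j j1 jr]; have r0 : 0 <= r.
  rewrite -lee_fin -jr; apply: le_ereal_inf_tmp => _ [u [u0 _] <-]; by rewrite lee_fin.
rewrite lt_neqAle r0 andbT; apply/negP => /eqP r00.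
by move: jr => /eqP; rewrite eq_le event_time_le// -r00 n0 leqNgt j1.
Qed.

Lemma ringsP k r : rings k r -> 0 < r /\ forall u, 0 <= u -> u < r -> (n k u < n k r)%N.
Proof.
move=> kr; have r0 := rings_gt0 kr; split => // u u0 ur; case: kr => j j1 jr.
have : (j <= n k r)%N by rewrite -event_time_le ?jr// ltW.
apply: leq_trans; rewrite ltnNge -event_time_le// jr lee_fin -ltNge//.
Qed.

(** The witness is the time of the last event before r, or 0 if there is none: the count keeps its
    value at r from there on. *)
Lemma not_rings k r : 0 < r -> ~ rings k r -> exists u, [/\ 0 <= u, u < r & forall v, u <= v -> v < r -> n k v = n k r].
Proof.
move=> r0 nr; have [m0|m0] := posnP (n k r).
  exists 0; split => // v v0 vr; apply/eqP; rewrite eqn_leq n_mono ?(ltW vr)// m0//.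
have : (event_time (n k) (n k r) <= r%:E)%E by rewrite event_time_le// ltW.
have e0 : (0%:E <= event_time (n k) (n k r))%E.
  by apply: le_ereal_inf_tmp => _ [u [u0 _] <-]; rewrite lee_fin.
case E : (event_time (n k) (n k r)) e0 => [u| |]// u0; rewrite lee_fin le_eqVlt => /predU1P[ur|ur].
  by exfalso; apply: nr; exists (n k r) => //; rewrite E ur.
exists u; split => // v uv vr; apply/eqP; rewrite eqn_leq n_mono ?(le_trans _ uv) ?(ltW vr)//=.
by rewrite -event_time_le ?(le_trans _ uv)// E lee_fin.
Qed.

(** [F] is finite, so none of its sites moves on a common interval ending at r. The increment of the
    clock there comes from the other sites, which contribute at most their whole total at r. *)
Lemma path_clock_jump (F : pred nat) (K : nat) (r : R) : 0 < r ->
  (forall k, F k -> (k < K)%N) -> (forall k, F k -> ~ rings k r) ->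
  exists2 u, 0 <= u < r & forall v, u <= v -> v < r ->
    (G r <= G v + path_clock (fun k => if F k then 0%R else c k) r)%E.
Proof.
move=> r0 FK nF.
have /choice[f fP] : forall k, exists u, 0 <= u < r /\ (F k -> forall v, u <= v -> v < r -> n k v = n k r).
  move=> k; have [Fk|_] := boolP (F k); last by exists 0; split => //; rewrite lexx.
  have [u [u0 ur uP]] := not_rings r0 (nF k Fk); exists u; split => //; exact/andP.
pose u := \big[Num.max/0]_(k < K) f k.
exists u.
  apply/andP; split; first by rewrite /u; elim/big_ind : _ => [//|x y x0 y0|k _]; [rewrite le_max x0|have [/andP[]] := fP k].
  rewrite /u; elim/big_ind : _ => // [x y xr yr|k _]; first by rewrite gt_max xr.
  by have [/andP[]] := fP k.
move=> v uv vr; rewrite -nneseriesD => [|k _ _|k _ _]; last 2 first.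
- by rewrite lee_fin mulr_ge0 ?path_holding_ge0 ?ltW.
- by rewrite lee_fin mulr_ge0 ?path_holding_ge0//; case: ifP => // _; rewrite ltW.
apply: lee_nneseries => k _; first by rewrite lee_fin mulr_ge0 ?path_holding_ge0 ?ltW.
rewrite -EFinD lee_fin; case: ifPn => [Fk|_]; last first.
  by rewrite lerDr mulr_ge0 ?path_holding_ge0 ?ltW.
rewrite mul0r addr0; have [_ /(_ Fk v)->//] := fP k.
apply: le_trans uv; have kK := FK k Fk.
by rewrite /u (bigmaxD1 (Ordinal kK))//= le_max lexx.
Qed.

(** The clock is nondecreasing, so its left limit is a supremum; the limit condition in [K_at]
    becomes one about all earlier times. *)
Lemma path_clock_left_lim (r : R) (t : \bar R) : 0 < r ->
  (lim (G u @[u --> r^'-]) <= t)%E <-> (forall u : R, 0 <= u -> u < r -> (G u <= t)%E).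
Proof.
move=> r0; have c0' k := ltW (c0 k).
pose S := ereal_sup ((G \o -%R) @` `]- r, 0[).
have cv : G u @[u --> r^'-] --> S.
  apply/cvg_at_leftNP; apply: (@nonincreasing_at_right_cvge _ (G \o -%R) (- r) (BLeft 0)).
    by rewrite bnd_simp oppr_lt0.
  move=> x y; rewrite !in_itv/= => /andP[_ x0] /andP[_ y0] xy.
  by apply: path_clock_mono => //; rewrite ?lerN2// oppr_ge0 ltW.
rewrite (cvg_lim _ cv)//; split => [St u u0 ur|Ht].
  (* The supremum runs over the open interval ]0, r[, so time 0 is compared with r / 2. *)
  have [->|u0'] := eqVneq u 0.
    apply: (@le_trans _ _ (G (r / 2))); first by apply: path_clock_mono => //; rewrite divr_ge0// ltW.
    apply: le_trans St; apply: ereal_sup_ubound; exists (- (r / 2)) => /=; rewrite ?opprK//.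
    by rewrite in_itv/= oppr_lt0 divr_gt0// ltrN2 ltr_pdivrMr// ltr_pMr// ltr1n.
  apply: le_trans St; apply: ereal_sup_ubound; exists (- u) => /=; rewrite ?opprK//.
  by rewrite in_itv/= ltrN2 ur oppr_lt0 lt_neqAle eq_sym u0'.
apply: ge_ereal_sup => _ [x xr <-]; move: xr; rewrite /= in_itv/= => /andP[rx x0].
by apply: Ht; rewrite ?oppr_ge0 ?(ltW x0)// ltrNl.
Qed.

Definition site_at (t : R) (k : nat) : Prop := exists j r,
  [/\ (1 <= j)%N, event_time (n k) j = r%:E,
      (lim (G u @[u --> r^'-]) <= t%:E)%E & (t%:E < G r)%E].

Lemma site_atP t k : site_at t k <-> exists r,
  [/\ rings k r, (forall u : R, 0 <= u -> u < r -> (G u <= t%:E)%E) & (t%:E < G r)%E].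
Proof.
split=> [[j [r [j1 jr l g]]]|[r [[j j1 jr] l g]]].
  have kr : rings k r by exists j.
  by exists r; split => //; apply/path_clock_left_lim => //; exact: rings_gt0 kr.
exists j, r; split => //; apply/path_clock_left_lim => //.
by apply: (@rings_gt0 k); exists j.
Qed.

Hypothesis G_fin : forall u, 0 <= u -> (G u < +oo)%E.

(** Only dyadic times are tested so that this is an event, namely the complement of [hit] for exp(-l
    clock). *)
Definition dyadic_gap (t1 t2 : R) : Prop := forall i m : nat,
  let q : R := m%:R * 2 ^- i in (G q <= t1%:E)%E \/ (t2%:E < G q)%E.

Lemma dyadic_between (x y : R) : 0 <= x -> x < y -> exists i m : nat, x < (m%:R * 2 ^- i : R) < y.
Proof.
move=> x0 xy; have yx : 0 < y - x by rewrite subr_gt0.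
have [i _ iP] : \forall i \near \oo, (2 ^- i : R) < y - x.
  have : (2^-1 : R) ^+ i @[i --> \oo] --> (0 : R).
    by apply: cvg_expr; rewrite ger0_norm ?invr_ge0// invf_lt1// ltr1n.
  move/cvgr0_norm_lt => /(_ _ yx); apply: filterS => i /=.
  by rewrite ger0_norm ?exprn_ge0 ?invr_ge0// exprVn.
have i2 : (0 : R) < 2 ^+ i by rewrite exprn_gt0.
pose m := (Num.truncn (x * 2 ^+ i)).+1.
have /andP[mx xm] : (Num.truncn (x * 2 ^+ i))%:R <= x * 2 ^+ i < m%:R.
  by apply: truncn_itv; rewrite mulr_ge0// ltW.
exists i, m; apply/andP; split; first by rewrite ltr_pdivlMr.
have h1 : m%:R * 2 ^- i <= x + 2 ^- i.
  by rewrite /m -natr1 mulrDl mul1r lerD2r ler_pdivrMr.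
apply: le_lt_trans h1 _; have := iP i (leqnn i); lra.
Qed.

Let cw k := ltW (c0 k).

(* Right continuity turns the dyadic gap into a gap at every time. *)
Lemma dyadic_gap_right (t1 t2 r : R) : dyadic_gap t1 t2 -> 0 <= r -> (t1%:E < G r)%E -> (t2%:E <= G r)%E.
Proof.
move=> gap r0 tr; rewrite leNgt; apply/negP => rt.
have Gr : (G r \is a fin_num).
  by rewrite ge0_fin_numE ?path_clock_ge0// (lt_le_trans rt)// leey.
have e0 : 0 < (t2 - fine (G r)) by rewrite subr_gt0 -lte_fin fineK.
have r1 : r < r + 1 by rewrite ltrDl.
have [v rv vG] := path_clock_right cw r0 r1 (G_fin (addr_ge0 r0 ler01)) e0.
have [i [m /andP[rq qv]]] := dyadic_between r0 rv.
have q0 : (0 : R) <= m%:R * 2 ^- i by rewrite ltW// (le_lt_trans r0).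
have [q1|q2] := gap i m.
  by have := le_trans (path_clock_mono cw r0 (ltW rq)) q1; rewrite leNgt tr.
have := lt_le_trans q2 (le_trans (path_clock_mono cw q0 (ltW qv)) vG).
by rewrite -{1}(fineK Gr) -EFinD addrC subrK ltxx.
Qed.

(** The margin t2 < t2' compensates for the loss of strictness in [dyadic_gap_right]. *)
Lemma site_at_gap (t1 t2 t2' : R) k : t1 <= t2 -> t2 < t2' -> dyadic_gap t1 t2' ->
  site_at t1 k <-> site_at t2 k.
Proof.
move=> t12 t22 gap; rewrite !site_atP; split=> -[r [kr l g]]; exists r; split => //.
- by move=> u u0 ur; apply: le_trans (l u u0 ur) _; rewrite lee_fin.
- apply: lt_le_trans (dyadic_gap_right gap (ltW (rings_gt0 kr)) g).
  by rewrite lte_fin.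
- move=> u u0 ur; have [i [m /andP[uq qr]]] := dyadic_between u0 ur.
  have q0 : (0 : R) <= m%:R * 2 ^- i by rewrite ltW// (le_lt_trans u0).
  have [q1|q2] := gap i m; first by apply: le_trans (path_clock_mono cw u0 (ltW uq)) q1.
  have := lt_le_trans q2 (l _ q0 qr); rewrite lte_fin => ?; exfalso; lra.
- by apply: le_lt_trans g; rewrite lee_fin.
Qed.

(** At the first time r from which the clock is beyond t, it leaps over a gap of length 2 eta. The
    sites outside [F] contribute at most eta up to rho, so some site of [F] must ring at r, and
    every site occupied at t rings at that same r. *)
Lemma site_at_crossing (F : pred nat) (K : nat) (t eta rho : R) : 0 <= t -> 0 < eta ->
  (forall k, F k -> (k < K)%N) -> 0 <= rho -> (t%:E < G rho)%E ->
  dyadic_gap t (t + eta *+ 2) ->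
  (path_clock (fun k => if F k then 0%R else c k) rho <= eta%:E)%E ->
  exists r, [/\ 0 < r <= rho, (forall k, site_at t k -> rings k r),
    (exists2 k, F k & site_at t k), (forall u : R, 0 <= u -> u < r -> (G u <= t%:E)%E)
    & ((t + eta *+ 2)%:E <= G r)%E].
Proof.
move=> t0 eta0 FK rho0 trho gap small.
pose S := [set u : R | 0 <= u /\ (t%:E < G u)%E].
have S0 : S !=set0 by exists rho.
have Slb : lbound S 0 by move=> u [].
have hS : has_inf S by split => //; exists 0.
pose r := inf S.
have r0 : 0 <= r by apply: lb_le_inf.
have below u : 0 <= u -> u < r -> (G u <= t%:E)%E.
  move=> u0 ur; rewrite leNgt; apply/negP => tu.
  have : r <= u by apply: ge_inf; [exists 0|split].
  by rewrite leNgt ur.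
have above u : r < u -> (t%:E < G u)%E.
  rewrite -subr_gt0 => ru; have [v [v0 tv] vu] := inf_adherent ru hS.
  apply: lt_le_trans tv _; apply: path_clock_mono => //; move: vu; rewrite addrC subrK => /ltW//.
have Gr : ((t + eta *+ 2)%:E <= G r)%E.
  rewrite leNgt; apply/negP => rt.
  have Gf : (G r \is a fin_num).
    by rewrite ge0_fin_numE ?path_clock_ge0// (lt_le_trans rt)// leey.
  have e0 : 0 < t + eta *+ 2 - fine (G r) by rewrite subr_gt0 -lte_fin fineK.
  have r1 : r < r + 1 by rewrite ltrDl.
  have [v rv vG] := path_clock_right cw r0 r1 (G_fin (addr_ge0 r0 ler01)) e0.
  have [i [m /andP[rq qv]]] := dyadic_between r0 rv.
  have q0 : (0 : R) <= m%:R * 2 ^- i by rewrite ltW// (le_lt_trans r0).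
  have [q1|q2] := gap i m; first by have := above _ rq; rewrite ltNge q1.
  have := lt_le_trans q2 (le_trans (path_clock_mono cw q0 (ltW qv)) vG).
  by rewrite -{1}(fineK Gf) -EFinD [fine _ + _]addrC subrK ltxx.
have tGr : (t%:E < G r)%E.
  by apply: lt_le_trans Gr; rewrite lte_fin ltrDl mulr2n addr_gt0.
have r_gt0 : 0 < r.
  rewrite lt_neqAle r0 andbT; apply/negP => /eqP r00; move: tGr; rewrite -r00.
  rewrite /path_clock eseries0 ?lte_fin ?ltNge ?t0//.
  by move=> k _ _; rewrite n0 /holding big_geq// mulr0.
have rrho : r <= rho by apply: ge_inf; [exists 0|split].
have only k : site_at t k -> rings k r.
  move=> /site_atP[r' [kr l g]]; suff <- : r' = r by [].
  apply/eqP; rewrite eq_le; apply/andP; split.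
    by rewrite leNgt; apply/negP => rr; have := l r r0 rr; rewrite leNgt tGr.
  apply: ge_inf; first by exists 0.
  by split => //; exact: ltW (rings_gt0 kr).
exists r; split => //; first by rewrite r_gt0.
apply: contrapT => nk.
have nF k : F k -> ~ rings k r.
  by move=> Fk kr; apply: nk; exists k => //; apply/site_atP; exists r.
have [u /andP[u0 ur] uP] := path_clock_jump r_gt0 FK nF.
have := uP u (lexx u) ur; apply/negP; rewrite -ltNge.
apply: lt_le_trans Gr.
apply: (@le_lt_trans _ _ (t%:E + eta%:E)%E).
  apply: leeD; first exact: below.
  apply: le_trans small; apply: path_clock_mono => //.
  by move=> k; case: ifP.
by rewrite -EFinD lte_fin ltrD2l mulr2n ltrDl.
Qed.

End clock_path.

(** * From the clock to the states Y and Z *)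

Section K_path.
Variable R : realType.
Variables (a : R) (g : R -> R) (nf : R -> R -> nat) (tf : R -> nat -> R) (en : nat -> R).
Hypothesis a1 : a < 1.
Hypothesis g0 : forall x, 0 <= g x.
Hypothesis en_inj : injective en.
Hypothesis en01 : forall k, 0 <= en k <= 1.
Hypothesis en_pos : forall k, 0 < g (en k).
Hypothesis en_surj : forall x, 0 <= x <= 1 -> 0 < g x -> exists k, en k = x.
Hypothesis nf0 : forall x, 0 <= x <= 1 -> g x = 0 -> forall r, 0 <= r -> nf x r = 0%N.
Hypothesis tf0 : forall x i, 0 <= x <= 1 -> (1 <= i)%N -> 0 <= tf x i.

Let c k := g (en k) `^ (1 - a).
Let n k := nf (en k).
Let h k := tf (en k).

Let a1' : 1 - a != 0. Proof. by rewrite subr_eq0 gt_eqF. Qed.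

Let g_cases x : g x = 0 \/ 0 < g x.
Proof. by have := g0 x; rewrite le_eqVlt => /predU1P[<-|]; [left|right]. Qed.

Lemma K_clockE u : K_clock a g nf tf u = path_clock n h c u.
Proof.
rewrite /path_clock nneseries_esumT; last first.
  by move=> k; rewrite lee_fin mulr_ge0 ?powR_ge0// path_holding_ge0// => i j j1; exact: tf0.
pose X := [set x : R | 0 < g x].
pose f (x : R) : \bar R := (g x `^ (1 - a) * \sum_(1 <= i < (nf x u).+1) tf x i)%:E.
transitivity (\esum_(x in [set x : R | (0 <= x <= 1)%R] `&` X) f x)%E.
  rewrite esum_mkcondr; apply: eq_esum => x _.
  case: ifPn => //; rewrite notin_setE => gx.
  by have [gx0|//] := g_cases x; rewrite gx0 powR0// mul0r.
rewrite (@reindex_esum _ _ _ setT _ en)//; split.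
- by move=> k _; split; [exact: en01|exact: en_pos].
- by move=> i j _ _; exact: en_inj.
- by move=> x [x01 gx]; have [k <-] := en_surj x01 gx; exists k.
Qed.

Lemma K_atP t x : K_at a g nf tf t x <-> exists2 k, x = en k & site_at c n h t k.
Proof.
have GE : K_clock a g nf tf = path_clock n h c by apply/funext => u; exact: K_clockE.
rewrite /K_at GE; split=> [[x01 [j [r [j1 jr l gr]]]]|[k -> [j [r [j1 jr l gr]]]]]; last first.
  by split => //; exists j, r.
have [gx|gx] := g_cases x; last first.
  by have [k kx] := en_surj x01 gx; exists k => //; exists j, r; rewrite /n kx.
exfalso; move: jr; rewrite /event_time (_ : [set _ | _ in _] = set0) ?ereal_inf0//.
rewrite -subset0 => z [u [u0]]; rewrite (nf0 x01 gx u0) leqNgt j1//.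
Qed.

Lemma K_Z_same t1 t2 : (forall k, site_at c n h t1 k <-> site_at c n h t2 k) ->
  K_Z a g nf tf t1 = K_Z a g nf tf t2.
Proof.
move=> same; rewrite /K_Z /K_Y (_ : K_at a g nf tf t1 = K_at a g nf tf t2)//.
by apply/funext => x; apply/propext; rewrite !K_atP; split => -[k kx ks]; exists k => //; exact/same.
Qed.

Lemma K_Z_single t k : site_at c n h t k -> (forall k', site_at c n h t k' -> k' = k) ->
  K_Z a g nf tf t = c k.
Proof.
move=> ks uniq; rewrite /K_Z /K_Y.
rewrite (_ : K_at a g nf tf t = [set en k]) ?image_set1 ?ereal_inf1//.
apply/seteqP; split => x; last by move=> ->; apply/K_atP; exists k.
by move=> /K_atP[k' -> /uniq ->].
Qed.

Lemma K_YE t k : K_Y a g nf tf t = (en k)%:E -> K_Z a g nf tf t = c k.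
Proof. by rewrite /K_Z => ->. Qed.

(** A finite infimum of locations may be a point without a jump; there g vanishes, and the power
    0^(1-a) = 0 agrees with the value of Z at an infinite infimum. *)
Lemma K_Y_other t : (forall k, K_Y a g nf tf t <> (en k)%:E) -> K_Z a g nf tf t = 0.
Proof.
rewrite /K_Z; move E : (K_Y a g nf tf t) => y other; case: y E other => [y| |]// E other.
have [->|gy] := g_cases y; first by rewrite powR0.
have y01 : 0 <= y <= 1.
  apply/andP; split.
    rewrite -lee_fin -E; apply: le_ereal_inf_tmp => _ [x [/andP[x0 _] _] <-]; by rewrite lee_fin.
  have [[x xt]|nx] := pselect (exists x, K_at a g nf tf t x).
    have [/andP[_ x1] _] := xt.
    rewrite -lee_fin -E; apply: (@le_trans _ _ x%:E); last by rewrite lee_fin.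
    by apply: ereal_inf_lbound; exists x.
  move: E; rewrite /K_Y (_ : [set _ | _ in _] = set0) ?ereal_inf0//.
  by rewrite -subset0 => z [x xt _]; apply: nx; exists x.
by have [k ky] := en_surj y01 gy; exfalso; apply: (other k); rewrite ky.
Qed.

Lemma K_Y_lt t (y : R) : (K_Y a g nf tf t < y%:E)%E <-> exists2 k, en k < y & site_at c n h t k.
Proof.
split=> [lt|[k ky ks]]; last first.
  by apply: (@le_lt_trans _ _ (en k)%:E); [apply: ereal_inf_lbound; exists (en k) => //; apply/K_atP; exists k|rewrite lte_fin].
apply: contrapT => nk; move: lt; rewrite ltNge => /negP; apply.
apply: le_ereal_inf_tmp => _ [x /K_atP[k -> ks] <-]; rewrite lee_fin leNgt; apply/negP => ky.
by apply: nk; exists k.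
Qed.

Hypothesis n0 : forall k, n k 0 = 0%N.
Hypothesis n_mono : forall k u v, 0 <= u -> u <= v -> (n k u <= n k v)%N.
Hypothesis n_right : forall k r, 0 <= r -> \forall u \near r^'+, n k u = n k r.
Hypothesis G_fin : forall u, 0 <= u -> (path_clock n h c u < +oo)%E.

Let c0 k : 0 < c k. Proof. by rewrite powR_gt0. Qed.
Let h0 k i : (1 <= i)%N -> 0 <= h k i. Proof. by move=> i1; exact: tf0. Qed.

Lemma K_Z_gap t1 t2 t2' : t1 <= t2 -> t2 < t2' -> dyadic_gap c n h t1 t2' ->
  K_Z a g nf tf t1 = K_Z a g nf tf t2.
Proof.
move=> t12 t22 gap; apply: K_Z_same => k.
exact: (site_at_gap c0 n0 n_mono n_right h0 G_fin k t12 t22 gap).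
Qed.

(** The pathwise core of the upper bound. If t2 were not crossed later than t1, the clock would leap
    over both; so they are crossed at times r1 < r2, each by a single site of [F]. Equal states then
    mean equal sizes, which [nopair] excludes even for two rings of one site. *)
Lemma K_Z_hit (F : pred nat) (K : nat) (t1 t2 eta rho : R) : 0 <= t1 -> t1 <= t2 -> 0 < eta ->
  (forall k, F k -> (k < K)%N) -> 0 <= rho ->
  (t2%:E < path_clock n h c rho)%E ->
  dyadic_gap c n h t1 (t1 + eta *+ 2) -> dyadic_gap c n h t2 (t2 + eta *+ 2) ->
  (path_clock n h (fun k => if F k then 0%R else c k) rho <= eta%:E)%E ->
  (forall k k' r, r <= rho -> rings n k r -> rings n k' r -> k = k') ->
  (forall k k' r r', F k -> F k' -> rings n k r -> rings n k' r' -> r < r' -> r' <= rho ->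
     g (en k) <> g (en k')) ->
  ~ dyadic_gap c n h t1 t2 -> K_Z a g nf tf t1 <> K_Z a g nf tf t2.
Proof.
move=> t10 t12 eta0 FK rho0 trho gap1 gap2 small noties nopair nogap Zeq.
have t1rho : (t1%:E < path_clock n h c rho)%E by apply: le_lt_trans trho; rewrite lee_fin.
have t20 := le_trans t10 t12.
have [r1 [/andP[r10 r1rho] only1 [k1 F1 s1] below1 above1]] :=
  site_at_crossing c0 n0 n_mono n_right h0 G_fin t10 eta0 FK rho0 t1rho gap1 small.
have [r2 [/andP[r20 r2rho] only2 [k2 F2 s2] below2 above2]] :=
  site_at_crossing c0 n0 n_mono n_right h0 G_fin t20 eta0 FK rho0 trho gap2 small.
have cw k := ltW (c0 k).
have r12 : r1 < r2.
  rewrite ltNge; apply/negP => r21; apply: nogap => i m /=.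
  set q : R := m%:R * 2 ^- i.
  have q0 : 0 <= q by rewrite divr_ge0// exprn_ge0.
  have [qr|rq] := ltP q r2; first by left; apply: below1 => //; exact: lt_le_trans r21.
  right; apply: lt_le_trans (path_clock_mono n_mono h0 cw (ltW r20) rq).
  by apply: lt_le_trans above2; rewrite lte_fin ltrDl mulr2n addr_gt0.
have u1 k : site_at c n h t1 k -> k = k1.
  by move=> /only1 kr; apply: (noties _ _ r1) => //; exact: only1.
have u2 k : site_at c n h t2 k -> k = k2.
  by move=> /only2 kr; apply: (noties _ _ r2) => //; exact: only2.
move: Zeq; rewrite (K_Z_single s1 u1) (K_Z_single s2 u2) /c => /eqP ceq.
apply: (nopair k1 k2 r1 r2) => //; [exact: only1|exact: only2|].
move: ceq; rewrite eq_le => /andP[c12 c21].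
have le k k' : g (en k) `^ (1 - a) <= g (en k') `^ (1 - a) -> g (en k) <= g (en k').
  move=> ckk; rewrite leNgt; apply/negP => lt; move: ckk; rewrite leNgt => /negP; apply.
  by rewrite gt0_ltr_powR ?nnegrE ?subr_gt0 ?(ltW (en_pos _)).
by apply/eqP; rewrite eq_le !le.
Qed.

End K_path.

(** * Measurability of the K process *)

Section site_measurable.
Context d (T : measurableType d) (R : realType) (P : probability T R).
Variables (r : nat -> R) (N : nat -> R -> T -> nat) (tau : nat -> nat -> T -> R).
Hypothesis drv : driven P r N tau.
Variable c : nat -> R.
Hypothesis c0 : forall k, 0 < c k.

Let n w k u := N k u w.
Let h w k i := tau k i w.

Lemma driven_right k w u : 0 <= u -> \forall v \near u^'+, n w k v = n w k u.
Proof. by move=> u0; have [/(_ k)[_ [_ [/(_ w)[_ _ hr] _]]] _ _ _ _] := drv; exact: hr. Qed.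

Let n0 w k : n w k 0 = 0%N. Proof. exact: (driven_count0 drv). Qed.
Let n_mono w k u v : 0 <= u -> u <= v -> (n w k u <= n w k v)%N.
Proof. exact: (driven_mono drv). Qed.
Let n_right w k s : 0 <= s -> \forall u \near s^'+, n w k u = n w k s.
Proof. exact: driven_right. Qed.
Let h0 w k i : (1 <= i)%N -> 0 <= h w k i. Proof. exact: (holding_ge0 drv). Qed.
Let cw k : 0 <= c k. Proof. exact: ltW. Qed.

Let dyad (p : nat * nat) : R := p.2%:R * 2 ^- p.1.
Let dyad0 p : 0 <= dyad p. Proof. by rewrite divr_ge0// exprn_ge0. Qed.

Lemma measurable_count_pred k u (Q : nat -> Prop) : 0 <= u -> measurable [set w | Q (N k u w)].
Proof.
move=> u0; have mN := driven_measurable_count drv k u0; have := mN measurableT [set m | Q m].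
by rewrite setTI; apply.
Qed.

(* N k' at the j-th event time of site k is at least i unless some dyadic
   time separates the two. *)
Let reached (k j k' i : nat) : set T :=
  [set w | forall p : nat * nat, ~ ((j <= N k (dyad p) w)%N /\ (N k' (dyad p) w < i)%N)].

Let measurable_reached k j k' i : measurable (reached k j k' i).
Proof.
have -> : reached k j k' i = ~` \bigcup_p [set w | (j <= N k (dyad p) w)%N /\ (N k' (dyad p) w < i)%N].
  apply/seteqP; split => w; first by move=> H [p _ pw]; exact: (H p).
  by move=> H p pw; apply: H; exists p.
apply: measurableC.
apply: (countable_bigcupT_measurable) => // p.
apply: measurableI; [exact: (measurable_count_pred k (fun m => (j <= m)%N))
  |exact: (measurable_count_pred k' (fun m => (m < i)%N))].
Qed.

Let reachedP k j k' i w (s : R) : event_time (n w k) j = s%:E -> 0 <= s ->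
  reached k j k' i w <-> (i <= n w k' s)%N.
Proof.
move=> js s0; split => [H|is_ p [jp ip]]; last first.
  have sp : s <= dyad p by rewrite -lee_fin -js (event_time_le (n_mono w) (n_right w)).
  by have := leq_trans is_ (n_mono w k' s0 sp); rewrite leqNgt ip.
rewrite leqNgt; apply/negP => lt.
have [v sv nv] : exists2 v, s < v & n w k' v = n w k' s.
  near s^'+ => v; exists v; first by near: v; exact: nbhs_right_gt.
  by near: v; exact: n_right.
have [i' [m /andP[sq qv]]] := dyadic_between s0 sv.
have q0 := le_trans s0 (ltW sq).
apply: (H (i', m)); split.
  by rewrite -(event_time_le (n_mono w) (n_right w)) ?js ?lee_fin// ltW.
by apply: leq_ltn_trans lt; rewrite -nv; apply: n_mono => //; exact: ltW.
Unshelve. all: by end_near. Qed.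

(** The clock at a random time, the j-th event of site k: expressing the count of k' through the
    events [reached] makes it a countable sum of measurable terms. *)
Let clock_at (k j : nat) (w : T) : \bar R :=
  (\sum_(k' <oo) \sum_(i <oo) (c k' * (tau k' i.+1 w * \1_(reached k j k' i.+1) w))%:E)%E.

Let measurable_clock_at k j : measurable_fun setT (clock_at k j).
Proof.
have t0 k' i w : (0 <= (c k' * (tau k' i.+1 w * \1_(reached k j k' i.+1) w))%:E)%E.
  by rewrite lee_fin !mulr_ge0// ?h0// indic_ge0.
apply: ge0_emeasurable_sum => [k' w _ _|k' _]; first by apply: nneseries_ge0 => i _ _.
apply: ge0_emeasurable_sum => [i w _ _|i _] //.
apply/measurable_EFinP; apply: measurable_funM => //; apply: measurable_funM.
  exact: (measurable_holding drv).
by apply: measurable_indic; exact: measurable_reached.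
Qed.

Let clock_atE k j w (s : R) : event_time (n w k) j = s%:E -> 0 <= s ->
  clock_at k j w = path_clock (n w) (h w) c s.
Proof.
move=> js s0; apply: eq_eseriesr => k' _.
set m := n w k' s.
have t0 i : (0 <= (c k' * (tau k' i.+1 w * \1_(reached k j k' i.+1) w))%:E)%E.
  by rewrite lee_fin !mulr_ge0// ?h0// indic_ge0.
rewrite (nneseries_split 0 m)// add0n [X in (_ + X)%E]eseries0 ?adde0; last first.
  move=> i mi _; rewrite indicE memNset ?mulr0// => /(reachedP _ _ js s0).
  by rewrite leqNgt ltnS mi.
rewrite sumEFin -mulr_sumr; congr ((_ * _)%:E).
rewrite /holding big_add1/= big_nat [RHS]big_nat; apply: eq_bigr => i /andP[_ im].
by rewrite indicE mem_set ?mulr1//; apply/(reachedP _ _ js s0).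
Qed.

(** The three conditions are made countable: the event time is below some integer, the clock is at
    most t at the dyadic times before it, and [clock_at] exceeds t. *)
Lemma measurable_site_at (t : R) k : measurable [set w | site_at c (n w) (h w) t k].
Proof.
have -> : [set w | site_at c (n w) (h w) t k] =
  \bigcup_j (\bigcup_m [set w | (j.+1 <= N k m%:R w)%N] `&`
    (~` (\bigcup_p [set w | ~ (j.+1 <= N k (dyad p) w)%N /\ (t%:E < clock N tau c (dyad p) w)%E]) `&`
     [set w | (t%:E < clock_at k j.+1 w)%E])); last first.
  apply: bigcupT_measurable => j; apply: measurableI.
    by apply: bigcupT_measurable => m; exact: (measurable_count_pred k (fun i => (j.+1 <= i)%N)).
  apply: measurableI.
    apply: measurableC; apply: countable_bigcupT_measurable => // p; apply: measurableI.
      exact: (measurable_count_pred k (fun i => ~ (j.+1 <= i)%N)).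
    have mc := measurable_clock drv cw (dyad0 p); have := mc measurableT `]t%:E, +oo[%classic (emeasurable_itv _).
    by rewrite setTI; congr measurable; apply/seteqP; split => w /=; rewrite in_itv/= ?andbT.
  have mc := measurable_clock_at k j.+1; have := mc measurableT `]t%:E, +oo[%classic (emeasurable_itv _).
  by rewrite setTI; congr measurable; apply/seteqP; split => w /=; rewrite in_itv/= ?andbT.
apply/seteqP; split => w.
  move=> /(site_atP c0 (n0 w) (n_mono w) (n_right w) (h0 w))[s [[[//|j] j1 js] l gs]].
  have s0 : 0 <= s by rewrite ltW// (rings_gt0 (n0 w) (n_mono w) (n_right w) (k := k))//; exists j.+1.
  exists j => //; split.
    exists (Num.truncn s).+1 => //=.
    rewrite -(event_time_le (n_mono w) (n_right w))// js lee_fin ltW// truncnS_gt//.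
  split; last by rewrite /= (clock_atE js s0).
  move=> [p _ [/negP jp]]; apply/negP; rewrite -leNgt; apply: l => //.
  by rewrite ltNge -lee_fin -js (event_time_le (n_mono w) (n_right w)).
move=> [j _ [[m _ jm] [gap gs]]].
have m0 : (0 : R) <= m%:R by [].
have : (event_time (n w k) j.+1 <= (m%:R)%:E)%E by rewrite (event_time_le (n_mono w) (n_right w)).
have : (0%:E <= event_time (n w k) j.+1)%E.
  by apply: le_ereal_inf_tmp => _ [u [u0 _] <-]; rewrite lee_fin.
case E : (event_time (n w k) j.+1) => [s| |]//; rewrite lee_fin => s0 _.
apply/(site_atP c0 (n0 w) (n_mono w) (n_right w) (h0 w)).
exists s; split; first by exists j.+1.
  move=> u u0 us; have [i' [m' /andP[uq qs]]] := dyadic_between u0 us.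
  apply: le_trans (path_clock_mono (n_mono w) (h0 w) cw u0 (ltW uq)) _.
  rewrite leNgt; apply/negP => tq; apply: gap; exists (i', m') => //; split => //.
  apply/negP; rewrite -(event_time_le (n_mono w) (n_right w))// E lee_fin -ltNge//.
by rewrite -(clock_atE E s0).
Qed.

End site_measurable.

Section K_measurable.
Context d (T : measurableType d) (R : realType) (P : probability T R).
Variables (a : R) (g : R -> R) (N : R -> R -> T -> nat) (tau : R -> nat -> T -> R) (en : nat -> R).
Hypothesis a1 : a < 1.
Hypothesis g0 : forall x, 0 <= g x.
Hypothesis en01 : forall k, 0 <= en k <= 1.
Hypothesis en_inj : injective en.
Hypothesis en_pos : forall k, 0 < g (en k).
Hypothesis en_surj : forall x, 0 <= x <= 1 -> 0 < g x -> exists k, en k = x.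
Hypothesis drvK : K_driving P a g N tau.

Let nf w x u := N x u w.
Let tf w x i := tau x i w.
Let c k := g (en k) `^ (1 - a).
Let n w k u := N (en k) u w.
Let h w k i := tau (en k) i w.
Let drv := K_driving_driven drvK en_inj en01 en_pos.

Let c0 k : 0 < c k. Proof. by rewrite powR_gt0. Qed.

Lemma K_count0 w x : 0 <= x <= 1 -> g x = 0 -> forall r, 0 <= r -> nf w x r = 0%N.
Proof. by move=> x01 gx r r0; have [_ N0 _ _ _] := drvK; exact: N0. Qed.

Lemma K_holding_ge0 w x i : 0 <= x <= 1 -> (1 <= i)%N -> 0 <= tf w x i.
Proof. by move=> x01 i1; have [_ _ _ tauP _] := drvK; have [_ t0 _] := tauP x i x01 i1; exact: t0. Qed.

Let measurable_const_set (Q : Prop) : measurable [set _ : T | Q].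
Proof.
have [q|q] := pselect Q; first by rewrite (_ : [set _ | _] = setT)//; apply/seteqP; split.
by rewrite (_ : [set _ | _] = set0)// -subset0 => z.
Qed.

Let Y t w := K_Y a g (nf w) (tf w) t.
Let Z t w := K_Z a g (nf w) (tf w) t.

Let Y_lt t w (y : R) : (Y t w < y%:E)%E <-> exists2 k, en k < y & site_at c (n w) (h w) t k.
Proof. exact: (K_Y_lt a1 g0 en_inj en01 en_pos en_surj (@K_count0 w) (@K_holding_ge0 w)). Qed.

Lemma measurable_K_Y_lt t (y : R) : measurable [set w | (Y t w < y%:E)%E].
Proof.
have -> : [set w | (Y t w < y%:E)%E] =
    \bigcup_k ([set _ | en k < y] `&` [set w | site_at c (n w) (h w) t k]).
  apply/seteqP; split => w /=; first by move/Y_lt => [k ky ks]; exists k.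
  by move=> [k _ [ky ks]]; apply/Y_lt; exists k.
apply: bigcupT_measurable => k; apply: measurableI; last exact: (measurable_site_at drv c0).
exact: measurable_const_set.
Qed.

Lemma measurable_K_Y_eq t k : measurable [set w | Y t w = (en k)%:E].
Proof.
have -> : [set w | Y t w = (en k)%:E] =
    ~` [set w | (Y t w < (en k)%:E)%E] `&` \bigcap_m [set w | (Y t w < (en k + m.+1%:R^-1)%:E)%E].
  apply/seteqP; split => w /=.
    by move=> E; rewrite E ltxx; split => // m _ /=; rewrite E lte_fin ltrDl invr_gt0.
  move=> [/negP]; rewrite -leNgt => le lt; apply/eqP; rewrite eq_le le andbT.
  apply/lee_addgt0Pr => e e0.
  have [m me] : exists m : nat, m.+1%:R^-1 < e.
    exists (Num.truncn e^-1); rewrite -[ltRHS]invrK ltf_pV2 ?posrE ?invr_gt0//.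
    exact: truncnS_gt.
  apply: ltW; apply: lt_le_trans (lt m I) _.
  by rewrite lee_fin lerD2l ltW.
apply: measurableI; first by apply: measurableC; exact: measurable_K_Y_lt.
by apply: bigcapT_measurable => m; exact: measurable_K_Y_lt.
Qed.

Lemma measurable_K_Z t : measurable_fun setT (Z t).
Proof.
move=> _ B mB; rewrite setTI.
have -> : Z t @^-1` B = (\bigcup_k ([set w | Y t w = (en k)%:E] `&` [set _ | B (c k)]))
   `|` (~` (\bigcup_k [set w | Y t w = (en k)%:E]) `&` [set _ | B 0]).
  apply/seteqP; split => w /=.
    have [[k Yk]|nY] := pselect (exists k, Y t w = (en k)%:E).
      by rewrite /Z (K_YE Yk) => Bc; left; exists k.
    rewrite /Z (K_Y_other a1 g0 en_surj) => [B0|k Yk]; last by apply: nY; exists k.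
    by right; split => // -[k _ Yk]; apply: nY; exists k.
  move=> [[k _ [Yk Bc]]|[nY B0]]; first by rewrite /Z (K_YE Yk).
  by rewrite /Z (K_Y_other a1 g0 en_surj)// => k Yk; apply: nY; exists k.
apply: measurableU.
  by apply: bigcupT_measurable => k; apply: measurableI => //; exact: measurable_K_Y_eq.
apply: measurableI => //; apply: measurableC.
by apply: bigcupT_measurable => k; exact: measurable_K_Y_eq.
Qed.

Lemma measurable_K_Z_eq t1 t2 : measurable [set w | Z t1 w = Z t2 w].
Proof.
have mE : measurable_fun setT (fun w => Z t1 w == Z t2 w).
  by apply: measurable_fun_eqr; exact: measurable_K_Z.
have := mE measurableT [set true]; rewrite setTI => /(_ I).
congr measurable; apply/seteqP; split => w /=; first by move/eqP.
by move=> ->; rewrite eqxx.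
Qed.

End K_measurable.

(** * Bad events and the limit *)

Lemma invr_cvg_pinfty (R : realType) : (e^-1 : R) @[e --> 0^'+] --> +oo.
Proof.
apply/cvgryPgt => A; near=> e; have e0 : 0 < e by near: e; exact: nbhs_right_gt.
have A1 : 0 < `|A| + 1 by rewrite ltr_pwDr.
apply: (@lt_trans _ _ (`|A| + 1)); first by rewrite ltr_pwDr// ler_norm.
rewrite invf_pgt.
near: e; apply: nbhs_right_lt; rewrite invr_gt0//.
Unshelve. all: by end_near. Qed.

Section gap_event.
Context d (T : measurableType d) (R : realType) (P : probability T R).
Variables (r : nat -> R) (N : nat -> R -> T -> nat) (tau : nat -> nat -> T -> R).
Hypothesis drv : driven P r N tau.
Variable c : nat -> R.
Hypothesis c0 : forall k, 0 < c k.
Hypothesis rc : cvgn (series (fun k => r k * c k)).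

Let n w k u := N k u w.
Let h w k i := tau k i w.
Let cw k : 0 <= c k. Proof. exact: ltW. Qed.

Lemma phi_gt0 l : 0 < l -> 0 < phi r c l.
Proof.
move=> l0; have l0' := ltW l0.
have t0 k : 0 <= r k * lap_exponent (l * c k).
  by rewrite mulr_ge0 ?lap_exponent_ge0 ?mulr_ge0// ltW// (driven_rate_gt0 drv).
apply: (@lt_le_trans _ _ (series (fun k => r k * lap_exponent (l * c k)) 1%N)).
  rewrite /series/= big_nat1 mulr_gt0 ?(driven_rate_gt0 drv)//.
  by rewrite divr_gt0 ?mulr_gt0// addr_gt0 ?mulr_gt0.
rewrite /phi; apply: nondecreasing_cvgn_le; last exact: (cvgP _ (phi_cvg drv cw rc l0')).
by apply/nondecreasing_seqP => k; rewrite /series/= big_nat_recr//= lerDl.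
Qed.

(** exp(-l x) reverses the order and so sends ]t1, t2] to [exp(-l t2), exp(-l t1)[. Every l > 0
    describes the same event, which leaves l free to be 1 / eps. *)
Lemma gap_eventE (l t1 t2 : R) : 0 < l ->
  [set w | dyadic_gap c (n w) (h w) t1 t2] =
  ~` hit (fun u w => expc l (clock N tau c u w)) (expR (- (l * t1))) (expR (- (l * t2))).
Proof.
move=> l0; apply/seteqP; split => w /=.
  move=> gap [i [m /andP[le lt]]].
  rewrite expc_lt ?(clock_ge0 drv)// in lt.
  have [q1|q2] := gap i m; first by have := lt_le_trans lt q1; rewrite ltxx.
  by rewrite -(expc_lt _ l0) ?(clock_ge0 drv)// ltNge le in q2.
move=> nhit i m /=; set q : R := m%:R * 2 ^- i.
have [q1|q1] := leP (path_clock (n w) (h w) c q) t1%:E; first by left.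
right; rewrite ltNge; apply/negP => q2; apply: nhit; exists i, m.
rewrite expc_lt ?(clock_ge0 drv)// q1 andbT leNgt expc_lt ?(clock_ge0 drv)//.
by rewrite -leNgt.
Qed.

Lemma measurable_gap_event (t1 t2 : R) :
  measurable [set w | dyadic_gap c (n w) (h w) t1 t2].
Proof.
rewrite (gap_eventE _ _ ltr01); apply: measurableC; apply: hit_measurable => u u0.
exact: (measurable_expc_clock drv).
Qed.

Section sandwich.
Variable l : R.
Hypothesis l0 : 0 < l.
Let y u w := expc l (clock N tau c u w).
Let my u : 0 <= u -> measurable_fun setT (y u).
Proof. by move=> u0; exact: (measurable_expc_clock drv). Qed.
Let y01 u w : 0 <= y u w <= 1.
Proof. by rewrite expc_ge0 expc_le1 ?(ltW l0)// (clock_ge0 drv). Qed.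
Let yd u v w : 0 <= u -> u <= v -> y v w <= y u w.
Proof.
by move=> u0 uv; apply: expc_anti; rewrite ?(ltW l0) ?(clock_ge0 drv)// (clock_mono drv).
Qed.
Let y1 w : y 0 w = 1.
Proof.
rewrite /y /clock eseries0 /= ?mulr0 ?oppr0 ?expR0//.
by move=> k _ _; rewrite (driven_count0 drv) /holding_sum big_geq// mulr0.
Qed.
Let Ey u v m j : 0 <= u -> u <= v -> (\int[P]_w (y u w ^+ m * y v w ^+ j)%:E =
   (expR (- (u * phi r c (l * (m + j)%:R) + (v - u) * phi r c (l * j%:R))))%:E)%E.
Proof. exact: (laplace_clock drv). Qed.
Let Lam0 : phi r c (l * 0%:R) = 0.
Proof.
rewrite mulr0 /phi (_ : series _ = cst 0) ?lim_cst//; apply/funext => k.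
by rewrite /series/= big1// => i _; rewrite mul0r /lap_exponent mul0r mulr0.
Qed.
Let Lam_gt0 i : (0 < i)%N -> 0 < phi r c (l * i%:R).
Proof. by move=> i0; rewrite phi_gt0// mulr_gt0// ltr0n. Qed.

Lemma clock_hit_lower (p q : {poly R}) (x b kp : R) :
  step_fun (horner p) -> step_fun (horner q) -> 0 <= b -> x <= 1 -> kp <= 1 ->
  p.[x] <= kp -> 1 - kp <= q.[b] ->
  (1 - kp) ^+ 2 * fine (P (hit y x b)) <= ratio_sum (fun j => phi r c (l * j%:R)) p q.
Proof. exact: (hit_lower my y01 yd y1 Ey Lam0 Lam_gt0). Qed.

Lemma clock_hit_upper (p q : {poly R}) (x b kp : R) :
  step_fun (horner p) -> step_fun (horner q) -> 0 <= x -> x <= 1 -> b <= 1 -> 0 <= kp ->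
  1 - kp <= p.[x] -> q.[b] <= kp ->
  ratio_sum (fun j => phi r c (l * j%:R)) p q <= fine (P (hit y x b)) + kp *+ 2.
Proof. exact: (hit_upper my y01 yd y1 Ey Lam0 Lam_gt0). Qed.

End sandwich.

(** With l = 1 / eps the thresholds become exp(-t) and exp(-(t + s)), the same for all eps; eps
    remains only in the exponents phi(j / eps). *)
Lemma gap_probability_cvg (al t s : R) : 0 < al < 1 -> 0 < t -> 0 < s ->
  (forall i j, (0 < i)%N -> phi r c (l * j%:R) / phi r c (l * (i + j)%:R) @[l --> +oo] -->
     (j%:R `^ al / (i + j)%:R `^ al : R)) ->
  fine (P [set w | dyadic_gap c (n w) (h w) (eps * t) (eps * (t + s))]) @[eps --> 0^'+] -->
    (Pihat al t s : R).
Proof.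
move=> al01 t0 s0 ratio.
pose y (e : R) u w := expc e^-1 (clock N tau c u w).
pose H (e : R) : R := fine (P (hit (y e) (expR (- t)) (expR (- (t + s))))).
have mhit (e : R) : 0 < e -> measurable (hit (y e) (expR (- t)) (expR (- (t + s)))).
  by move=> e0; apply: hit_measurable => u u0; apply: (measurable_expc_clock drv); rewrite ?invr_gt0.
have cH : H e @[e --> 0^'+] --> 1 - Pihat al t s.
  apply: (@hit_probability_cvg _ al al01 _ _ _ H (fun e j => phi r c (e^-1 * j%:R))) => //.
  - move=> i j i0; have := ratio i j i0.
    by move=> /(cvg_comp _ _ (@invr_cvg_pinfty R)); apply.
  - near=> e; have e0 : 0 < e by near: e; exact: nbhs_right_gt.
    rewrite /H fine_ge0//= -lee_fin fineK ?fin_num_measure//; last exact: mhit.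
    by rewrite probability_le1//; exact: mhit.
  - near=> e => p q kp sp sq /andP[k0 k1] pk qk; have e0 : 0 < e by near: e; exact: nbhs_right_gt.
    apply: (@clock_hit_lower e^-1) => //; rewrite ?invr_gt0 ?expR_ge0//.
    by rewrite -expR0 ler_expR oppr_le0 ltW.
  - near=> e => p q kp sp sq /andP[k0 k1] pk qk; have e0 : 0 < e by near: e; exact: nbhs_right_gt.
    apply: (@clock_hit_upper e^-1) => //; rewrite ?invr_gt0 ?expR_ge0//.
      by rewrite -expR0 ler_expR oppr_le0 ltW.
    by rewrite -expR0 ler_expR oppr_le0 ltW// addr_gt0.
have -> : Pihat al t s = 1 - (1 - Pihat al t s) by ring.
apply: (@cvg_trans _ (1 - H e @[e --> 0^'+])); last by apply: cvgB => //; exact: cvg_cst.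
apply: near_eq_cvg; near=> e; have e0 : 0 < e by near: e; exact: nbhs_right_gt.
have ei : 0 < e^-1 by rewrite invr_gt0.
rewrite (gap_eventE _ _ ei) !mulKf ?gt_eqF//.
by rewrite probability_setC ?fineB ?fin_num_measure//; exact: mhit.
Unshelve. all: by end_near. Qed.

End gap_event.

(** * Tail bounds for the clock *)

Section clock_deviation.
Context d (T : measurableType d) (R : realType) (P : probability T R).
Variables (r : nat -> R) (N : nat -> R -> T -> nat) (tau : nat -> nat -> T -> R).
Hypothesis drv : driven P r N tau.
Variable c : nat -> R.
Hypothesis c0 : forall k, 0 <= c k.
Hypothesis rc : cvgn (series (fun k => r k * c k)).

Notation G := (clock N tau c).

Lemma clock_has_mean l u : 0 < l -> 0 <= u ->
  has_mean P (fun w => expc l (G u w)) (expR (- (u * phi r c l))).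
Proof.
move=> l0 u0; apply: has_mean_bounded.
- exact: (measurable_expc_clock drv).
- by move=> w; rewrite expc_ge0 expc_le1 ?(ltW l0)// (clock_ge0 drv).
have := laplace_clock drv c0 rc 1 0 l0 u0 (lexx u).
rewrite addn0 mulr1 subrr mul0r addr0 => <-.
by apply: eq_integral => w _; rewrite expr1 expr0 mulr1.
Qed.

Let measurable_clock_set u (B : set (\bar R)) : 0 <= u -> measurable B -> measurable (G u @^-1` B).
Proof. by move=> u0 mB; have := measurable_clock drv c0 u0 measurableT mB; rewrite setTI. Qed.

Lemma measurable_clock_le u (x : R) : 0 <= u -> measurable [set w | (G u w <= x%:E)%E].
Proof.
move=> u0; have := measurable_clock_set u0 (emeasurable_itv `]-oo, x%:E]).
by congr measurable; apply/seteqP; split => w /=; rewrite in_itv.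
Qed.

Lemma measurable_clock_gt u (x : R) : 0 <= u -> measurable [set w | (x%:E < G u w)%E].
Proof.
move=> u0; have := measurable_clock_set u0 (emeasurable_itv `]x%:E, +oo[).
by congr measurable; apply/seteqP; split => w /=; rewrite in_itv/= andbT.
Qed.

Lemma clock_le_prob l u (x : R) : 0 < l -> 0 <= u ->
  fine (P [set w | (G u w <= x%:E)%E]) <= expR (l * x - u * phi r c l).
Proof.
move=> l0 u0; set A := [set w | _].
have mA : measurable A by exact: measurable_clock_le.
rewrite -(ler_pM2l (expR_gt0 (- (l * x)))) -expRD addrA addNr add0r.
apply: (has_mean_le (has_meanZ (expR (- (l * x))) (has_mean_indic P mA)) (clock_has_mean l0 u0)).
move=> w; rewrite indicE; case: (boolP (w \in A)) => [|_]; last by rewrite mulr0 expc_ge0.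
rewrite inE /A/= mulr1; case: (G u w) (clock_ge0 drv c0 u w) => [y| |]//= _.
by rewrite lee_fin => yx; rewrite ler_expR lerN2 ler_pM2l.
Qed.

Lemma phi_le_linear l (S : R) : 0 <= l -> (\sum_(k <oo) (r k * c k)%:E <= S%:E)%E ->
  phi r c l <= l * S.
Proof.
move=> l0 rS; have r0 k : 0 <= r k by rewrite ltW// (driven_rate_gt0 drv).
apply: limr_le; first exact: (cvgP _ (phi_cvg drv c0 rc l0)).
apply: nearW => m; apply: (@le_trans _ _ (l * series (fun k => r k * c k) m)).
  rewrite /series/= mulr_sumr; apply: ler_sum => k _.
  by rewrite [leRHS]mulrCA ler_wpM2l// lap_exponent_le// mulr_ge0.
rewrite ler_wpM2l// -lee_fin; apply: le_trans rS; rewrite /series/= -sumEFin.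
by apply: nneseries_lim_ge => k _ _; rewrite lee_fin mulr_ge0.
Qed.

(** Markov's inequality for 1 - exp(-clock / x): it is at least 1 - 1/e >= 1/2 where the clock
    exceeds x, infinite values included, and its mean is at most u phi(1/x) <= u S / x. *)
Lemma clock_gt_prob u (x S : R) : 0 < x -> 0 <= u ->
  (\sum_(k <oo) (r k * c k)%:E <= S%:E)%E ->
  fine (P [set w | (x%:E < G u w)%E]) <= 2 * u * S / x.
Proof.
move=> x0 u0 rS; set A := [set w | _]; have mA : measurable A by exact: measurable_clock_gt.
have xi0 : 0 < x^-1 by rewrite invr_gt0.
have half : expR (-1) <= 2^-1 :> R.
  rewrite expRN lef_pV2 ?posrE ?expR_gt0//.
  by have := expR_ge1Dx (1 : R).
have := has_mean_le (has_meanZ 2^-1 (has_mean_indic P mA))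
  (has_meanB (has_mean_cst P 1) (clock_has_mean xi0 u0)).
have H w : 2^-1 * \1_A w <= 1 - expc x^-1 (G u w).
  rewrite indicE; case: (boolP (w \in A)) => [|_]; last first.
    by rewrite mulr0 subr_ge0 expc_le1 ?(ltW xi0)// (clock_ge0 drv).
  rewrite inE /A/= mulr1 => xG.
  have : expc x^-1 (G u w) <= expR (- (x^-1 * x)).
    by rewrite expc_le ?(clock_ge0 drv)// ltW.
  by rewrite mulVf ?gt_eqF// => /le_trans/(_ half); lra.
move=> /(_ H) le.
have e1 := expR_ge1Dx (- (u * phi r c x^-1)).
have e2 : u * phi r c x^-1 <= u * (x^-1 * S) by rewrite ler_wpM2l// phi_le_linear// ltW.
have -> : 2 * u * S / x = 2 * (u * (x^-1 * S)) by ring.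
lra.
Qed.

(** At each integer time the bound of [clock_gt_prob] is made arbitrarily small by a large level;
    monotonicity covers the times in between. *)
Lemma clock_finite : P.-negligible [set w | exists2 u, 0 <= u & G u w = +oo%E].
Proof.
pose S := fine (\sum_(k <oo) (r k * c k)%:E)%E.
have r0 k : 0 <= r k by rewrite ltW// (driven_rate_gt0 drv).
have SE : (\sum_(k <oo) (r k * c k)%:E = S%:E)%E.
  by rewrite /S nneseries_limn// => k; rewrite mulr_ge0.
have mI m : measurable [set w | G m%:R w = +oo%E].
  have := measurable_clock_set (ler0n R m) (emeasurable_set1 +oo%E).
  by congr measurable.
have PI m : P [set w | G m%:R w = +oo%E] = 0%E.
  apply/eqP; rewrite eq_le measure_ge0 andbT.
  apply/lee_addgt0Pr => e e0; rewrite add0e.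
  pose x : R := 2 * m%:R * S / e + 1.
  have S0 : 0 <= S by rewrite -lee_fin -SE; apply: nneseries_ge0 => k _ _; rewrite lee_fin mulr_ge0.
  have q0 : 0 <= 2 * m%:R * S / e by rewrite divr_ge0 ?(ltW e0)// !mulr_ge0.
  have x0 : 0 < x by rewrite ltr_pwDr.
  have sub : [set w | G m%:R w = +oo%E] `<=` [set w | (x%:E < G m%:R w)%E].
    by move=> w /= ->; rewrite ltry.
  apply: le_trans (le_measure _ _ _ sub) _; rewrite ?inE//; first exact: measurable_clock_gt.
  rewrite -[leLHS]fineK ?fin_num_measure//; last exact: measurable_clock_gt.
  rewrite lee_fin; apply: le_trans (clock_gt_prob x0 (ler0n _ m) (_ : _ <= S%:E)%E) _.
    by rewrite SE.
  by rewrite ler_pdivrMr// /x mulrDr mulr1 mulrCA divff ?gt_eqF// mulr1 lerDl ltW.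
apply: (@negligibleS _ _ _ _ (\bigcup_m [set w | G m%:R w = +oo%E])); last first.
  by apply: negligible_bigcup => m; exists [set w | G m%:R w = +oo%E]; split; [exact: mI|exact: PI|].
move=> w [u u0 Gu]; exists (Num.truncn u).+1 => //=.
have le : u <= (Num.truncn u).+1%:R by rewrite ltW// truncnS_gt.
apply/eqP; rewrite -leye_eq -Gu; exact: (clock_mono drv).
Qed.

End clock_deviation.

(** * Simultaneous rings and repeated jump sizes *)

Section ring_probability.
Context d (T : measurableType d) (R : realType) (P : probability T R).
Variables (r : nat -> R) (N : nat -> R -> T -> nat) (tau : nat -> nat -> T -> R).
Hypothesis drv : driven P r N tau.

Let n w k u := N k u w.
Let n0 w k : n w k 0 = 0%N. Proof. exact: (driven_count0 drv). Qed.
Let n_mono w k u v : 0 <= u -> u <= v -> (n w k u <= n w k v)%N.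
Proof. exact: (driven_mono drv). Qed.
Let n_right w k s : 0 <= s -> \forall u \near s^'+, n w k u = n w k s.
Proof. exact: (driven_right drv). Qed.

Definition count_event k (u v : R) m : set T := [set w | (m <= N k v w - N k u w)%N].

Lemma sigma_count_event k u v m : 0 <= u -> 0 <= v ->
  sigma_of [set u : R | 0 <= u] (N k) (count_event k u v m).
Proof.
move=> u0 v0; rewrite (_ : count_event k u v m =
    \bigcup_i \bigcup_j (N k v @^-1` [set i] `&` N k u @^-1` [set j] `&` [set _ | (m <= i - j)%N])); last first.
  apply/seteqP; split => w; last by move=> [i _ [j _ [[/= <- <-]]]].
  by move=> wm; exists (N k v w) => //; exists (N k u w).
pose G := g_sigma_algebraType (\bigcup_(j in [set u : R | 0 <= u]) preimage_set_system setT (N k j) measurable).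
apply: (@bigcup_measurable _ G) => i _; apply: (@bigcup_measurable _ G) => j _.
apply: (@measurableI _ G); last exact: (@sigma_of_preimage _ _ _ _ _ [set u : R | 0 <= u] (N k) v [set _ | (m <= i - j)%N]).
by apply: sigma_of_setI; apply: sigma_of_preimage.
Qed.

Lemma measurable_count_event k u v m : 0 <= u -> 0 <= v -> measurable (count_event k u v m).
Proof.
move=> u0 v0; apply: (@sigma_of_measurable _ _ _ _ _ [set u : R | 0 <= u] (N k)).
  by move=> j; exact: (driven_measurable_count drv).
exact: sigma_count_event.
Qed.

Lemma count_event1_le k u v : 0 <= u -> u <= v ->
  (P (count_event k u v 1) <= (r k * (v - u))%:E)%E.
Proof.
move=> u0 uv; have v0 := le_trans u0 uv; have r0 := ltW (driven_rate_gt0 drv k).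
have -> : count_event k u v 1 = ~` [set w | (N k v w - N k u w)%N = 0%N].
  by apply/seteqP; split => w /=; rewrite /count_event /= lt0n => /eqP.
rewrite probability_setC; last exact: (measurable_increment drv).
rewrite (driven_increment drv)// poisson_law_pmf ?mulr_ge0 ?subr_ge0//.
rewrite expr0 fact0 divr1 mul1r -EFinB lee_fin.
have := expR_ge1Dx (- (r k * (v - u))); lra.
Qed.

(** With x the Poisson mean, 1 - (1 + x) exp(-x) <= 1 - (1 + x) (1 - x) = x^2. *)
Lemma count_event2_le k u v : 0 <= u -> u <= v ->
  (P (count_event k u v 2) <= ((r k * (v - u)) ^+ 2)%:E)%E.
Proof.
move=> u0 uv; have v0 := le_trans u0 uv; have r0 := ltW (driven_rate_gt0 drv k).
have m0 i := measurable_increment drv k i u0 v0.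
have -> : count_event k u v 2 = ~` ([set w | (N k v w - N k u w)%N = 0%N] `|` [set w | (N k v w - N k u w)%N = 1%N]).
  apply/seteqP; split => w /=; rewrite /count_event /=.
    by move=> le [E|E]; rewrite E in le.
  by case: (N k v w - N k u w)%N => [|[|m]]// H; exfalso; apply: H; [left|right].
rewrite probability_setC; last exact: measurableU.
set x := r k * (v - u); have x0 : 0 <= x by rewrite mulr_ge0 ?subr_ge0.
have E i : P [set w | (N k v w - N k u w)%N = i] = (x ^+ i / i`!%:R * expR (- x))%:E.
  by rewrite (driven_increment drv)// poisson_law_pmf.
have -> : P ([set w | (N k v w - N k u w)%N = 0%N] `|` [set w | (N k v w - N k u w)%N = 1%N]) =
    (expR (- x) + x * expR (- x))%:E.
  transitivity (P [set w | (N k v w - N k u w)%N = 0%N] + P [set w | (N k v w - N k u w)%N = 1%N])%E.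
    by apply: measureU => //; rewrite -subset0 => w /= [->].
  by rewrite !E -EFinD expr0 fact0 expr1 !divr1 mul1r.
rewrite -EFinB lee_fin.
have := expR_ge1Dx (- x) => e1.
have : (1 - x) * (1 + x) <= expR (- x) * (1 + x) by rewrite ler_wpM2r// addr_ge0.
rewrite expr2; lra.
Qed.

Lemma count_event_pair k k' u v : k != k' -> 0 <= u -> u <= v ->
  (P (count_event k u v 1 `&` count_event k' u v 1) <= (r k * (v - u) * (r k' * (v - u)))%:E)%E.
Proof.
move=> kk u0 uv; have v0 := le_trans u0 uv.
have [_ ind _ _ _] := drv.
have := ind [:: k; k'] (fun j => count_event j u v 1); rewrite /= inE kk => /(_ isT).
rewrite (_ : \bigcap_(_ in _) _ = count_event k u v 1 `&` count_event k' u v 1); last first.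
  apply/seteqP; split => w /=.
    by move=> H; split; apply: H; rewrite /= !inE eqxx ?orbT.
  by move=> [H1 H2] j /=; rewrite !inE => /orP[]/eqP ->.
move=> ->; last by move=> j _; split => //; exact: sigma_count_event.
rewrite !big_cons big_nil mule1 EFinM.
by apply: lee_pmul => //; exact: count_event1_le.
Qed.

Lemma rings_count_event w k s u v : rings (n w) k s -> 0 <= u -> u < s -> s <= v ->
  count_event k u v 1 w.
Proof.
move=> /(ringsP (n0 w) (n_mono w) (n_right w))[s0 lt] u0 us sv.
rewrite /count_event/= subn_gt0; apply: leq_trans (lt u u0 us) _.
by apply: n_mono => //; exact: ltW.
Qed.

Let ties k k' (rho : R) : set T := \bigcap_m \bigcup_(i in [set i | (i < m.+1)%N])
  (count_event k (i%:R * (rho / m.+1%:R)) (i.+1%:R * (rho / m.+1%:R)) 1 `&`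
   count_event k' (i%:R * (rho / m.+1%:R)) (i.+1%:R * (rho / m.+1%:R)) 1).

Let grid0 (i m : nat) (rho : R) : 0 <= rho -> 0 <= i%:R * (rho / m.+1%:R).
Proof. by move=> rho0; rewrite mulr_ge0// divr_ge0. Qed.

(** Each of the m + 1 cells contains rings of both sites with probability at most C / (m + 1)^2, so
    their union has probability at most C / (m + 1), for every m. *)
Let ties_null k k' (rho : R) : k != k' -> 0 <= rho -> P.-negligible (ties k k' rho).
Proof.
move=> kk rho0.
pose A (m i : nat) := count_event k (i%:R * (rho / m.+1%:R)) (i.+1%:R * (rho / m.+1%:R)) 1 `&`
   count_event k' (i%:R * (rho / m.+1%:R)) (i.+1%:R * (rho / m.+1%:R)) 1.
have mA m i : measurable (A m i) by apply: measurableI; apply: measurable_count_event; exact: grid0.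
have mU m : measurable (\bigcup_(i in [set i | (i < m.+1)%N]) A m i) by apply: bigcup_measurable.
have mt : measurable (ties k k' rho) by apply: bigcapT_measurable.
exists (ties k k' rho); split => //.
apply/eqP; rewrite eq_le measure_ge0 andbT; apply/lee_addgt0Pr => e e0; rewrite add0e.
have rr j : 0 <= r j by rewrite ltW// (driven_rate_gt0 drv).
pose C := r k * r k' * rho ^+ 2.
have C0 : 0 <= C by rewrite mulr_ge0 ?exprn_ge0// mulr_ge0.
pose m := Num.truncn (C / e).
have Cm : C / e < m.+1%:R by exact: truncnS_gt.
apply: (@le_trans _ _ (P (\bigcup_(i in [set i | (i < m.+1)%N]) A m i))).
  by apply: le_measure; rewrite ?inE// => w /(_ m I).
apply: (@le_trans _ _ (\sum_(i < m.+1) P (A m i))%E).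
  apply: (@content_subadditive _ _ _ P _ (A m)) => //.
  by rewrite -bigcup_mkord.
apply: (@le_trans _ _ (\sum_(i < m.+1) (C / m.+1%:R ^+ 2)%:E)%E).
  apply: lee_sum => i _.
  have le : i%:R * (rho / m.+1%:R) <= i.+1%:R * (rho / m.+1%:R).
    by rewrite ler_wpM2r ?divr_ge0// ler_nat.
  apply: le_trans (count_event_pair kk (grid0 i m rho0) le) _.
  rewrite lee_fin le_eqVlt; apply/orP; left; apply/eqP.
  rewrite /C -[i.+1%:R]natr1; field; by rewrite nat1r.
rewrite sumEFin lee_fin sumr_const card_ord -[leLHS]mulr_natl.
have m0 : (0 : R) < m.+1%:R by rewrite ltr0n.
rewrite (_ : m.+1%:R * (C / m.+1%:R ^+ 2) = C / m.+1%:R); last by field; rewrite nat1r.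
by rewrite ler_pdivrMr// mulrC -ler_pdivrMr// ltW.
Qed.

Let tiesP w k k' (rho s : R) : 0 < rho -> rings (n w) k s -> rings (n w) k' s -> s <= rho ->
  ties k k' rho w.
Proof.
move=> rho0 ks ks' srho m _.
have s0 := rings_gt0 (n0 w) (n_mono w) (n_right w) ks.
have m0 : (0 : R) < m.+1%:R by rewrite ltr0n.
pose dl := rho / m.+1%:R; have dl0 : 0 < dl by rewrite divr_gt0.
have ex : exists i, s <= i%:R * dl by exists m.+1; rewrite /dl mulrCA divff ?gt_eqF// mulr1.
have [i si imin] := ex_minnP ex.
case: i si imin => [|i] si imin; first by exfalso; move: si; rewrite mul0r leNgt s0.
have is_ : i%:R * dl < s by rewrite ltNge; apply/negP => /imin; rewrite ltnn.
exists i => /=.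
  have := imin m.+1; rewrite /dl mulrCA divff ?gt_eqF// mulr1 => /(_ srho)//.
have i0 : 0 <= i%:R * dl by rewrite mulr_ge0// ltW.
by split; [apply: (rings_count_event ks)|apply: (rings_count_event ks')].
Qed.

Lemma no_ties (rho : R) : 0 < rho -> P.-negligible
  [set w | exists k k' s, [/\ s <= rho, rings (n w) k s, rings (n w) k' s & k != k']].
Proof.
move=> rho0; apply: (@negligibleS _ _ _ _ (\bigcup_(p in [set p : nat * nat | p.1 != p.2]) ties p.1 p.2 rho)).
  move=> w [k [k' [s [srho ks ks' kk]]]]; exists (k, k') => //.
  exact: tiesP srho.
rewrite bigcup_mkcond.
have : P.-negligible (\bigcup_i (if (unpickle i : option (nat * nat)) is Some p then
   (if p.1 != p.2 then ties p.1 p.2 rho else set0) else set0)).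
  apply: negligible_bigcup => i; case: (unpickle i) => [p|]; last exact: negligible_set0.
  by case: ifPn => [pp|_]; [apply: ties_null => //; exact: ltW|exact: negligible_set0].
apply: negligibleS => w [p _]; case: ifPn => // /set_mem /= pp tp.
by exists (pickle p) => //; rewrite pickleK pp.
Qed.

(** For distinct k and k' independence bounds the event by rho^2 r_k r_k', which is rho^2 r_k^2
    since equal sizes have equal rates; for k = k' two rings obey the same bound. Summing over k'
    produces the multiplicity, in which k itself is counted. *)
Lemma repeated_size_prob (g : nat -> R) (F : pred nat) (rho : R) : 0 <= rho ->
  (forall k k', g k = g k' -> r k = r k') ->
  exists2 A : set T, measurable A &
   (P A <= (rho ^+ 2)%:E * \sum_(k <oo) ((if F k then r k ^+ 2 else 0)%:E * multiplicity g (g k)))%E /\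
   forall w k k' s s', F k -> rings (n w) k s -> rings (n w) k' s' -> s < s' -> s' <= rho -> g k = g k' -> A w.
Proof.
move=> rho0 gr; have rr j : 0 <= r j by rewrite ltW// (driven_rate_gt0 drv).
pose B k k' := if k == k' then count_event k 0 rho 2 else count_event k 0 rho 1 `&` count_event k' 0 rho 1.
pose A k k' := if F k && (g k' == g k) then B k k' else set0.
have mA k k' : measurable (A k k').
  rewrite /A /B; case: ifPn => // _; case: eqP => _; first exact: measurable_count_event.
  by apply: measurableI; exact: measurable_count_event.
have mA1 k : measurable (\bigcup_k' A k k') by exact: bigcupT_measurable.
exists (\bigcup_k \bigcup_k' A k k'); first exact: bigcupT_measurable.
split; last first.
  move=> w k k' s s' Fk ks ks' ss srho gg; exists k => //; exists k' => //.
  have s0 := rings_gt0 (n0 w) (n_mono w) (n_right w) ks.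
  rewrite /A Fk gg eqxx /= /B; case: eqP => [kk|_]; last first.
    by split; apply: rings_count_event; eauto; [exact: ltW (lt_le_trans ss srho)|exact: lt_trans ss].
  rewrite -kk in ks'.
  have [_ lt1] := ringsP (n0 w) (n_mono w) (n_right w) ks.
  have [_ lt2] := ringsP (n0 w) (n_mono w) (n_right w) ks'.
  rewrite /count_event/= -/(n w k rho) -/(n w k 0) n0 subn0.
  apply: leq_trans (n_mono w k (ltW (lt_trans s0 ss)) srho).
  apply: leq_ltn_trans (lt2 s (ltW s0) ss).
  by apply: leq_ltn_trans (lt1 0 (lexx _) s0).
apply: le_trans (measure_sigma_subadditive P mA1 (bigcupT_measurable _ mA1) (fun w H => H)) _.
rewrite -nneseriesZl; last first.
  move=> k _; rewrite mule_ge0 ?multiplicity_ge0//; case: ifP => _; by rewrite lee_fin ?exprn_ge0.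
apply: lee_nneseries => k _ //.
apply: le_trans (measure_sigma_subadditive P (mA k) (mA1 k) (fun w H => H)) _.
rewrite /multiplicity -nneseriesZl; last by move=> k' _; rewrite lee_fin.
rewrite -nneseriesZl; last first.
  by move=> k' _; rewrite mule_ge0 ?lee_fin//; case: ifP => _; rewrite ?exprn_ge0.
apply: lee_nneseries => k' _ //.
rewrite /A; case: (F k) => /=; last by rewrite measure0 !mul0e mule0.
case: (eqVneq (g k') (g k)) => [gg|_]; last by rewrite measure0 !mule0.
rewrite mule1 -EFinM /B; case: (eqVneq k k') => [_|kk].
  by apply: le_trans (count_event2_le k (lexx _) rho0) _; rewrite subr0 exprMn mulrC.
apply: le_trans (count_event_pair kk (lexx _) rho0) _.
by rewrite subr0 (gr _ _ gg) lee_fin le_eqVlt; apply/orP; left; apply/eqP; ring.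
Qed.

End ring_probability.

(** * From the bounds to the limit *)

Section arcsine_limit.
Variables (R : realType) (al : R).
Hypothesis al01 : 0 < al < 1.

Lemma Pihat_near_right (t s e : R) : 0 < t -> 0 < s -> 0 < e ->
  \forall eta \near 0^'+, Pihat al t s - e < Pihat al t (s + eta).
Proof.
move=> t0 s0 e0; have [H [cH dH]] := beta_primitive_exists al01.
pose D (x : R) := (H 1 - H ((s + x) / (t + (s + x)))) / (H 1 - H 0).
have ts0 : 0 < t + s by rewrite addr_gt0.
have cD : D x @[x --> 0] --> D 0.
  apply: cvgM; last exact: cvg_cst.
  apply: cvgB; first exact: cvg_cst.
  have csx : s + x @[x --> 0] --> s + 0 by apply: cvgD; [exact: cvg_cst|exact: cvg_id].
  have c1 : (s + x) / (t + (s + x)) @[x --> 0] --> (s + 0) / (t + (s + 0)).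
    apply: cvgM => //; apply: cvgV; first by rewrite addr0 gt_eqF.
    by apply: cvgD => //; exact: cvg_cst.
  apply: (@cvg_comp _ _ _ (fun x : R => (s + x) / (t + (s + x))) H _ (nbhs ((s + 0) / (t + (s + 0)))) _ c1).
  rewrite addr0.
  have x01 : 0 < s / (t + s) < 1 by rewrite divr_gt0//= ltr_pdivrMr// mul1r ltrDr.
  have [dx _] := dH _ x01.
  have cHx : {for s / (t + s), continuous H} by exact/differentiable_continuous/derivable1_diffP.
  exact: cHx.
move/cvg_at_right_filter/cvgrPdist_lt : cD => /(_ _ e0) cD.
near=> x; have x0 : 0 < x by near: x; exact: nbhs_right_gt.
have E : Pihat al t s = D 0 by rewrite (PihatE al01 cH dH)// /D addr0.
rewrite E (PihatE al01 cH dH)//; last by rewrite addr_gt0.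
rewrite -/(D x); have : `|D 0 - D x| < e.
  by near: x.
by rewrite ltr_norml => /andP[_]; lra.
Unshelve. all: by end_near. Qed.

Lemma Pihat_near0 (t e : R) : 0 < t -> 0 < e -> \forall eta \near 0^'+, 1 - e < Pihat al t eta.
Proof.
move=> t0 e0; have [H [cH dH]] := beta_primitive_exists al01.
have I0 : 0 < H 1 - H 0.
  by rewrite (beta_reflection al01 cH dH) divr_gt0 ?pi_gt0// sinpi_gt0.
have := cH; rewrite continuous_within_itvP// => -[_ + _].
move/cvgrPdist_lt => /(_ _ (mulr_gt0 e0 I0))[dl /= dl0 dlP].
near=> x; have x0 : 0 < x by near: x; exact: nbhs_right_gt.
have xd : x < dl * t by near: x; apply: nbhs_right_lt; rewrite mulr_gt0.
have tx0 : 0 < t + x by rewrite addr_gt0.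
rewrite (PihatE al01 cH dH)//.
have y0 : 0 < x / (t + x) by rewrite divr_gt0.
have yd : x / (t + x) < dl.
  rewrite ltr_pdivrMr// (lt_le_trans xd)// ler_wpM2l ?(ltW dl0)// lerDl ltW//.
have := dlP (x / (t + x)); rewrite /= sub0r normrN gtr0_norm// => /(_ yd y0).
rewrite ltr_pdivlMr// ltr_norml => /andP[h1 _]; lra.
Unshelve. all: by end_near. Qed.

(* The upper bound splits according to whether the clock leaves a gap on
   [t, t + s]; if it does not, the two states differ unless one of the bad
   events occurs, whose probabilities make up the remaining terms. *)
Lemma Pihat_limit (gap : R -> R -> R -> R) (Zeq : R -> R) (t s : R) : 0 < t -> 0 < s ->
  (forall t s, 0 < t -> 0 < s -> gap e t s @[e --> 0^'+] --> Pihat al t s) ->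
  (forall eta, 0 < eta -> \forall e \near 0^'+, gap e t (s + eta) <= Zeq e) ->
  (forall eta K kp : R, 0 < eta -> 0 < K -> 0 < kp -> \forall e \near 0^'+,
     Zeq e <= gap e t s + (1 - gap e t eta) + (1 - gap e (t + s) eta) +
       expR (t + s - K) + 4 * K * kp / eta + K ^+ 2 * kp) ->
  Zeq e @[e --> 0^'+] --> Pihat al t s.
Proof.
move=> t0 s0 cgap low up; apply/cvgrPdist_lt => om om0.
have ts0 : 0 < t + s by rewrite addr_gt0.
have o8 : 0 < om / 8 by rewrite divr_gt0.
(* Order of the choices: eta first, so that gaps of length eta are likely after both t and t + s and
   the lower bound stays sharp, then K, then kp depending on both. The errors of the upper bound add
   up to eight times om / 8. *)
have [eta [eta0 h1 h2 h3]] : exists eta, [/\ 0 < eta, Pihat al t s - om / 8 < Pihat al t (s + eta),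
    1 - om / 8 < Pihat al t eta & 1 - om / 8 < Pihat al (t + s) eta].
  near (0 : R)^'+ => eta; exists eta; split.
  - by near: eta; exact: nbhs_right_gt.
  - by near: eta; exact: Pihat_near_right.
  - by near: eta; exact: Pihat_near0.
  - by near: eta; exact: Pihat_near0.
have [K K0 hK] : exists2 K : R, 0 < K & expR (t + s - K) < om / 8.
  exists (Num.max 1 (t + s - ln (om / 8) + 1)); first by rewrite lt_max ltr01.
  rewrite -[ltRHS]lnK ?posrE// ltr_expR.
  have : t + s - ln (om / 8) + 1 <= Num.max 1 (t + s - ln (om / 8) + 1) by rewrite le_max lexx orbT.
  lra.
pose kp := Num.min (om / 8 / (4 * K / eta)) (om / 8 / K ^+ 2).
have q1 : 0 < 4 * K / eta by rewrite divr_gt0// mulr_gt0.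
have q2 : 0 < K ^+ 2 by rewrite exprn_gt0.
have kp0 : 0 < kp by rewrite lt_min; apply/andP; split; exact: divr_gt0.
have k1 : 4 * K * kp / eta <= om / 8.
  have : kp <= om / 8 / (4 * K / eta) by rewrite ge_min lexx.
  by rewrite ler_pdivlMr//; congr (_ <= _); ring.
have k2 : K ^+ 2 * kp <= om / 8.
  have : kp <= om / 8 / K ^+ 2 by rewrite ge_min lexx orbT.
  by rewrite ler_pdivlMr// mulrC.
have g t' s' : 0 < t' -> 0 < s' -> \forall e \near 0^'+, `|Pihat al t' s' - gap e t' s'| < om / 8.
  by move=> t'0 s'0; have /cvgrPdist_lt/(_ _ o8) := cgap _ _ t'0 s'0.
near=> e.
have u := near (up eta K kp eta0 K0 kp0) e.
have l := near (low eta eta0) e.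
have g1 := near (g t s t0 s0) e.
have g2 := near (g t (s + eta) t0 (addr_gt0 s0 eta0)) e.
have g3 := near (g t eta t0 eta0) e.
have g4 := near (g (t + s) eta ts0 eta0) e.
have {}u : Zeq e <= gap e t s + (1 - gap e t eta) + (1 - gap e (t + s) eta) +
       expR (t + s - K) + 4 * K * kp / eta + K ^+ 2 * kp by apply: u.
have {}l : gap e t (s + eta) <= Zeq e by apply: l.
have {}g1 : `|Pihat al t s - gap e t s| < om / 8 by apply: g1.
have {}g2 : `|Pihat al t (s + eta) - gap e t (s + eta)| < om / 8 by apply: g2.
have {}g3 : `|Pihat al t eta - gap e t eta| < om / 8 by apply: g3.
have {}g4 : `|Pihat al (t + s) eta - gap e (t + s) eta| < om / 8 by apply: g4.
move: g1 g2 g3 g4; rewrite !ltr_norml => /andP[? ?] /andP[? ?] /andP[? ?] /andP[? ?].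
apply/andP; split; lra.
Unshelve. all: by end_near. Qed.

End arcsine_limit.

Section probability_bounds.
Context d (T : measurableType d) (R : realType) (P : probability T R).

Lemma fine_prob_le_ae (A B N : set T) : measurable A -> measurable B -> P.-negligible N ->
  A `<=` B `|` N -> fine (P A) <= fine (P B).
Proof.
move=> mA mB [M [mM M0 NM]] AB; rewrite -lee_fin !fineK ?fin_num_measure//.
apply: (@le_trans _ _ (P (B `|` M))); last by rewrite measureU0.
apply: le_measure; rewrite ?inE//; first exact: measurableU.
by move=> w /AB[Bw|/NM Mw]; [left|right].
Qed.

Lemma fine_probU (A B : set T) : measurable A -> measurable B ->
  fine (P (A `|` B)) <= fine (P A) + fine (P B).
Proof.
move=> mA mB; have mAB := measurableU _ _ mA mB.
rewrite -lee_fin EFinD !fineK ?fin_num_measure//; exact: measureU2.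
Qed.

Lemma fine_probC (A : set T) : measurable A -> fine (P (~` A)) = 1 - fine (P A).
Proof. by move=> mA; rewrite probability_setC// fineB ?fin_num_measure. Qed.

End probability_bounds.

(** * Assembly for a fixed environment *)

Section K_process.
Variables (R : realType) (alpha a : R) (g : R -> R) (en : nat -> R).
Hypotheses (alpha01 : 0 < alpha < 1) (a_alpha : 0 <= a < alpha).
Hypothesis g0 : forall x, 0 <= g x.
Hypothesis en_inj : injective en.
Hypothesis en01 : forall k, 0 <= en k <= 1.
Hypothesis en_pos : forall k, 0 < g (en k).
Hypothesis en_surj : forall x, 0 <= x <= 1 -> 0 < g x -> exists k, en k = x.
Hypothesis exceed_fin : forall y, 0 < y -> (exceed (fun k => g (en k)) y < +oo)%E.
Hypothesis exceed_asym :
  y `^ alpha * fine (exceed (fun k => g (en k)) y) @[y --> 0^'+] --> (1 : R).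
Context d (T : measurableType d) (P : probability T R).
Variables (N : R -> R -> T -> nat) (tau : R -> nat -> T -> R).
Hypothesis drvK : K_driving P a g N tau.

Let gam k := g (en k).
Let r k := gam k `^ a.
Let c k := gam k `^ (1 - a).
Let n w k u := N (en k) u w.
Let h w k i := tau (en k) i w.
Let G := clock (fun k => N (en k)) (fun k => tau (en k)) c.
Let Z t w := K_Z a g (fun x u => N x u w) (fun x i => tau x i w) t.
Let drv := K_driving_driven drvK en_inj en01 en_pos.
Let ah := (alpha - a) / (1 - a).

Let a1 : a < 1. Proof. by case/andP: alpha01 => ? ?; case/andP: a_alpha => ? ?; lra. Qed.
Let c0 k : 0 < c k. Proof. by apply: powR_gt0; exact: en_pos. Qed.
Let cw k : 0 <= c k. Proof. exact: ltW. Qed.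
Let ah01 : 0 < ah < 1.
Proof.
case/andP: alpha01 => ? ?; case/andP: a_alpha => ? ?; have ? := a1.
by rewrite /ah divr_gt0/= ?subr_gt0// ltr_pdivrMr ?mul1r ?ltrD2r ?subr_gt0.
Qed.
Let rc : cvgn (series (fun k => r k * c k)).
Proof. exact: (rate_size_cvg alpha01 a_alpha en_pos exceed_fin exceed_asym). Qed.

Let gap (t1 t2 : R) : set T := [set w | dyadic_gap c (n w) (h w) t1 t2].
Let mgap t1 t2 : measurable (gap t1 t2). Proof. exact: (measurable_gap_event drv). Qed.
Let Zeq t1 t2 : set T := [set w | Z t1 w = Z t2 w].
Let mZeq t1 t2 : measurable (Zeq t1 t2).
Proof. exact: (measurable_K_Z_eq a1 g0 en01 en_inj en_pos en_surj drvK). Qed.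

Let Ginf : set T := [set w | exists2 u, 0 <= u & G u w = +oo%E].
Let Ginf_null : P.-negligible Ginf. Proof. exact: (clock_finite drv). Qed.
Let G_fin w : ~ Ginf w -> forall u, 0 <= u -> (path_clock (n w) (h w) c u < +oo)%E.
Proof. by move=> nG u u0; rewrite ltey; apply/eqP => Gu; apply: nG; exists u. Qed.

Let n0 w k : n w k 0 = 0%N. Proof. exact: (driven_count0 drv). Qed.
Let n_mono w k u v : 0 <= u -> u <= v -> (n w k u <= n w k v)%N.
Proof. exact: (driven_mono drv). Qed.
Let n_right w k u : 0 <= u -> \forall v \near u^'+, n w k v = n w k u.
Proof. exact: (driven_right drv). Qed.

(** Z is constant on a gap; the level t3 beyond t2 provides the margin of [site_at_gap]. *)
Lemma equal_state_lower (t1 t2 t3 : R) : t1 <= t2 -> t2 < t3 ->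
  fine (P (gap t1 t3)) <= fine (P (Zeq t1 t2)).
Proof.
move=> t12 t23; apply: (fine_prob_le_ae _ _ Ginf_null) => // w gw.
have [Gw|Gw] := pselect (Ginf w); [by right|left].
exact: (K_Z_gap a1 g0 en_inj en01 en_pos en_surj (K_count0 drvK w) (K_holding_ge0 drvK w)
  (n0 w) (n_mono w) (n_right w) (G_fin Gw) t12 t23 gw).
Qed.

Let finitely_many (y : R) : 0 < y -> exists K, forall k, y <= c k -> (k < K)%N.
Proof.
move=> y0; have a1' : 0 < 1 - a by rewrite subr_gt0.
pose z := y `^ (1 - a)^-1 / 2; have z0 : 0 < z by rewrite divr_gt0// powR_gt0.
have := @nneseries_cvgn _ (fun k => (z < gam k)%R%:R) (fun k => ler0n _ _) (exceed_fin z0).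
move/cvg_series_cvg_0/cvgr0_norm_lt => /(_ 2^-1).
rewrite invr_gt0 ltr0n => /(_ isT)[K _ KP].
exists K => k yc; rewrite ltnNge; apply/negP => Kk.
have := KP k Kk; rewrite (_ : (z < gam k) = true); first by rewrite normr1 => ?; lra.
have le : y `^ (1 - a)^-1 <= gam k.
  have -> : gam k = c k `^ (1 - a)^-1.
    by rewrite /c -powRrM divff ?gt_eqF// powRr1// ltW// en_pos.
  by rewrite ge0_ler_powR ?nnegrE ?invr_ge0 ?(ltW a1') ?(ltW y0) ?cw.
apply: lt_le_trans le; rewrite /z ltr_pdivrMr// ltr_pMr ?powR_gt0// ltr1n//.
Qed.

(** Off the bad events the hypotheses of [K_Z_hit] hold: [B1] is a late crossing, [B2] and [B3] a
    short gap, [B4] an excess of small jumps, [B5] a repeated size. *)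
Lemma equal_state_upper (t s eta K kp e dl : R) : 0 < t -> 0 < s -> 0 < eta -> 0 < K -> 0 < kp ->
  0 < e -> 0 < dl ->
  (\sum_(k <oo) (if e^-1 * c k < dl then r k * c k else 0)%:E <= (kp * phi r c e^-1 / e^-1)%:E)%E ->
  (\sum_(k <oo) ((if (dl <= e^-1 * c k)%R then r k ^+ 2 else 0)%:E * multiplicity gam (gam k))
    <= (kp * phi r c e^-1 ^+ 2)%:E)%E ->
  fine (P (Zeq (e * t) (e * (t + s)))) <=
    fine (P (gap (e * t) (e * (t + s)))) + (1 - fine (P (gap (e * t) (e * (t + eta))))) +
    (1 - fine (P (gap (e * (t + s)) (e * (t + s + eta))))) +
    expR (t + s - K) + 4 * K * kp / eta + K ^+ 2 * kp.
Proof.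
move=> t0 s0 eta0 K0 kp0 e0 dl0 small tied.
have ei : 0 < e^-1 by rewrite invr_gt0.
have ph := phi_gt0 drv c0 rc ei.
(* The mean of exp(-clock / e) at time rho is exp(-K): this is the time scale on which the clock
   reaches order e, and it bounds P([B1]) by exp(t + s - K). *)
pose rho := K / phi r c e^-1; have rho0 : 0 < rho by rewrite divr_gt0.
pose F k := dl <= e^-1 * c k.
pose c' k := if F k then 0 else c k.
have c'0 k : 0 <= c' k by rewrite /c'; case: ifP.
pose S := kp * phi r c e^-1 / e^-1.
have smallS : (\sum_(k <oo) (r k * c' k)%:E <= S%:E)%E.
  apply: le_trans small; apply: lee_nneseries => k _.
    by rewrite lee_fin mulr_ge0 ?powR_ge0.
  by rewrite lee_fin /c' /F; case: ltP => _; rewrite ?mulr0.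
have rc' : cvgn (series (fun k => r k * c' k)).
  apply: nneseries_cvgn; first by move=> k; rewrite mulr_ge0 ?powR_ge0.
  by apply: le_lt_trans smallS _; rewrite ltry.
(* Half of the gap length e eta, as [site_at_crossing] requires; P([B4]) is then at most 2 rho S / x
   = 4 K kp / eta. *)
pose x := e * eta / 2; have x0 : 0 < x by rewrite divr_gt0// mulr_gt0.
pose G' := clock (fun k => N (en k)) (fun k => tau (en k)) c'.
pose B1 : set T := [set w | (G rho w <= (e * (t + s))%:E)%E].
pose B2 := ~` gap (e * t) (e * (t + eta)).
pose B3 := ~` gap (e * (t + s)) (e * (t + s + eta)).
pose B4 : set T := [set w | (x%:E < G' rho w)%E].
have mB1 : measurable B1 by exact: (measurable_clock_le drv cw _ (ltW rho0)).
have mB2 : measurable B2 by exact: measurableC.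
have mB3 : measurable B3 by exact: measurableC.
have mB4 : measurable B4 by exact: (measurable_clock_gt drv c'0 _ (ltW rho0)).
have rE k k' : gam k = gam k' -> r k = r k' by move=> E; rewrite /r E.
have [B5 mB5 [PB5 B5P]] := repeated_size_prob drv F (ltW rho0) rE.
have [Kb KbP] := finitely_many (divr_gt0 dl0 ei).
pose ties : set T :=
  [set w | exists k k' u, [/\ u <= rho, rings (n w) k u, rings (n w) k' u & k != k']].
have ties_null : P.-negligible ties by exact: (no_ties drv rho0).
have sub : Zeq (e * t) (e * (t + s)) `<=`
    (gap (e * t) (e * (t + s)) `|` B2 `|` B3 `|` B1 `|` B4 `|` B5) `|` (Ginf `|` ties).
  move=> w Zw; apply: contrapT => /not_orP[+ /not_orP[nG nt]].
  move=> /not_orP[/not_orP[/not_orP[/not_orP[/not_orP[ng nb2] nb3] nb1] nb4] nb5].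
  apply: (K_Z_hit a1 g0 en_inj en01 en_pos en_surj (K_count0 drvK w) (K_holding_ge0 drvK w)
    (n0 w) (n_mono w) (n_right w) (G_fin nG) (F := F) (K := Kb) (eta := x) (rho := rho)
    (t1 := e * t) (t2 := e * (t + s))) => //.
  - by rewrite mulr_ge0 ?ltW.
  - by rewrite ler_pM2l// lerDl ltW.
  - by move=> k Fk; apply: KbP; rewrite ler_pdivrMr// mulrC.
  - exact: ltW.
  - by rewrite ltNge; apply/negP => H; apply: nb1.
  - have -> : e * t + x *+ 2 = e * (t + eta) by rewrite /x -mulr_natr; field.
    exact: contrapT.
  - have -> : e * (t + s) + x *+ 2 = e * (t + s + eta) by rewrite /x -mulr_natr; field.
    exact: contrapT.
  - by rewrite leNgt; apply/negP => H; apply: nb4.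
  - move=> k k' u urho ku ku'; apply: contrapT => /eqP kk; apply: nt.
    by exists k, k', u.
  - move=> k k' u u' Fk Fk' ku ku' uu' urho E; apply: nb5.
    exact: (B5P w k k' u u').
have null : P.-negligible (Ginf `|` ties) by exact: negligibleU.
have mU1 := measurableU _ _ (mgap (e * t) (e * (t + s))) mB2.
have mU2 := measurableU _ _ mU1 mB3.
have mU3 := measurableU _ _ mU2 mB1.
have mU4 := measurableU _ _ mU3 mB4.
have mU5 := measurableU _ _ mU4 mB5.
apply: le_trans (fine_prob_le_ae (mZeq _ _) mU5 null sub) _.
apply: le_trans (fine_probU P mU4 mB5) _; apply: lerD; last first.
  rewrite -lee_fin fineK ?fin_num_measure//; apply: le_trans PB5 _.
  apply: (@le_trans _ _ ((rho ^+ 2)%:E * (kp * phi r c e^-1 ^+ 2)%:E)%E).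
    by apply: lee_wpmul2l => //; rewrite lee_fin exprn_ge0// ltW.
  rewrite -EFinM lee_fin le_eqVlt; apply/orP; left; apply/eqP.
  by rewrite /rho; field; rewrite gt_eqF.
apply: le_trans (fine_probU P mU3 mB4) _; apply: lerD; last first.
  apply: le_trans (clock_gt_prob drv c'0 rc' x0 (ltW rho0) smallS) _.
  rewrite le_eqVlt; apply/orP; left; apply/eqP.
  by rewrite /rho /S /x; field; rewrite !gt_eqF.
apply: le_trans (fine_probU P mU2 mB1) _; apply: lerD; last first.
  apply: le_trans (clock_le_prob drv cw rc _ ei (ltW rho0)) _.
  rewrite ler_expR le_eqVlt; apply/orP; left; apply/eqP.
  by rewrite /rho; field; rewrite !gt_eqF.
apply: le_trans (fine_probU P mU1 mB3) _; apply: lerD; last by rewrite fine_probC.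
by apply: le_trans (fine_probU P (mgap _ _) mB2) _; rewrite lerD2l fine_probC.
Qed.

Lemma K_Rbar_cvg (t s : R) : 0 < t -> 0 < s ->
  K_Rbar P a g N tau (eps * t) (eps * s) @[eps --> 0^'+] --> (Pihat ah t s)%:E.
Proof.
move=> t0 s0.
have E eps : K_Rbar P a g N tau (eps * t) (eps * s) =
    (fine (P (Zeq (eps * t) (eps * (t + s)))))%:E.
  by rewrite fineK ?fin_num_measure// mulrDr.
under eq_fun do rewrite E.
apply/cvg_EFin; first exact: nearW.
apply: (@Pihat_limit _ ah ah01 (fun e t s => fine (P (gap (e * t) (e * (t + s)))))) => //.
- move=> t' s' t'0 s'0; apply: (gap_probability_cvg drv c0 rc ah01 t'0 s'0) => i j i0.
  exact: (phi_ratio_cvg alpha01 a_alpha en_pos exceed_fin exceed_asym).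
- move=> eta eta0; near=> e; have e0 : 0 < e by near: e; exact: nbhs_right_gt.
  apply: equal_state_lower; first by rewrite ler_pM2l// lerDl ltW.
  by rewrite ltr_pM2l// addrA ltrDl.
move=> eta K kp eta0 K0 kp0.
(* The threshold dl depends on kp only and is fixed before e varies; the tie estimate is then
   invoked for this dl. *)
have [dl dl0 small] := small_jumps_negligible alpha01 a_alpha en_pos exceed_fin exceed_asym kp0.
have tied := ties_negligible alpha01 a_alpha en_pos exceed_fin exceed_asym dl0 kp0.
have {}small := @invr_cvg_pinfty R _ small.
have {}tied := @invr_cvg_pinfty R _ tied.
near=> e; have e0 : 0 < e by near: e; exact: nbhs_right_gt.
by apply: (equal_state_upper t0 s0 eta0 K0 kp0 e0 dl0); near: e.
Unshelve. all: by end_near. Qed.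

End K_process.

Theorem mainTheorem3 (R : realType) (alpha a : R)
  (alpha01 : 0 < alpha < 1) (a_alpha : 0 <= a < alpha)
  (dE : measure_display) (E : measurableType dE) (PE : probability E R)
  (gamma : E -> R -> R) (gammaP : stable_jumps PE alpha gamma) :
  {ae PE, forall e : E,
    forall (d : measure_display) (T : measurableType d) (P : probability T R)
           (N : R -> R -> T -> nat) (tau : R -> nat -> T -> R),
      K_driving P a (gamma e) N tau ->
      forall t s : R, 0 < t -> 0 < s ->
        K_Rbar P a (gamma e) N tau (eps * t) (eps * s) @[eps --> 0^'+] -->
          (Pihat ((alpha - a) / (1 - a)) t s)%:E}.
Proof.
have alpha0 : 0 < alpha by case/andP: alpha01.
have [gamma0 _ _] := gammaP.
(* The exceptional null set is that of the jump counts; it is fixed before the driving space, t and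
   s, and therefore common to all of them. *)
apply: filterS (jump_counts alpha0 gammaP) => e counts d T P N tau drvK t s t0 s0.
have [en [en_inj [en01 en_pos] en_surj efin easym]] := jump_enumeration alpha0 counts.
exact: (K_Rbar_cvg alpha01 a_alpha (gamma0 e) en_inj en01 en_pos en_surj efin easym drvK t0 s0).
Qed.
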